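(* Let $k$ be an algebraically closed field of characteristic $p\ge 0$. Let $\mathcal{F}$ be a regular foliation on a minimal rational surface $X$ over $k$. Then $X$ is a Hirzebruch surface $\mathbb F_e$ with $e\ge 0$, $e\neq 1$, and either (1) $p\ge 0$ and $\mathcal{F}$ is the $\mathbb P^1_k$-fibration of $\mathbb F_e$ over $\mathbb P^1_k$; or (2) $p>0$, $p$ divides $e$ and $\mathcal F$ is a Riccati foliation on $\mathbb F_e$.
   Context: $X$ is a smooth projective surface over $k$. A foliation $\mathcal F$ on a smooth surface $X$ is (codimension one) given by a saturated coherent rank-one subsheaf $T_{\mathcal F}\subset T_X$ (i.e. $T_X/T_{\mathcal F}$ is torsion free) closed under the Lie bracket. It is regular if $T_{\mathcal F}$ and $T_X/T_{\mathcal F}$ are both locally free. The Hirzebruch surface is $\mathbb F_e=\mathbb P(\mathcal O_{\mathbb P^1_k}\oplus\mathcal O_{\mathbb P^1_k}(e))$, $e\ge 0$. ''$\mathcal F$ is the $\mathbb P^1_k$-fibration'' means $T_{\mathcal F}$ is the relative tangent sheaf of a $\mathbb P^1_k$-bundle projection $\mathbb F_e\to\mathbb P^1_k$; for $e=0$, where $\mathbb F_0=\mathbb P^1_k\times\mathbb P^1_k$ has two such projections, either one is allowed. A Riccati foliation on $\mathbb F_e$ is a foliation which is transverse to the generic fiber of the projection $\mathbb F_e\to\mathbb P^1_k$; equivalently $K_{\mathcal F}\cdot F=0$, where $K_{\mathcal F}=T_{\mathcal F}^*$ is the cotangent bundle of $\mathcal F$ and $F$ is a fiber. *)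

(* Defs.v *)
From mathcomp Require Import all_boot all_order all_algebra.
From mathcomp Require Import boolp classical_sets.

Set Implicit Arguments.
Unset Strict Implicit.
Unset Printing Implicit Defensive.

Import GRing.Theory.
Local Open Scope classical_set_scope.
Local Open Scope ring_scope.

(* Varieties over an algebraically closed field k are treated as models in
   the sense of Zariski.  A variety with function field K, where the structure
   map is iota : k -> K, is the set of the local rings O_P of its closed
   points P, each one being a subring of K.  A closed point is thus a set
   O : set K and a variety is an X : set (set K).
   Since varieties are separated, a point is determined by its local ring; a
   birational map that identifies function fields is a morphism exactly when
   every local ring of the source dominates a local ring of the target, and is
   an isomorphism exactly when the two sets of local rings are equal. *)

Definition has_characteristic (k : fieldType) (p : nat) : Prop :=
  if p is 0%N then [pchar k] =i pred0 else p \in [pchar k].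

Section Models.
Context (k : closedFieldType) (K : fieldType) (iota : {rmorphism k -> K}).

Inductive kalg (S : set K) : K -> Prop :=
| kalg_const c : kalg S (iota c)
| kalg_gen z : S z -> kalg S z
| kalg_add z w : kalg S z -> kalg S w -> kalg S (z + w)
| kalg_mul z w : kalg S z -> kalg S w -> kalg S (z * w).

Definition kfield (S : set K) : set K :=
  [set z | exists a b, [/\ kalg S a, kalg S b, b != 0 & z = a / b]].

Definition alg_independent (s t : K) : Prop :=
  forall P : {poly {poly k}},
    (map_poly (map_poly iota) P).[s%:P].[t] = 0 -> P = 0.

Definition algebraic_over (L : set K) (z : K) : Prop :=
  exists q : {poly K}, [/\ q != 0, forall i, L q`_i & q.[z] = 0].

Definition transcendence_degree_2 : Prop :=
  exists s t, alg_independent s t /\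
              forall z, algebraic_over (kfield [set s; t]) z.

Definition purely_transcendental (s t : K) : Prop :=
  alg_independent s t /\ kfield [set s; t] = setT.

Definition rational_surface : Prop := exists s t, purely_transcendental s t.

Definition maximal_ideal (A m : set K) : Prop :=
  [/\ m `<=` A,
      m 0 /\ (forall a b, m a -> m b -> m (a + b)),
      (forall a b, A a -> m b -> m (a * b)),
      ~ m 1 &
      (forall a, A a -> ~ m a -> exists2 b, A b & m (1 - a * b))].

Definition localization (A m : set K) : set K :=
  [set z | exists a b, [/\ A a, A b, ~ m b & z = a / b]].

(* The closed points of Spec A. *)
Definition affine_model (A : set K) : set (set K) :=
  [set O | exists2 m, maximal_ideal A m & O = localization A m].

(* The closed subvariety of P^n with generic point (x_0 : ... : x_n); its
   chart X_i != 0 is nonempty exactly when x_i != 0, and then has coordinate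
   ring k[x_0/x_i, ..., x_n/x_i]. *)
Definition projective_model n (x : 'I_n.+1 -> K) : set (set K) :=
  [set O | exists2 i, x i != 0 &
           affine_model (kalg [set x j / x i | j in [set: 'I_n.+1]]) O].

Definition projective_variety (X : set (set K)) : Prop :=
  exists n (x : 'I_n.+1 -> K),
    [/\ exists i, x i != 0,
        kfield [set z | exists i j, x i != 0 /\ z = x j / x i] = setT &
        X = projective_model x].

(* The condition is not phrased with f^-1 because 0^-1 = 0 in MathComp. *)
Definition max_ideal (O : set K) : set K :=
  [set f | O f /\ forall g, O g -> f * g <> 1].

(* Regularity of a local ring O of Krull dimension 2. The local ring of any
   closed point has dimension 2 as soon as K has transcendence degree 2. *)
Definition regular_local_ring_dim2 (O : set K) : Prop :=
  exists u v, [/\ max_ideal O u, max_ideal O v &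
    forall f, max_ideal O f ->
      exists a b, [/\ O a, O b & f = a * u + b * v]].

(* k is algebraically closed, so smooth over k means regular. *)
Definition smooth_projective_surface (X : set (set K)) : Prop :=
  [/\ transcendence_degree_2, projective_variety X &
      forall O, X O -> regular_local_ring_dim2 O].

Definition dominates (O O' : set K) : Prop :=
  O' `<=` O /\ max_ideal O' `<=` max_ideal O.

Definition birational_morphism (X Y : set (set K)) : Prop :=
  forall O, X O -> exists2 O', Y O' & dominates O O'.

(* Every birational morphism from X to a smooth projective surface is an
   isomorphism. The function field of the target can be taken to be K. *)
Definition minimal_surface (X : set (set K)) : Prop :=
  forall Y, smooth_projective_surface Y -> birational_morphism X Y -> Y = X.

Definition kderivation (D : K -> K) : Prop :=
  [/\ forall z w, D (z + w) = D z + D w,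
      forall z w, D (z * w) = D z * w + z * D w &
      forall c, D (iota c) = 0].

(* The stalk Der_k(O, O) of the tangent sheaf; a derivation of O extends
   uniquely to K. *)
Definition tangent_stalk (O : set K) : set (K -> K) :=
  [set D | kderivation D /\ forall f, O f -> O (D f)].

Definition span (O : set K) r (B : 'I_r -> K -> K) : set (K -> K) :=
  [set D | exists c : 'I_r -> K, (forall i, O (c i)) /\
           forall z, D z = \sum_(i < r) c i * B i z].

(* The O-module M / N is free of finite rank. *)
Definition free_quotient (O : set K) (M N : set (K -> K)) : Prop :=
  exists r (B : 'I_r -> K -> K),
    [/\ forall i, M (B i),
        forall D, M D -> exists2 c : 'I_r -> K, forall i, O (c i) &
          N (fun z => D z - \sum_(i < r) c i * B i z) &
        forall c : 'I_r -> K, (forall i, O (c i)) ->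
          N (fun z => \sum_(i < r) c i * B i z) -> forall i, c i = 0].

(* A subsheaf of the tangent sheaf is given by its stalks T O at the closed
   points O (the values of T outside X are irrelevant). The sets
   {O' in X | s is included in O'}, for s a finite subset of K, form a basis of
   the Zariski topology of X, so the last condition says that T is locally
   generated by finitely many sections. *)
Definition coherent_subsheaf (X : set (set K)) (T : set K -> set (K -> K)) :
    Prop :=
  (forall O, X O -> T O `<=` tangent_stalk O) /\
  forall O, X O -> exists (s : seq K) r (B : 'I_r -> K -> K),
    (forall f, f \in s -> O f) /\
    forall O', X O' -> (forall f, f \in s -> O' f) -> T O' = span O' B.

Definition rank_one (T : set (K -> K)) : Prop :=
  (exists2 D, T D & exists z, D z != 0) /\
  forall D E, T D -> T E ->
    exists a b, (a, b) != (0, 0) /\ forall z, a * D z + b * E z = 0.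

Definition torsion_free_quotient (O : set K) (M N : set (K -> K)) : Prop :=
  forall f D, O f -> f != 0 -> M D -> N (fun z => f * D z) -> N D.

Definition lie_closed (T : set (K -> K)) : Prop :=
  forall D E, T D -> T E -> T (fun z => D (E z) - E (D z)).

Definition foliation (X : set (set K)) (T : set K -> set (K -> K)) : Prop :=
  coherent_subsheaf X T /\
  forall O, X O ->
    [/\ rank_one (T O), torsion_free_quotient O (tangent_stalk O) (T O) &
        lie_closed (T O)].

Definition regular_foliation (X : set (set K)) (T : set K -> set (K -> K)) :
    Prop :=
  foliation X T /\
  forall O, X O ->
    free_quotient O (T O) [set (fun=> 0)] /\
    free_quotient O (tangent_stalk O) (T O).

(* P(O + O(e)) over P^1, where t is the coordinate of P^1 and y the
   fibre coordinate over t != oo; the fibre coordinate over t != 0 is y t^e. *)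
Definition hirzebruch_model (e : nat) (t y : K) : set (set K) :=
  affine_model (kalg [set t; y]) `|`
  affine_model (kalg [set t; y^-1]) `|`
  affine_model (kalg [set t^-1; y * t ^+ e]) `|`
  affine_model (kalg [set t^-1; (y * t ^+ e)^-1]).

(* X is isomorphic to F_e, the coordinates of F_e corresponding to t and y. *)
Definition is_hirzebruch (X : set (set K)) (e : nat) (t y : K) : Prop :=
  purely_transcendental t y /\ X = hirzebruch_model e t y.

(* The morphisms to P^1 are given by their coordinate z in K. *)
Definition hirzebruch_projection (e : nat) (t y z : K) : Prop :=
  z = t \/ (e = 0%N /\ z = y).

(* T is the relative tangent sheaf of z : X -> P^1, that is, consists of the
   vector fields that kill the functions pulled back from P^1. *)
Definition is_fibration (X : set (set K)) (T : set K -> set (K -> K)) (z : K) :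
    Prop :=
  forall O, X O ->
    T O = [set D | tangent_stalk O D /\ forall f, kfield [set z] f -> D f = 0].

(* T is transverse, at each of their points, to all but finitely many fibres
   z = c: the differential of z does not vanish on T at the point. *)
Definition is_riccati (X : set (set K)) (T : set K -> set (K -> K)) (z : K) :
    Prop :=
  exists s : seq k, forall c, c \notin s ->
    forall O, X O -> max_ideal O (z - iota c) ->
      exists2 D, T O D & ~ max_ideal O (D z).

End Models.

(* Main.v *)
Require Import Defs.
From mathcomp Require Import all_boot all_order all_algebra.
From mathcomp Require Import boolp classical_sets.
From mathcomp Require Import ring zify.
From HB Require Import structures.

Set Implicit Arguments.
Unset Strict Implicit.
Unset Printing Implicit Defensive.

Import Order.TTheory GRing.Theory Num.Theory.
Local Open Scope classical_set_scope.
Local Open Scope ring_scope.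

(* A closed point of the surface X is a factorial local ring O = (u, v); its
   height one primes give valuations w, and J u v, for a Jacobian J on K, is a
   local equation of the canonical divisor.  Among all ways of writing the
   projective coordinates of X, up to a common factor, as polynomials in two
   generators t, y of K, take one of minimal degree a in y and then of minimal
   total size 2 b + a e as sections of a line bundle on F_e.  Elementary
   transformations show that the linear system on F_e obtained in this way has
   multiplicity at most a / 2 everywhere, so that a power of J t y / J u v
   divided by a power of the coordinates is regular on X (Noether-Fano).  A
   valuation ring with a transcendental residue that dominates a point of X
   violates this unless X maps to F_e, or, when 2 b + a e < 2 a, to P^2.
   Minimality gives X = F_e with e <> 1, or X = P^2.

   A regular foliation is generated on each affine chart by a vector field
   without zeros.  On each fibre of a pencil of rational curves its two
   coefficients P, Q are coprime binary forms, so that the Sylvester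
   determinant of P, Q is constant.  Comparing the two trivializations over
   P^1 yields an equation between n = deg P, e and the degree of the foliation,
   which is c_2(T_X) = c_1(T_F) c_1(N_F) in disguise: it has no solution on
   P^2 and forces n = 0 or n = 1 on F_e unless P = 0.  Restriction to the
   negative section excludes n = 1 when e <> 1.  If P = 0 the foliation is the
   fibration, and if n = 0 a coefficient of the gluing of Q is e times a nonzero
   constant, so that e = 0 in k. *)

(** * Evaluation of polynomials and algebraic elements *)

(** All surfaces are sets of local rings in one field, so valuations take over the role of
    intersection numbers and exceptional curves. For the minimal system L, of degree a on the
    fibres, a K + 2 L is trivial on each fibre and equivalent to 2 b + a e - 2 a fibres; on the
    plane, (a + b) K + 3 L is trivial. This is the origin of the exponents 2 and 3 and of the
    dichotomy 2 a <= 2 b + a e. The contradiction with a dominating valuation ring [W] has one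
    source. On the side of F_e or of the plane, [W] is the local ring of a curve (or the whole
    field), and derivations regular on the chart preserve it. On the side of X, [W] is centred at a
    closed point, so u and v both lie in its maximal ideal and [J u v / J t y] is not a unit of [W],
    which gives the adjoint section a pole there. The obstacle is that smoothness is only given as
    two generators of each maximal ideal. Dimension two, factoriality and the detection of poles
    along height one primes have to be extracted from this, and the Nullstellensatz and Noether
    normalization serve that purpose. *)

Definition ev1 (R K : comNzRingType) (phi : {rmorphism R -> K}) (t : K) :
  {poly R} -> K := horner_morph (fun c => mulrC t (phi c)).
HB.instance Definition _ R K phi t :=
  GRing.RMorphism.on (@ev1 R K phi t).

(** Convention kept throughout: [t] is the inner and [y] the outer variable, so the coefficient of
    t^l y^j is found at outer index j and inner index l. *)
Definition ev (R K : comNzRingType) (phi : {rmorphism R -> K}) (t y : K) :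
  {poly {poly R}} -> K := ev1 (ev1 phi t) y.
HB.instance Definition _ R K phi t y :=
  GRing.RMorphism.on (@ev R K phi t y).

Local Notation gen_ev1 := @ev1.
Local Notation gen_ev := @ev.

Section Evaluation1.
Context (R K : comNzRingType) (phi : {rmorphism R -> K}).
Implicit Types (t y : K) (p : {poly R}) (P : {poly {poly R}}).

Lemma ev1E t p : ev1 phi t p = (map_poly phi p).[t].
Proof. by []. Qed.

Lemma ev1C t c : ev1 phi t c%:P = phi c.
Proof. by rewrite ev1E map_polyC hornerC. Qed.

Lemma ev1X t : ev1 phi t 'X = t.
Proof. by rewrite ev1E map_polyX hornerX. Qed.

Lemma ev1_sum t p : ev1 phi t p = \sum_(i < size p) phi p`_i * t ^+ i.
Proof.
rewrite ev1E (horner_coef_wide t (size_poly _ _)).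
by apply: eq_bigr => i _; rewrite coef_map.
Qed.


Lemma ev1D t p q : ev1 phi t (p + q) = ev1 phi t p + ev1 phi t q.
Proof. exact: rmorphD. Qed.
Lemma ev1B t p q : ev1 phi t (p - q) = ev1 phi t p - ev1 phi t q.
Proof. exact: rmorphB. Qed.
Lemma ev1M t p q : ev1 phi t (p * q) = ev1 phi t p * ev1 phi t q.
Proof. exact: rmorphM. Qed.
Lemma ev1Xn t p n : ev1 phi t (p ^+ n) = ev1 phi t p ^+ n.
Proof. exact: rmorphXn. Qed.
Lemma ev10 t : ev1 phi t 0 = 0.
Proof. exact: rmorph0. Qed.
Lemma ev11 t : ev1 phi t 1 = 1.
Proof. exact: rmorph1. Qed.

End Evaluation1.

Section Evaluation2.
Context (R K : comNzRingType) (phi : {rmorphism R -> K}).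
Implicit Types (t y : K) (p : {poly R}) (P : {poly {poly R}}).

Lemma evC t y p : ev phi t y p%:P = ev1 phi t p.
Proof. by rewrite /ev ev1C. Qed.

Lemma evX t y : ev phi t y 'X = y.
Proof. by rewrite /ev ev1X. Qed.

Lemma ev_sum t y P : ev phi t y P = \sum_(i < size P) ev1 phi t P`_i * y ^+ i.
Proof.
rewrite /ev ev1E (horner_coef_wide y (size_poly _ _)).
by apply: eq_bigr => i _; rewrite coef_map.
Qed.

Lemma evE t y P :
  ev phi t y P = (map_poly (map_poly phi) P).[y%:P].[t].
Proof.
elim/poly_ind: P => [|P p IH]; first by rewrite !rmorph0 !horner0.
rewrite !rmorphD !rmorphM /= evX evC map_polyX map_polyC.
by rewrite hornerD hornerMX hornerC hornerD hornerM hornerC -IH ev1E.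
Qed.

Lemma ev_swap t y P : ev phi y t (swapXY P) = ev phi t y P.
Proof.
elim/poly_ind: P => [|P p IH]; first by rewrite !rmorph0.
rewrite !rmorphD !rmorphM /= IH swapXY_X evC ev1X evX swapXY_polyC evC; congr (_ + _).
elim/poly_ind: p => [|p c IH']; first by rewrite !rmorph0.
rewrite !rmorphD !rmorphM /= IH' map_polyX evX ev1X map_polyC /=.
by rewrite evC !ev1C.
Qed.


Lemma evD t y P Q : ev phi t y (P + Q) = ev phi t y P + ev phi t y Q.
Proof. exact: rmorphD. Qed.
Lemma evB t y P Q : ev phi t y (P - Q) = ev phi t y P - ev phi t y Q.
Proof. by have := evD t y (P - Q) Q; rewrite subrK => ->; rewrite addrK. Qed.
Lemma evM t y P Q : ev phi t y (P * Q) = ev phi t y P * ev phi t y Q.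
Proof. exact: rmorphM. Qed.
Lemma evXn t y P n : ev phi t y (P ^+ n) = ev phi t y P ^+ n.
Proof. exact: rmorphXn. Qed.
Lemma ev0 t y : ev phi t y 0 = 0.
Proof. exact: rmorph0. Qed.
Lemma evo t y : ev phi t y 1 = 1.
Proof. exact: rmorph1. Qed.
Lemma ev_bigsum t y I (r : seq I) (A : pred I) F :
  ev phi t y (\sum_(i <- r | A i) F i) = \sum_(i <- r | A i) ev phi t y (F i).
Proof. exact: (big_morph _ (evD t y) (ev0 t y)). Qed.

End Evaluation2.


Section IntegralLead.
Context (R : comNzRingType) (K : fieldType) (phi : {rmorphism R -> K}).

Lemma integral_exp z n : integralOver phi z -> integralOver phi (z ^+ n).
Proof.
move=> iz; elim: n => [|n IH]; first by rewrite expr0; apply: integral1.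
by rewrite exprS; apply: integral_mul.
Qed.

Lemma integral_sum (I : Type) (r : seq I) (F : I -> K) :
  (forall i, integralOver phi (F i)) -> integralOver phi (\sum_(i <- r) F i).
Proof.
move=> h; elim/big_rec: _ => [|i x _ IH]; first exact: integral0.
exact: integral_add.
Qed.

(** Multiplying q(u) = 0, of degree n + 1 with leading coefficient l, by l^n gives a monic equation
    for l u whose coefficients, q_i times l^(n - i), are still integral. *)
Lemma integral_lead (q : {poly K}) u : q != 0 -> root q u ->
  (forall i, integralOver phi q`_i) -> integralOver phi (lead_coef q * u).
Proof.
move=> qn0 qu iq; have sq : (1 < size q)%N.
  rewrite ltnNge; apply/negP => /size1_polyC q0.
  move: qn0 qu; rewrite q0 polyC_eq0 => c0; rewrite /root hornerC.
  by rewrite (negbTE c0).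
case En : (size q) sq => [|[|n]] // _.
pose l := lead_coef q; pose r : {poly K} := 'X^(n.+1) + \poly_(i < n.+1) (q`_i * l ^+ (n - i)).
have rm : r \is monic.
  rewrite monicE /r lead_coefDl ?lead_coefXn // size_polyXn.
  by rewrite ltnS; apply: size_poly.
apply: (@integral_root_monic _ _ phi _ r) => //.
  rewrite /root /r hornerD hornerXn horner_poly.
  have -> : (l * u) ^+ n.+1 = l ^+ n * (q`_n.+1 * u ^+ n.+1).
    by rewrite exprMn exprS mulrCA !mulrA /l lead_coefE En /= mulrC !mulrA.
  have -> : \sum_(i < n.+1) q`_i * l ^+ (n - i) * (l * u) ^+ i
     = l ^+ n * \sum_(i < n.+1) q`_i * u ^+ i.
    rewrite big_distrr /=; apply: eq_bigr => i _.
    have -> : l ^+ n = l ^+ (n - i) * l ^+ i by rewrite -exprD subnK // -ltnS.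
    by rewrite exprMn; ring.
  rewrite -mulrDr addrC; move: qu; rewrite /root horner_coef En big_ord_recr /=.
  by move/eqP->; rewrite mulr0.
move=> z /(nthP 0) [i _ <-]; rewrite coefD coefXn coef_poly.
apply: integral_add.
  by case: eqP => _; [exact: integral1|exact: integral0].
case: ifP => _; last exact: integral0.
by apply: integral_mul => //; apply: integral_exp; rewrite /l lead_coefE.
Qed.

End IntegralLead.

(** The coefficients come from a domain and not from its fraction field. For R = k[s] a relation is
    then a polynomial in two variables, which can be exchanged. *)
Definition algR (R : idomainType) (K : fieldType) (phi : {rmorphism R -> K})
  (z : K) := exists2 p : {poly R}, p != 0 & ev1 phi z p = 0.

Section Algebraic.
Context (R : idomainType) (K : fieldType) (phi : {rmorphism R -> K}).
Hypothesis phi_inj : injective phi.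

Lemma algR_id c : algR phi (phi c).
Proof.
exists ('X - c%:P); first by rewrite polyXsubC_eq0.
by rewrite rmorphB /= ev1X ev1C subrr.
Qed.

Lemma phi_neq0 c : c != 0 -> phi c != 0.
Proof. by apply: contra_neq => h; apply: phi_inj; rewrite rmorph0. Qed.

Lemma map_poly_phi_neq0 p : p != 0 -> map_poly phi p != 0.
Proof.
apply: contra_neq => /polyP h; apply/polyP => i; apply: phi_inj.
by have := h i; rewrite coef_map !coef0 rmorph0.
Qed.

Lemma integral_algR z : integralOver phi z -> algR phi z.
Proof.
case=> p pm /rootP pz; exists p; first by rewrite monic_neq0.
by rewrite ev1E.
Qed.

(** Clearing the leading coefficient reduces sums and products of algebraic elements to sums and
    products of integral ones. *)
Lemma algR_integral z : algR phi z ->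
  exists2 c, c != 0 & integralOver phi (phi c * z).
Proof.
case=> p pn0 pz; exists (lead_coef p); first by rewrite lead_coef_eq0.
rewrite -(lead_coef_map_inj phi_inj (rmorph0 _)).
apply: integral_lead; first exact: map_poly_phi_neq0.
  by apply/rootP; rewrite -ev1E.
by move=> i; rewrite coef_map; apply: integral_id.
Qed.

Lemma integral_div_algR c z : c != 0 -> algR phi (phi c * z) -> algR phi z.
Proof.
move=> c0 [p pn0 pz]; exists (\poly_(i < size p) (p`_i * c ^+ i)).
  apply: contra_neq pn0 => /polyP h; apply/polyP => i; rewrite coef0.
  have := h i; rewrite coef0 coef_poly; case: ltnP => [_ /eqP|? _].
    by rewrite mulf_eq0 expf_eq0 (negbTE c0) andbF orbF => /eqP.
  by rewrite nth_default.
rewrite -pz !ev1_sum; apply/esym.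
rewrite (big_ord_widen_cond _ (fun _ => true)
  (fun i => phi (\poly_(i < size p) (p`_i * c ^+ i))`_i * z ^+ i) (size_poly _ _)).
rewrite [RHS]big_mkcond; apply: eq_bigr => i _.
rewrite coef_poly ltn_ord rmorphM rmorphXn exprMn mulrA.
case: ltnP => // /leq_sizeP h; have := h i (leqnn _).
rewrite coef_poly ltn_ord => /(congr1 phi); rewrite rmorphM rmorphXn rmorph0.
by move=> ->; rewrite mul0r.
Qed.

Lemma algR_add z w : algR phi z -> algR phi w -> algR phi (z + w).
Proof.
move=> /algR_integral [c c0 iz] /algR_integral [d d0 iw].
apply: (@integral_div_algR (c * d)); first by rewrite mulf_neq0.
apply: integral_algR; rewrite mulrDr rmorphM.
have -> : phi c * phi d * z = phi d * (phi c * z) by rewrite mulrAC mulrC.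
rewrite -mulrA; apply: integral_add; apply: integral_mul => //;
  exact: integral_id.
Qed.

Lemma algR_mul z w : algR phi z -> algR phi w -> algR phi (z * w).
Proof.
move=> /algR_integral [c c0 iz] /algR_integral [d d0 iw].
apply: (@integral_div_algR (c * d)); first by rewrite mulf_neq0.
apply: integral_algR; rewrite rmorphM mulrACA.
exact: integral_mul.
Qed.

Lemma algR_inv z : algR phi z -> algR phi z^-1.
Proof.
have [->|z0] := eqVneq z 0; first by rewrite invr0.
case=> p pn0 pz; pose n := size p.
(* The reversed polynomial; its constant coefficient is the leading coefficient of p, so it is
   nonzero. *)
exists (\poly_(i < n) p`_(n.-1 - i)).
  apply/eqP => /polyP /(_ 0%N); rewrite coef0 coef_poly subn0.
  rewrite lt0n size_poly_eq0 pn0 => /eqP.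
  by rewrite -lead_coefE lead_coef_eq0 (negbTE pn0).
rewrite ev1E (horner_coef_wide (n := n)); last first.
  by rewrite (leq_trans (size_poly _ _)) // size_poly.
suff : z ^+ n.-1 * \sum_(i < n) (map_poly phi (\poly_(i0 < n) p`_(n.-1 - i0)))`_i * z^-1 ^+ i = 0.
  by move/eqP; rewrite mulf_eq0 expf_eq0 (negbTE z0) andbF => /eqP.
rewrite -[RHS]pz ev1_sum -/n big_distrr /= (reindex_inj rev_ord_inj) /=.
apply: eq_bigr => i _; rewrite coef_map coef_poly.
have lt_in : (i < n)%N := ltn_ord i.
have e1 : (n.-1 - i)%N = (n - i.+1)%N by rewrite -subn1 subnAC subn1 -subnS.
rewrite -e1 (leq_ltn_trans (leq_subr _ _)); last by rewrite prednK // (leq_ltn_trans _ lt_in).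
have le_in : (i <= n.-1)%N by rewrite -ltnS prednK // (leq_ltn_trans _ lt_in).
rewrite subKn // mulrCA; congr (_ * _).
by rewrite exprVn -{1}(subnK le_in) exprD mulrC mulrA mulVf ?mul1r // expf_neq0.
Qed.

(** A common denominator c makes all coefficients of c q integral; [integral_lead] then applies, and
    the leading coefficient, algebraic and nonzero, is divided out. *)
Lemma algR_root (q : {poly K}) z : q != 0 -> root q z ->
  (forall i, algR phi q`_i) -> algR phi z.
Proof.
move=> q0 qz aq.
have [c c0 ic] : exists2 c, c != 0 & forall i, integralOver phi (phi c * q`_i).
  suff [c c0 ic] : exists2 c, c != 0 & forall i, (i < size q)%N -> integralOver phi (phi c * q`_i).
    exists c => // i; case: (ltnP i (size q)) => [/ic //|/(nth_default 0) ->].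
    by rewrite mulr0; apply: integral0.
  elim: (size q) => [|n [c c0 IH]]; first by exists 1; rewrite ?oner_neq0.
  have [d d0 id] := algR_integral (aq n).
  exists (c * d) => [|i]; first by rewrite mulf_neq0.
  rewrite ltnS leq_eqVlt rmorphM => /orP[/eqP->|/IH h].
    by rewrite -mulrA; apply: integral_mul => //; apply: integral_id.
  by rewrite mulrAC; apply: integral_mul => //; apply: integral_id.
have : integralOver phi (lead_coef (phi c *: q) * z).
  apply: integral_lead.
  - by rewrite scaler_eq0 negb_or q0 phi_neq0.
  - by rewrite rootZ ?phi_neq0.
  by move=> i; rewrite coefZ.
move/integral_algR => h; have l0 : lead_coef (phi c *: q) != 0.
  by rewrite lead_coef_eq0 scaler_eq0 negb_or q0 phi_neq0.
rewrite -(mulKf l0 z); apply: algR_mul => //; apply: algR_inv.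
by apply: integral_algR; rewrite lead_coefZ lead_coefE.
Qed.

Lemma algR_subfield_horner (p : {poly K}) z :
  (forall i, algR phi p`_i) -> algR phi z -> algR phi p.[z].
Proof.
move=> ap az; rewrite horner_coef; elim/big_rec: _ => [|i x _ IH].
  by rewrite -(rmorph0 phi); apply: algR_id.
apply: algR_add => //; apply: algR_mul => //.
elim: (i : nat) => [|n IHn]; first by rewrite expr0 -(rmorph1 phi); apply: algR_id.
by rewrite exprS; apply: algR_mul.
Qed.

End Algebraic.

Lemma rmorph_ev1 (R S K : comNzRingType) (phi : {rmorphism R -> S})
    (psi : {rmorphism S -> K}) (chi : {rmorphism R -> K}) t p :
  (forall c, psi (phi c) = chi c) ->
  psi (ev1 phi t p) = ev1 chi (psi t) p.
Proof.
move=> h; rewrite !ev1_sum rmorph_sum; apply: eq_bigr => i _.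
by rewrite rmorphM rmorphXn /= h.
Qed.

(** * Algebraic independence and transcendence bases *)

Section Independence.
Context (k : closedFieldType) (K : fieldType) (iota : {rmorphism k -> K}).
Local Notation ev1 := (ev1 iota).
Local Notation ev := (ev iota).
Local Notation alg1 s := (@algR ({poly k} : idomainType) K (ev1 s)).
Local Notation alg2 s t := (@algR ({poly {poly k}} : idomainType) K (ev s t)).

Definition indep (s t : K) := forall P, ev s t P = 0 -> P = 0.
Definition transc (s : K) := forall p, ev1 s p = 0 -> p = 0.

Lemma alg_independentE s t : alg_independent iota s t <-> indep t s.
Proof. by split=> h P e; apply: h; rewrite -e evE. Qed.

Lemma swapXY_neq0 (R : nzRingType) (P : {poly {poly R}}) : P != 0 -> swapXY P != 0.
Proof. by apply: contra_neq => h; rewrite -(swapXYK P) h rmorph0. Qed.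

Lemma indep_sym s t : indep s t -> indep t s.
Proof.
move=> h P e; have := h (swapXY P); rewrite ev_swap e => /(_ erefl) h'.
by rewrite -(swapXYK P) h' rmorph0.
Qed.

Lemma kernel0_inj (R S : nzRingType) (f : {rmorphism R -> S}) :
  (forall x, f x = 0 -> x = 0) -> injective f.
Proof.
move=> h x y e; apply/eqP; rewrite -subr_eq0; apply/eqP/h.
by rewrite rmorphB /= e subrr.
Qed.

Lemma transc_inj s : transc s -> injective (ev1 s).
Proof. exact: kernel0_inj. Qed.

Lemma indep_inj s t : indep s t -> injective (ev s t).
Proof. exact: kernel0_inj. Qed.

Lemma indep_transc s t : indep s t -> transc s.
Proof.
move=> h p e; have := h p%:P; rewrite evC => /(_ e) /eqP.
by rewrite polyC_eq0 => /eqP.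
Qed.

Lemma indepP s t : ~ alg1 s t -> indep s t.
Proof.
move=> h P e; apply: contra_notP h => /eqP P0; by exists P.
Qed.

Lemma indep_nalg s t : indep s t -> ~ alg1 s t.
Proof. by move=> h [P P0 /h e]; move: P0; rewrite e eqxx. Qed.

Lemma algR_closed z : algR iota z -> exists c, z = iota c.
Proof.
case=> p p0 pz; have [r def_p] := closed_field_poly_normal p.
move: pz; rewrite def_p ev1E map_polyZ hornerZ /= => /eqP.
rewrite mulf_eq0 fmorph_eq0 lead_coef_eq0 (negbTE p0) /=.
rewrite rmorph_prod horner_prod prodf_seq_eq0 => /hasP [c _].
rewrite rmorphB /= map_polyX map_polyC hornerXsubC subr_eq0 => /eqP ->.
by exists c.
Qed.

Lemma transcP s : transc s \/ exists c, s = iota c.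
Proof.
have [h|h] := EM (algR iota s); [by right; apply: algR_closed|left].
by move=> p e; apply: contra_notP h => /eqP p0; exists p.
Qed.

Lemma transc_const c : ~ transc (iota c).
Proof.
move=> /(_ ('X - c%:P)); rewrite rmorphB /= ev1X ev1C subrr => /(_ erefl).
by move/eqP; rewrite polyXsubC_eq0.
Qed.

Section Closure.
Context (R : idomainType) (phi : {rmorphism R -> K}).
Hypotheses (phi_inj : injective phi) (phik : forall c, algR phi (iota c)).

Lemma algR_ev1 a p : algR phi a -> algR phi (ev1 a p).
Proof.
move=> ha; rewrite ev1E; apply: algR_subfield_horner => // i.
by rewrite coef_map; apply: phik.
Qed.

Lemma algR_ev a b P : algR phi a -> algR phi b -> algR phi (ev a b P).
Proof.
move=> ha hb; rewrite /ev ev1E; apply: algR_subfield_horner => // i.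
by rewrite coef_map; apply: algR_ev1.
Qed.

Lemma algR_trans (R' : idomainType) (psi : {rmorphism R' -> K}) z :
  injective psi ->
  (forall c, algR phi (psi c)) -> algR psi z -> algR phi z.
Proof.
move=> psi_inj h [p p0 pz]; apply: (@algR_root _ _ phi phi_inj (map_poly psi p)).
- exact: (map_poly_phi_neq0 psi_inj).
- by apply/rootP; exact: pz.
- by move=> i; rewrite coef_map; apply: h.
Qed.
End Closure.

Lemma algR_ev1_const s c : alg1 s (iota c).
Proof.
have := @algR_id ({poly k} : idomainType) _ (ev1 s) c%:P.
by rewrite /= ev1C.
Qed.

Lemma algR_ev_const s t c : alg2 s t (iota c).
Proof.
have := @algR_id ({poly {poly k}} : idomainType) _ (ev s t) c%:P%:P.
by rewrite /= evC ev1C.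
Qed.

Lemma algR_ev1_gen s : alg1 s s.
Proof.
have := @algR_id ({poly k} : idomainType) _ (ev1 s) 'X.
by rewrite /= ev1X.
Qed.

Lemma algR_ev_gen1 s t : alg2 s t s.
Proof.
have := @algR_id ({poly {poly k}} : idomainType) _ (ev s t) 'X%:P.
by rewrite /= evC ev1X.
Qed.

Lemma algR_ev_gen2 s t : alg2 s t t.
Proof.
have := @algR_id ({poly {poly k}} : idomainType) _ (ev s t) 'X.
by rewrite /= evX.
Qed.

(** A relation is a nonzero polynomial in two variables, and swapping the variables keeps it
    nonzero. *)
Lemma exchange1 s t : alg1 s t -> alg1 t s.
Proof.
case=> P P0 e; exists (swapXY P); first exact: swapXY_neq0.
exact: etrans (ev_swap _ _ _ _) e.
Qed.

Lemma algR_trans1 x y w : transc x -> transc y ->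
  alg1 x y -> alg1 y w -> alg1 x w.
Proof.
move=> tx ty hy; apply: algR_trans; [exact: transc_inj|exact: transc_inj|].
by move=> c; apply: algR_ev1 => //; [exact: transc_inj|exact: algR_ev1_const].
Qed.

Lemma indep_not_both s t x : indep s t -> transc x ->
  alg1 x s -> alg1 x t -> False.
Proof.
move=> ist tx /exchange1 hs ht; apply: (indep_nalg ist).
by apply: (@algR_trans1 s x) => //; apply: indep_transc ist.
Qed.

Lemma exchange2 x r y : alg2 x r y -> alg2 x y r.
Proof.
case=> P P0 e; exists (swapXY P); first exact: swapXY_neq0.
exact: etrans (ev_swap (ev1 x) r y P) e.
Qed.

Definition trbasis x y := indep x y /\ forall z, alg2 x y z.

Lemma trbasis_change x y a b : indep x y -> trbasis a b ->
  alg2 x y a -> alg2 x y b -> trbasis x y.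
Proof.
move=> ixy [iab hab] ha hb; split=> // z; have := hab z.
apply: algR_trans; [exact: indep_inj|exact: indep_inj|] => c.
by apply: algR_ev => //; [exact: indep_inj|exact: algR_ev_const].
Qed.

Lemma trbasis_sym a b : trbasis a b -> trbasis b a.
Proof.
move=> h; have [iab _] := h.
apply: trbasis_change (indep_sym iab) h _ _; first exact: algR_ev_gen2.
exact: algR_ev_gen1.
Qed.

Lemma trbasis_step2 x r y : trbasis x r -> ~ alg1 x y -> trbasis x y.
Proof.
move=> h ny; have [_ hal] := h.
apply: trbasis_change (indepP ny) h _ _; first exact: algR_ev_gen1.
exact: exchange2.
Qed.

Lemma algR_ev1_ev x y z : alg1 x z -> alg2 x y z.
Proof.
case=> p p0 e; exists (map_poly polyC p).
  by rewrite map_poly_eq0_id0 // polyC_eq0 lead_coef_eq0.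
rewrite -e !ev1_sum size_map_polyC; apply: eq_bigr => i _.
by rewrite coef_map /= evC.
Qed.

Lemma trbasis_step1 a b x : trbasis a b -> transc x -> exists r, trbasis x r.
Proof.
move=> h tx; have [iab _] := h; have [hx|hx] := EM (alg1 a x).
  exists b; have ixb : indep x b.
    apply: indepP => hb.
    by apply: (indep_not_both iab tx) => //; apply: exchange1.
  apply: trbasis_change ixb h _ (algR_ev_gen2 _ _).
  exact/algR_ev1_ev/exchange1.
by exists a; apply/trbasis_sym/(trbasis_step2 h).
Qed.

(** Steinitz exchange in two steps: x replaces one of a and b, then y replaces the remaining element
    r. *)
Lemma indep_trbasis a b x y : trbasis a b -> indep x y -> trbasis x y.
Proof.
move=> h ixy; have [r hr] := trbasis_step1 h (indep_transc ixy).
exact/(trbasis_step2 hr)/indep_nalg.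
Qed.

(** If x and y were dependent, everything integral over k[x, y] would be algebraic over a single one
    of them, or over k when both are constants, which is too small for X and Y. *)
Lemma indep_of_integral x y X Y : indep X Y ->
  integralOver (ev x y) X -> integralOver (ev x y) Y -> indep x y.
Proof.
move=> iXY hX hY; apply: contrapT => nxy.
suff [z tz [aX aY]] : exists2 z, transc z & alg1 z X /\ alg1 z Y.
  exact: indep_not_both iXY tz aX aY.
have aint (R : idomainType) (phi : {rmorphism R -> K}) z :
    injective phi -> (forall c, algR phi (iota c)) -> algR phi x -> algR phi y ->
    integralOver (ev x y) z -> algR phi z.
  move=> phi_inj phik ax ay [p pm pz].
  apply: (@algR_root _ _ phi phi_inj (map_poly (ev x y) p)) => //.
    by rewrite monic_neq0 // monic_map.
  by move=> i; rewrite coef_map; apply: algR_ev.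
have [tx|[c ex]] := transcP x.
  have ay : alg1 x y by apply: contrapT => /indepP.
  exists x => //; split; apply: aint => //; first
    [exact: transc_inj|exact: algR_ev1_const|exact: algR_ev1_gen].
have [ty|[d ey]] := transcP y.
  exists y => //; split; apply: aint => //; first
    [exact: transc_inj|exact: algR_ev1_const|exact: algR_ev1_gen
    |by rewrite ex; exact: algR_ev1_const].
have aX : algR iota X.
  apply: aint => //; [exact: fmorph_inj|exact: algR_id| |];
    by rewrite ?ex ?ey; exact: algR_id.
have [c' eX] := algR_closed aX.
by have := indep_transc iXY; rewrite eX => /transc_const.
Qed.

End Independence.

(** * Noether normalization *)

Section BaseExpansion.
Context (R : idomainType) (U : R -> Prop) (g : {poly R}) (N : nat).
Hypotheses (gm : g \is monic) (sg : size g = N.+1).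

(** The degrees of the nonzero terms lie in the disjoint intervals from j N to (j + 1) N - 1, so
    nothing cancels at the top and the last nonzero F_j decides. [U] will be the set of nonzero
    constants of k. *)
Lemma base_expansion (F : nat -> {poly R}) n :
  (forall j, F j != 0 -> U (lead_coef (F j))) ->
  (forall j, (size (F j) <= N)%N) ->
  (exists2 j, (j < n)%N & F j != 0) ->
  \sum_(j < n) F j * g ^+ j != 0 /\ U (lead_coef (\sum_(j < n) F j * g ^+ j)).
Proof.
move=> hU hS.
have sgj j : size (g ^+ j) = (j * N).+1.
  elim: j => [|j IH]; first by rewrite expr0 size_poly1.
  by rewrite exprS size_Mmonic ?monic_neq0 ?monic_exp // sg IH; lia.
have sum_le m : (size (\sum_(j < m) F j * g ^+ j)%R <= m * N)%N.
  elim: m => [|m IH]; first by rewrite big_ord0 size_poly0.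
  rewrite big_ord_recr /=; apply: (leq_trans (size_polyD _ _)).
  rewrite geq_max (leq_trans IH) ?leq_mul //=.
  apply: (leq_trans (size_polyMleq _ _)); rewrite sgj.
  by have := hS m; lia.
elim: n => [|n IH] [j]; first by rewrite ltn0.
move=> lt_jn Fj; rewrite big_ord_recr /=.
have [Fn0|Fn0] := eqVneq (F n) 0.
  rewrite Fn0 mul0r addr0; apply: IH; exists j => //.
  move: lt_jn; rewrite ltnS leq_eqVlt => /orP[/eqP e|//].
  by rewrite e Fn0 eqxx in Fj.
have lt_s : (size (\sum_(j < n) F j * g ^+ j)%R < size (F n * g ^+ n)%R)%N.
  rewrite size_Mmonic ?monic_exp // sgj (leq_ltn_trans (sum_le _)) //.
  by have : (0 < size (F n))%N by [rewrite size_poly_gt0]; lia.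
split.
  by rewrite -size_poly_gt0 addrC size_polyDl // (leq_ltn_trans _ lt_s).
rewrite lead_coefDr // lead_coef_Mmonic ?monic_exp //.
exact: hU.
Qed.

End BaseExpansion.

(** * Nagata's change of variables *)

Section Nagata.
Context (k : fieldType).
Local Notation R := {poly {poly k}}.

Definition nagata_emb : {poly k} -> {poly R} := map_poly (polyC \o polyC).
HB.instance Definition _ := GRing.RMorphism.on nagata_emb.

(** The variables of the argument are z, x, y from the inside out. After x -> x + z^N1 and y -> y +
    z^N2 the result is read as a polynomial in z over k[x, y]. *)
Definition nagata_subst N1 N2 : {poly {poly {poly k}}} -> {poly R} :=
  ev nagata_emb ('X%:P%:P + 'X^N1) ('X%:P + 'X^N2).

Let U (c : R) := exists2 d : k, d != 0 & c = d%:P%:P.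

Let monic_XnD (c : R) N : (0 < N)%N -> (c%:P + 'X^N : {poly R}) \is monic.
Proof.
by move=> N0; rewrite monicE addrC lead_coefDl ?lead_coefXn // size_polyXn ltnS (leq_trans (size_polyC_leq1 _)).
Qed.

Let size_XnD (c : R) N : (0 < N)%N -> size (c%:P + 'X^N : {poly R}) = N.+1.
Proof.
by move=> N0; rewrite addrC size_polyDl size_polyXn // ltnS (leq_trans (size_polyC_leq1 _)).
Qed.

Lemma seq_bound (T : Type) (F : T -> nat) (s : seq T) x0 :
  exists2 N, (0 < N)%N & forall i, (i < size s)%N -> (F (nth x0 s i) <= N)%N.
Proof.
exists (\max_(i < size s) F (nth x0 s i)).+1 => // i lt_i.
exact/leqW/(leq_bigmax (Ordinal lt_i)).
Qed.

(** [N1] exceeds all degrees in z and [N2] all degrees after the first substitution, so f becomes a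
    base expansion twice over; no term cancels and the leading coefficient in z is a constant. *)
Lemma nagata_lead (f : {poly {poly {poly k}}}) : f != 0 -> exists N1 N2,
  exists2 d, d != 0 & lead_coef (nagata_subst N1 N2 f) = d%:P%:P.
Proof.
move=> f0.
have [N1 N1_gt0 hN1] : exists2 N, (0 < N)%N & forall i j, (size (f`_i`_j)%R <= N)%N.
  have [M _ hM] := seq_bound (fun p : {poly {poly k}} =>
    \max_(j < size p) size (p`_j)%R) f 0.
  exists M.+1 => // i j; apply: leqW.
  have [lt_i|le_i] := ltnP i (size f); last by rewrite (nth_default _ le_i) coef0 size_poly0.
  have [lt_j|le_j] := ltnP j (size (f`_i)%R); last by rewrite (nth_default _ le_j) size_poly0.
  by apply: leq_trans (hM _ lt_i); apply: (leq_bigmax (Ordinal lt_j)).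
pose g1 : {poly R} := 'X%:P%:P + 'X^N1.
have st0 (p : {poly k}) : p != 0 -> U (lead_coef (nagata_emb p)).
  move=> p0; exists (lead_coef p); first by rewrite lead_coef_eq0.
  by rewrite lead_coef_map_inj // => x y /polyC_inj/polyC_inj.
have st0' (p : {poly k}) : nagata_emb p != 0 -> p != 0.
  by apply: contra_neq => ->; rewrite rmorph0.
have emb0 (p : {poly k}) : p != 0 -> nagata_emb p != 0.
  move=> p0; have [d d0 e] := st0 _ p0.
  by rewrite -lead_coef_eq0 e !polyC_eq0.
have st1 i : f`_i != 0 -> ev1 nagata_emb g1 f`_i != 0 /\ U (lead_coef (ev1 nagata_emb g1 f`_i)).
  move=> fi0; rewrite ev1_sum.
  apply: (@base_expansion _ U g1 N1 _ _ (fun j => nagata_emb f`_i`_j)).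
  - exact: monic_XnD.
  - exact: size_XnD.
  - by move=> j /st0'; apply: st0.
  - by move=> j; rewrite (leq_trans (size_poly _ _)).
  exists (size (f`_i)%R).-1; first by rewrite prednK ?size_poly_gt0.
  by apply: emb0; rewrite -lead_coefE lead_coef_eq0.
have [N2 N2_gt0 hN2] : exists2 N, (0 < N)%N &
    forall i, (size (ev1 nagata_emb g1 (f`_i)%R) <= N)%N.
  have [M M0 hM] := seq_bound (fun p => size (ev1 nagata_emb g1 p)) f 0.
  exists M => // i; have [lt_i|le_i] := ltnP i (size f); first exact: hM.
  by rewrite (nth_default _ le_i) rmorph0 size_poly0.
exists N1, N2; rewrite /nagata_subst ev_sum.
have [] // := @base_expansion _ U ('X%:P + 'X^N2) N2 _ _
  (fun j => ev1 nagata_emb g1 f`_j) (size f).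
- exact: monic_XnD.
- exact: size_XnD.
- move=> j fj; apply: (proj2 (st1 _ _)).
  by apply: contra_neq fj => ->; rewrite rmorph0.
exists (size f).-1; first by rewrite prednK ?size_poly_gt0.
by apply: (proj1 (st1 _ _)); rewrite -lead_coefE lead_coef_eq0.
Qed.

Lemma ev_nagata (K : fieldType) (iota : {rmorphism k -> K}) N1 N2 x y z f :
  @ev1 {poly {poly k}} K (ev iota x y) z (nagata_subst N1 N2 f) =
  ev (ev1 iota z) (x + z ^+ N1) (y + z ^+ N2) f.
Proof.
have e0 p : @ev1 {poly {poly k}} K (ev iota x y) z (nagata_emb p) = ev1 iota z p.
  elim/poly_ind: p => [|p c IH]; first by rewrite !rmorph0.
  rewrite !rmorphD !rmorphM /= IH /nagata_emb map_polyX map_polyC /=.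
  by rewrite !ev1X !ev1C /= evC ev1C.
rewrite /nagata_subst /ev.
rewrite (rmorph_ev1 (chi := ev1 (ev1 iota z) (x + z ^+ N1))).
  by rewrite rmorphD rmorphXn /= ev1X ev1C /= evX.
move=> p; rewrite (rmorph_ev1 (chi := ev1 iota z)) //.
by rewrite rmorphD rmorphXn /= ev1X ev1C /= evC ev1X.
Qed.

End Nagata.

Section Normalization.
Context (k : closedFieldType) (K : fieldType) (iota : {rmorphism k -> K}).
Local Notation ev1 := (ev1 iota).
Local Notation ev := (ev iota).
Local Notation integ X Y := (@integralOver {poly {poly k}} K (ev X Y)).

Lemma integral_ev X Y X' Y' w : integ X' Y' X -> integ X' Y' Y ->
  integ X Y w -> integ X' Y' w.
Proof.
move=> iX iY [p pm pw].
have ic c : integ X' Y' (iota c).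
  have := @integral_id {poly {poly k}} K (ev X' Y') c%:P%:P.
  by rewrite /= evC ev1C.
have i1 q : integ X' Y' (ev1 X q).
  rewrite ev1_sum; apply: integral_sum => i; apply: integral_mul => //.
  exact: integral_exp.
have i2 q : integ X' Y' (ev X Y q).
  rewrite ev_sum; apply: integral_sum => i; apply: integral_mul => //.
  exact: integral_exp.
apply: (@integral_root_monic {poly {poly k}} K (ev X' Y') w (map_poly (ev X Y) p)) => //.
  exact: monic_map.
by move=> v /(nthP 0) [i _ <-]; rewrite coef_map; apply: i2.
Qed.

Lemma integral_gen1 X Y : integ X Y X.
Proof.
have := @integral_id {poly {poly k}} K (ev X Y) 'X%:P.
by rewrite /= evC ev1X.
Qed.

Lemma integral_gen2 X Y : integ X Y Y.
Proof.
have := @integral_id {poly {poly k}} K (ev X Y) 'X.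
by rewrite /= evX.
Qed.

(** The relation of z over k[X, Y], rewritten in X' = X - z^N1 and Y' = Y - z^N2, becomes monic in z
    up to a constant; X and Y are then integral over k[X', Y'] as well. *)
Lemma normalization_step X Y z :
  @algR ({poly {poly k}} : idomainType) K (ev X Y) z ->
  exists N1 N2, let: (X', Y') := (X - z ^+ N1, Y - z ^+ N2) in
    integ X' Y' z /\ forall w, integ X Y w -> integ X' Y' w.
Proof.
case=> f f0 fz.
(* In f the variable z is outermost; the two swaps make it innermost, as [nagata_subst] expects. *)
pose g : {poly {poly {poly k}}} := map_poly (fun p => swapXY p) (swapXY f).
have swap0 (p : {poly {poly k}}) : (swapXY p == 0) = (p == 0).
  by apply/idP/idP => [/eqP h|/eqP ->]; rewrite ?rmorph0 // -(swapXYK p) h rmorph0.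
have g0 : g != 0.
  rewrite map_poly_eq0_id0; first exact: swapXY_neq0.
  by rewrite swap0 lead_coef_eq0 swapXY_neq0.
have gz : gen_ev {poly k} K (ev1 z) X Y g = 0.
  have e1 : gen_ev {poly k} K (ev1 X) z Y (swapXY f) = 0 by rewrite ev_swap.
  rewrite -e1 /gen_ev !(@ev1_sum {poly {poly k}}) size_map_inj_poly //; last exact: rmorph0.
    apply: eq_bigr => i _; rewrite coef_map /=; congr (_ * _).
    exact: ev_swap.
  exact: can_inj (@swapXYK _).
have [N1 [N2 [d d0 lG]]] := nagata_lead g0.
exists N1, N2.
set X' := X - _; set Y' := Y - _.
have iz : integ X' Y' z.
  exists ((d^-1)%:P%:P *: nagata_subst N1 N2 g).
    by rewrite monicE lead_coefZ lG -!polyCM mulVf.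
  apply/rootP; rewrite -ev1E; have := ev_nagata iota N1 N2 X' Y' z g.
  by rewrite !subrK gz => h; rewrite -mul_polyC rmorphM /= h mulr0.
split=> // w; apply: integral_ev.
  rewrite -(subrK (z ^+ N1) X) -/X'; apply: integral_add; first exact: integral_gen1.
  exact: integral_exp.
rewrite -(subrK (z ^+ N2) Y) -/Y'; apply: integral_add; first exact: integral_gen2.
exact: integral_exp.
Qed.

End Normalization.

Opaque ev.

(** * Finitely generated algebras, their normalization and the Nullstellensatz *)

Section Subalgebras.
Context (k : closedFieldType) (K : fieldType) (iota : {rmorphism k -> K}).
Local Notation ev1 := (ev1 iota).
Local Notation ev := (ev iota).

Definition subalg (A : set K) : Prop :=
  [/\ forall c, A (iota c), forall a b, A a -> A b -> A (a + b) &
      forall a b, A a -> A b -> A (a * b)].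

Section SubalgTheory.
Context (A : set K) (sA : subalg A).

Lemma subalgC c : A (iota c). Proof. by case: sA. Qed.
Lemma subalgD a b : A a -> A b -> A (a + b). Proof. by case: sA => _ + _; apply. Qed.
Lemma subalgM a b : A a -> A b -> A (a * b). Proof. by case: sA => _ _; apply. Qed.
Lemma subalg0 : A 0. Proof. by rewrite -(rmorph0 iota); apply: subalgC. Qed.
Lemma subalg1 : A 1. Proof. by rewrite -(rmorph1 iota); apply: subalgC. Qed.
Lemma subalgN a : A a -> A (- a).
Proof.
by move=> h; rewrite -mulN1r -(rmorph1 iota) -rmorphN; apply: subalgM => //; apply: subalgC.
Qed.
Lemma subalgB a b : A a -> A b -> A (a - b).
Proof. by move=> ha /subalgN; apply: subalgD. Qed.
Lemma subalgX a n : A a -> A (a ^+ n).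
Proof.
move=> h; elim: n => [|n IH]; first by rewrite expr0; apply: subalg1.
by rewrite exprS; apply: subalgM.
Qed.
Lemma subalg_sum I (r : seq I) (P : pred I) F :
  (forall i, P i -> A (F i)) -> A (\sum_(i <- r | P i) F i).
Proof.
move=> h; elim/big_rec: _ => [|i x Pi IH]; first exact: subalg0.
by apply: subalgD => //; apply: h.
Qed.
Lemma subalg_ev1 a p : A a -> A (ev1 a p).
Proof.
move=> h; rewrite ev1_sum; apply: subalg_sum => i _.
by apply: subalgM; [exact: subalgC|exact: subalgX].
Qed.
Lemma subalg_ev a b P : A a -> A b -> A (ev a b P).
Proof.
move=> ha hb; rewrite ev_sum; apply: subalg_sum => i _.
by apply: subalgM; [exact: subalg_ev1|exact: subalgX].
Qed.
End SubalgTheory.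

Lemma kalg_subalg S : subalg (kalg iota S).
Proof.
by split=> *; [exact: kalg_const|exact: kalg_add|exact: kalg_mul].
Qed.

Lemma kalg_min S A : subalg A -> S `<=` A -> kalg iota S `<=` A.
Proof.
move=> sA SA z; elim=> [c|w /SA //|a b _ + _|a b _ + _]; first exact: subalgC.
  exact: subalgD.
exact: subalgM.
Qed.

Lemma kalg_mono S T : S `<=` kalg iota T -> kalg iota S `<=` kalg iota T.
Proof. exact: kalg_min (kalg_subalg T). Qed.

Lemma kalg2E t y z : kalg iota [set t; y] z <-> exists P, z = ev t y P.
Proof.
split=> [|[P ->]].
  elim=> [c|w|a b _ [P ->] _ [Q ->]|a b _ [P ->] _ [Q ->]].
  - by exists c%:P%:P; rewrite evC ev1C.
  - by case=> ->; [exists 'X%:P; rewrite evC ev1X|exists 'X; rewrite evX].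
  - by exists (P + Q); rewrite rmorphD.
  - by exists (P * Q); rewrite rmorphM.
by apply: subalg_ev; [exact: kalg_subalg| |]; apply: kalg_gen; [left|right].
Qed.

Definition frac_full (A : set K) :=
  forall z, exists a b, [/\ A a, A b, b != 0 & z = a / b].

Lemma frac_fullP S : frac_full (kalg iota S) <-> kfield iota S = setT.
Proof.
split=> [h|h z]; first by apply/seteqP; split=> // z _; apply: h.
by have : [set: K] z by []; rewrite -h.
Qed.

Lemma frac_full_sub A B : A `<=` B -> frac_full A -> frac_full B.
Proof. by move=> AB h z; have [a [b [/AB ? /AB ? ? ?]]] := h z; exists a, b. Qed.

Lemma pure_trbasis s t : purely_transcendental iota s t ->
  trbasis iota s t.
Proof.
case=> /alg_independentE /indep_sym ist /frac_fullP hf; split=> // z.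
have hin a : kalg iota [set s; t] a -> @algR ({poly {poly k}} : idomainType) K (ev s t) a.
  move=> /kalg2E [P ->]; exact: (@algR_id ({poly {poly k}} : idomainType) K (ev s t)).
have [a [b [/hin ha /hin hb _ ->]]] := hf z.
apply: algR_mul => //; first exact: indep_inj.
exact: algR_inv.
Qed.

(** Each generator in turn is made integral by [normalization_step]. Earlier integrality persists,
    and so does independence, because the old pair is integral over the new one. *)
Lemma normalization_list s t A X0 Y0 (zs : seq K) : trbasis iota s t -> subalg A ->
  A X0 -> A Y0 -> indep iota X0 Y0 -> (forall z, z \in zs -> A z) ->
  exists X Y, [/\ A X, A Y, indep iota X Y &
    forall z, z \in zs -> @integralOver {poly {poly k}} K (ev X Y) z].
Proof.
move=> htr sA AX0 AY0 i0; elim: zs => [|z zs IH] hz; first by exists X0, Y0.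
have [|X [Y [AX AY iXY h]]] := IH.
  by move=> w hw; apply: hz; rewrite inE hw orbT.
have Az : A z by apply: hz; rewrite inE eqxx.
have [_ /(_ z) /normalization_step [N1 [N2 []]]] := indep_trbasis htr iXY.
set X' := X - _; set Y' := Y - _ => iz iw.
exists X', Y'; split.
- by apply: subalgB => //; apply: subalgX.
- by apply: subalgB => //; apply: subalgX.
- apply: indep_of_integral iXY _ _; apply: iw; first exact: integral_gen1.
  exact: integral_gen2.
move=> w; rewrite inE => /orP[/eqP-> //|/h]; exact: iw.
Qed.

Lemma algR_closure_subalg (R : idomainType) (phi : {rmorphism R -> K}) :
  injective phi -> (forall c, algR phi (iota c)) -> subalg (algR phi).
Proof. by move=> h hk; split=> [//|a b|a b]; [exact: algR_add|exact: algR_mul]. Qed.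

Lemma normalization s t (zs : seq K) : trbasis iota s t ->
  let A := kalg iota [set z | z \in zs] in frac_full A ->
  exists X Y, [/\ A X, A Y, indep iota X Y &
    forall a, A a -> @integralOver {poly {poly k}} K (ev X Y) a].
Proof.
move=> htr A hA; have sA : subalg A := kalg_subalg _.
have [ist _] := htr.
have frac_alg (R : idomainType) (phi : {rmorphism R -> K}) :
    injective phi -> (forall c, algR phi (iota c)) ->
    (forall z, z \in zs -> algR phi z) -> forall z, algR phi z.
  move=> phi_inj hc hz z; have [a [b [Aa Ab _ ->]]] := hA z.
  have sub : A `<=` algR phi by apply: kalg_min => //; exact: algR_closure_subalg.
  exact: (algR_mul phi_inj (sub _ Aa) (algR_inv (sub _ Ab))).
(* If all generators were constants, K would be algebraic over k. *)
have [X0 X0z tX0] : exists2 X0, X0 \in zs & transc iota X0.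
  apply: contrapT => hn.
  suff /algR_closed [c es] : algR iota s.
    by have := indep_transc ist; rewrite es => /transc_const.
  apply: frac_alg; [exact: fmorph_inj|exact: algR_id|] => z hz.
  have [tz|[c ->]] := transcP iota z; last exact: algR_id.
  by case: hn; exists z.
(* If all generators were algebraic over k(X0), so would be both s and t. *)
have [Y0 Y0z nY0] : exists2 Y0, Y0 \in zs & ~ @algR ({poly k} : idomainType) K (ev1 X0) Y0.
  apply: contrapT => hn.
  have hall : forall z, @algR ({poly k} : idomainType) K (ev1 X0) z.
    apply: frac_alg; [exact: transc_inj|exact: algR_ev1_const|] => z hz.
    by apply: contrapT => nz; case: hn; exists z.
  exact: indep_not_both ist tX0 (hall s) (hall t).
have [||||X [Y [AX AY iXY h]]] := @normalization_list s t A X0 Y0 zs htr sA.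
- exact: kalg_gen.
- exact: kalg_gen.
- exact: indepP.
- by move=> z zz; apply: kalg_gen.
exists X, Y; split=> // a; elim=> [c|w /h //|b c _ + _|b c _ + _].
- have := @integral_id {poly {poly k}} K (ev X Y) c%:P%:P.
  by rewrite /= evC ev1C.
- exact: integral_add.
- exact: integral_mul.
Qed.

Section MaximalIdeal.
Context (A m : set K) (sA : subalg A) (hm : maximal_ideal A m).

Lemma max_sub a : m a -> A a. Proof. by case: hm => + _ _ _ _; apply. Qed.
Lemma max0 : m 0. Proof. by case: hm => _ []. Qed.
Lemma maxD a b : m a -> m b -> m (a + b). Proof. by case: hm => _ [_ +] _ _ _; apply. Qed.
Lemma maxM a b : A a -> m b -> m (a * b). Proof. by case: hm => _ _ + _ _; apply. Qed.
Lemma maxMr a b : m a -> A b -> m (a * b). Proof. by rewrite mulrC => ? ?; apply: maxM. Qed.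
Lemma max1 : ~ m 1. Proof. by case: hm. Qed.
Lemma maxV a : A a -> ~ m a -> exists2 b, A b & m (1 - a * b).
Proof. by case: hm => _ _ _ _; apply. Qed.
Lemma maxN a : m a -> m (- a).
Proof.
move=> h; rewrite -mulN1r; apply: maxM => //.
exact/(subalgN sA)/(subalg1 sA).
Qed.
Lemma maxB a b : m a -> m b -> m (a - b). Proof. by move=> ? /maxN; apply: maxD. Qed.
Lemma max_sum I (r : seq I) (P : pred I) F :
  (forall i, P i -> m (F i)) -> m (\sum_(i <- r | P i) F i).
Proof.
move=> h; elim/big_rec: _ => [|i x Pi IH]; first exact: max0.
by apply: maxD => //; apply: h.
Qed.

Lemma max_prime a b : A a -> A b -> m (a * b) -> m a \/ m b.
Proof.
move=> Aa Ab mab; have [ma|nma] := EM (m a); first by left.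
right; have [c Ac h] := maxV Aa nma.
rewrite -[b](subrK (b * (a * c))); apply: maxD.
  by rewrite -{1}(mulr1 b) -mulrBr; apply: maxM.
by rewrite mulrA [b * a]mulrC; apply: maxMr.
Qed.

Lemma max_const c : c != 0 -> ~ m (iota c).
Proof.
move=> c0 /(maxM (subalgC sA c^-1)); rewrite -rmorphM mulVf // rmorph1.
exact: max1.
Qed.

Lemma max_ev1_root z p : A z -> p != 0 -> m (ev1 z p) -> exists c, m (z - iota c).
Proof.
move=> Az p0; have [r ->] := closed_field_poly_normal p.
have l0 : lead_coef p != 0 by rewrite lead_coef_eq0.
rewrite -mul_polyC rmorphM /= ev1C => /(max_prime (subalgC sA _)) [].
- exact: subalg_ev1.
- by move/(max_const l0).
elim: r {p0 l0} => [|c r IH]; first by rewrite big_nil rmorph1 => /max1.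
rewrite big_cons rmorphM rmorphB /= ev1X ev1C => /max_prime [].
- by apply: subalgB => //; apply: subalgC.
- exact: subalg_ev1.
- by exists c.
exact: IH.
Qed.

Lemma max_cong_ev1 u v p : A u -> A v -> m (u - v) -> m (ev1 u p - ev1 v p).
Proof.
move=> Au Av muv; elim/poly_ind: p => [|p c IH].
  by rewrite !rmorph0 subrr; apply: max0.
rewrite !rmorphD !rmorphM /= !ev1X !ev1C.
have -> : ev1 u p * u + iota c - (ev1 v p * v + iota c) =
  (ev1 u p - ev1 v p) * u + ev1 v p * (u - v) by ring.
by apply: maxD; [exact: maxMr|apply: maxM => //; exact: subalg_ev1].
Qed.

Lemma max_cong_ev u v u' v' P : A u -> A v -> A u' -> A v' ->
  m (u - v) -> m (u' - v') -> m (ev u u' P - ev v v' P).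
Proof.
move=> Au Av Au' Av' muv muv'; elim/poly_ind: P => [|P c IH].
  by rewrite !rmorph0 subrr; apply: max0.
rewrite !rmorphD !rmorphM /= !evX !evC.
have -> : ev u u' P * u' + ev1 u c - (ev v v' P * v' + ev1 v c) =
  (ev u u' P - ev v v' P) * u' + ev v v' P * (u' - v') + (ev1 u c - ev1 v c) by ring.
apply: maxD; last exact: max_cong_ev1.
by apply: maxD; [exact: maxMr|apply: maxM => //; exact: subalg_ev].
Qed.

Context (X Y : K) (AX : A X) (AY : A Y) (iXY : indep iota X Y).
Hypothesis int : forall a, A a -> @integralOver {poly {poly k}} K (ev X Y) a.

(** If z has no residue in k, then z - a has an inverse w modulo m. Multiplying the integral
    equation of w by (z - a)^n removes w and leaves an element of m that is 1 modulo Z - a in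
    k[X, Y]. *)
Lemma max_inverse_relation Z : (forall c, ~ m (ev X Y Z - iota c)) ->
  forall a, exists h, m (ev X Y (1 + (Z - a%:P%:P) * h)).
Proof.
move=> hZ a; set z := ev X Y Z in hZ *.
have Az : A z by apply: subalg_ev.
have Aza : A (z - iota a) by apply: subalgB => //; apply: subalgC.
have [w Aw mw] := maxV Aza (hZ a).
have [p pm /rootP pw] := int Aw.
pose n := (size p).-1; pose zeta := Z - a%:P%:P.
have ezeta : ev X Y zeta = z - iota a by rewrite /zeta evB evC ev1C.
have sp : size p = n.+1 by rewrite /n prednK // size_poly_gt0 monic_neq0.
exists (\sum_(i < n) p`_i * zeta ^+ (n - i.+1)).
have -> : 1 + (Z - a%:P%:P) * \sum_(i < n) p`_i * zeta ^+ (n - i.+1) =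
    \sum_(i < n.+1) p`_i * zeta ^+ (n - i).
  have pn : p`_n = 1 := monicP pm.
  rewrite big_ord_recr /= subnn expr0 mulr1 pn addrC; congr (_ + _).
  rewrite big_distrr /=; apply: eq_bigr => i _.
  by rewrite mulrCA -exprS subnSK.
set r := (z - iota a) * w in mw.
have Ar : A r by apply: subalgM.
have mr i : m (1 - r ^+ i).
  elim: i => [|i IH]; first by rewrite expr0 subrr; apply: max0.
  have -> : 1 - r ^+ i.+1 = (1 - r ^+ i) + r ^+ i * (1 - r) by rewrite exprS; ring.
  by apply: maxD => //; apply: maxM => //; apply: subalgX.
suff -> : ev X Y (\sum_(i < n.+1) p`_i * zeta ^+ (n - i)) =
   \sum_(i < n.+1) (ev X Y p`_i * (z - iota a) ^+ (n - i)) * (1 - r ^+ i).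
  apply: max_sum => i _; apply: maxM => //.
  by apply: subalgM; [|exact: subalg_ev|exact: subalgX].
have e0 : \sum_(i < n.+1) (ev X Y p`_i * (z - iota a) ^+ (n - i)) * r ^+ i = 0.
  have pw' : gen_ev1 {poly {poly k}} K (ev X Y) w p = 0 := pw.
  transitivity ((z - iota a) ^+ n * gen_ev1 {poly {poly k}} K (ev X Y) w p).
    rewrite ev1_sum sp big_distrr /=; apply: eq_bigr => i _.
    rewrite /r exprMn.
    have -> : (z - iota a) ^+ n = (z - iota a) ^+ (n - i) * (z - iota a) ^+ i.
      by rewrite -exprD subnK // -ltnS.
    by move: (ev X Y p`_i) (_ ^+ (n - i)) (_ ^+ i) (w ^+ i) => *; ring.
  by rewrite pw' mulr0.
under [RHS]eq_bigr => i _ do rewrite mulrBr mulr1.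
rewrite sumrB e0 subr0 ev_bigsum; apply: eq_bigr => i _.
by rewrite evM evXn ezeta.
Qed.

Lemma ev_horner_inner a y P : ev (iota a) y P = ev1 y (map_poly (horner_eval a) P).
Proof.
rewrite ev_sum ev1E (horner_coef_wide y (n := size P)).
  apply: eq_bigr => i _; rewrite !coef_map /= /horner_eval; congr (_ * _).
  by rewrite ev1E horner_map.
by rewrite (leq_trans (size_poly _ _)) // (leq_trans (size_poly _ _)).
Qed.

(** The Nullstellensatz through normalization: X and then Y are shown to have residues x0 and y0 in
    k, and the integral equation of z, specialized there, is a nonzero polynomial over k that z
    satisfies modulo m. *)
Lemma max_residue z : A z -> exists c, m (z - iota c).
Proof.
have [x0 mx0] : exists c, m (X - iota c).
  apply: contrapT => hn; have hX c : ~ m (X - iota c) by move=> ?; apply: hn; exists c.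
  have hX' c : ~ m (ev X Y 'X%:P - iota c) by rewrite evC ev1X.
  have nz b h : map_poly (horner_eval b) (1 + ('X%:P - b%:P%:P) * h) = 1 :> {poly k}.
    rewrite rmorphD rmorph1 rmorphM rmorphB /= !map_polyC /= /horner_eval.
    by rewrite hornerX hornerC subrr mul0r addr0.
  (* Q has least degree in Y among the nonzero polynomials lying in m. This degree is positive,
     since a polynomial in X alone would split and give X a residue. *)
  have [Q [Q0 mQ minQ]] : exists Q, [/\ Q != 0, m (ev X Y Q) &
      forall Q', Q' != 0 -> m (ev X Y Q') -> (size Q <= size Q')%N].
    pose P n := `[< exists Q, [/\ Q != 0, m (ev X Y Q) & size Q = n] >].
    have exP : exists n, P n.
      have [h mh] := max_inverse_relation hX' 0.
      exists (size (1 + ('X%:P - 0%:P%:P) * h)); apply/asboolP.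
      eexists; split; [|exact: mh|by []].
      apply/eqP => e0; have := nz 0 h; rewrite e0 rmorph0.
      by move/eqP; rewrite eq_sym oner_eq0.
    case: (ex_minnP exP) => n /asboolP [Q [Q0 mQ sQ]] minn.
    exists Q; split=> // Q' Q'0 mQ'; rewrite sQ; apply: minn.
    by apply/asboolP; exists Q'.
  have sQ : (1 < size Q)%N.
    rewrite ltnNge; apply/negP => /size1_polyC e.
    move: Q0 mQ; rewrite e polyC_eq0 evC => q0 /(max_ev1_root AX q0) [c].
    exact: hX.
  have l0 : lead_coef Q != 0 by rewrite lead_coef_eq0.
  have /closed_nonrootP [a la] := l0.
  have [h mh] := max_inverse_relation hX' a.
  set g := 1 + _ in mh.
  (* By minimality Q pseudo-divides g. At X = a, where the leading coefficient of Q does not vanish,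
     g becomes 1, so a nonzero constant would be a multiple of a polynomial of positive degree. *)
  have := Pdiv.Idomain.divp_eq g Q; set q := g %/ Q; set r := g %% Q => er.
  have r0 : r = 0.
    apply/eqP; apply: contraT => r0.
    have : m (ev X Y r).
      have -> : r = lead_coef Q ^+ scalp g Q *: g - q * Q by rewrite er addrC addKr.
      rewrite -mul_polyC evB !evM; apply: maxB; apply: maxM => //;
        exact: subalg_ev.
    by move=> /(minQ _ r0); rewrite leqNgt ltn_modp Q0.
  move: er; rewrite r0 addr0 => /(congr1 (map_poly (horner_eval a))).
  rewrite -mul_polyC !rmorphM /= nz mulr1 map_polyC /= /horner_eval => /(congr1 (fun p : {poly k} => size p)).
  have lan0 : (lead_coef Q).[a] != 0 by [].
  rewrite size_polyC horner_exp expf_neq0 //=.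
  set Qa := map_poly _ Q; set qa := map_poly _ q => es.
  have sQa : size Qa = size Q by rewrite size_map_poly_id0.
  have qa0 : qa != 0 by apply: contra_eq_neq es => ->; rewrite mul0r size_poly0.
  have Qa0 : Qa != 0 by rewrite -size_poly_gt0 sQa ltnW.
  move: es; rewrite size_mul // sQa.
  have : (0 < size qa)%N by rewrite size_poly_gt0.
  by move: sQ; case: (size Q) => [|[|u]] //; case: (size qa) => // v _ _; rewrite addSn !addnS.
have mcg y P : A y -> m (ev X Y P) -> m (Y - y) -> m (ev1 y (map_poly (horner_eval x0) P)).
  move=> Ay mP mY; rewrite -ev_horner_inner.
  rewrite -[ev _ _ _](subKr (ev X Y P)); apply: maxB => //.
  by apply: max_cong_ev => //; apply: subalgC.
have [y0 my0] : exists c, m (Y - iota c).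
  apply: contrapT => hn; have hY c : ~ m (ev X Y 'X - iota c).
    by rewrite evX => ?; apply: hn; exists c.
  have [h mh] := max_inverse_relation hY 0.
  have := mcg Y _ AY mh; rewrite subrr => /(_ max0) /(max_ev1_root AY) [].
    apply/eqP => /(congr1 (fun p => p.[0])).
    rewrite !polyC0 subr0 rmorphD rmorph1 rmorphM /= map_polyX hornerD hornerM hornerX.
    by rewrite mul0r addr0 -polyC1 -polyC0 !hornerC => /eqP; rewrite oner_eq0.
  by move=> c hc; apply: hn; exists c.
move=> Az; have [p pm /rootP pz] := int Az.
pose f : {poly {poly k}} -> k := fun P => (map_poly (horner_eval x0) P).[y0].
have fM : f =1 horner_eval y0 \o map_poly (horner_eval x0) by [].
apply: (@max_ev1_root z (map_poly f p)) => //.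
  apply/eqP => /(congr1 (fun q : {poly k} => q`_(size p).-1)).
  rewrite coef0 coef_poly prednK ?size_poly_gt0 ?monic_neq0 // leqnn -lead_coefE.
  rewrite (monicP pm) /f rmorph1 hornerC => /eqP; by rewrite oner_eq0.
have e0 : gen_ev1 {poly {poly k}} K (ev X Y) z p = 0 := pz.
suff : m (ev1 z (map_poly f p) - gen_ev1 {poly {poly k}} K (ev X Y) z p).
  by rewrite e0 subr0.
rewrite (ev1_sum _ _ p) ev1E (horner_coef_wide z (n := size p)); last first.
  by rewrite (leq_trans (size_poly _ _)) // size_poly.
rewrite -sumrB; apply: max_sum => i _; rewrite -mulrBl; apply: maxMr; last exact: subalgX.
rewrite coef_map coef_poly ltn_ord -/(f _).
rewrite -opprB; apply: maxN.
have := max_cong_ev p`_i AX (subalgC sA x0) AY (subalgC sA y0) mx0 my0.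
by rewrite ev_horner_inner ev1E horner_map.
Qed.

End MaximalIdeal.
End Subalgebras.

(** * Noetherian rings *)

Section Modules.
Context (K : fieldType).
Implicit Types (C : set K) (g : seq K).

(** The coefficient set [C] is arbitrary: Nakayama's lemma uses it with the maximal ideal, and the
    construction of valuation rings with an ideal basis that is not yet closed. *)
Fixpoint gen C g (x : K) : Prop :=
  if g is y :: g' then exists a b, [/\ C a, gen C g' b & x = a * y + b]
  else x = 0.

Definition ideal (A I : set K) : Prop :=
  [/\ I `<=` A, I 0, forall a b, I a -> I b -> I (a + b) &
      forall a b, A a -> I b -> I (a * b)].

Definition noeth (A : set K) : Prop := forall I, ideal A I ->
  exists2 g, forall x, x \in g -> I x & forall x, I x -> gen A g x.

Lemma gen0 C g : C 0 -> gen C g 0.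
Proof.
move=> C0; elim: g => // y g IH /=; exists 0, 0.
by rewrite mul0r addr0.
Qed.

Lemma gen_mem C g x : C 0 -> C 1 -> x \in g -> gen C g x.
Proof.
move=> C0 C1; elim: g => // y g IH; rewrite inE => /orP[/eqP ->|/IH h] /=.
  by exists 1, 0; split=> //; [exact: gen0|rewrite mul1r addr0].
by exists 0, x; rewrite mul0r add0r.
Qed.

Lemma genD C g x y : (forall a b, C a -> C b -> C (a + b)) ->
  gen C g x -> gen C g y -> gen C g (x + y).
Proof.
move=> CD; elim: g x y => [|z g IH] x y /=; first by move=> -> ->; rewrite addr0.
case=> a [b [Ca gb ->]] [a' [b' [Ca' gb' ->]]].
by exists (a + a'), (b + b'); split; [exact: CD|exact: IH|ring].
Qed.

Lemma genM C C' c g x : (forall a, C a -> C' (c * a)) ->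
  gen C g x -> gen C' g (c * x).
Proof.
move=> CM; elim: g x => [|z g IH] x /=; first by move=> ->; rewrite mulr0.
case=> a [b [Ca gb ->]].
by exists (c * a), (c * b); split; [exact: CM|exact: IH|ring].
Qed.

Lemma gen_subset C C' g x : C `<=` C' -> gen C g x -> gen C' g x.
Proof. by move=> h /(@genM C C' 1); rewrite mul1r; apply=> a; rewrite mul1r; apply: h. Qed.

Lemma gen_cat C g h x y : gen C g x -> gen C h y -> gen C (g ++ h) (x + y).
Proof.
elim: g x => [|z g IH] x /=; first by move=> -> ; rewrite add0r.
by case=> a [b [Ca gb ->]] gy; exists a, (b + y); split=> //; [exact: IH|ring].
Qed.

Lemma gen_in (N : set K) C g x : N 0 -> (forall a b, N a -> N b -> N (a + b)) ->
  (forall a b, C a -> b \in g -> N (a * b)) -> gen C g x -> N x.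
Proof.
move=> N0 ND; elim: g x => [|y g IH] x h /=; first by move=> ->.
case=> a [b [Ca gb ->]]; apply: ND; first by apply: h => //; rewrite inE eqxx.
by apply: IH gb => c d Cc dg; apply: h => //; rewrite inE dg orbT.
Qed.

Lemma noeth_acc A (I : nat -> set K) : noeth A ->
  (forall n, ideal A (I n)) -> (forall n, I n `<=` I n.+1) ->
  exists N, forall n, I n `<=` I N.
Proof.
move=> nA hI mono.
have mono' m n : (m <= n)%N -> I m `<=` I n.
  move=> /subnK <-; elim: (n - m)%N => [|d IH] //.
  by apply: subset_trans IH _; rewrite addSn.
have [] := nA [set x | exists n, I n x].
  split=> [x [n]|||].
  - by case: (hI n) => + _ _ _; apply.
  - by exists 0%N; case: (hI 0%N).
  - move=> a b [m am] [n bn]; exists (maxn m n).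
    case: (hI (maxn m n)) => _ _ + _; apply.
      exact: mono' (leq_maxl _ _) _ am.
    exact: mono' (leq_maxr _ _) _ bn.
  - by move=> a b Aa [n bn]; exists n; case: (hI n) => _ _ _; apply.
move=> g hg gen_g.
have [N hN] : exists N, forall x, x \in g -> I N x.
  elim: g hg {gen_g} => [|y g IH] hg; first by exists 0%N.
  have [N hN] := IH (fun x xg => hg x (mem_behead (s := y :: g) xg)).
  have [M hM] := hg y (mem_head _ _).
  exists (maxn M N) => x; rewrite inE => /orP[/eqP ->|/hN].
    exact: mono' (leq_maxl _ _) _ hM.
  exact: mono' (leq_maxr _ _) _.
exists N => n x Ix; case: (hI N) => _ I0 ID IM.
by apply: (gen_in _ _ _ (gen_g x _)) => //; [move=> a b Aa /hN; apply: IM|exists n].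
Qed.

Section HilbertBasis.
Context (A B : set K) (z : K).
Hypotheses (A0 : A 0) (A1 : A 1) (AD : forall a b, A a -> A b -> A (a + b))
  (AM : forall a b, A a -> A b -> A (a * b)).
Hypotheses (BD : forall a b, B a -> B b -> B (a + b))
  (BM : forall a b, B a -> B b -> B (a * b)).
Hypotheses (AB : A `<=` B) (Bz : B z) (AN : forall a, A a -> A (- a)).

Let PA (p : {poly K}) := forall i, A p`_i.

Let PAD p q : PA p -> PA q -> PA (p + q).
Proof. by move=> hp hq i; rewrite coefD; apply: AD. Qed.
Let PAZ a p : A a -> PA p -> PA (a *: p).
Proof. by move=> ha hp i; rewrite coefZ; apply: AM. Qed.
Let PAX p j : PA p -> PA ('X^j * p).
Proof. by move=> hp i; rewrite coefXnM; case: ifP. Qed.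
Let BX j : B (z ^+ j).
Proof.
elim: j => [|j IH]; first by rewrite expr0; apply: AB.
by rewrite exprS; apply: BM.
Qed.

Hypothesis Bpoly : forall b, B b -> exists2 p, PA p & b = p.[z].

(** Hilbert's argument, run on the preimage of I under evaluation A[X] -> B at z, since B = A[z]
    need not be a polynomial ring. [L n] holds the coefficients of X^n in the members of that
    preimage of degree at most n. *)
Lemma hilbert_basis : noeth A -> noeth B.
Proof.
move=> nA I [IB I0 ID IM].
pose L n : set K := [set c | exists p, [/\ PA p, I p.[z], (size p <= n.+1)%N & p`_n = c]].
have B0 : B 0 by apply: AB.
have hL n : ideal A (L n).
  split=> [c [p [hp _ _ <-]] //| |c d [p [hp ip sp <-]] [q [hq iq sq <-]]|
           c d Ac [p [hp ip sp <-]]].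
  - by exists 0; rewrite horner0 size_poly0 coef0; split=> // i; rewrite coef0.
  - exists (p + q); rewrite hornerD coefD; split=> //; [exact: PAD|exact: ID|].
    by rewrite (leq_trans (size_polyD _ _)) // geq_max sp.
  - exists (c *: p); rewrite hornerZ coefZ; split=> //; first exact: PAZ.
      by apply: IM => //; apply: AB.
    by rewrite (leq_trans (size_scale_leq _ _)).
have Lmono n : L n `<=` L n.+1.
  move=> c [p [hp ip sp <-]]; exists ('X^1 * p); rewrite coefXnM hornerM hornerXn /= subn1.
  split=> //; [exact: PAX|exact: IM|].
  rewrite (leq_trans (size_polyMleq _ _)) // size_polyXn add2n /=.
  by rewrite ltnS.
(* Generators of [L n] are lifted to polynomials; multiplying these by X^j reaches every leading
   coefficient in degree n + j without new elements of I. *)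
have lead_gens n g : (forall y, y \in g -> L n y) ->
    exists2 H, forall x, x \in H -> I x &
      forall c, gen A g c -> forall j, exists q,
        [/\ PA q, (size q <= (n + j).+1)%N, q`_(n + j) = c & gen B H q.[z]].
  elim: g => [|y g IH] hg.
    exists [::] => // c /= -> j; exists 0; rewrite size_poly0 coef0 horner0.
    by split=> // i; rewrite coef0.
  have [|H HI hH] := IH; first by move=> x xg; apply: hg; rewrite inE xg orbT.
  have [q [hq iq sq qn]] := hg y (mem_head _ _).
  exists (q.[z] :: H) => [x|c /= [a [b [Aa gb ->]]] j].
    by rewrite inE => /orP[/eqP ->|/HI].
  have [q' [hq' sq' qn' gq']] := hH b gb j.
  exists (a *: ('X^j * q) + q'); split.
  - by apply: PAD => //; apply: PAZ => //; apply: PAX.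
  - rewrite (leq_trans (size_polyD _ _)) // geq_max sq' andbT.
    rewrite (leq_trans (size_scale_leq _ _)) //.
    rewrite (leq_trans (size_polyMleq _ _)) // size_polyXn /= addnC.
    by rewrite -addSn leq_add2r.
  - rewrite coefD coefZ coefXnM ltnNge leq_addl /= addnK qn qn'.
    by rewrite mulrC.
  exists (a * z ^+ j), q'.[z]; split=> //; first by apply: BM => //; apply: AB.
  by rewrite hornerD hornerZ hornerM hornerXn mulrA.
have reduce n H p q : (forall x, x \in H -> I x) -> PA p -> I p.[z] ->
    (size p <= n.+1)%N -> PA q -> (size q <= n.+1)%N -> q`_n = p`_n -> gen B H q.[z] ->
    [/\ PA (p - q), I (p - q).[z] & (size (p - q)%R <= n)%N].
  move=> HI hp ip sp hq sq e gq.
  have Iq : I q.[z] by apply: gen_in gq => // a b Ba /HI; apply: IM.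
  have AN1 : A (-1) by apply: AN.
  split; first by move=> i; rewrite coefB -mulN1r; apply: AD => //; apply: AM.
    rewrite hornerD hornerN -mulN1r; apply: ID => //; apply: IM => //.
    exact: AB.
  apply/leq_sizeP => j; rewrite coefB leq_eqVlt => /orP[/eqP <-|lt_nj].
    by rewrite e subrr.
  by rewrite !nth_default ?subrr // (leq_trans _ lt_nj).
have low n : exists2 G, forall x, x \in G -> I x &
    forall p, PA p -> I p.[z] -> (size p <= n)%N -> gen B G p.[z].
  elim: n => [|n [G GI hG]].
    exists [::] => // p _ _; rewrite leqn0 size_poly_eq0 => /eqP ->.
    by rewrite horner0.
  have [g gL hg] := nA _ (hL n).
  have [H HI hH] := lead_gens n g gL.
  exists (H ++ G) => [x|p hp ip sp]; first by rewrite mem_cat => /orP[/HI|/GI].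
  have gp : gen A g p`_n by apply: hg; exists p.
  have [q [hq]] := hH _ gp 0%N; rewrite addn0 => sq qn gq.
  have [h1 h2 h3] := reduce _ _ _ _ HI hp ip sp hq sq qn gq.
  rewrite -(subrK q p) hornerD addrC; apply: gen_cat => //.
  exact: hG.
(* From degree d on the leading ideals are constant, so the lifts from degree d suffice there; [low]
   handles the finitely many degrees below. *)
have [d hd] := noeth_acc nA hL Lmono.
have [g gL hg] := nA _ (hL d).
have [H HI hH] := lead_gens d g gL.
have [G GI hG] := low d.
exists (H ++ G) => [x|x Ix]; first by rewrite mem_cat => /orP[/HI|/GI].
have [p hp ex] := Bpoly (IB _ Ix); rewrite ex in Ix *.
have [n] := ubnP (size p); elim: n p hp Ix {ex} => // n IH p hp ip.
have genHGD := @genD B (H ++ G) _ _ BD.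
have [le_pd _|lt_dp lt_pn] := leqP (size p) d.
  by rewrite -[_.[z]]add0r; apply: gen_cat; [exact: gen0|exact: hG].
pose m := (size p).-1.
have sp : size p = m.+1 by rewrite prednK // (leq_ltn_trans _ lt_dp).
have le_dm : (d <= m)%N by rewrite -ltnS -sp.
have gp : gen A g p`_m by apply/hg/(hd m); exists p; rewrite sp.
have [q [hq]] := hH _ gp (m - d)%N; rewrite subnKC // => sq qn gq.
have [|h1 h2 h3] := reduce _ _ _ _ HI hp ip _ hq sq qn gq; first by rewrite sp.
rewrite -(subrK q p) hornerD; apply: genHGD.
  by apply: IH => //; rewrite (leq_ltn_trans h3) // -ltnS -sp.
by rewrite -[q.[z]]addr0; apply: gen_cat => //; apply: gen0.
Qed.

End HilbertBasis.
End Modules.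

Section NoetherianAlgebras.
Context (k : closedFieldType) (K : fieldType) (iota : {rmorphism k -> K}).

Lemma kalg_noeth (zs : seq K) : noeth (kalg iota [set z | z \in zs]).
Proof.
elim: zs => [|z zs IH].
  move=> I [IA I0 ID IM].
  have [[x [Ix x0]]|h] := EM (exists x, I x /\ x != 0).
    have [c ex] : exists c, x = iota c.
      elim: (IA _ Ix) => [c|//|a b _ [c ->] _ [d ->]|a b _ [c ->] _ [d ->]].
      - by exists c.
      - by exists (c + d); rewrite rmorphD.
      - by exists (c * d); rewrite rmorphM.
    have c0 : c != 0 by move: x0; rewrite ex fmorph_eq0.
    exists [:: 1] => [y|y Iy]; last first.
      by exists y, 0; rewrite mulr1 addr0; split=> //; apply: IA.
    rewrite inE => /eqP ->; rewrite -(rmorph1 iota) -(mulVf c0) rmorphM -ex.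
    by apply: IM => //; apply: kalg_const.
  exists [::] => // y Iy /=; apply/eqP; apply: contraT => y0.
  by case: h; exists y.
set A := kalg _ _ in IH; set B := kalg _ _.
have sA : subalg iota A := kalg_subalg _ _.
have sB : subalg iota B := kalg_subalg _ _.
have AB : A `<=` B by apply: kalg_mono => w wz; apply: kalg_gen; rewrite /= inE wz orbT.
have Bz : B z by apply: kalg_gen; rewrite /= inE eqxx.
apply: (@hilbert_basis _ A B z) => //.
- exact: subalg0 sA.
- exact: subalg1 sA.
- exact: subalgD sA.
- exact: subalgM sA.
- exact: subalgD sB.
- exact: subalgM sB.
- exact: subalgN sA.
have PC a : A a -> exists2 p : {poly K}, forall i, A p`_i & a = p.[z].
  move=> Aa; exists a%:P; last by rewrite hornerC.
  by move=> i; rewrite coefC; case: ifP => // _; apply: subalg0 sA.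
move=> b; elim=> [c|w|a c _ [p hp ->] _ [q hq ->]|a c _ [p hp ->] _ [q hq ->]].
- by apply: PC; apply: kalg_const.
- rewrite /= inE => /orP[/eqP ->|wz]; last by apply: PC; apply: kalg_gen.
  exists 'X; last by rewrite hornerX.
  by move=> i; rewrite coefX; case: eqP => _; [exact: subalg1 sA|exact: subalg0 sA].
- exists (p + q); last by rewrite hornerD.
  by move=> i; rewrite coefD; apply: subalgD sA _ _ _ _.
- exists (p * q); last by rewrite hornerM.
  move=> i; rewrite coefM; apply: (subalg_sum sA) => j _.
  by apply: subalgM sA _ _ _ _.
Qed.

End NoetherianAlgebras.

Section NoetherianModules.
Context (K : fieldType) (B : set K).
Hypotheses (B0 : B 0) (B1 : B 1) (BD : forall a b, B a -> B b -> B (a + b))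
  (BM : forall a b, B a -> B b -> B (a * b)) (BN : forall a, B a -> B (- a)).

(** Induction on the generators of the ambient module: the ideal of possible coefficients of y is
    finitely generated, and what remains lies in the span of the other generators. *)
Lemma noeth_module (g : seq K) (N : set K) : noeth B -> N `<=` gen B g -> N 0 ->
  (forall a b, N a -> N b -> N (a + b)) -> (forall a b, B a -> N b -> N (a * b)) ->
  exists2 h, forall x, x \in h -> N x & forall x, N x -> gen B h x.
Proof.
move=> nB; elim: g N => [|y g IH] N Ng N0 ND NM.
  by exists [::] => // x /Ng.
have [] := nB [set a | B a /\ exists n b, [/\ N n, gen B g b & n = a * y + b]].
  split=> [a []//| |a b|a b Ba].
  - by split=> //; exists 0, 0; rewrite mul0r addr0; split=> //; apply: gen0.
  - move=> [Ba [n [c [Nn gc en]]]] [Bb [n' [c' [Nn' gc' en']]]]; split; first exact: BD.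
    exists (n + n'), (c + c'); split; [exact: ND|exact: genD|].
    by rewrite en en'; ring.
  move=> [Bb [n [c [Nn gc en]]]]; split; first exact: BM.
  exists (a * n), (a * c); split; [exact: NM| |by rewrite en; ring].
  by apply: genM gc => d; apply: BM.
move=> l hl gl.
have [] := IH [set x | N x /\ gen B g x].
- by move=> x [].
- by split=> //; apply: gen0.
- by move=> a b [Na ga] [Nb gb]; split; [exact: ND|exact: genD].
- move=> a b Ba [Nb gb]; split; first exact: NM.
  by apply: genM gb => d; apply: BM.
move=> h2 hh2 gh2.
have [h1 [hh1 gh1]] : exists h1, (forall x, x \in h1 -> N x) /\
    forall a, gen B l a -> exists n b, [/\ gen B h1 n, gen B g b & n = a * y + b].
  elim: l hl {gl} => [|a l IHl] hl.
    exists [::]; split=> // a /= ->; exists 0, 0; split=> //; first exact: gen0.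
    by rewrite mul0r addr0.
  have [|h1 [hh1 gh1]] := IHl; first by move=> x xl; apply: hl; rewrite inE xl orbT.
  have [Ba [n [b [Nn gb en]]]] := hl a (mem_head _ _).
  exists (n :: h1); split=> [x|c /= [a' [b' [Ba' gb' ->]]]].
    by rewrite inE => /orP[/eqP ->|/hh1].
  have [n' [b'' [gn' gb'' en']]] := gh1 _ gb'.
  exists (a' * n + n'), (a' * b + b''); split.
  - by exists a', n'.
  - by apply: genD => //; apply: genM gb => d; apply: BM.
  by rewrite en en'; ring.
exists (h1 ++ h2) => [x|x Nx]; first by rewrite mem_cat => /orP[/hh1|/hh2 []].
have [a [b [Ba gb ex]]] := Ng _ Nx.
have [|n [b' [gn gb' en]]] := gh1 a; first by apply: gl; split=> //; exists x, b.
have BN1 : B (-1) by apply: BN.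
have -> : x = n + (x - n) by ring.
apply: gen_cat => //; apply: gh2; split.
  apply: (ND) => //; rewrite -mulN1r; apply: (NM) => //.
  by apply: (gen_in N0 ND _ gn) => c d Bc /hh1; apply: NM.
have -> : x - n = b + -1 * b' by rewrite ex en; ring.
by apply: genD => //; apply: genM gb' => d; apply: BM.
Qed.

(** The submodule generated by all c z^j is finitely generated, so some c z^N is a combination of
    the preceding ones; cancelling c gives an integral equation. *)
Lemma integral_of_bounded_powers (g : seq K) (c z : K) : noeth B -> c != 0 -> B c ->
  (forall j, gen B g (c * z ^+ j)) ->
  exists n, exists2 a : nat -> K, forall i, B (a i) & z ^+ n = \sum_(i < n) a i * z ^+ i.
Proof.
move=> nB c0 Bc hz.
pose P n := [seq c * z ^+ (i : nat) | i <- iota 0 n].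
have Pmono n x : gen B (P n) x -> gen B (P n.+1) x.
  move=> h; rewrite /P -addn1 iotaD map_cat -[x]addr0.
  by apply: gen_cat => //; apply: gen0.
have Pmono' m n x : (m <= n)%N -> gen B (P m) x -> gen B (P n) x.
  by move=> /subnK <- h; elim: (n - m)%N => [|d IH] //; rewrite addSn; apply: Pmono.
have [||||h hh gh] := @noeth_module g [set x | exists n, gen B (P n) x] nB.
- move=> x [n]; apply: gen_in; [exact: gen0|by move=> a b; apply: genD|].
  by move=> a b Ba /mapP [i _ ->]; apply: genM (hz i) => d; apply: BM.
- by exists 0%N.
- move=> a b [m ga] [n gb]; exists (maxn m n); apply: genD => //.
    exact: Pmono' (leq_maxl _ _) ga.
  exact: Pmono' (leq_maxr _ _) gb.
- by move=> a b Ba [n gb]; exists n; apply: genM gb => d; apply: BM.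
have [N hN] : exists N, forall x, x \in h -> gen B (P N) x.
  elim: h hh {gh} => [|y h IH] hh; first by exists 0%N.
  have [|N hN] := IH; first by move=> x xh; apply: hh; rewrite inE xh orbT.
  have [M hM] := hh y (mem_head _ _).
  exists (maxn M N) => x; rewrite inE => /orP[/eqP ->|/hN].
    exact: Pmono' (leq_maxl _ _) hM.
  exact: Pmono' (leq_maxr _ _).
have gN : gen B (P N) (c * z ^+ N).
  apply: (@gen_in K (gen B (P N)) B h).
  - exact: gen0.
  - by move=> a b; apply: genD.
  - by move=> a b Ba /hN; apply: genM => d; apply: BM.
  apply: gh; exists N.+1; apply: gen_mem => //.
  by apply/mapP; exists N => //; rewrite mem_iota /= add0n ltnS.
exists N.
have gE n x : gen B (P n) (c * x) -> exists2 a : nat -> K, forall i, B (a i) & x = \sum_(i < n) a i * z ^+ i.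
  elim: n x => [|n IH] x.
    move=> /= /eqP; rewrite mulf_eq0 (negbTE c0) => /eqP ->.
    by exists (fun=> 0) => //; rewrite big_ord0.
  rewrite /P -addn1 iotaD map_cat /= add0n => hx.
  have [y [b [gy Bb e]]] : exists y b, [/\ gen B (P n) (c * y), B b & c * x = c * y + b * (c * z ^+ n)].
    move: hx; rewrite -/(P n).
    elim: (P n) (c * x) => [|w l IHl] v /=.
      move=> [a [b [Ba -> ->]]]; exists 0, a; rewrite mulr0; split=> //; by ring.
    move=> [a [b [Ba /IHl [y [d [gy Bd eb]]] ->]]].
    exists (c^-1 * (a * w) + y), d; rewrite mulrDr mulVKf //; split=> //.
      by exists a, (c * y).
    by rewrite eb; ring.
  have ex : x = y + b * z ^+ n by apply: (mulfI c0); rewrite e; ring.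
  have [a Ba ey] := IH _ gy.
  exists (fun i => if i == n then b else a i) => [i|]; first by case: ifP.
  rewrite addn1 big_ord_recr /= eqxx ex ey; congr (_ + _).
  by apply: eq_bigr => i _; rewrite ltn_eqF.
exact: gE.
Qed.

End NoetherianModules.

(** * Integrality over k[X, Y] tested by two coprime multipliers *)

Section CoprimeIntegrality.
Context (k : closedFieldType) (K : fieldType) (iota : {rmorphism k -> K}).
Local Notation ev := (ev iota).
Context (X Y : K) (iXY : indep iota X Y).
Local Notation R := {poly {poly k}}.
Local Notation phi := (ev X Y).
Local Notation evz := (@ev1 R K phi).

(** Since [be] is monic in Y, the leading coefficient of x is divisible by q; removing the leading
    term and inducting on the degree divides all of x. *)
Lemma coprime_divide (q : {poly k}) (be x y : R) : be \is monic ->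
  be * x = q%:P * y -> exists x', x = q%:P * x'.
Proof.
move=> bm; have [n] := ubnP (size x); elim: n x y => // n IH x y.
have [-> _ _|x0] := eqVneq x 0; first by exists 0; rewrite mulr0.
rewrite ltnS => sx e.
have el : lead_coef x = q * y`_(size (be * x)).-1.
  by rewrite -[LHS]mul1r -(monicP bm) -lead_coefM lead_coefE e coefCM.
set c := y`_ _ in el.
pose x1 := x - (q * c)%:P * 'X^((size x).-1).
have sx1 : (size x1 < size x)%N.
  rewrite /x1 -el -{2}(prednK (n := size x)) ?size_poly_gt0 // ltnS.
  apply/leq_sizeP => j; rewrite coefB coefCM coefXn leq_eqVlt => /orP[/eqP <-|lt_j].
    by rewrite eqxx mulr1 -lead_coefE subrr.
  rewrite (gtn_eqF lt_j) mulr0 subr0 nth_default //.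
  by rewrite -(prednK (n := size x)) ?size_poly_gt0.
have [||x' ex'] := IH x1 (y - c%:P * 'X^((size x).-1) * be).
- exact: leq_trans sx1 sx.
- by rewrite /x1 polyCM mulrBr e; ring.
exists (x' + c%:P * 'X^((size x).-1)).
by rewrite mulrDr -ex' /x1 polyCM; ring.
Qed.

(* Every power of z lies, up to one fixed denominator, in the free module
   spanned by the first powers of z. *)
Lemma integral_multiple_powers (f : {poly R}) (z : K) (al : R) : f != 0 -> evz z f = 0 ->
  @integralOver R K phi (phi al * z) ->
  exists2 b, b != 0 & forall j, exists2 g : {poly R}, (size g < size f)%N &
    phi b * phi al ^+ j * z ^+ j = evz z g.
Proof.
move=> f0 fz [p pm /rootP pw].
have red j : exists2 c, c != 0 & exists2 g : {poly R}, (size g < size f)%N & phi c * z ^+ j = evz z g.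
  exists (lead_coef f ^+ scalp 'X^j f); first by rewrite expf_neq0 // lead_coef_eq0.
  exists ('X^j %% f); first by rewrite ltn_modp.
  have := Pdiv.Idomain.divp_eq 'X^j f => /(congr1 (evz z)).
  by rewrite -mul_polyC !(ev1M, ev1D) ev1C ev1Xn ev1X fz mulr0 add0r.
have [b b0 hb] : exists2 b, b != 0 & forall j, (j < size p)%N ->
    exists2 g : {poly R}, (size g < size f)%N & phi b * z ^+ j = evz z g.
  elim: (size p) => [|n [b b0 hb]]; first by exists 1; rewrite ?oner_neq0.
  have [c c0 [g sg eg]] := red n.
  exists (b * c); first by rewrite mulf_neq0.
  move=> j; rewrite ltnS leq_eqVlt => /orP[/eqP ->|/hb [g' sg' eg']].
    exists (b *: g); first by rewrite (leq_ltn_trans (size_scale_leq _ _)).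
    by rewrite evM -mulrA eg -mul_polyC ev1M ev1C.
  exists (c *: g'); first by rewrite (leq_ltn_trans (size_scale_leq _ _)).
  by rewrite evM -mul_polyC ev1M ev1C -eg'; ring.
exists b => // j.
have pw' : evz (phi al * z) p = 0 := pw.
have ew : (phi al * z) ^+ j = evz (phi al * z) ('X^j %% p).
  have := Pdiv.IdomainMonic.divp_eq pm 'X^j => /(congr1 (evz (phi al * z))).
  by rewrite ev1D ev1M pw' mulr0 add0r ev1Xn ev1X.
have sr : (size ('X^j %% p)%R <= size p)%N by apply: ltnW; rewrite ltn_modp monic_neq0.
set r := 'X^j %% p in ew sr.
rewrite -mulrA -exprMn ew ev1_sum big_distrr /=.
have [n] : exists n, n = size r by exists (size r).
move=> en; rewrite -en in sr *.
elim: n sr {en} => [|n IH] sr.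
  exists 0; first by rewrite size_poly0 size_poly_gt0.
  by rewrite big_ord0 ev10.
have [g sg eg] := IH (ltnW sr).
have [g' sg' eg'] := hb n sr.
exists (g + r`_n * al ^+ n *: g').
  rewrite (leq_ltn_trans (size_polyD _ _)) // gtn_max sg /=.
  by rewrite (leq_ltn_trans (size_scale_leq _ _)).
rewrite big_ord_recr /= eg ev1D -mul_polyC ev1M ev1C /= -eg' evM evXn exprMn; ring.
Qed.

Lemma range_ev_noeth : noeth [set x | exists P, x = phi P].
Proof.
have -> : [set x | exists P, x = phi P] = kalg iota [set z | z \in [:: X; Y]].
  apply/seteqP; split=> x.
    case=> P ->; apply: subalg_ev; [exact: kalg_subalg| |]; apply: kalg_gen;
      by rewrite /= !inE eqxx ?orbT.
  move=> h; apply/kalg2E; apply: kalg_mono h => w /=.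
  by rewrite !inE => /orP[/eqP ->|/eqP ->]; apply: kalg_gen; [left|right].
exact: kalg_noeth.
Qed.

(** With bounded denominators, q^j z^j and be^j z^j both lie in the free module on the powers of z
    below the degree of f. As q and [be] are coprime, so does z^j, and bounded powers give
    integrality. This replaces Krull's height theorem in the dimension argument. *)
Lemma coprime_integral (q : {poly k}) (be : R) z : q != 0 -> be \is monic ->
  @integralOver R K phi (phi q%:P * z) -> @integralOver R K phi (phi be * z) ->
  @integralOver R K phi z.
Proof.
move=> q0 bm i1 i2.
have phi_inj := indep_inj iXY.
have [f [f0 fz minf]] : exists f : {poly R}, [/\ f != 0, evz z f = 0 &
    forall g, g != 0 -> evz z g = 0 -> (size f <= size g)%N].
  pose P n := `[< exists f : {poly R}, [/\ f != 0, evz z f = 0 & size f = n] >].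
  have exP : exists n, P n.
    have [f f0 fz] : @algR (R : idomainType) K phi z.
      apply: (@integral_div_algR (R : idomainType) K phi q%:P).
        by rewrite polyC_eq0.
      exact: (@integral_algR (R : idomainType) K phi).
    by exists (size f); apply/asboolP; exists f.
  case: (ex_minnP exP) => n /asboolP [f [f0 fz sf]] minn.
  by exists f; split=> // g g0 gz; rewrite sf; apply: minn; apply/asboolP; exists g.
have inj_small (g : {poly R}) : (size g < size f)%N -> evz z g = 0 -> g = 0.
  move=> sg gz; apply/eqP; apply: contraT => g0.
  by have := minf _ g0 gz; rewrite leqNgt sg.
have [b1 b10 h1] := integral_multiple_powers f0 fz i1.
have [b2 b20 h2] := integral_multiple_powers f0 fz i2.
pose c := phi (b1 * b2).
have hz j : exists2 g : {poly R}, (size g < size f)%N & c * z ^+ j = evz z g.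
  have [g1 sg1 e1] := h1 j; have [g2 sg2 e2] := h2 j.
  (* Both sides take the same value at z and have degree less than that of the minimal relation f,
     hence they are equal as polynomials. *)
  have eqg : be ^+ j *: (b2 *: g1) = q%:P ^+ j *: (b1 *: g2).
    apply/eqP; rewrite -subr_eq0; apply/eqP; apply: inj_small.
      rewrite (leq_ltn_trans (size_polyD _ _)) // gtn_max size_polyN.
      by rewrite !(leq_ltn_trans (size_scale_leq _ _)) // (leq_ltn_trans (size_scale_leq _ _)).
    by rewrite ev1B -!mul_polyC !ev1M !ev1C /= -e1 -e2 !evXn; ring.
  have hx i : exists x', b2 * g1`_i = (q ^+ j)%:P * x'.
    apply: (@coprime_divide _ (be ^+ j) _ (b1 * g2`_i)); first exact: monic_exp.
    have := congr1 (fun g : {poly R} => g`_i) eqg.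
    by rewrite !coefZ rmorphXn.
  have [x' hx'] := choice hx.
  exists (\poly_(i < size g1) x' i); first by rewrite (leq_ltn_trans (size_poly _ _)).
  have eg : b2 *: g1 = (q ^+ j)%:P *: \poly_(i < size g1) x' i.
    apply/polyP => i; rewrite !coefZ coef_poly; case: ltnP => [_|le_i]; first exact: hx'.
    by rewrite nth_default // !mulr0.
  have qj0 : phi (q ^+ j)%:P != 0.
    by apply: (phi_neq0 phi_inj); rewrite polyC_eq0 expf_neq0.
  apply: (mulfI qj0); have := congr1 (evz z) eg.
  rewrite -!mul_polyC !ev1M !ev1C /= => <-; rewrite -e1 /c evM rmorphXn /= evXn; ring.
pose B : set K := [set x | exists P, x = phi P].
have BC P : B (phi P) by exists P.
have B0 : B 0 by rewrite -(ev0 iota X Y).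
have B1 : B 1 by rewrite -(evo iota X Y).
have BD a b : B a -> B b -> B (a + b).
  by move=> [P ->] [Q ->]; rewrite -evD; apply: BC.
have BM a b : B a -> B b -> B (a * b).
  by move=> [P ->] [Q ->]; rewrite -evM; apply: BC.
have BN a : B a -> B (- a).
  by move=> [P ->]; exists (- P); rewrite -[in RHS]sub0r evB ev0 sub0r.
have c0 : c != 0 by apply: (phi_neq0 phi_inj); rewrite mulf_neq0.
have [|n [a Ba ez]] := @integral_of_bounded_powers K B B0 B1 BD BM BN
   [seq z ^+ (i : nat) | i <- seq.iota 0 (size f)] c z range_ev_noeth c0 (BC _).
  move=> j; have [g sg ->] := hz j.
  rewrite ev1_sum; elim/big_rec: _ => [|i x _ IH]; first exact: gen0.
  apply: genD => //; apply: (@genM K B B); first by move=> d; apply: BM; apply: BC.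
  apply: gen_mem => //; apply/mapP; exists (i : nat) => //.
  by rewrite mem_iota /= add0n (ltn_trans (ltn_ord i)).
have [P hP] := choice Ba.
exists ('X^n - \poly_(i < n) P i).
  rewrite monicE lead_coefDl ?lead_coefXn // size_polyN size_polyXn ltnS.
  exact: size_poly.
apply/rootP; rewrite -[LHS]/(evz z ('X^n - \poly_(i < n) P i)).
rewrite ev1B ev1Xn ev1X ez ev1E (horner_coef_wide z (n := n)); last first.
  by rewrite (leq_trans (size_poly _ _)) // size_poly.
apply/eqP; rewrite subr_eq0; apply/eqP/eq_bigr => i _.
by rewrite coef_map coef_poly ltn_ord hP.
Qed.

End CoprimeIntegrality.

(** * Localizations and dimension *)

Section Localization.
Context (k : closedFieldType) (K : fieldType) (iota : {rmorphism k -> K}).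
Context (A m : set K) (sA : subalg iota A) (hm : maximal_ideal A m).
Hypothesis res : forall z, A z -> exists c, m (z - iota c).
Local Notation O := (localization A m).

Lemma loc_sub : A `<=` O.
Proof.
move=> a Aa; exists a, 1; split=> //; [exact: subalg1 sA|exact: max1 hm|by rewrite divr1].
Qed.

Lemma nmax_neq0 b : ~ m b -> b != 0.
Proof. by move=> h; apply/eqP => e; apply: h; rewrite e; apply: (max0 hm). Qed.

Lemma nmaxM b d : A b -> A d -> ~ m b -> ~ m d -> ~ m (b * d).
Proof. by move=> Ab Ad nb nd /(max_prime hm Ab Ad) []. Qed.

Lemma loc_subalg : subalg iota O.
Proof.
split.
- by move=> c; apply/loc_sub/(subalgC sA).
- move=> _ _ [a [b [Aa Ab nb ->]]] [c [d [Ac Ad nd ->]]].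
  exists (a * d + c * b), (b * d); split; [|exact: (subalgM sA)|exact: nmaxM|].
    by apply: (subalgD sA); apply: (subalgM sA).
  by field; rewrite (nmax_neq0 nb) (nmax_neq0 nd).
move=> _ _ [a [b [Aa Ab nb ->]]] [c [d [Ac Ad nd ->]]].
exists (a * c), (b * d); split; [exact: (subalgM sA)|exact: (subalgM sA)|exact: nmaxM|].
by field; rewrite (nmax_neq0 nb) (nmax_neq0 nd).
Qed.

Lemma loc_maxP z : max_ideal O z <-> exists a b, [/\ m a, A b, ~ m b & z = a / b].
Proof.
split=> [[[a [b [Aa Ab nb ->]]] h]|[a [b [ma Ab nb ->]]]].
  exists a, b; split=> //; apply: contrapT => na; apply: (h (b / a)).
    by exists b, a.
  by rewrite mulrA divfK ?mulfV ?nmax_neq0.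
split; first by exists a, b; split=> //; apply: (max_sub hm ma).
move=> _ [c [d [Ac Ad nd ->]]] e; apply: (nmaxM Ab Ad nb nd).
have -> : b * d = a * c.
  rewrite -[LHS]mulr1 -e; field; by rewrite (nmax_neq0 nb) (nmax_neq0 nd).
exact: (maxMr hm ma Ac).
Qed.

Lemma loc_maxD z w : max_ideal O z -> max_ideal O w -> max_ideal O (z + w).
Proof.
move=> /loc_maxP [a [b [ma Ab nb ->]]] /loc_maxP [c [d [mc Ad nd ->]]].
apply/loc_maxP; exists (a * d + c * b), (b * d); split.
- by apply: (maxD hm); apply: (maxMr hm).
- exact: (subalgM sA).
- exact: nmaxM.
by field; rewrite (nmax_neq0 nb) (nmax_neq0 nd).
Qed.

Lemma loc_max_mem a : A a -> max_ideal O a -> m a.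
Proof.
move=> Aa /loc_maxP [c [b [mc Ab nb e]]].
have : m (a * b) by rewrite e divfK ?nmax_neq0.
by case/(max_prime hm Aa Ab).
Qed.

Lemma max_loc_mem a : m a -> max_ideal O a.
Proof.
move=> ma; apply/loc_maxP; exists a, 1; split=> //; [exact: subalg1 sA|exact: max1 hm|].
by rewrite divr1.
Qed.

Lemma loc_res z : O z -> exists c, max_ideal O (z - iota c).
Proof.
case=> a [b [Aa Ab nb ->]].
have [c mc] := res Aa; have [d md] := res Ab.
have d0 : d != 0.
  by apply/eqP => d0; apply: nb; move: md; rewrite d0 rmorph0 subr0.
exists (c / d); apply/loc_maxP; exists (a - iota (c / d) * b), b; split=> //.
  have -> : a - iota (c / d) * b = (a - iota c) - iota (c / d) * (b - iota d).
    rewrite mulrBr -rmorphM divfK //; ring.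
  by apply: (maxB sA hm mc); apply: (maxM hm) => //; apply: (subalgC sA).
by rewrite mulrBl mulfK ?nmax_neq0.
Qed.

Lemma loc_noeth : noeth A -> noeth O.
Proof.
move=> nA J [JO J0 JD JM].
have [] := nA [set x | A x /\ J x].
  split=> [x []//| |a b [Aa Ja] [Ab Jb]|a b Aa [Ab Jb]].
  - by split=> //; apply: subalg0 sA.
  - by split; [exact: (subalgD sA)|exact: JD].
  - by split; [exact: (subalgM sA)|apply: JM => //; exact: loc_sub].
move=> g hg gg; exists g => [x /hg []//|x Jx].
have [a [b [Aa Ab nb ex]]] := JO _ Jx.
have Ja : J a by rewrite -[a](divfK (nmax_neq0 nb)) -ex mulrC; apply: JM => //; exact: loc_sub.
rewrite ex mulrC; apply: genM (gg a _) => // c Ac.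
by exists c, b; rewrite mulrC.
Qed.

Lemma loc_common_den (W : seq K) : (forall w, w \in W -> O w) ->
  exists h, [/\ A h, ~ m h & forall w, w \in W -> A (h * w)].
Proof.
elim: W => [|w W IH] hW.
  by exists 1; split=> //; [exact: subalg1 sA|exact: max1 hm].
have [|h [Ah nh hh]] := IH; first by move=> x xW; apply: hW; rewrite inE xW orbT.
have [a [b [Aa Ab nb ew]]] := hW w (mem_head _ _).
exists (h * b); split; [exact: (subalgM sA)|exact: nmaxM|].
move=> x; rewrite inE => /orP[/eqP ->|/hh Ax].
  have -> : h * b * w = h * a by rewrite ew; field; apply: nmax_neq0 nb.
  exact: (subalgM sA).
by rewrite mulrAC; apply: (subalgM sA).
Qed.

End Localization.

(** * The local rings have dimension two *)

Section Dimension.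
Context (k : closedFieldType) (K : fieldType) (iota : {rmorphism k -> K}).
Context (s t : K) (htr : trbasis iota s t) (zs : seq K).
Local Notation A := (kalg iota [set z | z \in zs]).
Context (m : set K) (hm : maximal_ideal A m) (hA : frac_full A).
Local Notation O := (localization A m).

Let sA : subalg iota A := kalg_subalg _ _.

Lemma kalg_max_residue z : A z -> exists c, m (z - iota c).
Proof.
have [X [Y [AX AY iXY int]]] := normalization htr hA.
exact: (max_residue sA hm AX AY int).
Qed.

Let sO : subalg iota O := loc_subalg sA hm.

(** If v^n were a multiple of u, some power of every element of the maximal ideal would be a
    multiple of u. Then (X - c)^N / u and (Y - d)^M / u are integral over k[X, Y] for a
    normalization X, Y, hence so is 1 / u by [coprime_integral], and its equation makes u a unit. *)
Lemma dimension_ge2 u v : max_ideal O u ->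
  (forall f, max_ideal O f -> exists a b, [/\ O a, O b & f = a * u + b * v]) -> O v ->
  forall n a, O a -> v ^+ n <> a * u.
Proof.
move=> mu huv Ov n a Oa ev_n.
have Ou : O u by case: mu.
have nu w : O w -> u * w <> 1 by case: mu => _; apply.
have /choice [f hf] : forall z, exists cw : k * K, z \in zs ->
    O cw.2 /\ (z - iota cw.1) ^+ n = u * cw.2.
  move=> z.
  have [zz|nzz] := boolP (z \in zs); last by exists (0, 0).
  have [c mc] : exists c, max_ideal O (z - iota c).
    by apply: (loc_res sA hm kalg_max_residue); apply: (loc_sub sA hm); apply: kalg_gen.
  have [al [be [Oal Obe e]]] := huv _ mc.
  pose w := al * (\sum_(i < n) (al * u + be * v) ^+ (n.-1 - i) * (be * v) ^+ i) + be ^+ n * a.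
  exists (c, w) => _ /=; split.
    have Ouv : O (al * u + be * v).
      by apply: (subalgD sO); apply: (subalgM sO).
    apply: (subalgD sO); apply: (subalgM sO) => //.
      apply: (subalg_sum sO) => i _; apply: (subalgM sO); apply: (subalgX sO) => //.
      exact: (subalgM sO).
    exact: (subalgX sO).
  rewrite e -[LHS](subrK ((be * v) ^+ n)) subrXX exprMn ev_n /w.
  by move: (\sum_(i < n) _) => S; ring.
(* A single denominator h moves u and all cofactors into A[1/h], which still lies in O. *)
pose W := u :: [seq (f z).2 | z <- zs].
have [|h [Ah nh hh]] := loc_common_den sA hm (W := W).
  move=> w; rewrite inE => /orP[/eqP -> //|/mapP [z zz ->]].
  by have [] := hf z zz.
have h0 : h != 0 := nmax_neq0 hm nh.
pose A' := kalg iota [set z | z \in h^-1 :: zs].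
have sA' : subalg iota A' := kalg_subalg _ _.
have AA' : A `<=` A' by apply: kalg_mono => z zz; apply: kalg_gen; rewrite /= inE zz orbT.
have A'h : A' h^-1 by apply: kalg_gen; rewrite /= inE eqxx.
have A'O : A' `<=` O.
  apply: kalg_min => // z; rewrite /= inE => /orP[/eqP ->|zz].
    by exists 1, h; split=> //; [exact: subalg1 sA|rewrite mul1r].
  by apply: (loc_sub sA hm); apply: kalg_gen.
have WA' w : w \in W -> A' w.
  by move=> /hh /AA' ?; rewrite -[w](mulKf h0); apply: (subalgM sA').
have A'u : A' u by apply: WA'; rewrite inE eqxx.
(* The radical of u A'. Modulo it every element of A' turns out to be a constant. *)
pose Nil x := A' x /\ exists N w, A' w /\ x ^+ N = u * w.
have NilM x y : A' y -> Nil x -> Nil (y * x).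
  move=> Ay [Ax [N [w [Aw e]]]]; split; first exact: (subalgM sA').
  exists N, (y ^+ N * w); split; last by rewrite exprMn e; ring.
  by apply: (subalgM sA') => //; apply: (subalgX sA').
have NilD x y : Nil x -> Nil y -> Nil (x + y).
  move=> [Ax [N [w [Aw e]]]] [Ay [M [w' [Aw' e']]]]; split; first exact: (subalgD sA').
  have key i j : (N <= i)%N || (M <= j)%N -> exists2 w, A' w & x ^+ i * y ^+ j = u * w.
    case/orP => [/subnK <-|/subnK <-].
      exists (x ^+ (i - N) * w * y ^+ j); last by rewrite exprD e; ring.
      by apply: (subalgM sA'); [apply: (subalgM sA')|]; rewrite // ; apply: (subalgX sA').
    exists (x ^+ i * (y ^+ (j - M) * w')); last by rewrite exprD e'; ring.
    by apply: (subalgM sA'); [|apply: (subalgM sA')]; rewrite // ; apply: (subalgX sA').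
  have key' (i : 'I_(N + M).+1) : exists2 w, A' w & x ^+ (N + M - i) * y ^+ i = u * w.
    apply: key; case: leqP => //= h1; lia.
  have /choice [g hg'] : forall i : 'I_(N + M).+1, exists w, A' w /\
      x ^+ (N + M - i) * y ^+ (i : nat) = u * w.
    by move=> i; have [w'' Aw'' e''] := key' i; exists w''.
  have Ag i : A' (g i) by case: (hg' i).
  have hg (i : 'I_(N + M).+1) : x ^+ (N + M - i) * y ^+ i = u * g i by case: (hg' i).
  exists (N + M)%N, (\sum_(i < (N + M).+1) g i *+ 'C(N + M, i)); split.
    apply: (subalg_sum sA') => i _; rewrite -mulr_natr -(rmorph_nat iota).
    by apply: (subalgM sA') => //; apply: (subalgC sA').
  rewrite exprDn big_distrr /=; apply: eq_bigr => i _.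
  by rewrite hg mulrnAr.
have NilA x : kalg iota [set z | z \in zs] x -> exists c, Nil (x - iota c).
  elim=> [c|z zz|x1 y1 _ [c hc] _ [d hd]|x1 y1 Ax1 [c hc] Ay1 [d hd]].
  - exists c; rewrite subrr; split; first exact: subalg0 sA'.
    by exists 1%N, 0; rewrite expr1 mulr0; split=> //; apply: subalg0 sA'.
  - have [Ow e] := hf z zz; exists (f z).1; split.
      by apply: (subalgB sA'); [exact/AA'/kalg_gen|exact: (subalgC sA')].
    exists n, (f z).2; split=> //; apply: WA'; rewrite inE; apply/orP; right.
    exact: map_f.
  - exists (c + d); rewrite rmorphD.
    have -> : x1 + y1 - (iota c + iota d) = (x1 - iota c) + (y1 - iota d) by ring.
    exact: NilD.
  exists (c * d); rewrite rmorphM.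
  have -> : x1 * y1 - iota c * iota d = x1 * (y1 - iota d) + iota d * (x1 - iota c) by ring.
  by apply: NilD; apply: NilM => //; [exact: AA'|exact: (subalgC sA')].
have NilA' x : A' x -> exists c, Nil (x - iota c).
  elim=> [c|z|x1 y1 _ [c hc] _ [d hd]|x1 y1 Ax1 [c hc] Ay1 [d hd]].
  - by apply: NilA; apply: kalg_const.
  - rewrite /= inE => /orP[/eqP ->|zz]; last by apply: NilA; apply: kalg_gen.
    (* The constant of h is nonzero: otherwise u would divide a power of the unit h. *)
    have [c hc] := NilA _ Ah.
    have c0 : iota c != 0.
      apply/eqP => c0; move: hc => [_ [N [w [Aw]]]]; rewrite c0 subr0 => e.
      apply: (nu (w * h^-1 ^+ N)).
        by apply: (subalgM sO); [exact: A'O|apply/A'O/(subalgX sA')].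
      by rewrite mulrA -e -exprMn mulfV // expr1n.
    exists c^-1; have -> : h^-1 - iota c^-1 = - (h^-1 * iota c^-1) * (h - iota c).
      by rewrite fmorphV; field; rewrite h0 c0.
    apply: NilM hc; apply: (subalgN sA'); apply: (subalgM sA') => //.
    exact: (subalgC sA').
  - exists (c + d); rewrite rmorphD.
    have -> : x1 + y1 - (iota c + iota d) = (x1 - iota c) + (y1 - iota d) by ring.
    exact: NilD.
  exists (c * d); rewrite rmorphM.
  have -> : x1 * y1 - iota c * iota d = x1 * (y1 - iota d) + iota d * (x1 - iota c) by ring.
  by apply: NilD; apply: NilM => //; exact: (subalgC sA').
have fA' : frac_full A' := frac_full_sub AA' hA.
have [X [Y [AX AY iXY int]]] := normalization htr fA'.
have [c [_ [N [w1 [Aw1 e1]]]]] := NilA' X AX.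
have [d [_ [M [w2 [Aw2 e2]]]]] := NilA' Y AY.
have u0 : u != 0 by apply/eqP => u0; apply: (nu 0); [exact: subalg0 sO|];
  have := e1; rewrite u0 mul0r => /eqP; rewrite expf_eq0 => /andP[_];
  rewrite subr_eq0 => /eqP eX; have := indep_transc iXY; rewrite eX => /transc_const.
have iu : @integralOver {poly {poly k}} K (ev iota X Y) u^-1.
  apply: (@coprime_integral k K iota X Y iXY (('X - c%:P) ^+ N) (('X - d%:P%:P) ^+ M)).
  - by rewrite expf_neq0 // polyXsubC_eq0.
  - by rewrite monic_exp // monicXsubC.
  - rewrite evC ev1Xn ev1B ev1X ev1C e1 mulrAC mulfV // mul1r; exact: int.
  - rewrite evXn evB evX evC ev1C e2 mulrAC mulfV // mul1r; exact: int.
have [p pm /rootP pu] := iu.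
have pu' : @ev1 {poly {poly k}} K (ev iota X Y) u^-1 p = 0 := pu.
have sp : size p = (size p).-1.+1 by rewrite prednK // size_poly_gt0 monic_neq0.
set l := (size p).-1 in sp.
apply: (nu (- \sum_(i < l) ev iota X Y p`_i * u ^+ (l - i.+1))).
  apply: (subalgN sO); apply: (subalg_sum sO) => i _; apply: (subalgM sO).
    by apply: (subalg_ev sO); exact: A'O.
  exact: (subalgX sO).
have : u ^+ l * @ev1 {poly {poly k}} K (ev iota X Y) u^-1 p = 0 by rewrite pu' mulr0.
rewrite ev1_sum sp big_ord_recr /=.
have -> : p`_l = 1 := monicP pm.
rewrite evo mul1r mulrDr -exprMn mulfV // expr1n big_distrr /= => /eqP.
rewrite addrC addr_eq0 => /eqP ->; rewrite mulrN; congr (- _).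
rewrite big_distrr /=; apply: eq_bigr => i _.
have -> : u ^+ l = u ^+ (l - i.+1) * u * u ^+ i by rewrite -exprSr -exprD subnSK // subnK // ltnW.
rewrite exprVn; field; exact: expf_neq0.
Qed.

End Dimension.

(** * Regular points of a surface *)

Section NoetherianMaximal.
Context (K : fieldType) (A : set K).

(** Choosing a strictly larger member of F at each stage would produce an infinite increasing
    chain. *)
Lemma noeth_max (F : set (set K)) : noeth A -> (exists I, F I) ->
  (forall I, F I -> ideal A I) ->
  exists2 I, F I & forall I', F I' -> I `<=` I' -> I' `<=` I.
Proof.
move=> nA [I0 F0] hF; apply: contrapT => hn.
have step I : exists I', F I -> [/\ F I', I `<=` I' & ~ (I' `<=` I)].
  have [FI|nFI] := EM (F I); last by exists I0.
  apply: contrapT => hn'; apply: hn; exists I => // I' FI' II'.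
  by apply: contrapT => h; apply: hn'; exists I'.
have /choice [f hf] := step.
pose c n := iter n f I0.
have Fc n : F (c n) by elim: n => //= n IH; have [] := hf _ IH.
have [||N hN] := @noeth_acc K A c nA; first by move=> n; apply: hF.
  by move=> n; have [] := hf _ (Fc n).
by have [_ _] := hf _ (Fc N); apply; apply: (hN N.+1).
Qed.

End NoetherianMaximal.

(** * Derivations and alternating biderivations *)

Section Derivations.
Context (k : closedFieldType) (K : fieldType) (iota : {rmorphism k -> K}).

Section OneDerivation.
Context (D : K -> K) (hD : kderivation iota D).

Lemma derD z w : D (z + w) = D z + D w. Proof. by case: hD. Qed.
Lemma derM z w : D (z * w) = D z * w + z * D w. Proof. by case: hD. Qed.
Lemma derC c : D (iota c) = 0. Proof. by case: hD. Qed.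
Lemma der0 : D 0 = 0. Proof. by have := derC 0; rewrite rmorph0. Qed.
Lemma der1 : D 1 = 0. Proof. by have := derC 1; rewrite rmorph1. Qed.
Lemma derN z : D (- z) = - D z.
Proof. by apply/eqP; rewrite -addr_eq0 -derD addNr der0 eqxx. Qed.
Lemma derB z w : D (z - w) = D z - D w. Proof. by rewrite derD derN. Qed.
Lemma derV z : z != 0 -> D z^-1 = - D z / z ^+ 2.
Proof.
move=> z0; have := derM z z^-1; rewrite mulfV // der1 => e.
apply: (mulfI z0); apply/eqP; rewrite -subr_eq0; apply/eqP.
have -> : z * D z^-1 = - (D z * z^-1).
  by apply/eqP; rewrite -addr_eq0 addrC -e eqxx.
by field.
Qed.
Lemma derf z w : w != 0 -> D (z / w) = (D z * w - z * D w) / w ^+ 2.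
Proof. by move=> w0; rewrite derM derV //; field. Qed.

Lemma der_kalg (M : set K) S : M 0 -> (forall a b, M a -> M b -> M (a + b)) ->
  (forall a b, kalg iota S a -> M b -> M (a * b)) ->
  (forall z, S z -> M (D z)) -> forall z, kalg iota S z -> M (D z).
Proof.
move=> M0 MD MM MS z; elim=> [c|w /MS //|a b _ + _|a b Ha IHa Hb IHb].
- by rewrite derC.
- by rewrite derD; apply: MD.
by rewrite derM; apply: MD; [rewrite mulrC|]; apply: MM.
Qed.

End OneDerivation.

(** J f g stands for df ^ dg divided by a fixed nonzero rational two-form. Ratios such as
    [J t y / J u v] then compare two-forms. *)
Record biderivation (J : K -> K -> K) : Prop := Biderivation {
  bider_l : forall g, kderivation iota (J^~ g);
  bider_r : forall f, kderivation iota (J f);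
  bider_alt : forall f, J f f = 0;
  bider_neq0 : exists f g, J f g != 0 }.

Lemma bider_anti J f g : biderivation J -> J g f = - J f g.
Proof.
move=> hJ; have := bider_alt hJ (f + g).
rewrite (derD (bider_r hJ _)) !(derD (bider_l hJ _)) /= !(bider_alt hJ).
by rewrite add0r addr0 => /eqP; rewrite addr_eq0 => /eqP.
Qed.

End Derivations.

(** What is used of a regular point of a surface. [rp_dimu] and [rp_dimv] are dimension two in
    elementary form; the last two fields, finite generation up to localization, make the values of a
    Jacobian on O a finitely generated module. *)
Record regular_point (k : closedFieldType) (K : fieldType) (iota : {rmorphism k -> K})
  (O : set K) (u v : K) (zs : seq K) : Prop := RegularPoint {
  rp_sub : subalg iota O;
  rp_frac : frac_full O;
  rp_noeth : noeth O;
  rp_maxD : forall z w, max_ideal O z -> max_ideal O w -> max_ideal O (z + w);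
  rp_res : forall z, O z -> exists c, max_ideal O (z - iota c);
  rp_u : max_ideal O u;
  rp_v : max_ideal O v;
  rp_uv : forall f, max_ideal O f -> exists a b, [/\ O a, O b & f = a * u + b * v];
  rp_dimu : forall n a, O a -> v ^+ n <> a * u;
  rp_dimv : forall n a, O a -> u ^+ n <> a * v;
  rp_gens : forall z, O z -> exists a b, [/\ kalg iota [set z | z \in zs] a,
      kalg iota [set z | z \in zs] b, ~ max_ideal O b & z = a / b];
  rp_gens_sub : forall z, z \in zs -> O z }.

Lemma regular_point_sym k K iota O u v zs :
  @regular_point k K iota O u v zs -> regular_point iota O v u zs.
Proof.
case=> h1 h2 h3 h4 h5 h6 h7 h8 h9 h10 h11 h12; split=> //.
by move=> f /h8 [a [b [Oa Ob ->]]]; exists b, a; rewrite addrC.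
Qed.

(** * Factoriality of the local rings *)

Section RegularPoint.
Context (k : closedFieldType) (K : fieldType) (iota : {rmorphism k -> K}).
Context (O : set K) (zs : seq K).
Local Notation m := (max_ideal O).
Local Notation rp u v := (regular_point iota O u v zs).

Lemma max_idealM a b : subalg iota O -> m a -> O b -> m (a * b).
Proof.
move=> sO [Oa ha] Ob; split=> [|g Og]; first exact: (subalgM sO).
by rewrite -mulrA; apply: ha; apply: (subalgM sO).
Qed.

Lemma max_ideal_unit a : O a -> ~ m a -> a != 0 /\ O a^-1.
Proof.
move=> Oa na.
have [g [Og e]] : exists g, O g /\ a * g = 1.
  apply: contrapT => hn; apply: na; split=> // g Og e; apply: hn.
  by exists g.
have a0 : a != 0 by apply/eqP => a0; move/eqP: e; rewrite a0 mul0r eq_sym oner_eq0.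
by split=> //; rewrite -[a^-1](mulr1) -e mulKf.
Qed.

Section WithParameters.
Context (u v : K) (hO : rp u v).
Let sO : subalg iota O := rp_sub hO.

Let mM a b : m a -> O b -> m (a * b). Proof. exact: max_idealM. Qed.
Let mO a : m a -> O a. Proof. by case. Qed.
Let m0 : m 0.
Proof. by rewrite -(mulr0 u); apply: (mM) (rp_u hO) (subalg0 sO). Qed.
Let n1 : ~ m 1.
Proof. by case=> _ /(_ 1 (subalg1 sO)); rewrite mulr1. Qed.

(** Nakayama's lemma for a submodule N of K. Generators are eliminated one by one: y = n + c y + w
    with c in m is solved for y because 1 - c is a unit. *)
Lemma nakayama (N : set K) (g : seq K) : N 0 -> (forall a b, N a -> N b -> N (a + b)) ->
  (forall a b, O a -> N b -> N (a * b)) ->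
  (forall y, y \in g -> exists n w, [/\ N n, gen m g w & y = n + w]) ->
  forall y, y \in g -> N y.
Proof.
move=> N0 ND NM; elim: g => [|y g IH] hg; first by [].
have [n [_ [Nn [c [w [mc gw ->]]] ey]]] := hg y (mem_head _ _).
have [c0 Oc] : 1 - c != 0 /\ O (1 - c)^-1.
  apply: max_ideal_unit; first by apply: (subalgB sO) (mO mc); apply: (subalg1 sO).
  by move=> h; apply: n1; rewrite -(subrK c 1); apply: (rp_maxD hO).
have ey' : y = (1 - c)^-1 * n + (1 - c)^-1 * w.
  apply: (mulfI c0); rewrite -mulrDr mulVKf // mulrBl mul1r.
  by rewrite {1}ey; ring.
have gm d x : O d -> gen m g x -> gen m g (d * x).
  by move=> Od; apply: genM => e me; rewrite mulrC; apply: (mM).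
have mD a b : m a -> m b -> m (a + b) by apply: (rp_maxD hO).
have gN x : x \in g -> N x.
  apply: IH => x' xg'.
  have [n' [_ [Nn' [c' [w' [mc' gw' ->]]] ex]]] := hg x' (mem_behead (s := y :: g) xg').
  exists (n' + c' * ((1 - c)^-1 * n)), (c' * ((1 - c)^-1 * w) + w'); split.
  - by apply: (ND) => //; apply: (NM); [exact: mO|exact: (NM)].
  - by apply: (genD mD) => //; apply: (gm); [exact: mO|exact: (gm)].
  by rewrite ex {1}ey'; ring.
move=> x; rewrite inE => /orP[/eqP ->|]; last exact: gN.
rewrite ey'; apply: (ND); first exact: NM.
apply: (NM) => //; apply: (gen_in N0 ND _ gw) => a b ma /gN; apply: NM.
exact: mO.
Qed.

(* The set of f lying in the ideal (u, v^n) for all n is (u): this is Krull's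
   intersection theorem in O/(u), whose maximal ideal is generated by v. *)
Lemma krull_mod_u f : (forall n, exists a b, [/\ O a, O b & f = a * u + b * v ^+ n]) ->
  exists2 a, O a & f = a * u.
Proof.
pose I n : set K := [set f | exists a b, [/\ O a, O b & f = a * u + b * v ^+ n]].
pose Q n : set K := [set b | O b /\ exists2 a, O a & v ^+ n * b = a * u].
have Ou := mO (rp_u hO); have Ov := mO (rp_v hO).
have OX n : O (v ^+ n) by apply: (subalgX sO).
have idQ n : ideal O (Q n).
  split=> [b []//| |a b [Oa [a' Oa' ea]] [Ob [b' Ob' eb]]|a b Oa [Ob [b' Ob' eb]]].
  - split; first exact: (subalg0 sO).
    by exists 0; [exact: (subalg0 sO)|rewrite mulr0 mul0r].
  - split; first exact: (subalgD sO).
    by exists (a' + b'); [exact: (subalgD sO)|rewrite mulrDr ea eb; ring].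
  split; first exact: (subalgM sO).
  by exists (a * b'); [exact: (subalgM sO)|rewrite mulrCA eb; ring].
have monoQ n : Q n `<=` Q n.+1.
  move=> b [Ob [a Oa e]]; split=> //; exists (v * a); first exact: (subalgM sO).
  by rewrite exprS -mulrA e mulrA.
(* Substitute for Artin-Rees: the ideals of those b with v^n b in (u) are constant from N on.
   Comparing two expressions of y then shows that v^N b again lies in all the ideals (u, v^n), so
   that Nakayama applies. *)
have [N hN] := noeth_acc (rp_noeth hO) idQ monoQ.
have idI n : ideal O (I n).
  split=> [_ [a [b [Oa Ob ->]]]| |_ _ [a [b [Oa Ob ->]]] [c [d [Oc Od ->]]]|
           e _ Oe [a [b [Oa Ob ->]]]].
  - by apply: (subalgD sO); apply: (subalgM sO).
  - by exists 0, 0; rewrite !mul0r addr0; split=> //; exact: (subalg0 sO).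
  - exists (a + c), (b + d); split; [exact: (subalgD sO)|exact: (subalgD sO)|by ring].
  exists (e * a), (e * b); split; [exact: (subalgM sO)|exact: (subalgM sO)|by ring].
have [g hg gg] : exists2 g, forall x, x \in g -> (forall n, I n x) &
    forall x, (forall n, I n x) -> gen O g x.
  apply: (rp_noeth hO (I := [set f | forall n, I n f])).
  split=> [x /(_ 0%N)|n|a b ha hb n|a b Oa hb n]; first by case: (idI 0%N) => + _ _ _; apply.
  - by case: (idI n).
  - by case: (idI n) => _ _ + _; apply.
  by case: (idI n) => _ _ _; apply.
pose uO : set K := [set f | exists2 a, O a & f = a * u].
have uO0 : uO 0 by exists 0; [exact: (subalg0 sO)|rewrite mul0r].
have uOD a b : uO a -> uO b -> uO (a + b).
  by move=> [a' Oa' ->] [b' Ob' ->]; exists (a' + b'); [exact: (subalgD sO)|rewrite mulrDl].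
have uOM a b : O a -> uO b -> uO (a * b).
  by move=> Oa [b' Ob' ->]; exists (a * b'); [exact: (subalgM sO)|rewrite mulrA].
have gN : forall y, y \in g -> uO y.
  apply: nakayama => // y /hg hy.
  have [a [b [Oa Ob ey]]] := hy N.+1.
  exists (a * u), (v * (v ^+ N * b)); split; first by exists a.
    apply: (@genM K O m v); first by move=> d Od; apply: (mM) (rp_v hO) Od.
    apply: gg => n; have [a' [b' [Oa' Ob' ey']]] := hy (n + N.+1)%N.
    have [|_ [a'' Oa'' e]] := hN N.+1 (b - b' * v ^+ n).
      split; first by apply: (subalgB sO) => //; apply: (subalgM sO).
      exists (a' - a); first exact: (subalgB sO).
      have : a * u + b * v ^+ N.+1 = a' * u + b' * (v ^+ n * v ^+ N.+1) by rewrite -exprD -ey' -ey.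
      move=> e; apply/eqP; rewrite -subr_eq0.
      have -> : v ^+ N.+1 * (b - b' * v ^+ n) - (a' - a) * u =
        (a * u + b * v ^+ N.+1) - (a' * u + b' * (v ^+ n * v ^+ N.+1)) by ring.
      by rewrite e subrr.
    exists a'', (b' * v ^+ N); split=> //; first exact: (subalgM sO).
    by rewrite -e; ring.
  by rewrite ey exprS; ring.
move=> /gg gf; apply: (gen_in uO0 uOD _ gf) => a b Oa /gN; exact: uOM.
Qed.

(** O/(u) behaves as a discrete valuation ring with uniformizer v. The exponent is the largest n for
    which f lies in (u, v^n); it exists by [krull_mod_u]. *)
Lemma mod_u_form f : O f -> (exists2 a, O a & f = a * u) \/
  exists n e a, [/\ O e, ~ m e, O a & f = e * v ^+ n + a * u].
Proof.
move=> Of; have [h|h] := EM (forall n, exists a b, [/\ O a, O b & f = a * u + b * v ^+ n]).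
  by left; apply: krull_mod_u.
right; have exn : exists n, `[< ~ exists a b, [/\ O a, O b & f = a * u + b * v ^+ n] >].
  by have /existsNP [n hn] := h; exists n; apply/asboolP.
case: (ex_minnP exn) => [[|n]] /asboolP hn minn.
  case: hn; exists 0, f; rewrite mul0r add0r expr0 mulr1; split=> //; exact: (subalg0 sO).
have : exists a b, [/\ O a, O b & f = a * u + b * v ^+ n].
  apply: contrapT => hn'; have := minn n; rewrite ltnn => h'.
  by suff : false by []; apply: h'; apply/asboolP.
move=> [a [b [Oa Ob e]]]; exists n, b, a; split=> //; last by rewrite e addrC.
move=> /(rp_uv hO) [c [d [Oc Od eb]]]; apply: hn.
exists (a + c * v ^+ n), d; split=> //; last by rewrite e eb exprS; ring.
by apply: (subalgD sO) => //; apply: (subalgM sO) => //; apply: (subalgX sO); apply/mO/(rp_v hO).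
Qed.

(** A product of two elements with forms e1 v^n and e2 v^n' modulo u is a unit times v^(n + n'),
    which is not a multiple of u by [rp_dimu]. *)
Lemma param_prime f g a : O f -> O g -> O a -> f * g = a * u ->
  (exists2 b, O b & f = b * u) \/ (exists2 b, O b & g = b * u).
Proof.
move=> Of Og Oa e.
have [|[n [e1 [a1 [Oe1 ne1 Oa1 ef]]]]] := mod_u_form Of; first by left.
have [|[n' [e2 [a2 [Oe2 ne2 Oa2 eg]]]]] := mod_u_form Og; first by right.
have Ou := mO (rp_u hO); have Ov := mO (rp_v hO).
have [e10 Oe1'] := max_ideal_unit Oe1 ne1; have [e20 Oe2'] := max_ideal_unit Oe2 ne2.
case: (@rp_dimu _ _ _ _ _ _ _ hO (n + n')%N (e1^-1 * e2^-1 * (a - e1 * v ^+ n * a2 - a1 * g))).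
  have OM := subalgM sO; have OB := subalgB sO.
  by apply: (OM); [exact: OM|apply: (OB); [apply: (OB) => //; apply: (OM) => //; apply: (OM) => //; apply: (subalgX sO)|exact: OM]].
apply: (mulfI (mulf_neq0 e10 e20)).
have -> : e1 * e2 * v ^+ (n + n') = f * g - e1 * v ^+ n * a2 * u - a1 * u * g.
  rewrite exprD ef eg; ring.
by rewrite e; field; rewrite e10 e20.
Qed.

(** Let p in P have the least order in v modulo u. Every f in P is c p + u b, and b lies in P
    because u does not; hence P = (p) + u P and Nakayama gives P = (p). Such a p exists, since
    otherwise P = u P would vanish. *)
Lemma prime_ideal_principal (P : set K) p0 : ideal O P ->
  (forall f g, O f -> O g -> P (f * g) -> P f \/ P g) -> ~ P u -> P p0 -> p0 != 0 ->
  exists2 p, P p & forall f, P f -> exists2 a, O a & f = a * p.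
Proof.
move=> idP prP nPu Pp0 p00; have [PO P0 PD PM] := idP.
have Ou := mO (rp_u hO); have Ov := mO (rp_v hO).
have [g hg gg] := rp_noeth hO idP.
have divu a : O a -> P (a * u) -> P a by move=> Oa /(prP _ _ Oa Ou) [].
have exn : exists n, `[< exists p e a, [/\ P p, O e, ~ m e, O a & p = e * v ^+ n + a * u] >].
  apply: contrapT => hn; move/eqP: p00; apply.
  have allu f : P f -> exists2 a, P a & f = a * u.
    move=> Pf; have [[a Oa ef]|[n [e [a [Oe ne Oa ef]]]]] := mod_u_form (PO _ Pf).
      by exists a => //; apply: (divu) => //; rewrite -ef.
    by case: hn; exists n; apply/asboolP; exists f, e, a.
  have g0 : forall y, y \in g -> [set 0] y.
    apply: nakayama => //.
    - by move=> a b -> ->; rewrite addr0.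
    - by move=> a b _ ->; rewrite mulr0.
    move=> y /hg /allu [a Pa ey]; exists 0, y; split=> //; last by rewrite add0r.
    rewrite ey mulrC; apply: (@genM K O m) (gg _ Pa) => d Od.
    exact: mM (rp_u hO) Od.
  apply: (@gen_in K [set 0] O g) (gg _ Pp0) => //; first by move=> a b -> ->; rewrite addr0.
  by move=> a b _ /g0 ->; rewrite mulr0.
case: (ex_minnP exn) => n /asboolP [p [e [a [Pp Oe ne Oa ep]]]] minn.
have [e0 Oe'] := max_ideal_unit Oe ne.
exists p => //.
pose N : set K := [set f | exists2 a, O a & f = a * p].
have N0 : N 0 by exists 0; [exact: (subalg0 sO)|rewrite mul0r].
have ND x y : N x -> N y -> N (x + y).
  by move=> [x' Ox ->] [y' Oy ->]; exists (x' + y'); [exact: (subalgD sO)|rewrite mulrDl].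
have NM x y : O x -> N y -> N (x * y).
  by move=> Ox [y' Oy ->]; exists (x * y'); [exact: (subalgM sO)|rewrite mulrA].
have gN : forall y, y \in g -> N y.
  apply: nakayama => // y /hg Py.
  have [c Oc [b Pb ey]] : exists2 c, O c & exists2 b, P b & y = c * p + u * b.
    have [[b Ob ey]|[n' [e' [a' [Oe1 ne' Oa' ey]]]]] := mod_u_form (PO _ Py).
      exists 0; first exact: (subalg0 sO).
      by exists b; [apply: (divu) => //; rewrite -ey|rewrite mul0r add0r mulrC].
    have le_nn' : (n <= n')%N by apply: minn; apply/asboolP; exists y, e', a'.
    pose c := e' * e^-1 * v ^+ (n' - n).
    have Oc : O c by apply: (subalgM sO); [exact: (subalgM sO)|exact: (subalgX sO)].
    exists c => //; exists (a' - c * a); last first.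
      rewrite ey ep /c -{1}(subnK le_nn') exprD; field; exact: e0.
    apply: (divu); first by apply: (subalgB sO) => //; apply: (subalgM sO).
    have -> : (a' - c * a) * u = y + (- c) * p.
      rewrite ey ep /c -{2}(subnK le_nn') exprD; field; exact: e0.
    by apply: (PD) => //; apply: (PM) => //; apply: (subalgN sO).
  exists (c * p), (u * b); split=> //; first by exists c.
  by apply: (@genM K O m) (gg _ Pb) => d Od; apply: (mM) (rp_u hO) Od.
move=> f /gg gf; apply: (gen_in N0 ND _ gf) => x y Ox /gN; exact: NM.
Qed.

(** An ideal containing f and maximal among those that contain no power of w is prime. *)
Lemma avoiding_prime (f w : K) : O f -> O w -> (forall n a, O a -> w ^+ n <> a * f) ->
  exists P, [/\ ideal O P, (forall f g, O f -> O g -> P (f * g) -> P f \/ P g), ~ P w & P f].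
Proof.
move=> Of Ow hw.
pose F : set (set K) := [set I | [/\ ideal O I, I f & forall n, ~ I (w ^+ n)]].
have OM := subalgM sO; have OD := subalgD sO.
have [|I [idI If hI] maxI] := noeth_max (F := F) (rp_noeth hO) _ (fun I h => let: And3 a _ _ := h in a).
  exists [set x | exists2 a, O a & x = a * f]; split.
  - split=> [_ [a Oa ->]| |_ _ [a Oa ->] [b Ob ->]|a _ Oa [b Ob ->]]; first exact: OM.
    + by exists 0; [exact: (subalg0 sO)|rewrite mul0r].
    + by exists (a + b); [exact: OD|rewrite mulrDl].
    by exists (a * b); [exact: OM|rewrite mulrA].
  - by exists 1; [exact: (subalg1 sO)|rewrite mul1r].
  by move=> n [a Oa /hw]; apply.
have [IO I0 ID IM] := idI.
have ext g : O g -> ~ I g -> exists n p a, [/\ I p, O a & w ^+ n = p + a * g].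
  move=> Og nIg; apply: contrapT => hn; apply: nIg.
  apply: (maxI [set x | exists p a, [/\ I p, O a & x = p + a * g]]); last first.
  - by exists 0, 1; rewrite mul1r add0r; split=> //; exact: (subalg1 sO).
  - by move=> x Ix; exists x, 0; rewrite mul0r addr0; split=> //; exact: (subalg0 sO).
  split; last by move=> n [p [a h]]; apply: hn; exists n, p, a.
    split.
    - by move=> _ [p [a [Ip Oa ->]]]; apply: (OD); [exact: IO|exact: OM].
    - by exists 0, 0; rewrite mul0r addr0; split=> //; exact: (subalg0 sO).
    - move=> _ _ [p [a [Ip Oa ->]]] [q [b [Iq Ob ->]]]; exists (p + q), (a + b).
      by split; [exact: ID|exact: OD|ring].
    move=> x _ Ox [p [a [Ip Oa ->]]]; exists (x * p), (x * a).
    by split; [exact: IM|exact: OM|ring].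
  by exists f, 0; rewrite mul0r addr0; split=> //; exact: (subalg0 sO).
exists I; split=> //; last by have := hI 1%N.
move=> g h Og Oh Igh; apply: contrapT => /not_orP [nIg nIh].
have [n [p [a [Ip Oa ep]]]] := ext g Og nIg; have [n' [q [b [Iq Ob eq]]]] := ext h Oh nIh.
apply: (hI (n + n')%N); rewrite exprD ep eq.
have -> : (p + a * g) * (q + b * h) = (q + b * h) * p + (a * g * q + a * b * (g * h)) by ring.
by apply: (ID); [apply: (IM) => //; apply: (OD); [exact: IO|exact: OM]|apply: (ID); apply: (IM) => //; exact: OM].
Qed.

End WithParameters.

Definition prime_elt (p : K) := [/\ m p, p != 0 &
  forall f g a, O f -> O g -> O a -> f * g = a * p ->
  (exists2 b, O b & f = b * p) \/ (exists2 b, O b & g = b * p)].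

(** A prime ideal containing f and avoiding u or v is principal. If it is impossible to avoid
    either, f divides a power of u and a power of v; the first makes f a multiple of the prime u,
    and then u divides a power of v, against dimension two. *)
Lemma prime_divisor u v f : rp u v -> m f -> f != 0 ->
  exists p, prime_elt p /\ exists2 a, O a & f = a * p.
Proof.
move=> hO mf f0; have sO := rp_sub hO; have [Of _] := mf.
have from_avoid u' v' : rp u' v' -> (forall n a, O a -> u' ^+ n <> a * f) ->
    exists p, prime_elt p /\ exists2 a, O a & f = a * p.
  move=> hO' hu.
  have [P [idP prP nPu Pf]] := avoiding_prime hO' Of (proj1 (rp_u hO')) hu.
  have [p Pp hp] := prime_ideal_principal hO' idP prP nPu Pf f0.
  have [PO P0 PD PM] := idP.
  exists p; split; last exact: hp.
  split.
  - split; [exact: PO|move=> g Og e; apply: nPu].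
    by rewrite -[u']mulr1 -e mulrCA mulrC; apply: (PM) => //; apply: (subalgM sO) => //; case: (rp_u hO').
  - by apply/eqP => p0; have [a _ ef] := hp _ Pf; move: f0; rewrite ef p0 mulr0 eqxx.
  move=> g h a Og Oh Oa e.
  by have := prP g h Og Oh; rewrite e => /(_ (PM _ _ Oa Pp)) [/hp|/hp]; [left|right].
have [hu|/existsNP [n /existsNP [a /not_implyP [Oa /contrapT e]]]] :=
  EM (forall n a, O a -> u ^+ n <> a * f).
  exact: (from_avoid u v hO hu).
apply: (from_avoid v u (regular_point_sym hO)) => n' a' Oa' e'.
have [b Ob ef] : exists2 b, O b & f = b * u.
  elim: n a Oa e => [|n IH] a Oa e.
    by case: mf => _ /(_ a Oa); rewrite mulrC -e expr0.
  have Ou := proj1 (rp_u hO).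
  have Oun : O (u ^+ n) by apply: (subalgX sO).
  have eu : a * f = u ^+ n * u by rewrite -e exprSr.
  have [[c Oc ea]|//] := param_prime hO Oa Of Oun eu; apply: (IH c Oc).
  have u0 : u != 0.
    by apply/eqP => u0; apply: (rp_dimv hO (n := 1%N) (a := 0)); [exact: (subalg0 sO)|rewrite u0 expr1 mul0r].
  by apply: (mulIf u0); rewrite -eu ea mulrAC.
by apply: (rp_dimu hO (n := n') (a := a' * b)); [exact: (subalgM sO)|rewrite e' ef mulrA].
Qed.

End RegularPoint.

(** * Valuations and orders along prime divisors *)

Section Valuations.
Context (k : closedFieldType) (K : fieldType) (iota : {rmorphism k -> K}).

Implicit Types (a b z y : K) (n : int).

Definition vge (w : K -> int) (n : int) (z : K) : Prop := z = 0 \/ n <= w z.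

Record valuation (w : K -> int) : Prop := Valuation {
  val_M : forall a b, a != 0 -> b != 0 -> w (a * b) = w a + w b;
  val_D : forall n a b, vge w n a -> vge w n b -> vge w n (a + b);
  val_C : forall c, c != 0 -> w (iota c) = 0 }.

Context (w : K -> int) (hw : valuation w).

Lemma vgeP n z : z != 0 -> vge w n z <-> n <= w z.
Proof. by move=> z0; split; [case=> // z0'; rewrite z0' eqxx in z0|right]. Qed.

Lemma vge0 n : vge w n 0. Proof. by left. Qed.
Lemma vge_le n n' z : n' <= n -> vge w n z -> vge w n' z.
Proof. by move=> h [->|h']; [left|right; apply: le_trans h']. Qed.

Lemma vgeC c : vge w 0 (iota c).
Proof.
have [->|c0] := eqVneq c 0; first by left; rewrite rmorph0.
by right; rewrite (val_C hw).
Qed.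

Lemma val_1 : w 1 = 0.
Proof. by have := val_C hw (oner_neq0 k); rewrite rmorph1. Qed.

Lemma vgeM n n' a b : vge w n a -> vge w n' b -> vge w (n + n') (a * b).
Proof.
case=> [->|ha]; first by left; rewrite mul0r.
case=> [->|hb]; first by left; rewrite mulr0.
have [->|a0] := eqVneq a 0; first by left; rewrite mul0r.
have [->|b0] := eqVneq b 0; first by left; rewrite mulr0.
by right; rewrite (val_M hw) // lerD.
Qed.

Lemma vgeM0 a b : vge w 0 a -> vge w 0 b -> vge w 0 (a * b).
Proof. by move=> ha hb; rewrite -[0]addr0; apply: vgeM. Qed.

Lemma subalg_vge : subalg iota (vge w 0).
Proof. by split; [exact: vgeC|exact: val_D hw 0|exact: vgeM0]. Qed.

Lemma val_V a : a != 0 -> w a^-1 = - w a.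
Proof.
move=> a0; apply/eqP; rewrite -addr_eq0 -(val_M hw) ?invr_eq0 //.
by rewrite mulVf // val_1.
Qed.

Lemma val_X a (n : nat) : a != 0 -> w (a ^+ n) = w a *+ n.
Proof.
move=> a0; elim: n => [|n IH]; first by rewrite expr0 mulr0n val_1.
by rewrite exprS mulrS (val_M hw) ?expf_neq0 // IH.
Qed.

Lemma val_N a : w (- a) = w a.
Proof.
have [->|a0] := eqVneq a 0; first by rewrite oppr0.
rewrite -mulN1r (val_M hw) ?oppr_eq0 ?oner_eq0 //.
by rewrite -(rmorph1 iota) -rmorphN (val_C hw) ?oppr_eq0 ?oner_eq0 // add0r.
Qed.

Lemma vgeN n a : vge w n a -> vge w n (- a).
Proof. by case=> [->|h]; [left; rewrite oppr0|right; rewrite val_N]. Qed.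

Lemma vge_sum n I (r : seq I) (P : pred I) F :
  (forall i, P i -> vge w n (F i)) -> vge w n (\sum_(i <- r | P i) F i).
Proof.
move=> h; elim/big_rec: _ => [|i x Pi IH]; first exact: vge0.
by apply: (val_D hw) => //; apply: h.
Qed.

Lemma vgeX a (n : nat) : vge w 0 a -> vge w 0 (a ^+ n).
Proof. exact: (subalgX subalg_vge). Qed.

Lemma val_addr_eq a b : a != 0 -> vge w (w a + 1) b -> w (a + b) = w a /\ a + b != 0.
Proof.
move=> a0 hb; have ab0 : a + b != 0.
  apply/eqP => e; have eb : b = - a by apply/eqP; rewrite -addr_eq0 addrC e.
  by move: hb; rewrite eb vgeP ?oppr_eq0 // val_N lezD1 ltxx.
split=> //; apply/eqP; rewrite eq_le; apply/andP; split.
  rewrite leNgt; apply/negP => h.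
  suff : vge w (w a + 1) a by rewrite vgeP // lezD1 ltxx.
  rewrite -[a in vge _ _ a](addrK b); apply: (val_D hw); last exact: vgeN.
  by right; rewrite lezD1.
rewrite -vgeP //; apply: (val_D hw); first by right.
by apply: vge_le hb; rewrite lerDl.
Qed.

Lemma val_prod_XsubC y (r : seq k) : (forall c, ~ (y - iota c = 0 \/ 0 < w (y - iota c))) ->
  vge w 0 y -> w (\prod_(c <- r) (y - iota c)) = 0 /\ \prod_(c <- r) (y - iota c) != 0.
Proof.
move=> hy y0; elim: r => [|c r [IH1 IH2]]; first by rewrite big_nil val_1 oner_neq0.
have c0 : y - iota c != 0 by apply/eqP => e; apply: (hy c); left.
rewrite big_cons mulf_neq0 // (val_M hw) // IH1 addr0; split=> //.
have : vge w 0 (y - iota c) by apply: (subalgB subalg_vge) => //; apply: vgeC.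
rewrite vgeP // => h; apply/eqP; rewrite eq_le h andbT leNgt.
by apply/negP => h'; apply: (hy c); right.
Qed.

(** Over the closed field k the polynomial p splits, and no factor y - c has positive value; so all
    nonzero polynomials in y are units. *)
Lemma val_residue_transc y p : (forall c, ~ (y - iota c = 0 \/ 0 < w (y - iota c))) ->
  vge w 0 y -> p != 0 -> w (ev1 iota y p) = 0 /\ ev1 iota y p != 0.
Proof.
move=> hy y0 p0; have [r ->] := closed_field_poly_normal p.
have l0 : iota (lead_coef p) != 0 by rewrite fmorph_eq0 lead_coef_eq0.
rewrite -mul_polyC ev1M ev1C.
have -> : ev1 iota y (\prod_(z <- r) ('X - z%:P)) = \prod_(c <- r) (y - iota c).
  rewrite (big_morph _ (ev1M iota y) (ev11 iota y)); apply: eq_bigr => c _.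
  by rewrite ev1B ev1X ev1C.
have [h1 h2] := val_prod_XsubC r hy y0.
rewrite mulf_neq0 // (val_M hw) // h1 addr0; split=> //.
by rewrite (val_C hw) // lead_coef_eq0.
Qed.

End Valuations.

Section PrimeValuation.
Context (k : closedFieldType) (K : fieldType) (iota : {rmorphism k -> K}).
Context (O : set K) (zs : seq K) (u v : K) (hO : regular_point iota O u v zs).
Context (p : K) (hp : prime_elt O p).
Let sO : subalg iota O := rp_sub hO.

Let p0 : p != 0. Proof. by case: hp. Qed.
Let Op : O p. Proof. by case: hp => [[]]. Qed.
Let div a := exists2 b, O b & a = b * p.
Let OM := subalgM sO.
Let OX := subalgX sO.

Let prime_factor f : O f -> f != 0 -> exists n a, [/\ O a, ~ div a & f = p ^+ n * a].
Proof.
move=> Of f0.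
pose F : set (set K) := [set I | exists n a, [/\ O a, f = p ^+ n * a & I = [set x | exists2 b, O b & x = b * a]]].
(* A cofactor generating a maximal ideal can no longer be divided by p, for its quotient by p would
   generate a larger one. *)
have [||_ [n [a [Oa ea ->]]] maxI] := noeth_max (F := F) (rp_noeth hO).
- by eexists; exists 0%N, f; rewrite expr0 mul1r.
- move=> _ [n [a [Oa ea ->]]]; split=> [_ [b Ob ->]| |_ _ [b Ob ->] [c Oc ->]|c _ Oc [b Ob ->]].
  + exact: OM.
  + by exists 0; [exact: (subalg0 sO)|rewrite mul0r].
  + by exists (b + c); [exact: (subalgD sO)|rewrite mulrDl].
  by exists (c * b); [exact: OM|rewrite mulrA].
exists n, a; split=> // -[b Ob eab].
have a0 : a != 0 by apply: contra_neq f0 => a0; rewrite ea a0 mulr0.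
pose S : set K := [set x | exists2 c, O c & x = c * b].
have FS : F S by exists n.+1, b; split=> //; rewrite ea eab exprSr; ring.
have subS : [set x | exists2 c, O c & x = c * a] `<=` S.
  by move=> _ [c Oc ->]; exists (c * p); [exact: OM|rewrite eab; ring].
have Sb : S b by exists 1; [exact: (subalg1 sO)|rewrite mul1r].
have [c Oc ec] := maxI _ FS subS _ Sb.
have [[_ /(_ c Oc) h] _ _] := hp; apply: h.
have b0 : b != 0 by apply: contra_neq a0 => b0; rewrite eab b0 mul0r.
by apply: (mulIf b0); rewrite mul1r [in RHS]ec eab; ring.
Qed.

Let rel z (n : int) := exists a b, [/\ O a, O b, ~ div a, ~ div b & z = p ^ n * (a / b)].

Let ndiv_neq0 a : ~ div a -> a != 0.
Proof.
by move=> na; apply/eqP => a0; apply: na; exists 0; [exact: (subalg0 sO)|rewrite mul0r].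
Qed.

Let ndivM a b : O a -> O b -> ~ div a -> ~ div b -> ~ div (a * b).
Proof.
by move=> Oa Ob na nb [c Oc e]; have [_ _ h] := hp; case: (h a b c Oa Ob Oc e).
Qed.

Let rel_le z n n' : rel z n -> rel z n' -> n <= n'.
Proof.
move=> [a [b [Oa Ob na nb e]]] [a' [b' [Oa' Ob' na' nb' e']]].
rewrite leNgt; apply/negP => lt_n.
have [d ed] : exists d : nat, n = n' + d.+1%:Z by exists (`|n - n'|%N.-1); lia.
apply: (ndivM Oa' Ob na' nb); exists (p ^+ d * a * b').
  by apply: OM => //; apply: OM => //; apply: OX.
have b0 := ndiv_neq0 nb; have b0' := ndiv_neq0 nb'.
have e1 : p ^ n' * (a' / b') = p ^ n' * (p ^+ d.+1 * (a / b)).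
  by rewrite -e' e ed expfzDr // -mulrA.
have pn0 : p ^ n' != 0 by rewrite expfz_neq0.
have := mulfI pn0 e1 => e2; have -> : a' = p ^+ d.+1 * (a / b) * b' by rewrite -e2 divfK.
by rewrite exprS; field.
Qed.

Let rel_ex z : z != 0 -> exists n, rel z n.
Proof.
move=> z0; have [a [b [Oa Ob b0 ez]]] := rp_frac hO z.
have a0 : a != 0 by apply: contra_neq z0 => a0; rewrite ez a0 mul0r.
have [n [a' [Oa' na' ea]]] := prime_factor Oa a0.
have [n' [b' [Ob' nb' eb]]] := prime_factor Ob b0.
exists (n%:Z - n'%:Z), a', b'; split=> //.
rewrite ez ea eb expfzDr // -exprnP -exprnN; field.
by rewrite (ndiv_neq0 nb') expf_neq0.
Qed.

(** w is the order along p. The third clause identifies its valuation ring as a localization of O,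
    and the last one is what produces poles. *)
Lemma prime_valuation : exists w, [/\ valuation iota w,
  forall f, O f -> vge w 0 f,
  forall z, vge w 0 z -> exists a b, [/\ O a, O b, b != 0, w b = 0 & z = a / b] &
  forall f g, O f -> O g -> ~ div f -> div g -> g != 0 -> w (f / g) < 0].
Proof.
have /choice [w hw] : forall z, exists n, z != 0 -> rel z n.
  by move=> z; have [->|/rel_ex [n hn]] := eqVneq z 0; [exists 0|exists n].
have wE z n : z != 0 -> rel z n -> w z = n.
  by move=> z0 h; apply/eqP; rewrite eq_le !(rel_le (z := z)) //; apply: hw.
have n1 : ~ div 1.
  by move=> [b Ob e]; have [[_ /(_ b Ob) h] _ _] := hp; apply: h; rewrite mulrC.
have relO f n a : O a -> ~ div a -> f = p ^+ n * a -> rel f n%:Z.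
  by move=> Oa na ->; exists a, 1; rewrite divr1; split=> //; exact: (subalg1 sO).
have wO f : O f -> f != 0 -> 0 <= w f.
  move=> Of f0; have [n [a [Oa na ef]]] := prime_factor Of f0.
  by rewrite (wE _ _ f0 (relO _ _ _ Oa na ef)).
have wM a b : a != 0 -> b != 0 -> w (a * b) = w a + w b.
  move=> a0 b0; apply: wE; first exact: mulf_neq0.
  have [c [d [Oc Od nc nd ea]]] := hw a a0; have [c' [d' [Oc' Od' nc' nd' eb]]] := hw b b0.
  exists (c * c'), (d * d'); split; [exact: OM|exact: OM|exact: ndivM|exact: ndivM|].
  rewrite [in LHS]ea [in LHS]eb expfzDr //.
  have d0 := ndiv_neq0 nd; have d0' := ndiv_neq0 nd'; field.
  by rewrite d0 d0'.
have nonneg z : z != 0 -> 0 <= w z -> exists a b, [/\ O a, O b, ~ div b & z = a / b].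
  move=> z0 h; have [a [b [Oa Ob na nb ez]]] := hw z z0.
  exists (p ^+ `|w z|%N * a), b; split=> //; first by apply: OM => //; apply: OX.
  by rewrite {1}ez -{1}(gez0_abs h) -exprnP mulrA.
exists w; split.
- split=> // [n a b ha hb|c c0]; last first.
    apply: wE; first by rewrite fmorph_eq0.
    exists (iota c), 1; split; [exact: (subalgC sO)|exact: (subalg1 sO)| |by []|by rewrite divr1 mul1r].
    move=> [b Ob e]; apply: n1; exists (iota c^-1 * b); first by apply: OM => //; apply: (subalgC sO).
    by rewrite -mulrA -e -rmorphM mulVf // rmorph1.
  have [->|a0] := eqVneq a 0; first by rewrite add0r.
  have [->|b0] := eqVneq b 0; first by rewrite addr0.
  have [ab0|ab0] := eqVneq (a + b) 0; [by left|right].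
  have {}ha : n <= w a by case: ha => // e; rewrite e eqxx in a0.
  have {}hb : n <= w b by case: hb => // e; rewrite e eqxx in b0.
  have pn0 : p ^ (- n) != 0 by rewrite expfz_neq0.
  have wp i : w (p ^ i) = i.
    apply: wE; first by rewrite expfz_neq0.
    by exists 1, 1; rewrite divr1 mulr1; split=> //; exact: (subalg1 sO).
  have [c [d [Oc Od nd ea]]] : exists c d, [/\ O c, O d, ~ div d & p ^ (- n) * a = c / d].
    by apply: nonneg; rewrite ?mulf_neq0 // wM // wp; lia.
  have [c' [d' [Oc' Od' nd' eb]]] : exists c d, [/\ O c, O d, ~ div d & p ^ (- n) * b = c / d].
    by apply: nonneg; rewrite ?mulf_neq0 // wM // wp; lia.
  have d0 := ndiv_neq0 nd; have d0' := ndiv_neq0 nd'.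
  suff : 0 <= w (p ^ (- n) * (a + b)) by rewrite wM // wp; lia.
  rewrite mulrDr ea eb.
  have e : c / d + c' / d' = (c * d' + c' * d) * (d * d')^-1 by field; rewrite d0 d0'.
  have s0 : c * d' + c' * d != 0.
    have : p ^ (- n) * (a + b) != 0 by rewrite mulf_neq0.
    by rewrite mulrDr ea eb e; apply: contra_neq => ->; rewrite mul0r.
  have dd0 : d * d' != 0 by rewrite mulf_neq0.
  rewrite e wM ?invr_eq0 //.
  have -> : w (d * d')^-1 = 0.
    apply: wE; first by rewrite invr_eq0.
    exists 1, (d * d'); rewrite mul1r; split=> //; [exact: (subalg1 sO)|exact: OM|exact: ndivM|].
    by rewrite mul1r.
  rewrite addr0; apply: wO => //.
  by apply: (subalgD sO); apply: OM.
- by move=> f Of; have [->|f0] := eqVneq f 0; [left|right; apply: wO].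
- move=> z [->|h].
    exists 0, 1; rewrite mul0r; split=> //; [exact: (subalg0 sO)|exact: (subalg1 sO)|exact: oner_neq0|].
    apply: wE; first exact: oner_neq0.
    by exists 1, 1; rewrite divr1 mulr1; split=> //; exact: (subalg1 sO).
  have [->|z0] := eqVneq z 0.
    exists 0, 1; rewrite mul0r; split=> //; [exact: (subalg0 sO)|exact: (subalg1 sO)|exact: oner_neq0|].
    apply: wE; first exact: oner_neq0.
    by exists 1, 1; rewrite divr1 mulr1; split=> //; exact: (subalg1 sO).
  have [a [b [Oa Ob nb ez]]] := nonneg _ z0 h; exists a, b; split=> //; first exact: ndiv_neq0.
  apply: wE; first exact: ndiv_neq0.
  by exists b, 1; rewrite divr1 mul1r; split=> //; exact: (subalg1 sO).
move=> f g Of Og nf [h Oh eg] g0.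
have h0 : h != 0 by apply: contra_neq g0 => h0; rewrite eg h0 mul0r.
have [n [a [Oa na eh]]] := prime_factor Oh h0.
rewrite (wE _ (- n.+1%:Z)) //; first by rewrite mulf_neq0 ?invr_eq0 ?(ndiv_neq0 nf).
exists f, a; split=> //; rewrite -exprnN eg eh exprSr; field.
by rewrite (ndiv_neq0 na) p0 expf_neq0.
Qed.

End PrimeValuation.

(** * Poles and Jacobians at a regular point *)

Section DivisorialCriterion.
Context (k : closedFieldType) (K : fieldType) (iota : {rmorphism k -> K}).
Context (O : set K) (zs : seq K) (u v : K) (hO : regular_point iota O u v zs).
Let sO : subalg iota O := rp_sub hO.

(** The third clause says that the valuation ring is a localization of O, so that w is not
    exceptional over this point. *)
Definition divisorial (w : K -> int) := [/\ valuation iota w,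
  forall f, O f -> vge w 0 f &
  forall z, vge w 0 z -> exists a b, [/\ O a, O b, b != 0, w b = 0 & z = a / b]].

(** Take a denominator g of z whose ideal is maximal. It is not a unit, so it has a prime factor p,
    and the numerator g z is not divisible by p, since otherwise p could be cancelled; the order
    along p is then negative on z. *)
Lemma divisorial_criterion z : ~ O z -> exists w, divisorial w /\ w z < 0.
Proof.
move=> nz; have OM := subalgM sO.
pose F : set (set K) := [set I | exists g, [/\ O g, g != 0, O (g * z) &
   I = [set x | exists2 b, O b & x = b * g]]].
have [||_ [g [Og g0 Ogz ->]] maxI] := noeth_max (F := F) (rp_noeth hO).
- have [a [b [Oa Ob b0 ez]]] := rp_frac hO z.
  by eexists; exists b; split=> //; rewrite ez mulrC divfK.
- move=> _ [g [Og g0 Ogz ->]]; split=> [_ [b Ob ->]| |_ _ [b Ob ->] [c Oc ->]|c _ Oc [b Ob ->]].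
  + exact: OM.
  + by exists 0; [exact: (subalg0 sO)|rewrite mul0r].
  + by exists (b + c); [exact: (subalgD sO)|rewrite mulrDl].
  by exists (c * b); [exact: OM|rewrite mulrA].
have mg : max_ideal O g.
  apply: contrapT => /(max_ideal_unit Og) [_ Og']; apply: nz.
  by rewrite -(mulKf g0 z); apply: OM.
have [p [hp [g' Og' eg]]] := prime_divisor hO mg g0.
have [p00 Op] : p != 0 /\ O p by case: hp => [[]].
have [w [hw1 hw2 hw3 hw4]] := prime_valuation hO hp.
exists w; split=> //; have -> : z = g * z / g by rewrite mulrC mulKf.
apply: hw4 => //; last by exists g'.
move=> [f Of ef].
have g0' : g' != 0 by apply: contra_neq g0 => h; rewrite eg h mul0r.
pose S : set K := [set x | exists2 c, O c & x = c * g'].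
have FS : F S.
  exists g'; split=> //; suff -> : g' * z = f by [].
  by apply: (mulIf p00); rewrite -ef eg; ring.
have subS : [set x | exists2 c, O c & x = c * g] `<=` S.
  by move=> _ [c Oc ->]; exists (c * p); [exact: OM|rewrite eg; ring].
have Sg : S g' by exists 1; [exact: (subalg1 sO)|rewrite mul1r].
have [c Oc ec] := maxI _ FS subS _ Sg.
have [[_ /(_ c Oc) h] _ _] := hp; apply: h.
by apply: (mulIf g0'); rewrite mul1r [in RHS]ec eg; ring.
Qed.

Context (J : K -> K -> K) (hJ : biderivation iota J).

(** Modulo constants each generator of O is a u + b v, so J of two generators is a determinant times
    J u v, up to the maximal ideal times the module of all values; Nakayama removes that error. *)
Lemma jacobian_generator : J u v != 0 /\
  forall f g, O f -> O g -> exists2 a, O a & J f g = a * J u v.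
Proof.
have OM := subalgM sO; have OD := subalgD sO.
have OC := subalgC sO.
pose G := [seq J a b | a <- zs, b <- zs].
have D1 g := bider_l hJ g; have D2 f := bider_r hJ f.
have Ou : O u by case: (rp_u hO).
have Ov : O v by case: (rp_v hO).
have A_O : kalg iota [set z | z \in zs] `<=` O.
  by apply: kalg_min => // z; apply: (rp_gens_sub hO).
have O0 := subalg0 sO; have O1 := subalg1 sO.
have GD := genD OD (g := G).
have GM a b : O a -> gen O G b -> gen O G (a * b).
  by move=> Oa; apply: genM => d; apply: OM.
have loc (M : set K) (D : K -> K) : kderivation iota D -> M 0 -> (forall a b, M a -> M b -> M (a + b)) ->
    (forall a b, O a -> M b -> M (a * b)) -> (forall z, z \in zs -> M (D z)) ->
    forall z, O z -> M (D z).
  move=> hD M0 MD MM Mz z /(rp_gens hO) [a [b [ka kb nb ->]]].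
  have MA x : kalg iota [set z | z \in zs] x -> M (D x).
    by apply: (der_kalg hD) => // c d /A_O; apply: MM.
  have [b0 Ob'] := max_ideal_unit (A_O _ kb) nb.
  have -> : D (a / b) = b^-1 * D a + (- a / b ^+ 2) * D b.
    by rewrite (derf hD) //; field.
  apply: MD; apply: MM => //; try exact: MA.
  apply: OM; first by apply: (subalgN sO); apply: A_O.
  by rewrite -exprVn; apply: (subalgX sO).
have genJ f g : O f -> O g -> gen O G (J f g).
  move=> Of Og; apply: (loc (gen O G) (J^~ g) (D1 g)) => //; first exact: gen0.
  move=> z zz; apply: (loc (gen O G) (J z) (D2 z)) => //; first exact: gen0.
  move=> z' zz'; apply: gen_mem => //.
  by apply/allpairsP; exists (z, z').
pose N : set K := [set x | exists2 a, O a & x = a * J u v].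
have NG : forall y, y \in G -> N y.
  apply: (nakayama hO).
  - by exists 0; rewrite ?mul0r.
  - by move=> _ _ [a Oa ->] [b Ob ->]; exists (a + b); [exact: OD|rewrite mulrDl].
  - by move=> a _ Oa [b Ob ->]; exists (a * b); [exact: OM|rewrite mulrA].
  move=> _ /allpairsP [[z1 z2] /= [zz1 zz2 ->]].
  have [c1 mc1] := rp_res hO (rp_gens_sub hO zz1).
  have [c2 mc2] := rp_res hO (rp_gens_sub hO zz2).
  have [a1 [b1 [Oa1 Ob1 e1]]] := rp_uv hO mc1.
  have [a2 [b2 [Oa2 Ob2 e2]]] := rp_uv hO mc2.
  have ez1 : z1 = a1 * u + b1 * v + iota c1 by rewrite -e1 subrK.
  have ez2 : z2 = a2 * u + b2 * v + iota c2 by rewrite -e2 subrK.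
  have Oz2 : O z2 by apply: (rp_gens_sub hO).
  have mgen a x : max_ideal O a -> gen O G x -> gen (max_ideal O) G (a * x).
    by move=> ma; apply: (@genM K O (max_ideal O)) => d Od; apply: (max_idealM sO).
  have mD := genD (rp_maxD hO) (g := G).
  have mu := rp_u hO; have mv := rp_v hO.
  exists ((a1 * b2 - b1 * a2) * J u v),
    ((u * J a1 z2 + v * J b1 z2) + a1 * (u * J u a2 + v * J u b2) + b1 * (u * J v a2 + v * J v b2)).
  split; first by exists (a1 * b2 - b1 * a2) => //; apply: (subalgB sO); exact: OM.
    apply: (mD); [apply: (mD); [|rewrite mulrDr]|rewrite mulrDr]; apply: (mD);
      rewrite ?[_ * (u * _)]mulrA ?[_ * (v * _)]mulrA;
      apply: (mgen) => //; try (exact: genJ); rewrite mulrC; exact: (max_idealM sO).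
  rewrite {1}ez1 (derD (D1 z2)) (derD (D1 z2)) (derM (D1 z2)) (derM (D1 z2)) (derC (D1 z2)) addr0.
  have E f : J f z2 = (J f a2 * u + a2 * J f u) + (J f b2 * v + b2 * J f v).
    rewrite ez2 (derD (D2 f)) (derD (D2 f)) (derM (D2 f)) (derM (D2 f)).
    by rewrite (derC (D2 f)) addr0.
  rewrite (E u) (E v) !(bider_alt hJ) (bider_anti u v hJ); ring.
have NO f g : O f -> O g -> exists2 a, O a & J f g = a * J u v.
  move=> Of Og; apply: (gen_in (N := N) _ _ _ (genJ f g Of Og)).
  - by exists 0; rewrite ?mul0r.
  - by move=> _ _ [a Oa ->] [b Ob ->]; exists (a + b); [exact: OD|rewrite mulrDl].
  by move=> a _ Oa /NG [b Ob ->]; exists (a * b); [exact: OM|rewrite mulrA].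
split=> //; apply/eqP => J0; have [f [g]] := bider_neq0 hJ; apply/negP; rewrite negbK; apply/eqP.
have J00 x y : O x -> O y -> J x y = 0 by move=> Ox /(NO _ _ Ox) [a _ ->]; rewrite J0 mulr0.
have J0l x z : O x -> J x z = 0.
  move=> Ox; have [c [d [Oc Od d0 ->]]] := rp_frac hO z.
  by rewrite (derf (D2 x)) // !J00 // mul0r mulr0 subrr mul0r.
have [c [d [Oc Od d0 ->]]] := rp_frac hO f.
by rewrite (derf (D1 g)) // !J0l // mul0r mulr0 subrr mul0r.
Qed.

(** The quotient rule extends the previous lemma from O to the valuation ring, whose denominators
    have value 0. *)
Lemma divisorial_jacobian w f g : divisorial w -> vge w 0 f -> vge w 0 g ->
  vge w (w (J u v)) (J f g).
Proof.
move=> [hw Ow Owf] hf hg; have [J0 hJO] := jacobian_generator.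
have D1 h := bider_l hJ h; have D2 h := bider_r hJ h.
have vJ a b : O a -> O b -> vge w (w (J u v)) (J a b).
  move=> Oa /(hJO _ _ Oa) [c Oc ->]; rewrite -[w _]add0r; apply: (vgeM hw); first exact: Ow.
  by right.
have inv b : b != 0 -> w b = 0 -> vge w 0 (b ^+ 2)^-1.
  by move=> b0 wb; right; rewrite (val_V hw) ?expf_neq0 // (val_X hw) // wb mul0rn.
have comb n x y b c z : vge w n x -> vge w n y -> vge w 0 b -> vge w 0 c -> vge w 0 z ->
    vge w n ((x * b - c * y) * z).
  move=> hx hy hb hc hz; rewrite -[n]addr0; apply: (vgeM hw) => //.
  apply: (val_D hw); first by rewrite -[n]addr0; apply: (vgeM hw).
  by apply: (vgeN hw); rewrite -[n]add0r; apply: (vgeM hw).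
have [a [b [Oa Ob b0 wb ->]]] := Owf f hf; have [c [d [Oc Od d0 wd ->]]] := Owf g hg.
have vJl x : O x -> vge w (w (J u v)) (J x (c / d)).
  by move=> Ox; rewrite (derf (D2 x)) //; apply: (comb); try (exact: vJ); try (exact: Ow); exact: inv.
by rewrite (derf (D1 _)) //; apply: (comb); try (exact: vJl); try (exact: Ow); exact: inv.
Qed.

End DivisorialCriterion.

(** * Valuation rings *)

Section ValuationRings.
Context (k : closedFieldType) (K : fieldType) (iota : {rmorphism k -> K}).

Definition val_ring (W : set K) :=
  subalg iota W /\ forall z, z != 0 -> W z \/ W z^-1.

Section Extension.
Context (B0 I0 : set K).
Local Notation R S := (kalg iota (B0 `|` S)).
Local Notation bad S := (exists g, (forall y, y \in g -> I0 y) /\ gen (R S) g 1).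

Let R_mono S T : S `<=` T -> R S `<=` R T.
Proof.
move=> ST; apply: kalg_mono => z [Bz|Sz]; apply: kalg_gen; first by left.
by right; apply: ST.
Qed.

(** Chevalley's extension argument: Zorn's lemma on the sets of adjoined elements for which [I0]
    does not generate the unit ideal. *)
Lemma max_avoiding_ring : ~ bad set0 -> exists W, [/\ subalg iota W, B0 `<=` W,
  ~ (exists g, (forall y, y \in g -> I0 y) /\ gen W g 1) &
  forall x, ~ W x -> exists g, (forall y, y \in g -> I0 y) /\
    gen (kalg iota (W `|` [set x])) g 1].
Proof.
move=> nbad.
have [|S [nS maxS]] := @Zorn_bigcup K (fun S => ~ bad S).
  move=> F FP totF.
  (* The chain may be empty, which accounts for the alternative with [set0]. *)
  have key z : R (\bigcup_(X in F) X) z -> R set0 z \/ exists2 S, F S & R S z.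
    have common S T : F S -> F T -> exists2 U, F U & S `<=` U /\ T `<=` U.
      by move=> FS FT; case: (totF S T FS FT) => h; [exists T|exists S] => //; split.
    have comb (op : K -> K -> K) : (forall S a b, R S a -> R S b -> R S (op a b)) ->
        forall a b, (R set0 a \/ exists2 S, F S & R S a) -> (R set0 b \/ exists2 S, F S & R S b) ->
        R set0 (op a b) \/ exists2 S, F S & R S (op a b).
      move=> hop a b [ha|[S FS ha]] [hb|[T FT hb]].
      - by left; apply: hop.
      - by right; exists T => //; apply: hop => //; apply: R_mono ha.
      - by right; exists S => //; apply: hop => //; apply: R_mono hb.
      have [U FU [SU TU]] := common S T FS FT.
      by right; exists U => //; apply: hop; [apply: R_mono ha|apply: R_mono hb].
    elim=> [c|w [Bw|[S FS Sw]]|a b _ + _|a b _ + _].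
    - by left; apply: kalg_const.
    - by left; apply: kalg_gen; left.
    - by right; exists S => //; apply: kalg_gen; right.
    - by apply: (comb +%R) => *; apply: kalg_add.
    by apply: (comb *%R) => *; apply: kalg_mul.
  have keyg g z : gen (R (\bigcup_(X in F) X)) g z ->
      gen (R set0) g z \/ exists2 S, F S & gen (R S) g z.
    elim: g z => [|y g IH] z /=; first by move=> ->; left.
    move=> [a [b [/key ha /IH hb ->]]].
    case: ha => [ha|[S FS ha]]; case: hb => [hb|[T FT hb]].
    - by left; exists a, b.
    - by right; exists T => //; exists a, b; split=> //; apply: R_mono ha.
    - right; exists S => //; exists a, b; split=> //; apply: gen_subset hb.
      exact: R_mono.
    have [ST|TS] := totF S T FS FT.
      by right; exists T => //; exists a, b; split=> //; apply: R_mono ha.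
    by right; exists S => //; exists a, b; split=> //; apply: gen_subset hb; apply: R_mono.
  move=> [g [hg /keyg [h|[S FS h]]]]; first by apply: nbad; exists g.
  by apply: (FP S FS); exists g.
exists (R S); split=> //; first exact: kalg_subalg.
  by move=> z Bz; apply: kalg_gen; left.
move=> x nx; have : S `<` S `|` [set x].
  split; first by move=> z; left.
  by move=> h; apply: nx; apply: kalg_gen; right; apply: h; right.
move=> /maxS /contrapT [g [hg gg]]; exists g; split=> //; apply: gen_subset gg.
apply: kalg_mono => z [Bz|[Sz|->]]; apply: kalg_gen; [left|left|right] => //.
  by apply: kalg_gen; left.
by apply: kalg_gen; right.
Qed.

End Extension.

Section Maximal.
Context (W I0 : set K) (sW : subalg iota W) (I0W : I0 `<=` W).
Local Notation bad V := (exists g, (forall y, y \in g -> I0 y) /\ gen V g 1).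
Hypotheses (nbad : ~ bad W) (maxW : forall x, ~ W x -> bad (kalg iota (W `|` [set x]))).

Let I : set K := [set z | exists2 g, forall y, y \in g -> I0 y & gen W g z].

Let IM a b : W a -> I b -> I (a * b).
Proof.
by move=> Wa [g hg gb]; exists g => //; apply: genM gb => d; apply: (subalgM sW).
Qed.

Let ID a b : I a -> I b -> I (a + b).
Proof.
move=> [g hg ga] [h hh gb]; exists (g ++ h); last exact: gen_cat.
by move=> y; rewrite mem_cat => /orP[/hg|/hh].
Qed.

Let I0' : I 0. Proof. by exists [::]. Qed.

Let I1 : ~ I 1. Proof. by move=> [g hg gg]; apply: nbad; exists g. Qed.

Let IW a : I a -> W a.
Proof.
move=> [g hg ga]; apply: (@gen_in K W W g a (subalg0 sW)) => //; first exact: (subalgD sW).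
by move=> x y Wx /hg /I0W; apply: (subalgM sW).
Qed.

Let adjoin x z : kalg iota (W `|` [set x]) z -> exists2 p : {poly K}, forall i, W p`_i & z = p.[x].
Proof.
elim=> [c|w [Ww|->]|a c _ [p hp ->] _ [q hq ->]|a c _ [p hp ->] _ [q hq ->]].
- exists (iota c)%:P; last by rewrite hornerC.
  by move=> i; rewrite coefC; case: ifP => _; [exact: (subalgC sW)|exact: (subalg0 sW)].
- exists w%:P; last by rewrite hornerC.
  by move=> i; rewrite coefC; case: ifP => _ //; exact: (subalg0 sW).
- exists 'X; last by rewrite hornerX.
  by move=> i; rewrite coefX; case: eqP => _; [exact: (subalg1 sW)|exact: (subalg0 sW)].
- exists (p + q); last by rewrite hornerD.
  by move=> i; rewrite coefD; apply: (subalgD sW).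
- exists (p * q); last by rewrite hornerM.
  by move=> i; rewrite coefM; apply: (subalg_sum sW) => j _; apply: (subalgM sW).
Qed.

Let relation x : ~ W x -> exists2 p : {poly K}, forall i, I p`_i & 1 = p.[x].
Proof.
move=> /maxW [g [hg]].
suff H z : gen (kalg iota (W `|` [set x])) g z -> exists2 p : {poly K}, forall i, I p`_i & z = p.[x].
  exact: H.
elim: g z hg => [|y g IH] z hg /=.
  by move=> ->; exists 0; rewrite ?horner0 // => i; rewrite coef0.
move=> [a [b [/adjoin [p hp ->] gb ->]]].
have [|q hq ->] := IH b _ gb; first by move=> w wg; apply: hg; rewrite inE wg orbT.
exists (y *: p + q); last by rewrite hornerD hornerZ mulrC.
move=> i; rewrite coefD coefZ mulrC; apply: ID => //; apply: IM => //.
exists [:: y]; first by move=> w; rewrite inE => /eqP ->; apply: hg; rewrite inE eqxx.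
exists 1, 0; split=> //; [exact: (subalg1 sW)|by rewrite mul1r addr0].
Qed.

(** If W could be enlarged by the inverse of 1 - b, a relation 1 = p(1 / (1 - b)) over I, multiplied
    by a power of 1 - b, would put that power into I; as b lies in I, the exponent descends to 0 and
    1 lies in I. *)
Let unit_1B b : I b -> 1 - b != 0 /\ W (1 - b)^-1.
Proof.
move=> Ib; have b0 : 1 - b != 0.
  by rewrite subr_eq0; apply/eqP => e; apply: I1; rewrite e.
split=> //; apply: contrapT => /relation [p hp e].
have Wb : W (1 - b) by apply: (subalgB sW); [exact: (subalg1 sW)|exact: IW].
have pw n j : (j <= n)%N -> (1 - b) ^+ n * (1 - b)^-1 ^+ j = (1 - b) ^+ (n - j).
  by move=> le_jn; rewrite -{1}(subnK le_jn) exprD -mulrA -exprMn mulfV // expr1n mulr1.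
have : I ((1 - b) ^+ size p).
  have -> : (1 - b) ^+ size p = (1 - b) ^+ size p * p.[(1 - b)^-1] by rewrite -e mulr1.
  rewrite horner_coef big_distrr /=.
  elim/big_rec: _ => [|i x _ IH]; first exact: I0'.
  apply: ID => //; rewrite mulrCA mulrC; apply: IM => //.
  by rewrite pw ?(ltnW (ltn_ord i)) //; apply: (subalgX sW).
elim: (size p) => [|n IH]; first by rewrite expr0; apply: I1.
move=> h; apply: IH; have -> : (1 - b) ^+ n = (1 - b) ^+ n.+1 + (1 - b) ^+ n * b by rewrite exprSr; ring.
by apply: ID => //; apply: IM => //; apply: (subalgX sW).
Qed.

(** If neither x nor 1 / x lies in W, there are relations 1 = p(x) = q(1 / x) with coefficients in
    I. The shorter one lowers the degree of the longer one, because 1 - q(0) is a unit, and this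
    descends to a contradiction. *)
Lemma max_avoiding_val_ring : val_ring W.
Proof.
split=> // x x0; apply: contrapT => /not_orP [nx nx'].
suff H n : forall y, y != 0 -> forall p q : {poly K}, (size p + size q <= n)%N ->
    (forall i, I p`_i) -> (forall i, I q`_i) -> 1 = p.[y] -> 1 = q.[y^-1] -> False.
  have [p hp ep] := relation nx; have [q hq eq] := relation nx'.
  exact: (H _ x x0 p q (leqnn _)).
elim: n => [|n IH] y y0 p q.
  rewrite leqn0 addn_eq0 size_poly_eq0 => /andP[/eqP -> _] _ _.
  by rewrite horner0 => /eqP; rewrite oner_eq0.
wlog le_qp : y y0 p q / (size q <= size p)%N.
  move=> wl spq hp hq ep eq; have [le_qp|/ltnW le_pq] := leqP (size q) (size p).
    exact: (wl y y0 p q).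
  apply: (wl y^-1 _ q p) => //; first by rewrite invr_eq0.
    by rewrite addnC.
  by rewrite invrK.
move=> spq hp hq ep eq.
have [sp|sp] := leqP (size p) 1.
  by apply: I1; rewrite ep (size1_polyC sp) hornerC.
have [b0 Wb] := unit_1B (hq 0%N).
case Ep : (size p) sp => [|[|d]] // _.
(* The second relation times y^(d + 1): the top power of y is expressed through lower ones and can
   be eliminated from p. *)
have ey : \sum_(j < d.+1) q`_(d.+1 - j) * y ^+ j = (1 - q`_0) * y ^+ d.+1.
  have : y ^+ d.+1 * 1 = y ^+ d.+1 * q.[y^-1] by rewrite -eq.
  rewrite (horner_coef_wide _ (n := d.+2)) -?Ep // Ep big_ord_recl /= expr0 !mulr1 mulrDr.
  rewrite mulrBl mul1r [_ * q`_0]mulrC => {1}->; rewrite addrAC subrr add0r.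
  rewrite (reindex_inj rev_ord_inj) big_distrr /=; apply: eq_bigr => i _.
  have le_id : (i <= d)%N by rewrite -ltnS.
  rewrite /bump /= add1n subSS subSn ?leq_subr // subKn // exprVn.
  have -> : y ^+ d.+1 = y ^+ (d - i) * y ^+ i.+1 by rewrite -exprD addnS subnK.
  by field; apply: expf_neq0.
pose l := p`_d.+1; pose c := (1 - q`_0)^-1.
have Wl : W (l * c) by apply: (subalgM sW); [exact/IW/hp|exact: Wb].
apply: (IH y y0 (\poly_(j < d.+1) (p`_j + l * c * q`_(d.+1 - j))) q) => //.
- move: spq; rewrite Ep => spq; have := size_poly d.+1 (fun j => p`_j + l * c * q`_(d.+1 - j)).
  by move: spq; set a := size q; set b := size _; lia.
- move=> i; rewrite coef_poly; case: ifP => _; last exact: I0'.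
  by apply: ID => //; apply: IM.
rewrite ep horner_poly horner_coef Ep big_ord_recr /= -/l.
under [RHS]eq_bigr => j _ do rewrite mulrDl -mulrA.
rewrite big_split /= -big_distrr /= ey; congr (_ + _).
by rewrite /c; field.
Qed.

End Maximal.
End ValuationRings.

(** * Dominating valuation rings with a transcendental residue *)

Section TranscendentalResidue.
Context (k : closedFieldType) (K : fieldType) (iota : {rmorphism k -> K}).
Context (O : set K) (zs : seq K) (u v : K) (hO : regular_point iota O u v zs).
Context (y : K) (ny : ~ O y) (ny' : ~ O y^-1).
Local Notation m := (max_ideal O).
Let sO : subalg iota O := rp_sub hO.

Let mB a b : m a -> m b -> m (a - b).
Proof.
move=> ma mb; apply: (rp_maxD hO) => //; rewrite -mulN1r mulrC.
by apply: (max_idealM sO) => //; apply/(subalgN sO)/(subalg1 sO).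
Qed.

Let m0 : m 0.
Proof. by rewrite -(mulr0 u); apply: (max_idealM sO (rp_u hO)); exact: (subalg0 sO). Qed.

Let y0 : y != 0.
Proof. by apply/eqP => e; apply: ny; rewrite e; exact: (subalg0 sO). Qed.

(* O is integrally closed, so a relation Q(y) = 0 over O with a unit coefficient
   would put y or its inverse in O. *)
Lemma relation_coef_max (Q : {poly K}) : (forall i, O Q`_i) -> Q.[y] = 0 -> forall i, m Q`_i.
Proof.
have [n] := ubnP (size Q); elim: n Q => // n IH Q sQ OQ Qy.
have [sQ1|] := leqP (size Q) 1.
  move: Qy; rewrite (size1_polyC sQ1) hornerC => -> i.
  by rewrite polyC0 coef0.
case En : (size Q) => [|[|d]] // _.
pose c := Q`_d.+1.
have eQ : c * y ^+ d.+1 = - \sum_(i < d.+1) Q`_i * y ^+ i.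
  by apply/eqP; rewrite -addr_eq0 addrC; move: Qy; rewrite horner_coef En big_ord_recr /= => ->.
have Ocy : O (c * y).
  apply: contrapT => nO; have [w [[hw Ow _] wcy]] := divisorial_criterion hO nO.
  have cy0 : c * y != 0 by apply/eqP => e; apply: nO; rewrite e; exact: (subalg0 sO).
  suff : vge w 0 (c * y) by rewrite vgeP // leNgt wcy.
  have [hy|hy] := leP 0 (w y).
    by apply: (vgeM0 hw); [exact/Ow/OQ|right].
  have hy' : vge w 0 y^-1 by right; rewrite (val_V hw) // oppr_ge0 ltW.
  have -> : c * y = - \sum_(i < d.+1) Q`_i * y^-1 ^+ (d - i).
    apply: (mulIf (expf_neq0 d y0)); rewrite -mulrA -exprS eQ mulNr mulr_suml.
    congr (- _); apply: eq_bigr => i _; rewrite -mulrA; congr (_ * _).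
    have le_id : (i <= d)%N by rewrite -ltnS.
    have -> : y ^+ d = y ^+ i * y ^+ (d - i) by rewrite -exprD subnKC.
    by rewrite mulrCA -exprMn mulVf // expr1n mulr1.
  apply/(vgeN hw)/(vge_sum hw) => i _; apply: (vgeM0 hw); first exact/Ow/OQ.
  exact: (vgeX hw).
have mc : m c.
  apply: contrapT => /(max_ideal_unit (OQ _)) [c0 Oc']; apply: ny.
  by rewrite -(mulKf c0 y); apply: (subalgM sO).
have mcy : m (c * y).
  apply: contrapT => /(max_ideal_unit Ocy) [cy0 Ocy']; apply: ny'.
  have c0 : c != 0 by apply: contra_neq cy0 => ->; rewrite mul0r.
  have -> : y^-1 = c * (c * y)^-1 by field; rewrite y0 c0.
  by apply: (subalgM sO) => //; exact: OQ.
(* The leading term is absorbed as (c y) y^d into the next coefficient, which stays in O, so the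
   degree drops. *)
pose Q2 := \poly_(i < d.+1) (Q`_i + if i == d then c * y else 0).
have hQ2 : forall i, m Q2`_i.
  apply: IH.
  - by rewrite (leq_ltn_trans (size_poly _ _)) // -ltnS -En.
  - move=> i; rewrite coef_poly; case: ifP => _; last exact: (subalg0 sO).
    by apply: (subalgD sO) => //; case: ifP => _ //; exact: (subalg0 sO).
  rewrite horner_poly; under eq_bigr => i _ do rewrite mulrDl.
  rewrite big_split /= [X in _ + X]big_ord_recr /= eqxx -mulrA -exprS eQ.
  rewrite [X in _ + (X + _)]big1 ?add0r ?subrr // => i _.
  by rewrite ltn_eqF // mul0r.
move=> i; have [lt_i|lt_i|->] := ltngtP i d.+1; last exact: mc.
  have := hQ2 i; rewrite coef_poly lt_i.
  by case: eqP => _ h; [rewrite -(addrK (c * y) Q`_i); exact: mB|rewrite addr0 in h].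
by rewrite nth_default // En.
Qed.

(** Chevalley's construction starts from O with y and the inverses of all nonzero polynomials in y
    adjoined. The maximal ideal does not become the unit ideal there: 1 = Q(y) / p(y) with Q over m
    is a relation p - Q, whose coefficients lie in m, and so p would vanish. *)
Lemma transcendental_residue : exists W, [/\ val_ring iota W, O `<=` W,
  forall z, m z -> z != 0 -> ~ W z^-1 &
  forall p, p != 0 -> [/\ ev1 iota y p != 0, W (ev1 iota y p) & W (ev1 iota y p)^-1]].
Proof.
have p0 p : p != 0 -> ev1 iota y p != 0.
  apply: contra_neq => e; apply/polyP => i; rewrite coef0.
  have := @relation_coef_max (map_poly iota p) _ e i.
  rewrite coef_map => h; have {h} : m (iota p`_i).
    by apply: h => j; rewrite coef_map; apply: (subalgC sO).
  case=> _ h; apply/eqP; apply: contraT => c0; case: (h (iota (p`_i)^-1)).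
    exact: (subalgC sO).
  by rewrite -rmorphM mulfV // rmorph1.
pose B0 : set K := [set z | [\/ O z, z = y | exists2 p, p != 0 & z = (ev1 iota y p)^-1]].
have form z : kalg iota (B0 `|` set0) z -> exists (Q : {poly K}) p,
    [/\ forall i, O Q`_i, p != 0 & z = Q.[y] / ev1 iota y p].
  have const c : O c -> exists (Q : {poly K}) p, [/\ forall i, O Q`_i, p != 0 & c = Q.[y] / ev1 iota y p].
    move=> Oc; exists c%:P, 1; rewrite oner_neq0 ev11 divr1 hornerC; split=> // i.
    by rewrite coefC; case: ifP => _ //; exact: (subalg0 sO).
  have OCp p i : O (map_poly iota p)`_i by rewrite coef_map; apply: (subalgC sO).
  have OMp (P Q : {poly K}) : (forall i, O P`_i) -> (forall i, O Q`_i) -> forall i, O (P * Q)`_i.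
    by move=> hP hQ i; rewrite coefM; apply: (subalg_sum sO) => j _; apply: (subalgM sO).
  elim=> [c|w [[Ow|->|[p pn0 ->]]|//]|a b _ [P [p [hP pn0 ->]]] _ [Q [q [hQ qn0 ->]]]|
          a b _ [P [p [hP pn0 ->]]] _ [Q [q [hQ qn0 ->]]]].
  - by apply: const; apply: (subalgC sO).
  - exact: const.
  - exists 'X, 1; rewrite oner_neq0 ev11 divr1 hornerX; split=> // i.
    by rewrite coefX; case: eqP => _; [exact: (subalg1 sO)|exact: (subalg0 sO)].
  - exists 1, p; rewrite -polyC1 hornerC mul1r; split=> // i.
    by rewrite coefC; case: ifP => _; [exact: (subalg1 sO)|exact: (subalg0 sO)].
  - exists (P * map_poly iota q + Q * map_poly iota p), (p * q); rewrite mulf_neq0 //; split=> //.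
      by move=> i; rewrite coefD; apply: (subalgD sO); apply: OMp.
    rewrite ev1M hornerD !hornerM -!(ev1E iota); field.
    by rewrite !p0.
  exists (P * Q), (p * q); rewrite mulf_neq0 //; split=> //; first exact: OMp.
  by rewrite ev1M hornerM; field; rewrite !p0.
have [|W [sW B0W nbad maxW]] := @max_avoiding_ring k K iota B0 m.
  move=> [g [hg gg]].
  have [Q [p [hQ pn0 e]]] : exists (Q : {poly K}) p, [/\ forall i, m Q`_i, p != 0 & 1 = Q.[y] / ev1 iota y p].
    elim: g 1 hg gg => [|x g IH] z hg /=.
      by move=> ->; exists 0, 1; rewrite oner_neq0 horner0 mul0r; split=> // i; rewrite coef0.
    move=> [a [b [/form [P [p [hP pn0 ->]]] gb ->]]].
    have [|Q [q [hQ qn0 ->]]] := IH b _ gb; first by move=> w wg; apply: hg; rewrite inE wg orbT.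
    have mx : m x by apply: hg; rewrite inE eqxx.
    have OCp r i : O (map_poly iota r)`_i by rewrite coef_map; apply: (subalgC sO).
    exists ((x *: P) * map_poly iota q + Q * map_poly iota p), (p * q).
    rewrite mulf_neq0 //; split=> //.
      move=> i; rewrite coefD; apply: (rp_maxD hO); rewrite coefM.
        elim/big_rec: _ => [|j w _ IHw]; first exact: m0.
        apply: (rp_maxD hO) => //; rewrite coefZ -mulrA; apply: (max_idealM sO) => //.
        exact: (subalgM sO).
      elim/big_rec: _ => [|j w _ IHw]; first exact: m0.
      by apply: (rp_maxD hO) => //; apply: (max_idealM sO).
    rewrite ev1M hornerD !hornerM hornerZ -!(ev1E iota); field.
    by rewrite !p0.
  have eQ : Q.[y] = ev1 iota y p by rewrite -[RHS]mul1r e divfK // p0.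
  have h i : m (map_poly iota p - Q)`_i.
    apply: relation_coef_max.
      move=> j; rewrite coefB coef_map; apply: (subalgB sO); first exact: (subalgC sO).
      by case: (hQ j).
    by rewrite hornerD hornerN eQ -ev1E subrr.
  move/eqP: pn0; apply; apply/polyP => i; rewrite coef0.
  have {h} : m (iota p`_i).
    have -> : iota p`_i = (map_poly iota p - Q)`_i + Q`_i by rewrite coefB coef_map subrK.
    exact: (rp_maxD hO).
  case=> _ h; apply/eqP; apply: contraT => c0; case: (h (iota (p`_i)^-1)).
    exact: (subalgC sO).
  by rewrite -rmorphM mulfV // rmorph1.
have OW : O `<=` W by move=> z Oz; apply: B0W; constructor 1.
have mW : m `<=` W by move=> z [Oz _]; apply: OW.
exists W; split=> //.
- exact: max_avoiding_val_ring sW mW nbad maxW.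
- move=> z mz z0 Wz; apply: nbad; exists [:: z]; split.
    by move=> w; rewrite inE => /eqP ->.
  by exists z^-1, 0; rewrite mulVf // addr0.
move=> p pn0; split; first exact: p0.
  by apply: (subalg_ev1 sW); apply: B0W; constructor 2.
by apply: B0W; constructor 3; exists p.
Qed.

End TranscendentalResidue.

(** * Multiplicities under blowing up *)

Section Blowup.
Context (k : closedFieldType) (K : fieldType) (iota : {rmorphism k -> K}).
Local Notation ev1 := (ev1 iota).
Local Notation ev := (ev iota).

Lemma ev_comp x y (P q : {poly {poly k}}) : ev x y (P \Po q) = ev x (ev x y q) P.
Proof.
elim/poly_ind: P => [|P c IH]; first by rewrite comp_poly0 !ev0.
by rewrite comp_poly_MXaddC !evD !evM IH !evC evX.
Qed.

Lemma ev1_split0 x p : ev1 x p = iota p`_0 + x * ev1 x (drop_poly 1 p).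
Proof.
rewrite -{1}(poly_take_drop 1 p) ev1D ev1M ev1Xn ev1X expr1 mulrC; congr (_ + _).
rewrite -(ev1C iota x); congr ev1.
by apply/polyP => i; rewrite coef_take_poly coefC; case: i.
Qed.

Lemma drop_shift (p : {poly k}) n : (forall i, (i < n)%N -> p`_i = 0) -> p = drop_poly n p * 'X^n.
Proof.
move=> h; rewrite -{1}(poly_take_drop n p) -[RHS]add0r; congr (_ + _).
by apply/polyP => i; rewrite coef_take_poly coef0; case: ifP => // /h.
Qed.

Context (J : K -> K -> K) (hJ : biderivation iota J).
Context (w : K -> int) (hw : valuation iota w) (c0 : int).
Hypothesis hc0 : forall f g, vge w 0 f -> vge w 0 g -> vge w c0 (J f g).

(* At a point of multiplicity m the blow-up lowers the discrepancy
   w (J x y) - c0 by w x and the value of P by at most m * w x. *)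
Lemma multiplicity_bound x y (P : {poly {poly k}}) i j m :
  x != 0 -> y != 0 -> 0 < w x -> 0 < w y -> J x y != 0 -> P`_j`_i != 0 -> (i + j <= m)%N ->
  ev x y P != 0 /\ w (ev x y P) <= (w (J x y) - c0) *+ m.
Proof.
have [n] := ubnP `|(w (J x y) - c0)|%N.
elim: n x y P i j m => // n IH x y P i j m lt_n x0 y0 wx wy J0 Pij le_m.
(* The roles of x and y are symmetric, J only changes its sign, and y / x may be assumed to have
   nonnegative value. *)
wlog le_xy : x y P i j lt_n x0 y0 wx wy J0 Pij le_m / w x <= w y.
  move=> wl; have [le_xy|/ltW le_yx] := leP (w x) (w y); first exact: (wl x y P i j).
  have eJ : J y x = - J x y := bider_anti x y hJ.
  have := wl y x (swapXY P) j i; rewrite ev_swap eJ oppr_eq0 (val_N hw) coef_swapXY addnC.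
  exact.
have vx : vge w 0 x by right; apply: ltW.
have vy : vge w 0 y by right; apply: ltW.
have D2 := bider_r hJ x.
have exmu : exists mu, [exists j' : 'I_(size P), exists i' : 'I_(size P`_j'), (P`_j'`_i' != 0) && (i' + j' == mu)%N].
  exists (i + j)%N.
  have lt_j : (j < size P)%N.
    by rewrite ltnNge; apply/negP => /(nth_default 0) e; rewrite e coef0 eqxx in Pij.
  apply/existsP; exists (Ordinal lt_j) => /=.
  have lt_i : (i < size (P`_j)%R)%N.
    by rewrite ltnNge; apply/negP => /(nth_default 0) e; rewrite e eqxx in Pij.
  by apply/existsP; exists (Ordinal lt_i); rewrite /= Pij eqxx.
case: (ex_minnP exmu) => mu /existsP [[j0 lt_j0] /existsP [[i0 lt_i0] /= /andP[Pij0 /eqP emu]]] minmu.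
have low i' j' : (i' + j' < mu)%N -> P`_j'`_i' = 0.
  move=> lt_mu; apply/eqP; apply: contraT => P0; move: lt_mu; rewrite ltnNge minmu //.
  have lt_j : (j' < size P)%N.
    by rewrite ltnNge; apply/negP => /(nth_default 0) e; rewrite e coef0 eqxx in P0.
  apply/existsP; exists (Ordinal lt_j) => /=.
  have lt_i : (i' < size (P`_j')%R)%N.
    by rewrite ltnNge; apply/negP => /(nth_default 0) e; rewrite e eqxx in P0.
  by apply/existsP; exists (Ordinal lt_i); rewrite /= P0 eqxx.
have le_mu : (mu <= m)%N.
  apply: leq_trans le_m; rewrite leqNgt; apply/negP => /low e.
  by rewrite e eqxx in Pij.
(* B j' is the coefficient of r^j' in P(x, x r) / x^mu. *)
pose B j' : {poly k} := if (j' <= mu)%N then drop_poly (mu - j') P`_j' else P`_j' * 'X^(j' - mu).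
have eB j' : 'X^j' * P`_j' = 'X^mu * B j'.
  rewrite /B; case: leqP => [le_j|lt_j].
    rewrite {1}(@drop_shift P`_j' (mu - j')); last by move=> i' lt_i; apply: low; rewrite addnC -ltn_subRL.
    by rewrite mulrCA -exprD mulrC subnKC.
  by rewrite mulrCA -exprD subnKC ?(ltnW lt_j) // mulrC.
pose PB := \poly_(j' < size P) B j'.
set r := y / x.
have ey : y = x * r by rewrite /r mulrC divfK.
have eP : ev x y P = x ^+ mu * ev x r PB.
  rewrite ev_sum (ev_sum _ _ _ PB) big_distrr /=.
  rewrite (big_ord_widen _ (fun l => x ^+ mu * (ev1 x PB`_l * r ^+ l)) (size_poly _ _)).
  rewrite [RHS]big_mkcond; apply: eq_bigr => l _.
  have eb : ev1 x P`_l * y ^+ l = x ^+ mu * (ev1 x (B l) * r ^+ l).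
    rewrite ey exprMn; have := congr1 (ev1 x) (eB l).
    rewrite !ev1M !ev1Xn ev1X => e; rewrite !mulrA -e; ring.
  rewrite eb coef_poly ltn_ord; case: ltnP => // /leq_sizeP h.
  by have := h l (leqnn _); rewrite coef_poly ltn_ord => ->; rewrite ev10 mul0r mulr0.
(* The restriction of the strict transform to the exceptional curve x = 0: the initial form of P,
   nonzero and of degree at most mu. *)
pose W := map_poly (horner_eval 0) PB.
have cW l : W`_l = if (l < size P)%N then (if (l <= mu)%N then P`_l`_(mu - l) else 0) else 0.
  rewrite coef_map coef_poly; case: ifP => _; last by rewrite /= /horner_eval horner0.
  rewrite /= /horner_eval horner_coef0 /B; have [_|lt_l] := leqP l mu.
    by rewrite coef_drop_poly add0n.
  by rewrite coefMXn subn_gt0 lt_l.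
have W0 : W != 0.
  apply/eqP => /polyP /(_ j0); rewrite coef0 cW lt_j0 -emu leq_addl addnK => e.
  by rewrite e eqxx in Pij0.
have sW : (size W <= mu.+1)%N.
  by apply/leq_sizeP => l lt_l; rewrite cW (leqNgt l mu) lt_l; case: ifP.
have wr : vge w 0 r.
  by right; rewrite (val_M hw) ?invr_eq0 // (val_V hw) // subr_ge0.
have eJ : J x r = J x y / x.
  by rewrite /r (derf D2) // (bider_alt hJ) mulr0 subr0; field.
have Jxr : vge w c0 (J x r) by apply: hc0.
have Jxr0 : J x r != 0 by rewrite eJ mulf_neq0 ?invr_eq0.
have wJ : w (J x r) = w (J x y) - w x by rewrite eJ (val_M hw) ?invr_eq0 // (val_V hw).
have wJ' : c0 <= w (J x y) - w x by rewrite -wJ; case: Jxr => // e; rewrite e eqxx in Jxr0.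
have finish e : e != 0 -> w e <= (w (J x y) - w x - c0) *+ mu ->
    x ^+ mu * e != 0 /\ w (x ^+ mu * e) <= (w (J x y) - c0) *+ m.
  move=> e0 he; rewrite mulf_neq0 ?expf_neq0 //; split=> //.
  rewrite (val_M hw) ?expf_neq0 // (val_X hw) //.
  apply: (@le_trans _ _ ((w (J x y) - c0) *+ mu)).
    have -> : w (J x y) - c0 = w x + (w (J x y) - w x - c0) by ring.
    by rewrite mulrnDl lerD2l.
  apply: ler_wpMn2l => //; rewrite subr_ge0.
  by apply: le_trans wJ' _; rewrite gerBl ltW.
rewrite eP.
(* If the residue of r is transcendental, W(r) is a unit and x^mu accounts for the whole value of P.
   Otherwise r has a residue c and the argument continues at this point of the exceptional curve,
   with a smaller discrepancy. *)
have [[c hc]|nc] := EM (exists c, r - iota c = 0 \/ 0 < w (r - iota c)); last first.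
  have hr c : ~ (r - iota c = 0 \/ 0 < w (r - iota c)) by move=> h; apply: nc; exists c.
  have [wW eW0] := val_residue_transc hw hr wr W0.
  have eE : ev x r PB = ev1 r W + x * \sum_(l < size P) ev1 x (drop_poly 1 (B l)) * r ^+ l.
    rewrite ev_sum (big_ord_widen _ (fun l => ev1 x PB`_l * r ^+ l) (size_poly _ _)).
    have -> : ev1 r W = \sum_(l < size P) iota W`_l * r ^+ l.
      rewrite ev1E (horner_coef_wide r (n := size P)).
        by apply: eq_bigr => l _; rewrite coef_map.
      by rewrite (leq_trans (size_poly _ _)) // (leq_trans (size_poly _ _)) // size_poly.
    rewrite big_distrr -big_split big_mkcond /=; apply: eq_bigr => l _.
    have -> : iota W`_l * r ^+ l + x * (ev1 x (drop_poly 1 (B l)) * r ^+ l) = ev1 x (B l) * r ^+ l.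
      rewrite (ev1_split0 x (B l)) coef_map coef_poly ltn_ord /= /horner_eval horner_coef0.
      ring.
    rewrite coef_poly ltn_ord; case: ltnP => // /leq_sizeP h.
    by have := h l (leqnn _); rewrite coef_poly ltn_ord => ->; rewrite ev10 mul0r.
  have [||wE E0] := @val_addr_eq k K iota w hw (ev1 r W)
     (x * \sum_(l < size P) ev1 x (drop_poly 1 (B l)) * r ^+ l) => //.
    rewrite wW add0r -[1]addr0; apply: (vgeM hw); first by right; rewrite -gtz0_ge1.
    apply: (vge_sum hw) => l _; apply: (vgeM0 hw); last exact: (vgeX hw).
    exact: (subalg_ev1 (subalg_vge hw)).
  rewrite -eE in wE E0; apply: finish => //; rewrite wE wW mulrn_wge0 //.
  by rewrite subr_ge0.
set y1 := r - iota c in hc.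
have y10 : y1 != 0.
  apply/eqP => e; move/eqP: Jxr0; apply.
  have -> : r = iota c by apply/eqP; rewrite -subr_eq0 -/y1 e.
  exact: (derC D2).
have wy1 : 0 < w y1 by case: hc => // e; rewrite e eqxx in y10.
have eJ1 : J x y1 = J x r by rewrite /y1 (derB D2) (derC D2) subr0.
pose q : {poly {poly k}} := 'X + c%:P%:P.
have eq1 : ev x y1 q = r by rewrite evD evX evC ev1C subrK.
have eP1 : ev x r PB = ev x y1 (PB \Po q) by rewrite ev_comp eq1.
pose W1 := map_poly (horner_eval 0) (PB \Po q).
have eW1 : W1 = W \Po ('X + c%:P).
  rewrite /W1 map_comp_poly rmorphD /= map_polyX map_polyC /= /horner_eval hornerC.
  by [].
have sW1 : size W1 = size W by rewrite eW1 size_comp_poly2 // size_XaddC.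
have W10 : W1 != 0 by rewrite -size_poly_gt0 sW1 size_poly_gt0.
(* The restriction to the exceptional curve has degree at most mu, which bounds the multiplicity at
   the new point by mu. *)
pose j1 := (size W1).-1.
have P1j : (PB \Po q)`_j1`_0 != 0.
  have : W1`_j1 != 0 by rewrite -lead_coefE lead_coef_eq0.
  by rewrite coef_map /= /horner_eval horner_coef0.
have w1 : w (J x y1) = w (J x y) - w x by rewrite eJ1.
have lt_n1 : (`|(w (J x y1) - c0)| < n)%N.
  rewrite w1; move: lt_n wJ' wx; move: (w (J x y)) (w x) => a b; clear; lia.
have J10 : J x y1 != 0 by rewrite eJ1.
have le_j1 : (0 + j1 <= mu)%N by rewrite /j1 sW1 add0n -ltnS (leq_trans _ sW) // ltn_predL size_poly_gt0.
have [e0 he] := IH x y1 _ 0%N j1 mu lt_n1 x0 y10 wx wy1 J10 P1j le_j1.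
by rewrite eP1; apply: finish => //; rewrite -w1.
Qed.

End Blowup.

(** * Derivations and Jacobians *)

Section PureDerivations.
Context (k : closedFieldType) (K : fieldType) (iota : {rmorphism k -> K}).
Local Notation ev1 := (ev1 iota).
Local Notation ev := (ev iota).
Context (t y : K) (hty : purely_transcendental iota t y).

Lemma pure_indep : indep iota t y.
Proof. by have [/alg_independentE/indep_sym] := hty. Qed.

Lemma pure_frac z : exists PQ : {poly {poly k}} * {poly {poly k}},
  ev t y PQ.2 != 0 /\ z = ev t y PQ.1 / ev t y PQ.2.
Proof.
have : kfield iota [set t; y] z by have [_ ->] := hty.
by move=> [a [b [/kalg2E[P eP] /kalg2E[Q eQ] b0 ez]]]; exists (P, Q); rewrite ez /= -eP -eQ.
Qed.

Lemma map_derivM (P Q : {poly {poly k}}) :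
  map_poly (@deriv k) (P * Q) = map_poly (@deriv k) P * Q + P * map_poly (@deriv k) Q.
Proof.
apply/polyP => i; rewrite coefD !coef_map !coefM /= raddf_sum -big_split /=.
by apply: eq_bigr => j _; rewrite derivM !coef_map.
Qed.

Section Prescribed.
Let gen_add (p q p' q' p1 q1 p1' q1' : K) : q != 0 -> q' != 0 ->
  ((p1 * q' + p * q1' + (p1' * q + p' * q1)) * (q * q') -
   (p * q' + p' * q) * (q1 * q' + q * q1')) / (q * q') ^+ 2 =
  (p1 * q - p * q1) / q ^+ 2 + (p1' * q' - p' * q1') / q' ^+ 2.
Proof. by move=> q0 q0'; field; rewrite q0 q0'. Qed.

Let gen_mul (p q p' q' p1 q1 p1' q1' : K) : q != 0 -> q' != 0 ->
  ((p1 * p' + p * p1') * (q * q') - p * p' * (q1 * q' + q * q1')) / (q * q') ^+ 2 =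
  (p1 * q - p * q1) / q ^+ 2 * (p' / q') + p / q * ((p1' * q' - p' * q1') / q' ^+ 2).
Proof. by move=> q0 q0'; field; rewrite q0 q0'. Qed.

Context (a b : K).

Let dd (P : {poly {poly k}}) := ev t y (map_poly (@deriv k) P) * a + ev t y P^`() * b.

Let ddD P Q : dd (P + Q) = dd P + dd Q.
Proof. by rewrite /dd raddfD derivD !evD; ring. Qed.

Let ddM P Q : dd (P * Q) = dd P * ev t y Q + ev t y P * dd Q.
Proof. by rewrite /dd map_derivM derivM !(evD, evM); ring. Qed.

Let dq (P Q : {poly {poly k}}) := (dd P * ev t y Q - ev t y P * dd Q) / ev t y Q ^+ 2.

Let dq_wd P Q P' Q' : ev t y Q != 0 -> ev t y Q' != 0 ->
  ev t y P / ev t y Q = ev t y P' / ev t y Q' -> dq P Q = dq P' Q'.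
Proof.
move=> q0 q0' /eqP; rewrite eqr_div // -!evM => /eqP /(indep_inj pure_indep) e.
have := congr1 dd e; rewrite !ddM; have := congr1 (ev t y) e; rewrite !evM => e1 e2.
apply/eqP; rewrite /dq eqr_div ?expf_neq0 //; apply/eqP.
move: e1 e2 q0 q0'; move: (dd P) (dd Q) (dd P') (dd Q') (ev t y P) (ev t y Q) (ev t y P') (ev t y Q').
move=> p1 q1 p1' q1' p q p' q' e1 e2 q0 q0'.
transitivity (q * q' * (p1 * q' + p * q1') - p * q' * q1 * q' - q * (p * q') * q1'); first ring.
rewrite e2 e1; ring.
Qed.

(** The quotient rule applied to a chosen fraction; [dq_wd] makes the result independent of the
    choice. *)
Lemma pure_derivation : exists D, [/\ kderivation iota D, D t = a & D y = b].
Proof.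
have /choice [f hf] := pure_frac.
pose D z := dq (f z).1 (f z).2.
have hD z P Q : ev t y Q != 0 -> z = ev t y P / ev t y Q -> D z = dq P Q.
  by move=> q0 e; have [q1 e1] := hf z; apply: dq_wd => //; rewrite -e1.
have Dev P : D (ev t y P) = dd P.
  have d1 : dd 1 = 0.
    have := ddM 1 1; rewrite mulr1 evo mulr1 mul1r => /eqP.
    by rewrite -subr_eq0 opprD addNKr oppr_eq0 => /eqP.
  have q1 : ev t y 1 != 0 by rewrite evo oner_neq0.
  rewrite (hD _ P 1 q1); last by rewrite evo divr1.
  by rewrite /dq d1 evo expr1n divr1 mulr1 mulr0 subr0.
exists D; split.
- split.
  + move=> z w; have [q1 e1] := hf z; have [q2 e2] := hf w.
    rewrite (hD (z + w) ((f z).1 * (f w).2 + (f w).1 * (f z).2) ((f z).2 * (f w).2)).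
    * rewrite /D /dq ddD !ddM evD !evM gen_add //.
    * by rewrite evM mulf_neq0.
    * by rewrite [LHS](congr2 +%R e1 e2) evD !evM addf_div.
  + move=> z w; have [q1 e1] := hf z; have [q2 e2] := hf w.
    rewrite (hD (z * w) ((f z).1 * (f w).1) ((f z).2 * (f w).2)).
    * rewrite [X in _ = _ * X + _]e2 [X in _ = _ + X * _]e1 /D /dq !ddM !evM gen_mul //.
    * by rewrite evM mulf_neq0.
    * by rewrite [LHS](congr2 *%R e1 e2) !evM mulf_div.
  + move=> c; have := Dev c%:P%:P; rewrite evC ev1C => ->.
    by rewrite /dd map_polyC /= derivC polyC0 derivC !ev0; ring.
- have := Dev 'X%:P; rewrite evC ev1X => ->.
  by rewrite /dd map_polyC /= derivX derivC ev0 polyC1 evo; ring.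
have := Dev 'X; rewrite evX /dd => ->.
have -> : map_poly (@deriv k) 'X = 0.
  by apply/polyP => i; rewrite coef_map coefX coef0 /=; case: (i == 1%N); rewrite ?derivC // -polyC1 derivC.
by rewrite derivX ev0 evo; ring.
Qed.
End Prescribed.

Lemma der_ext D E : kderivation iota D -> kderivation iota E -> D t = E t -> D y = E y -> D =1 E.
Proof.
move=> hD hE et ey.
have hsub (M : {poly {poly k}}) : D (ev t y M) = E (ev t y M).
  have hk z : kalg iota [set t; y] z -> D z = E z.
    elim=> {z} [c|z|z w _ ez _ ew|z w _ ez _ ew].
    - by rewrite (derC hD) (derC hE).
    - by case=> ->.
    - by rewrite (derD hD) (derD hE) ez ew.
    - by rewrite (derM hD) (derM hE) ez ew.
  by apply: hk; apply/kalg2E; exists M.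
move=> z; have [[P Q] /= [q0 ->]] := pure_frac z.
by rewrite (derf hD) // (derf hE) // !hsub.
Qed.

Lemma pure_biderivation : exists J, biderivation iota J /\ J t y = 1.
Proof.
have [D1 [h1 t1 y1]] := pure_derivation 1 0.
have [D2 [h2 t2 y2]] := pure_derivation 0 1.
exists (fun f g => D1 f * D2 g - D2 f * D1 g); split; last by rewrite t1 y2 t2 y1; ring.
split.
- move=> g; split=> [z w|z w|c].
  + by rewrite (derD h1) (derD h2); ring.
  + by rewrite (derM h1) (derM h2); ring.
  + by rewrite (derC h1) (derC h2); ring.
- move=> f; split=> [z w|z w|c].
  + by rewrite (derD h1) (derD h2); ring.
  + by rewrite (derM h1) (derM h2); ring.
  + by rewrite (derC h1) (derC h2); ring.
- by move=> f; rewrite mulrC subrr.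
exists t, y; rewrite t1 y2 t2 y1 mulr0 subr0 mulr1; exact: oner_neq0.
Qed.

(** For J t y != 0 both sides are derivations in f, up to a factor, that agree at t and y; for J t y
    = 0 both partial derivatives vanish identically. *)
Lemma der_partials J D f : biderivation iota J -> kderivation iota D ->
  J t y * D f = J f y * D t + J t f * D y.
Proof.
move=> hJ hD.
have [J0|J0] := eqVneq (J t y) 0.
  have z1 : J^~ y =1 fun=> 0.
    apply: der_ext; first exact: (bider_l hJ).
    - by split=> *; rewrite ?mulr0 ?mul0r ?addr0.
    - by [].
    - by rewrite (bider_alt hJ).
  have z2 : J t =1 fun=> 0.
    apply: der_ext; first exact: (bider_r hJ).
    - by split=> *; rewrite ?mulr0 ?mul0r ?addr0.
    - by rewrite (bider_alt hJ).
    - by [].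
  by have /= -> := z1 f; rewrite !z2 !mul0r addr0.
pose E f := J f y * (D t / J t y) + J t f * (D y / J t y).
have h1 := bider_l hJ y; have h2 := bider_r hJ t.
have hE : kderivation iota E.
  split=> [z w|z w|c]; rewrite /E.
  - by rewrite (derD h1) (derD h2) /=; ring.
  - by rewrite (derM h1) (derM h2) /=; ring.
  - by rewrite (derC h1) (derC h2) /=; ring.
have -> : D f = E f.
  apply: (der_ext hD hE); rewrite /E (bider_alt hJ) mul0r ?addr0 ?add0r mulrC divfK //.
by rewrite /E; field.
Qed.
End PureDerivations.

Section SurfacePoints.
Context (k : closedFieldType) (K : fieldType) (iota : {rmorphism k -> K}).

Lemma frac_full_gen (A S : set K) : subalg iota A ->
  (forall z, S z -> exists a b, [/\ A a, A b, b != 0 & z = a / b]) ->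
  kfield iota S = setT -> frac_full A.
Proof.
move=> sA hS full z.
pose F z := exists a b, [/\ A a, A b, b != 0 & z = a / b].
have FM z1 z2 : F z1 -> F z2 -> F (z1 * z2).
  move=> [a [b [Aa Ab b0 ->]]] [c [d [Ac Ad d0 ->]]]; exists (a * c), (b * d).
  by split; [exact: (subalgM sA)|exact: (subalgM sA)|exact: mulf_neq0|rewrite mulf_div].
have FC c : F (iota c) by exists (iota c), 1; split; rewrite ?divr1 ?oner_eq0 //; [exact: (subalgC sA)|exact: (subalg1 sA)].
have FA z1 : kalg iota S z1 -> F z1.
  elim=> {z1} // z1 z2 _ [a [b [Aa Ab b0 ->]]] _ [c [d [Ac Ad d0 ->]]].
    exists (a * d + c * b), (b * d); split; rewrite ?addf_div ?mulf_neq0 //; last exact: (subalgM sA).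
    by apply: (subalgD sA); apply: (subalgM sA).
  by apply: FM; [exists a, b|exists c, d].
have : kfield iota S z by rewrite full.
case=> a [b [/FA Fa /FA [c [d [Ac Ad d0 e]]] b0 ->]]; apply: FM => //.
have c0 : c != 0 by apply: contraNneq b0 => c0; rewrite e c0 mul0r.
by exists d, c; split=> //; rewrite e invf_div.
Qed.

Lemma regular_point_localization s t (zs : seq K) m : trbasis iota s t ->
  frac_full (kalg iota [set z | z \in zs]) ->
  maximal_ideal (kalg iota [set z | z \in zs]) m ->
  regular_local_ring_dim2 (localization (kalg iota [set z | z \in zs]) m) ->
  exists u v, regular_point iota (localization (kalg iota [set z | z \in zs]) m) u v zs.
Proof.
move=> htr hA hm [u [v [mu mv huv]]].
have sA := kalg_subalg iota [set z | z \in zs].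
exists u, v; split=> //.
- exact: (loc_subalg sA hm).
- exact: (frac_full_sub (loc_sub sA hm)).
- exact: (loc_noeth sA hm (@kalg_noeth _ _ iota zs)).
- exact: (loc_maxD sA hm).
- exact: (loc_res sA hm (kalg_max_residue htr hm hA)).
- by apply: (dimension_ge2 htr hm hA mu huv); case: mv.
- apply: (dimension_ge2 htr hm hA mv); last by case: mu.
  by move=> f /huv [a [b [Oa Ob ->]]]; exists b, a; rewrite addrC.
- move=> z [a [b [Aa Ab nb ->]]]; exists a, b; split=> //.
  by move=> mb; apply: nb; exact: (loc_max_mem hm Ab mb).
by move=> z zz; apply: (loc_sub sA hm); apply: kalg_gen.
Qed.

Lemma surface_point n (x : 'I_n.+1 -> K) s t O : trbasis iota s t ->
  kfield iota [set z | exists i j, x i != 0 /\ z = x j / x i] = setT ->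
  projective_model iota x O -> regular_local_ring_dim2 O ->
  exists i, [/\ x i != 0, forall j, O (x j / x i) & exists u v zs, regular_point iota O u v zs].
Proof.
move=> htr full [i xi [m hm ->]] reg.
pose zs := [seq x j / x i | j <- enum 'I_n.+1].
have eS : [set x j / x i | j in [set: 'I_n.+1]] = [set z | z \in zs].
  apply/seteqP; split=> [_ [j _ <-]|z /mapP [j _ ->]] /=; last by exists j.
  by apply/mapP; exists j; rewrite ?mem_enum.
rewrite eS in hm reg *.
have sA := kalg_subalg iota [set z | z \in zs].
have Ax j : kalg iota [set z | z \in zs] (x j / x i).
  by apply: kalg_gen; apply/mapP; exists j; rewrite ?mem_enum.
have hA : frac_full (kalg iota [set z | z \in zs]).
  apply: (frac_full_gen sA _ full) => _ [i' [j' [xi' ->]]].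
  exists (x j' / x i), (x i' / x i); split; [exact: Ax|exact: Ax| |]; first by rewrite mulf_neq0 ?invr_eq0.
  by field; rewrite xi xi'.
exists i; split=> //; first by move=> j; apply: (loc_sub sA hm).
have [u [v h]] := regular_point_localization htr hA hm reg.
by exists u, v, zs.
Qed.
End SurfacePoints.

(** * Valuation rings seen from a plane chart *)

Section CentersOfValuationRings.
Context (k : closedFieldType) (K : fieldType) (iota : {rmorphism k -> K}).
Local Notation ev1 := (ev1 iota).
Local Notation ev := (ev iota).
Context (W : set K) (hW : val_ring iota W).
Local Notation m := (max_ideal W).
Let sW : subalg iota W. Proof. by have [] := hW. Qed.

(** Equivalently, the field k(z) is contained in W. *)
Definition residue_transc (z : K) :=
  forall p, p != 0 -> [/\ ev1 z p != 0, W (ev1 z p) & W (ev1 z p)^-1].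

Lemma val_ring_maxP z : z != 0 -> m z <-> ~ W z^-1.
Proof.
move=> z0; split=> [[_ h] Wz|nz]; first by apply: (h _ Wz); rewrite mulfV.
split; first by case: (hW.2 z z0).
by move=> g Wg e; apply: nz; rewrite -[z^-1]mulr1 -e mulKf.
Qed.

Lemma val_ring_max0 : m 0.
Proof. by split=> [|g _]; [exact: (subalg0 sW)|rewrite mul0r => /eqP; rewrite eq_sym oner_eq0]. Qed.

Lemma val_ring_maximal : maximal_ideal W m.
Proof.
have mM a b : W a -> m b -> m (a * b).
  by move=> Wa [Wb h]; split=> [|g Wg]; [exact: (subalgM sW)|rewrite mulrAC mulrC => /h; apply; exact: (subalgM sW)].
split=> //.
- by move=> z [].
- split; first exact: val_ring_max0.
  move=> a b ma mb; have [->|a0] := eqVneq a 0; first by rewrite add0r.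
  have [->|b0] := eqVneq b 0; first by rewrite addr0.
  wlog Wab : a b ma mb a0 b0 / W (a / b).
    move=> wl; have [|Wab|] := hW.2 (a / b); first by rewrite mulf_neq0 ?invr_eq0.
      exact: wl.
    by rewrite invf_div addrC; apply: wl.
  have -> : a + b = (a / b + 1) * b by rewrite mulrDl divfK // mul1r.
  by apply: mM => //; apply: (subalgD sW) => //; exact: (subalg1 sW).
- by case=> W1 /(_ 1 W1); apply; rewrite mulr1.
move=> a Wa /(max_ideal_unit Wa) [a0 Wa']; exists a^-1 => //.
by rewrite mulfV // subrr; exact: val_ring_max0.
Qed.
Let hm := val_ring_maximal.

Lemma val_ring_residue z : W z -> residue_transc z \/ exists c, m (z - iota c).
Proof.
move=> Wz; have [h|nh] := EM (exists c, m (z - iota c)); [by right|left=> p p0].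
have Wp : W (ev1 z p) by apply: (subalg_ev1 sW).
have np : ~ m (ev1 z p) by move=> mp; apply: nh; exact: (max_ev1_root sW hm Wz p0 mp).
by have [] := max_ideal_unit Wp np.
Qed.

Lemma residue_transc_nmax z p : residue_transc z -> p != 0 -> ~ m (ev1 z p).
Proof. by move=> h p0 mp; have [e0 _ Wi] := h p p0; case: mp => _ /(_ _ Wi); apply; rewrite mulfV. Qed.

Section TranscendentalFibre.
Context (t y : K) (hty : purely_transcendental iota t y).
Context (tr : residue_transc t) (Wy : W y).
Let Wt : W t.
Proof. by have [|_] := @tr ('X : {poly k}); rewrite ?polyX_eq0 ?ev1X. Qed.
Let Wev P : W (ev t y P). Proof. exact: (subalg_ev sW). Qed.
Let ev_neq0 (P : {poly {poly k}}) : P != 0 -> ev t y P != 0.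
Proof. by apply: contra_neq; exact: (pure_indep hty). Qed.

(** A polynomial of least degree in y among those lying in the maximal ideal divides all others by
    pseudo-division; the powers of its leading coefficient are units of W. *)
Lemma val_ring_generator (P0 : {poly {poly k}}) : P0 != 0 -> m (ev t y P0) ->
  exists Q : {poly {poly k}}, [/\ m (ev t y Q), (1 < size Q)%N &
    forall P, m (ev t y P) -> exists n (h : {poly {poly k}}), (lead_coef Q ^+ n)%:P * P = h * Q].
Proof.
move=> P00 mP0.
have ex : exists s, `[< exists Q : {poly {poly k}}, [/\ Q != 0, m (ev t y Q) & size Q = s] >].
  by exists (size P0); apply/asboolP; exists P0.
have [s /asboolP [Q [Q0 mQ <-]] mins] := ex_minnP ex.
exists Q; split=> //.
  rewrite ltnNge; apply/negP => /size1_polyC e.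
  move: mQ; rewrite e evC; apply: (residue_transc_nmax tr).
  by apply: contraNneq Q0 => q0; rewrite e q0 polyC0.
move=> P mP; exists (scalp P Q), (P %/ Q).
have e := Pdiv.Idomain.divp_eq P Q; rewrite mul_polyC e.
suff -> : P %% Q = 0 by rewrite addr0.
apply/eqP; apply: contraT => R0.
have : (size Q <= size (P %% Q)%R)%N.
  apply: mins; apply/asboolP; exists (P %% Q); split=> //.
  have -> : P %% Q = (lead_coef Q ^+ scalp P Q)%:P * P - (P %/ Q) * Q by rewrite mul_polyC e addrC addKr.
  rewrite evB !evM; apply: (maxB sW hm); apply: (maxM hm) => //.
by rewrite leqNgt ltn_modp Q0.
Qed.

(** While the denominator lies in the maximal ideal so does the numerator, and both are multiples of
    Q up to units; cancelling Q lowers their degrees. *)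
Lemma val_ring_fraction f : W f -> exists A B, [/\ ~ m (ev t y B), ev t y B != 0 & f = ev t y A / ev t y B].
Proof.
have [[A B] /= [B0 ->]] := pure_frac hty f.
have [n] := ubnP (size A + size B); elim: n A B B0 => // n IH A B B0 lt_n WAB.
have [mB|nB] := EM (m (ev t y B)); last by exists A, B.
have [A0|A0] := eqVneq A 0.
  exists 0, 1; rewrite A0 evo ev0 !mul0r oner_eq0; split=> //; exact: (max1 hm).
have mA : m (ev t y A).
  apply: contrapT => /(max_ideal_unit (Wev A)) [a0 Wa]; case: mB => WB /(_ (ev t y A / ev t y B * (ev t y A)^-1)).
  by apply; [exact: (subalgM sW)|field; rewrite a0 B0].
have B0' : B != 0 by apply: contraNneq B0 => ->; rewrite ev0.
have [Q [mQ sQ hQ]] := val_ring_generator B0' mB.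
have Q0 : Q != 0 by rewrite -size_poly_gt0 ltnW.
have lc0 n0 : lead_coef Q ^+ n0 != 0 by rewrite expf_neq0 // lead_coef_eq0.
have [n1 [h]] := hQ A mA; have [n2 [h']] := hQ B mB.
set d := _ ^+ n2; set c := _ ^+ n1 => eB eA; have c0 := lc0 n1; have d0 := lc0 n2; rewrite -/c in c0; rewrite -/d in d0.
have h0 : h != 0.
  by apply: contraNneq A0 => h0; move: eA => /eqP; rewrite h0 mul0r mulf_eq0 polyC_eq0 (negbTE c0).
have h0' : h' != 0 by apply: contraNneq B0' => h0'; move: eB => /eqP; rewrite h0' mul0r mulf_eq0 polyC_eq0 (negbTE d0).
have sA : (size h < size A)%N.
  by have := congr1 (fun p : {poly {poly k}} => size p) eA; rewrite size_Cmul // size_mul // => ->; rewrite ltn_predRL -addn1 ltn_add2l.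
have sB : (size h' < size B)%N.
  by have := congr1 (fun p : {poly {poly k}} => size p) eB; rewrite size_Cmul // size_mul // => ->; rewrite ltn_predRL -addn1 ltn_add2l.
have e1 := congr1 (ev t y) eA; have e2 := congr1 (ev t y) eB.
rewrite !evM !evC in e1 e2.
have c1 : ev1 t c != 0 by case: (tr c0).
have d1 : ev1 t d != 0 by case: (tr d0).
have q1 := ev_neq0 Q0; have hh1 := ev_neq0 h0'.
have e : ev t y A / ev t y B = ev t y (d%:P * h) / ev t y (c%:P * h').
  apply/eqP; rewrite !evM !evC eqr_div ?mulf_neq0 //; apply/eqP.
  apply: (mulfI (mulf_neq0 c1 d1)); transitivity ((ev1 t c * ev t y A) * (ev1 t d * (ev1 t c * ev t y h'))); first ring.
  rewrite e1; transitivity ((ev1 t d * ev t y B) * (ev1 t d * (ev1 t c * ev t y h))); last ring.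
  by rewrite e2; ring.
rewrite e; apply: IH; last by rewrite -e.
  by rewrite evM evC mulf_neq0.
have -> : size (d%:P * h) = size h by apply: size_Cmul.
have -> : size (c%:P * h') = size h' by apply: size_Cmul.
rewrite -ltnS; apply: leq_trans lt_n; rewrite ltnS -addSn; exact: leq_add sA (ltnW sB).
Qed.

Lemma val_ring_max_form Q f : Q != 0 -> m f ->
  (forall P, m (ev t y P) -> exists n (h : {poly {poly k}}), (lead_coef Q ^+ n)%:P * P = h * Q) ->
  exists2 g, W g & f = ev t y Q * g.
Proof.
move=> Q0 mf hQ; have Wf : W f by case: mf.
have [A [B [nB B0 e]]] := val_ring_fraction Wf.
have mA : m (ev t y A).
  by rewrite -(divfK B0 (ev t y A)) -e; apply: (maxMr hm).
have [n1 [h]] := hQ A mA; set c := _ ^+ n1 => eA.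
have c0 : c != 0 by rewrite expf_neq0 // lead_coef_eq0.
have [c1 _ Wc] := tr c0; have [_ WB] := max_ideal_unit (Wev B) nB.
exists ((ev1 t c)^-1 * ev t y h / ev t y B); first by do !apply: (subalgM sW).
have e1 := congr1 (ev t y) eA; rewrite !evM evC in e1.
rewrite e; apply: (mulfI c1); rewrite mulrA e1; field; by rewrite B0 c1.
Qed.

Lemma val_ring_der D : kderivation iota D -> W (D t) -> W (D y) -> forall f, W f -> W (D f).
Proof.
move=> hD Dt Dy f Wf; have [A [B [nB B0 ->]]] := val_ring_fraction Wf.
have [_ WB] := max_ideal_unit (Wev B) nB.
have hk z : kalg iota [set t; y] z -> W z by apply: (kalg_min sW) => _ [->|->].
have Dev P : W (D (ev t y P)).
  apply: (@der_kalg k K iota D hD W [set t; y]).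
  - exact: (subalg0 sW).
  - exact: (subalgD sW).
  - by move=> a b /hk Wa Wb; apply: (subalgM sW).
  - by move=> _ [->|->].
  by apply/kalg2E; exists P.
rewrite (derf hD) // -exprVn; apply: (subalgM sW); last exact: (subalgX sW).
by apply: (subalgB sW); apply: (subalgM sW).
Qed.

(* W is the discrete valuation ring k(t)[y]_(Q), so u and v are both
   multiples of Q and their Jacobian vanishes modulo Q. *)
Lemma val_ring_jacobian J u v : biderivation iota J -> J t y != 0 -> m u -> m v ->
  m (J u v / J t y).
Proof.
move=> hJ J0 mu mv.
have hl g := bider_l hJ g; have hr g := bider_r hJ g.
pose D1 f := J f y / J t y; pose D2 f := J t f / J t y.
have h1 : kderivation iota D1.
  split=> [z w|z w|c]; rewrite /D1.
  - by rewrite (derD (hl y)) mulrDl.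
  - by rewrite (derM (hl y)) /=; ring.
  - by rewrite (derC (hl y)) mul0r.
have h2 : kderivation iota D2.
  split=> [z w|z w|c]; rewrite /D2.
  - by rewrite (derD (hr t)) mulrDl.
  - by rewrite (derM (hr t)); ring.
  - by rewrite (derC (hr t)) mul0r.
have W0 := subalg0 sW; have W1 := subalg1 sW.
have WD1 : forall f, W f -> W (D1 f).
  by apply: val_ring_der => //; rewrite /D1 ?(bider_alt hJ) ?mul0r ?divff.
have WD2 : forall f, W f -> W (D2 f).
  by apply: val_ring_der => //; rewrite /D2 ?(bider_alt hJ) ?mul0r ?divff.
have eJ : J u v / J t y = D1 u * D2 v - D2 u * D1 v.
  have := der_partials hty v hJ (hr u).
  rewrite (bider_anti t u hJ) => e; apply: (mulfI J0); rewrite mulrCA mulfV // mulr1.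
  apply: (mulfI J0); rewrite e /D1 /D2; field; exact: J0.
have [u0|u0] := eqVneq u 0.
  by rewrite u0 (der0 (hl v)) mul0r; exact: val_ring_max0.
have [[A B] /= [B0 eu]] := pure_frac hty u.
have [A1 [B1 [nB1 B10 eu1]]] := val_ring_fraction (proj1 mu).
have mA1 : m (ev t y A1) by rewrite -(divfK B10 (ev t y A1)) -eu1; apply: (maxMr hm).
have A10 : A1 != 0.
  by apply: contraNneq u0 => a0; rewrite eu1 a0 ev0 mul0r.
have [Q [mQ sQ hQ]] := val_ring_generator A10 mA1.
have Q0 : Q != 0 by rewrite -size_poly_gt0 ltnW.
have [u' Wu' e1] := val_ring_max_form Q0 mu hQ; have [v' Wv' e2] := val_ring_max_form Q0 mv hQ.
rewrite eJ e1 e2 !(derM h1) !(derM h2).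
set q := ev t y Q; set d1 := D1 q; set d2 := D2 q.
have Wd1 : W d1 by apply: WD1; case: mQ.
have Wd2 : W d2 by apply: WD2; case: mQ.
have Wq : W q by case: mQ.
have := WD1 _ Wu'; have := WD2 _ Wu'; have := WD1 _ Wv'; have := WD2 _ Wv'.
clearbody d1 d2; move: (D1 u') (D2 u') (D1 v') (D2 v') => p1 p2 r1 r2 Wr2 Wr1 Wp2 Wp1.
have -> : (d1 * u' + q * p1) * (d2 * v' + q * r2) - (d2 * u' + q * p2) * (d1 * v' + q * r1)
   = (d1 * u' * r2 + p1 * (d2 * v') + q * (p1 * r2) - (d2 * u' * r1 + p2 * (d1 * v') + q * (p2 * r1))) * q by ring.
apply: (maxM hm) => //.
by apply: (subalgB sW); do 2?apply: (subalgD sW); do ?apply: (subalgM sW).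
Qed.
End TranscendentalFibre.
End CentersOfValuationRings.

(** * Prescribed exponents and changes of generators *)

Section MonomialSpans.
Context (k : closedFieldType) (K : fieldType) (iota : {rmorphism k -> K}).
Local Notation ev1 := (ev1 iota).
Local Notation ev := (ev iota).
Implicit Types S : nat -> nat -> Prop.

(** S is a Newton polygon: [S l j] admits the monomial t^l y^j, in the order opposite to the
    coefficient indices. *)
Definition mspan S (t y z : K) : Prop := exists2 P : {poly {poly k}},
  forall j l, P`_j`_l != 0 -> S l j & z = ev t y P.

Lemma mspan_sub S S' t y z : (forall l j, S l j -> S' l j) -> mspan S t y z -> mspan S' t y z.
Proof. by move=> h [P hP ->]; exists P => // j l /hP /h. Qed.

Lemma mspan0 S t y : mspan S t y 0.
Proof. by exists 0; rewrite ?ev0 // => j l; rewrite !coef0 eqxx. Qed.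

Lemma mspanD S t y z w : mspan S t y z -> mspan S t y w -> mspan S t y (z + w).
Proof.
move=> [P hP ->] [Q hQ ->]; exists (P + Q); last by rewrite evD.
move=> j l; rewrite !coefD; have [p0|/hP //] := eqVneq P`_j`_l 0.
by rewrite p0 add0r => /hQ.
Qed.

Lemma mspan_mono S t y l j c : S l j -> mspan S t y (iota c * t ^+ l * y ^+ j).
Proof.
move=> h; exists ((c *: 'X^l)%:P * 'X^j); last first.
  by rewrite evM evC evXn evX -mul_polyC ev1M ev1C ev1Xn ev1X.
move=> j' l'; rewrite coefCM coefXn; have [->|_] := eqVneq j' j; last by rewrite mulr0 coef0 eqxx.
by rewrite mulr1 coefZ coefXn; have [->|_] := eqVneq l' l; rewrite ?mulr0 ?eqxx.
Qed.

Lemma ev_monomials t y P : ev t y P =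
  \sum_(j < size P) \sum_(l < size P`_j) iota P`_j`_l * t ^+ l * y ^+ j.
Proof. by rewrite ev_sum; apply: eq_bigr => j _; rewrite ev1_sum big_distrl. Qed.

Lemma mspan_ind S t y (Q : K -> Prop) : Q 0 -> (forall z w, Q z -> Q w -> Q (z + w)) ->
  (forall l j c, S l j -> Q (iota c * t ^+ l * y ^+ j)) -> forall z, mspan S t y z -> Q z.
Proof.
move=> Q0 QD Qm z [P hP ->]; rewrite ev_monomials.
elim/big_ind: _ => // j _; elim/big_ind: _ => // l _.
have [->|p0] := eqVneq P`_j`_l 0; first by rewrite rmorph0 !mul0r.
by apply: Qm; apply: hP.
Qed.

Lemma mspanM S1 S2 S t y z w :
  (forall l j l' j', S1 l j -> S2 l' j' -> S (l + l')%N (j + j')%N) ->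
  mspan S1 t y z -> mspan S2 t y w -> mspan S t y (z * w).
Proof.
move=> hS hz hw; move: z hz; apply: mspan_ind => [|z z' hz hz'|l j c Slj].
- by rewrite mul0r; exact: mspan0.
- by rewrite mulrDl; exact: mspanD.
move: w hw; apply: mspan_ind => [|w w' hw hw'|l' j' c' Slj'].
- by rewrite mulr0; exact: mspan0.
- by rewrite mulrDr; exact: mspanD.
have -> : iota c * t ^+ l * y ^+ j * (iota c' * t ^+ l' * y ^+ j') =
  iota (c * c') * t ^+ (l + l') * y ^+ (j + j') by rewrite rmorphM !exprD; ring.
by apply: mspan_mono; apply: hS.
Qed.

Lemma mspan_const S t y c : S 0%N 0%N -> mspan S t y (iota c).
Proof. by move=> /(mspan_mono t y c); rewrite !expr0 !mulr1. Qed.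

Lemma mspan_kalg S t y z : mspan S t y z -> kalg iota [set t; y] z.
Proof. by move=> [P _ ->]; apply/kalg2E; exists P. Qed.

Lemma mspan_shift1 t y c l : mspan (fun l' j => (l' <= l)%N /\ j = 0%N) t y ((t + iota c) ^+ l).
Proof.
elim: l => [|l IH]; first by rewrite expr0 -(rmorph1 iota); apply: mspan_const.
rewrite exprS; apply: (mspanM _ _ IH (S1 := fun l' j => (l' <= 1)%N /\ j = 0%N)).
  by move=> a b a' b' [h ->] [h' ->]; rewrite addn0; split=> //; lia.
apply: mspanD; last by apply: mspan_const.
by have := @mspan_mono (fun l' j => (l' <= 1)%N /\ j = 0%N) t y 1 0 1; rewrite rmorph1 mul1r expr1 expr0 mulr1; apply.
Qed.

Lemma mspan_swap S t y z : mspan S t y z -> mspan (fun l j => S j l) y t z.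
Proof.
move: z; apply: mspan_ind => [|z w|l j c Slj]; [exact: mspan0|exact: mspanD|].
by rewrite mulrAC; apply: mspan_mono.
Qed.

Lemma mspan_shift2 t y c j : mspan (fun l' j' => l' = 0%N /\ (j' <= j)%N) t y ((y + iota c) ^+ j).
Proof.
apply: mspan_sub (mspan_swap (mspan_shift1 y t c j)).
by move=> a b [].
Qed.

Lemma mspan_change S S' t y t' y' u z :
  (forall l j, S l j -> mspan S' t' y' (u * (t ^+ l * y ^+ j))) ->
  mspan S t y z -> mspan S' t' y' (u * z).
Proof.
move=> h; move: z; apply: mspan_ind => [|z w hz hw|l j c Slj].
- by rewrite mulr0; exact: mspan0.
- by rewrite mulrDr; exact: mspanD.
have -> : u * (iota c * t ^+ l * y ^+ j) = iota c * (u * (t ^+ l * y ^+ j)) by ring.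
apply: (mspanM _ (mspan_const (S := fun l j => l = 0%N /\ j = 0%N) t' y' c _) (h l j Slj)) => //.
by move=> a b a' b' [-> ->].
Qed.

Local Notation alg1 s := (@algR ({poly k} : idomainType) K (ev1 s)).

Lemma kfield_alg x t y z : transc iota x -> alg1 x t -> alg1 x y -> kfield iota [set t; y] z -> alg1 x z.
Proof.
move=> tx ht hy [a [b [/kalg2E[P eP] /kalg2E[Q eQ] b0 ->]]].
have hev R : alg1 x (ev t y R).
  by apply: algR_ev => //; [exact: transc_inj|exact: algR_ev1_const].
apply: algR_mul; [exact: transc_inj|by rewrite eP|].
by apply: algR_inv; rewrite eQ.
Qed.

(** Two generators of a field of transcendence degree two are independent: otherwise t and y would
    both be algebraic over one transcendental element. *)
Lemma pure_change t y t' y' : purely_transcendental iota t y ->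
  kfield iota [set t'; y'] t -> kfield iota [set t'; y'] y -> purely_transcendental iota t' y'.
Proof.
move=> hty Ft Fy.
have full : kfield iota [set t'; y'] = setT.
  apply/frac_fullP.
  apply: (frac_full_gen (kalg_subalg iota [set t'; y']) (S := [set t; y])); last by have [] := hty.
  by move=> _ [->|->].
split=> //; apply/alg_independentE/indep_sym/indepP => h.
have it := pure_indep hty; have tt := indep_transc it.
have fin x : transc iota x -> alg1 x t' -> alg1 x y' -> False.
  move=> tx a1 a2; apply: (indep_not_both it tx); exact: (kfield_alg tx a1 a2).
have [tt'|[c et']] := transcP iota t'; first by apply: (fin t') => //; exact: algR_ev1_gen.
have [ty'|[d ey']] := transcP iota y'.
  by apply: (fin y') => //; [rewrite et'; exact: algR_ev1_const|exact: algR_ev1_gen].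
by apply: (fin t) => //; rewrite ?et' ?ey'; exact: algR_ev1_const.
Qed.

Lemma kfield_add t y a b : kfield iota [set t; y] a -> kfield iota [set t; y] b -> kfield iota [set t; y] (a + b).
Proof.
have sA := kalg_subalg iota [set t; y].
move=> [p [q [Ap Aq q0 ->]]] [r [s [Ar As s0 ->]]]; exists (p * s + r * q), (q * s).
split; rewrite ?addf_div ?mulf_neq0 //; last exact: (subalgM sA).
by apply: (subalgD sA); apply: (subalgM sA).
Qed.

Lemma kfield_mul t y a b : kfield iota [set t; y] a -> kfield iota [set t; y] b -> kfield iota [set t; y] (a * b).
Proof.
have sA := kalg_subalg iota [set t; y].
move=> [p [q [Ap Aq q0 ->]]] [r [s [Ar As s0 ->]]]; exists (p * r), (q * s).
by split; rewrite ?mulf_div ?mulf_neq0 //; apply: (subalgM sA).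
Qed.

Lemma kfield_sub t y a : kalg iota [set t; y] a -> kfield iota [set t; y] a.
Proof.
have sA := kalg_subalg iota [set t; y].
by move=> h; exists a, 1; split; rewrite ?divr1 ?oner_neq0 //; exact: (subalg1 sA).
Qed.

Lemma kfield_inv t y a : kfield iota [set t; y] a -> kfield iota [set t; y] a^-1.
Proof.
move=> [p [q [Ap Aq q0 ->]]]; have [->|p0] := eqVneq p 0.
  by rewrite mul0r invr0; apply: kfield_sub; exact: (subalg0 (kalg_subalg iota _)).
by exists q, p; rewrite invf_div.
Qed.

Lemma kfield1 t y : kfield iota [set t; y] t.
Proof. by apply/kfield_sub/kalg_gen; left. Qed.

Lemma kfield2 t y : kfield iota [set t; y] y.
Proof. by apply/kfield_sub/kalg_gen; right. Qed.

Lemma kfieldC t y c : kfield iota [set t; y] (iota c).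
Proof. exact/kfield_sub/kalg_const. Qed.

Lemma pure_swap t y : purely_transcendental iota t y -> purely_transcendental iota y t.
Proof. move=> h; apply: (pure_change h); [exact: kfield2|exact: kfield1]. Qed.

Lemma pure_neq_const t y c : purely_transcendental iota t y -> t != iota c.
Proof.
move=> /pure_indep/indep_transc h; apply/eqP => e; apply: (@transc_const _ _ iota c).
by rewrite -e.
Qed.

Lemma pure_neq0 t y : purely_transcendental iota t y -> t != 0.
Proof. by move=> h; rewrite -(rmorph0 iota); apply: pure_neq_const h. Qed.

(** A derivation is determined by its values at t and y, so J t y = 0 would make J vanish. *)
Lemma jacobian_neq0 J t y : biderivation iota J -> purely_transcendental iota t y -> J t y != 0.
Proof.
move=> hJ hty; apply/eqP => J0; have [f [g]] := bider_neq0 hJ; apply/negP; rewrite negbK.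
have z : kderivation iota (fun=> 0 : K) by split=> *; rewrite ?mulr0 ?mul0r ?addr0.
have z2 : J t =1 fun=> 0 by apply: (der_ext hty (bider_r hJ t) z); rewrite ?(bider_alt hJ).
have z1 : J^~ y =1 fun=> 0 by apply: (der_ext hty (bider_l hJ y) z); rewrite /= ?(bider_alt hJ).
have -> // : J f =1 fun=> 0.
apply: (der_ext hty (bider_r hJ f) z); last exact: z1.
by rewrite (bider_anti t f hJ) z2 oppr0.
Qed.
End MonomialSpans.

(** * Linear systems and centres of valuations *)

Section Charts.
Context (k : closedFieldType) (K : fieldType) (iota : {rmorphism k -> K}).
Local Notation ev1 := (ev1 iota).
Local Notation ev := (ev iota).
Context (n : nat) (x : 'I_n.+1 -> K) (x_neq0 : exists i, x i != 0).

(** The linear system of the coordinates x has degree at most a on the fibres of t; [la] is the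
    common factor that makes all coordinates polynomial. *)
Definition fibre_data (a : nat) (t y la : K) : Prop :=
  [/\ purely_transcendental iota t y, la != 0 &
      forall i, mspan iota (fun _ j => j <= a)%N t y (la * x i)].

(** The system has no base point at the centre of W: some section is a unit there. *)
Definition unit_section (W : set K) (la : K) : Prop :=
  (forall i, W (la * x i)) /\ exists i, la * x i != 0 /\ W (la * x i)^-1.

Section Minimal.
Context (a : nat) (min_a : forall a' t y la, fibre_data a' t y la -> (a <= a')%N).
Context (t y la : K) (h : fibre_data a t y la).
Context (W : set K) (hW : val_ring iota W).
Let sW : subalg iota W. Proof. by have [] := hW. Qed.
Let hm := val_ring_maximal hW.

Lemma section_int i : W t -> W y -> W (la * x i).
Proof.
move=> Wt Wy; have [_ _ /(_ i)] := h; move/mspan_kalg.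
by apply: (kalg_min sW) => _ [->|->].
Qed.

(* A common factor of positive y-degree could be removed from all the
   sections, against the minimality of a. *)
Lemma unit_section_transc : residue_transc iota W t -> W y -> unit_section W la.
Proof.
move=> tr Wy; have [hty la0 hx] := h.
have Wt : W t by have [|_] := @tr ('X : {poly k}); rewrite ?polyX_eq0 ?ev1X.
split=> [i|]; first exact: section_int.
apply: contrapT => nu.
have mx i : max_ideal W (la * x i).
  have [->|x0] := eqVneq (la * x i) 0; first exact: (max0 hm).
  by apply/(val_ring_maxP hW x0) => Wi; apply: nu; exists i.
have /choice [P hP] : forall i, exists P : {poly {poly k}}, la * x i = ev t y P /\ (size P <= a.+1)%N.
  move=> i; have [P hP ->] := hx i; exists P; split=> //.
  apply/leq_sizeP => j lt_j; apply/polyP => l; rewrite coef0; apply/eqP; apply: contraT => /hP.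
  by rewrite leqNgt lt_j.
have [i0 xi0] := x_neq0.
have P0 : P i0 != 0.
  by apply: contra_neq (mulf_neq0 la0 xi0) => e; rewrite (hP i0).1 e ev0.
have [|Q [mQ sQ hQ]] := val_ring_generator hW tr Wy P0; first by rewrite -(hP i0).1.
have Q0 : Q != 0 by rewrite -size_poly_gt0 ltnW.
have /choice [f hf] : forall i, exists nh : nat * {poly {poly k}},
    (lead_coef Q ^+ nh.1)%:P * P i = nh.2 * Q.
  by move=> i; have [|N [q e]] := hQ (P i); [rewrite -(hP i).1|exists (N, q)].
have lc0 N : lead_coef Q ^+ N != 0 by rewrite expf_neq0 // lead_coef_eq0.
have evq : ev t y Q != 0 by apply: contra_neq Q0; exact: (pure_indep hty).
pose N := (\sum_i (f i).1)%N.
have lN0 : ev1 t (lead_coef Q ^+ N) != 0 by case: (tr _ (lc0 N)).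
have sf i : (size (f i).2 <= a)%N.
  have [->|fi0] := eqVneq (f i).2 0; first by rewrite size_poly0.
  have := congr1 (fun p : {poly {poly k}} => size p) (hf i).
  rewrite size_Cmul // size_mul // => e; rewrite -ltnS; apply: leq_trans (hP i).2.
  by rewrite e ltn_predRL -addn1 ltn_add2l.
have a_gt0 : (0 < a)%N.
  apply: leq_trans (sf i0); rewrite size_poly_gt0; apply: contraNneq P0 => e.
  by have /eqP := hf i0; rewrite e mul0r mulf_eq0 polyC_eq0 (negbTE (lc0 _)).
have : (a <= a.-1)%N.
  apply: (min_a (t := t) (y := y) (la := la * ev1 t (lead_coef Q ^+ N) / ev t y Q)).
  split=> // [|i]; first by rewrite !mulf_neq0 ?invr_eq0.
  have leN : ((f i).1 <= N)%N by rewrite /N (bigD1 i) //= leq_addr.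
  exists ((lead_coef Q ^+ (N - (f i).1))%:P * (f i).2).
    move=> j l; rewrite coefCM; have [lt_j|] := ltnP j a; first by move: lt_j; lia.
    by move=> /(leq_trans (sf i)) le_j; rewrite (nth_default 0 le_j) mulr0 coef0 eqxx.
  have := congr1 (ev t y) (hf i); rewrite evM evC evM -(hP i).1 => e.
  apply: (mulIf evq); rewrite evM evC -[RHS]mulrA -e [RHS]mulrA -ev1M -exprD subnK //.
  by field.
by rewrite leqNgt ltn_predL a_gt0.
Qed.

(** W is centred on the fibre t = c with y transcendental, so a section that does not vanish on this
    whole fibre keeps a nonzero residue. *)
Lemma unit_section_alg c : (exists i P, la * x i = ev t y P /\ map_poly (horner_eval c) P != 0) ->
  W t -> max_ideal W (t - iota c) -> W y -> residue_transc iota W y -> unit_section W la.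
Proof.
move=> [i [P [e P0]]] Wt mt Wy tr; split=> [j|]; first exact: section_int.
exists i; have Wi := section_int i Wt Wy.
apply: (max_ideal_unit Wi) => mi.
apply: (residue_transc_nmax tr P0); rewrite -ev_horner_inner.
have -> : ev (iota c) y P = ev t y P - (ev t y P - ev (iota c) y P) by rewrite subKr.
rewrite -e; apply: (maxB sW hm mi); rewrite e.
apply: (max_cong_ev sW hm) => //; first exact: (subalgC sW).
by rewrite subrr; exact: (max0 hm).
Qed.
End Minimal.
End Charts.

Section ChartInequality.
Context (k : closedFieldType) (K : fieldType) (iota : {rmorphism k -> K}).
Local Notation ev1 := (ev1 iota).
Local Notation ev := (ev iota).

Lemma val_ring_vge w : valuation iota w -> val_ring iota (vge w 0).
Proof.
move=> hw; split=> [|z z0]; first exact: (subalg_vge hw).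
have [le|/ltW le] := leP 0 (w z); [by left; right|right; right].
by rewrite (val_V hw) // oppr_ge0.
Qed.

Lemma max_ideal_vge w z : valuation iota w -> max_ideal (vge w 0) z <-> vge w 1 z.
Proof.
move=> hw; have [->|z0] := eqVneq z 0.
  by split=> _; [left|exact: (val_ring_max0 (val_ring_vge hw))].
rewrite (val_ring_maxP (val_ring_vge hw)) // !vgeP ?invr_eq0 // (val_V hw) // oppr_ge0.
by split=> [/negP|h]; [rewrite -ltNge gtz0_ge1|apply/negP; rewrite -ltNge gtz0_ge1].
Qed.

Context (n : nat) (x : 'I_n.+1 -> K).
Context (O : set K) (u v : K) (zs : seq K) (hO : regular_point iota O u v zs).
Context (i0 : 'I_n.+1) (xi0 : x i0 != 0) (Ox : forall j, O (x j / x i0)).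
Context (J : K -> K -> K) (hJ : biderivation iota J).
Local Notation kap := (J u v).

(** The Noether-Fano inequality for r K + s L. If w is centred at a closed point of the chart,
    [multiplicity_bound] and s m <= r give it; otherwise some section is a unit at w. The coordinate
    x i0 has the least value, since all quotients by it lie in O. *)
Lemma chart_ineq (r s m : nat) (t y la : K) (w : K -> int) :
  purely_transcendental iota t y -> divisorial iota O w -> vge w 0 t -> vge w 0 y ->
  la != 0 -> (s * m <= r)%N ->
  (forall c c', vge w 1 (t - iota c) -> vge w 1 (y - iota c') ->
    exists i P j l, [/\ la * x i = ev (t - iota c) (y - iota c') P, P`_j`_l != 0 & (l + j <= m)%N]) ->
  ((forall c c', ~ (vge w 1 (t - iota c) /\ vge w 1 (y - iota c'))) ->
    unit_section x (vge w 0) la) ->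
  w kap *+ r + w (la * x i0) *+ s <= w (J t y) *+ r.
Proof.
move=> hty dw wt wy la0 le_sm hcl hop; have [hw wO _] := dw.
have Jty0 := jacobian_neq0 hJ hty.
have hc0 f g : vge w 0 f -> vge w 0 g -> vge w (w kap) (J f g).
  exact: (divisorial_jacobian hO hJ).
have leJ : w kap <= w (J t y) by case: (hc0 t y wt wy) => // e; rewrite e eqxx in Jty0.
have le_x i : la * x i != 0 -> w (la * x i0) <= w (la * x i).
  move=> x0; have xi : x i != 0 by apply: contraNneq x0 => ->; rewrite mulr0.
  have -> : la * x i = x i / x i0 * (la * x i0) by field.
  rewrite [in leRHS](val_M hw) ?mulf_neq0 ?invr_eq0 // lerDr.
  by have := wO _ (Ox i); rewrite vgeP // mulf_neq0 ?invr_eq0.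
have [[c [c' [wc wc']]]|nc] := EM (exists c c', vge w 1 (t - iota c) /\ vge w 1 (y - iota c')); last first.
  have [|_ [i [x0 Wi]]] := hop; first by move=> c c' h; apply: nc; exists c, c'.
  have le0 : w (la * x i0) <= 0.
    apply: le_trans (le_x i x0) _; move: Wi; rewrite vgeP ?invr_eq0 // (val_V hw) //.
    by rewrite oppr_ge0.
  apply: le_trans (_ : w kap *+ r <= _); last exact: ler_wMn2r.
  by rewrite gerDl mulrn_wle0.
have [i [P [j [l [eP Pjl le_m]]]]] := hcl c c' wc wc'.
have t0 : t - iota c != 0 by rewrite subr_eq0 (pure_neq_const _ hty).
have y0 : y - iota c' != 0 by rewrite subr_eq0 (pure_neq_const _ (pure_swap hty)).
have pos z : z != 0 -> vge w 1 z -> 0 < w z by move=> z0; rewrite vgeP // -gtz0_ge1.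
have eJ : J (t - iota c) (y - iota c') = J t y.
  rewrite (derB (bider_r hJ _)) (derC (bider_r hJ _)) subr0.
  by rewrite (derB (bider_l hJ _)) (derC (bider_l hJ _)) subr0.
have J0 : J (t - iota c) (y - iota c') != 0 by rewrite eJ.
have [e0 le] := multiplicity_bound hJ hw hc0 t0 y0 (pos _ t0 wc) (pos _ y0 wc') J0 Pjl le_m.
rewrite -eP eJ in e0 le.
have le1 : w (la * x i0) *+ s <= (w (J t y) - w kap) *+ r.
  apply: le_trans (_ : ((w (J t y) - w kap) *+ m) *+ s <= _).
    by apply: ler_wMn2r; apply: le_trans le; exact: le_x.
  by rewrite -mulrnA mulnC; apply: ler_wpMn2l => //; rewrite subr_ge0.
apply: le_trans (lerD (lexx _) le1) _.
by rewrite mulrnBl addrC subrK.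
Qed.

(** W contains u and v in its maximal ideal, so kap / J t y lies there by [val_ring_jacobian]; if
    the section belonged to W, its product with powers of this quotient and of a section of L would
    be 1 and lie in the maximal ideal. *)
Lemma chart_dominate (r s : nat) (t y la : K) (W : set K) :
  purely_transcendental iota t y -> val_ring iota W -> O `<=` W ->
  (forall z, max_ideal O z -> z != 0 -> ~ W z^-1) ->
  residue_transc iota W t -> W y -> unit_section x W la -> (0 < r)%N ->
  ~ W (J t y ^+ r / (kap ^+ r * (la * x i0) ^+ s)).
Proof.
move=> hty hW OW dom tr Wy [Wx [i [x0 Wi]]] r_gt0 WXi.
have sW : subalg iota W by case: hW.
have hm := val_ring_maximal hW.
have J0 := jacobian_neq0 hJ hty; have [kap0 _] := jacobian_generator hO hJ.
have hdom z : max_ideal O z -> max_ideal W z.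
  move=> mz; have [->|z0] := eqVneq z 0; first exact: (max0 hm).
  by apply/(val_ring_maxP hW z0)/dom.
have mu := hdom _ (rp_u hO); have mv := hdom _ (rp_v hO).
have mk := val_ring_jacobian hW hty tr Wy hJ J0 mu mv.
have la0 : la * x i0 != 0.
  by apply: contraNneq x0 => /eqP; rewrite mulf_eq0 (negbTE xi0) orbF => /eqP ->; rewrite mul0r.
have mX : max_ideal W ((kap / J t y) ^+ r).
  by rewrite -(prednK r_gt0) exprS; apply: (maxMr hm) => //; apply: (subalgX sW); apply: (max_sub hm).
apply: (max1 hm).
have -> : 1 = (kap / J t y) ^+ r * (J t y ^+ r / (kap ^+ r * (la * x i0) ^+ s) * (la * x i0) ^+ s).
  rewrite expr_div_n invfM; have := expf_neq0 r kap0; have := expf_neq0 r J0; have := expf_neq0 s la0.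
  move: (kap ^+ r) (J t y ^+ r) ((la * x i0) ^+ s) => a b c c0 b0 a0; field; by rewrite a0 b0 c0.
by apply: (maxMr hm) => //; apply: (subalgM sW) => //; apply: (subalgX sW).
Qed.
End ChartInequality.

(** * Linear systems on ruled surfaces *)

Section BoxData.
Context (k : closedFieldType) (K : fieldType) (iota : {rmorphism k -> K}).
Local Notation ev1 := (ev1 iota).
Local Notation ev := (ev iota).
Context (n : nat) (x : 'I_n.+1 -> K) (x_neq0 : exists i, x i != 0).
Local Notation fibre_data := (fibre_data iota x).
Local Notation pure := (purely_transcendental iota).

(** Exponents of the sections of a line bundle on F_e with degree a on the fibres and degree b on
    the curve y = 0, the negative section when e > 0. Its self-intersection is a (2 b + a e). *)
Definition box (a e b l j : nat) : Prop := (j <= a)%N /\ (l <= b + e * j)%N.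

Definition box_data (a e b : nat) (t y la : K) : Prop :=
  [/\ pure t y, la != 0 & forall i, mspan iota (box a e b) t y (la * x i)].

Lemma box_fibre a e b t y la : box_data a e b t y la -> fibre_data a t y la.
Proof. by case=> h1 h2 h3; split=> // i; apply: mspan_sub (h3 i) => l j []. Qed.

Lemma mspan_monomial S t y l j : S l j -> mspan iota S t y (t ^+ l * y ^+ j).
Proof. by move=> /(mspan_mono iota t y 1); rewrite rmorph1 mul1r. Qed.

Lemma box_change a' e' b' S t y la t' y' mu : pure t' y' -> la != 0 -> mu != 0 ->
  (forall i, mspan iota S t y (la * x i)) ->
  (forall l j, S l j -> mspan iota (box a' e' b') t' y' (mu / la * (t ^+ l * y ^+ j))) ->
  box_data a' e' b' t' y' mu.
Proof.
move=> hp la0 mu0 hx hS; split=> // i.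
have -> : mu * x i = mu / la * (la * x i) by field.
exact: mspan_change (hx i).
Qed.

Lemma pure_shift1 t y c : pure t y -> pure (t - iota c) y.
Proof.
move=> h; apply: (pure_change h); last exact: kfield2.
rewrite -[X in kfield _ _ X](subrK (iota c)); apply: kfield_add; [exact: kfield1|exact: kfieldC].
Qed.

Lemma pure_inv2 t y : pure t y -> pure t y^-1.
Proof.
move=> h; apply: (pure_change h); first exact: kfield1.
by rewrite -[X in kfield _ _ X]invrK; apply/kfield_inv/kfield2.
Qed.

Lemma kfieldX t y z l : kfield iota [set t; y] z -> kfield iota [set t; y] (z ^+ l).
Proof.
move=> h; elim: l => [|l IH]; first by rewrite expr0 -(rmorph1 iota); exact: kfieldC.
by rewrite exprS; apply: kfield_mul.
Qed.

Lemma pure_mulX t y l : pure t y -> pure t (y * t ^+ l).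
Proof.
move=> h; apply: (pure_change h); first exact: kfield1.
have t0 := pure_neq0 h.
rewrite -[X in kfield _ _ X](mulfK (expf_neq0 l t0)).
by apply: kfield_mul; [exact: kfield2|apply/kfield_inv/kfieldX/kfield1].
Qed.

Lemma pure_divX t y l : pure t y -> pure t (y / t ^+ l).
Proof.
move=> h; apply: (pure_change h); first exact: kfield1.
have t0 := pure_neq0 h.
rewrite -[X in kfield _ _ X](divfK (expf_neq0 l t0)).
by apply: kfield_mul; [exact: kfield2|apply/kfieldX/kfield1].
Qed.

Lemma box_shift a e b t y la c : box_data a e b t y la -> box_data a e b (t - iota c) y la.
Proof.
move=> [h la0 hx]; apply: (box_change (pure_shift1 c h) la0 la0 hx) => // l j [le_j le_l].
rewrite divff // mul1r -[X in X ^+ l](subrK (iota c)).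
have hj : mspan iota (fun l' j' => l' = 0%N /\ j' = j) (t - iota c) y (y ^+ j).
  by have := @mspan_monomial (fun l' j' => l' = 0%N /\ j' = j) (t - iota c) y 0 j; rewrite mul1r; apply.
apply: (mspanM _ (mspan_shift1 iota (t - iota c) y c l) hj).
move=> p q p' q' [le_p ->] [-> ->]; split; first by rewrite add0n.
by rewrite add0n addn0 (leq_trans le_p).
Qed.

Lemma box_inv a e b t y la : box_data a e b t y la ->
  box_data a e b t^-1 (y * t ^+ e) (la * t^-1 ^+ b).
Proof.
move=> [h la0 hx]; have t0 := pure_neq0 h.
have h' : pure t^-1 (y * t ^+ e) by apply/pure_swap/pure_inv2/pure_swap/pure_mulX.
apply: (box_change h' la0 _ hx) => //; first by rewrite mulf_neq0 ?expf_neq0 ?invr_eq0.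
move=> l j [le_j le_l].
have -> : la * t^-1 ^+ b / la * (t ^+ l * y ^+ j) = t^-1 ^+ (b + e * j - l) * (y * t ^+ e) ^+ j.
  have e1 : t ^+ (b + e * j - l) * t ^+ l = t ^+ b * t ^+ (e * j) by rewrite -!exprD subnK.
  rewrite exprMn -exprM !exprVn; apply: (mulfI (expf_neq0 (b + e * j - l) t0)).
  have := expf_neq0 (b + e * j - l) t0; have := expf_neq0 b t0; move: e1.
  move: (t ^+ (b + e * j - l)) (t ^+ b) (t ^+ (e * j)) (t ^+ l) (y ^+ j) => p q r s z e1 q0 p0.
  transitivity (p * s / q * z); first by field; rewrite q0.
  by rewrite e1; field; rewrite q0 p0.
apply: mspan_monomial; split=> //; exact: leq_subr.
Qed.

(** A translation of 1 / y by a constant fixes the curve y = 0 and moves any other point of a fibre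
    to y = infinity. *)
Lemma box_shift_infty a e b t y y' la c : box_data a e b t y la -> y'^-1 = y^-1 - iota c ->
  box_data a e b t y' (la * (y' / y) ^+ a).
Proof.
move=> [h la0 hx] ey; have y0 := pure_neq0 (pure_swap h).
have y0' : y' != 0.
  rewrite -invr_eq0 ey subr_eq0; apply: (pure_neq_const _ (pure_swap (pure_inv2 h))).
have h' : pure t y'.
  rewrite -[y']invrK ey; apply: pure_inv2.
  by apply/pure_swap/pure_shift1/pure_swap/pure_inv2.
apply: (box_change h' la0 _ hx) => //; first by rewrite mulf_neq0 ?expf_neq0 ?mulf_neq0 ?invr_eq0.
move=> l j [le_j le_l].
have -> : la * (y' / y) ^+ a / la * (t ^+ l * y ^+ j) = y' ^+ a * ((y'^-1 + iota c) ^+ (a - j)) * t ^+ l.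
  rewrite ey subrK expr_div_n exprVn -[in y ^+ a](subnK le_j) exprD; have := expf_neq0 (a - j) y0; have := expf_neq0 j y0.
  move: (y' ^+ a) (y ^+ (a - j)) (y ^+ j) (t ^+ l) => p q r s r0 q0.
  by field; rewrite r0 q0 la0.
pose S l' j' := l' = 0%N /\ (j <= j' <= a)%N.
apply: (mspanM (S1 := S) (S2 := fun l' j' => l' = l /\ j' = 0%N)).
- move=> p q p' q' [-> /andP[le_q le_a]] [-> ->]; rewrite addn0 add0n; split=> //.
  by apply: leq_trans le_l _; rewrite leq_add2l leq_mul2l le_q orbT.
- apply: (mspan_change (S := fun l' j' => l' = 0%N /\ (j' <= a - j)%N) (t := t) (y := y'^-1)).
    move=> p q [-> le_q]; rewrite expr0 mul1r.
    have -> : y' ^+ a * y'^-1 ^+ q = t ^+ 0 * y' ^+ (a - q).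
      have le_qa : (q <= a)%N by apply: leq_trans le_q (leq_subr _ _).
      by rewrite expr0 mul1r -[in y' ^+ a](subnK le_qa) exprD exprVn mulfK ?expf_neq0.
    apply: mspan_monomial; split=> //; rewrite leq_subr andbT.
    by rewrite leq_subRL ?(leq_trans le_q) ?leq_subr // addnC -leq_subRL.
  exact: mspan_shift2.
by have := @mspan_monomial (fun l' j' => l' = l /\ j' = 0%N) t y' l 0; rewrite expr0 mulr1; apply.
Qed.

Lemma box_inv_fibre a b t y la : box_data a 0 b t y la -> box_data a 0 b t y^-1 (la * y^-1 ^+ a).
Proof.
move=> [h la0 hx]; have y0 := pure_neq0 (pure_swap h).
apply: (box_change (pure_inv2 h) la0 _ hx) => //; first by rewrite mulf_neq0 ?expf_neq0 ?invr_eq0.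
move=> l j [le_j le_l].
have -> : la * y^-1 ^+ a / la * (t ^+ l * y ^+ j) = t ^+ l * y^-1 ^+ (a - j).
  rewrite !exprVn -[in y ^+ a](subnK le_j) exprD; have := expf_neq0 (a - j) y0; have := expf_neq0 j y0.
  move: (y ^+ (a - j)) (y ^+ j) (t ^+ l) => q r s r0 q0.
  by field; rewrite r0 q0 la0.
apply: mspan_monomial; split=> //; exact: leq_subr.
Qed.

Lemma box_swap a b t y la : box_data a 0 b t y la -> fibre_data b y t la.
Proof.
move=> [h la0 hx]; split=> // [|i]; first exact: pure_swap.
by apply: mspan_sub (mspan_swap (hx i)) => l j [_]; rewrite mul0n addn0.
Qed.

Section Minimal.
Context (a : nat) (min_a : forall a' t y la, fibre_data a' t y la -> (a <= a')%N).

(** Dividing by y would lower a. This also guarantees that the natural subtractions b - m and b + a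
    - m below are exact. *)
Lemma not_divisible t y la : pure t y -> la != 0 ->
  ~ forall i, mspan iota (fun _ j => 0 < j <= a)%N t y (la * x i).
Proof.
move=> h la0 hx; have y0 := pure_neq0 (pure_swap h).
have a_gt0 : (0 < a)%N.
  rewrite lt0n; apply/eqP => a0; have [i xi] := x_neq0.
  have: la * x i != 0 by rewrite mulf_neq0.
  apply/negP; rewrite negbK; move: (hx i); rewrite a0; elim/mspan_ind => [|z w /eqP-> /eqP->|l j c].
  - by [].
  - by rewrite addr0.
  by case/andP=> j_gt0; rewrite leqn0 => /eqP j0; rewrite j0 in j_gt0.
have : fibre_data a.-1 t y (la / y).
  split=> // [|i]; first by rewrite mulf_neq0 ?invr_eq0.
  have -> : la / y * x i = y^-1 * (la * x i) by rewrite mulrAC mulrC.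
  apply: mspan_change (hx i) => l j /andP[j_gt0 le_j].
  have -> : y^-1 * (t ^+ l * y ^+ j) = t ^+ l * y ^+ j.-1.
    by rewrite -[in y ^+ j](prednK j_gt0) exprS mulrCA mulKf.
  by apply: mspan_monomial; rewrite -!subn1 leq_sub2r.
by move=> /min_a; rewrite leqNgt ltn_predL a_gt0.
Qed.

(** Elementary transformation at the point t = y = 0, which lies on the curve of degree b: e grows
    by 1, b drops by m, and 2 b + a e changes by a - 2 m. *)
Lemma elementary_zero e b m t y la : box_data a e b t y la ->
  (forall i, mspan iota (fun l j => box a e b l j /\ (m <= l + j)%N) t y (la * x i)) ->
  (m <= b)%N /\ box_data a e.+1 (b - m) t (y / t) (la / t ^+ m).
Proof.
move=> [h la0 _] hx; have t0 := pure_neq0 h.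
have le_m : (m <= b)%N.
  rewrite leqNgt; apply/negP => lt_b; apply: (not_divisible h la0) => i.
  apply: mspan_sub (hx i) => l j [[le_j le_l] le_m]; rewrite le_j andbT lt0n.
  apply/eqP => j0; move: le_l le_m; rewrite j0 muln0 !addn0 => le_l le_m.
  by move: lt_b; rewrite ltnNge (leq_trans le_m le_l).
split=> //.
have h' : pure t (y / t) by have := pure_divX 1 h; rewrite expr1.
apply: (box_change h' la0 _ hx) => //; first by rewrite mulf_neq0 ?invr_eq0 ?expf_neq0.
  move=> l j [[le_j le_l] le_ml].
  have -> : la / t ^+ m / la * (t ^+ l * y ^+ j) = t ^+ (l + j - m) * (y / t) ^+ j.
    have e1 : t ^+ (l + j - m) * t ^+ m = t ^+ l * t ^+ j by rewrite -!exprD subnK.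
    rewrite expr_div_n; move: e1; have := expf_neq0 m t0; have := expf_neq0 j t0.
    move: (t ^+ (l + j - m)) (t ^+ m) (t ^+ l) (t ^+ j) (y ^+ j) => p q r s z s0 q0 e1.
    apply: (mulIf q0); transitivity (r * s * z / s); first by field; rewrite s0 q0 la0.
    by rewrite -e1; ring.
  apply: mspan_monomial; split=> //.
  move: le_l le_m le_ml; rewrite mulSn; move: (e * j)%N => p; lia.
Qed.

(** Elementary transformation at t = 0, y = infinity, away from the negative section: e drops by 1,
    and 2 b + a e again changes by a - 2 m. *)
Lemma elementary_infty e b m t y la : box_data a e.+1 b t y la ->
  (forall i, mspan iota (fun l j => box a e.+1 b l j /\ (m <= l + (a - j))%N) t y (la * x i)) ->
  (m <= b + a)%N /\ box_data a e (b + a - m) t (y * t) (la * t ^+ a / t ^+ m).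
Proof.
move=> [h la0 _] hx; have t0 := pure_neq0 h.
have le_m : (m <= b + a)%N.
  rewrite leqNgt; apply/negP => lt_b; apply: (not_divisible h la0) => i.
  apply: mspan_sub (hx i) => l j [[le_j le_l] le_m]; rewrite le_j andbT lt0n.
  apply/eqP => j0; move: le_l le_m lt_b; rewrite j0 muln0 subn0 addn0; lia.
split=> //.
have h' : pure t (y * t) by have := pure_mulX 1 h; rewrite expr1.
apply: (box_change h' la0 _ hx) => //; first by rewrite !mulf_neq0 ?invr_eq0 ?expf_neq0.
  move=> l j [[le_j le_l] le_ml].
  have -> : la * t ^+ a / t ^+ m / la * (t ^+ l * y ^+ j) = t ^+ (l + (a - j) - m) * (y * t) ^+ j.
    have e1 : t ^+ (l + (a - j) - m) * t ^+ m = t ^+ l * t ^+ (a - j) by rewrite -!exprD subnK.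
    rewrite exprMn -[in t ^+ a](subnK le_j) exprD; move: e1; have := expf_neq0 m t0.
    move: (t ^+ (l + (a - j) - m)) (t ^+ m) (t ^+ l) (t ^+ j) (t ^+ (a - j)) (y ^+ j) => p q r s s' z q0 e1.
    apply: (mulIf q0); transitivity (r * s' * s * z); first by field; rewrite q0 la0.
    by rewrite -e1; ring.
  apply: mspan_monomial; split=> //.
  move: le_l le_m le_ml le_j; rewrite mulSn; move: (e * j)%N => p; lia.
Qed.

Lemma remove_fibre e b t y la : box_data a e b t y la ->
  (forall i, mspan iota (fun l j => box a e b l j /\ (0 < l)%N) t y (la * x i)) ->
  (0 < b)%N /\ box_data a e b.-1 t y (la / t).
Proof.
move=> [h la0 _] hx; have t0 := pure_neq0 h.
have b_gt0 : (0 < b)%N.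
  rewrite lt0n; apply/negP => /eqP b0; apply: (not_divisible h la0) => i.
  apply: mspan_sub (hx i) => l j [[le_j le_l] le_m]; rewrite le_j andbT lt0n.
  apply/eqP => j0; move: le_l le_m; rewrite j0 muln0 b0; lia.
split=> //.
apply: (box_change h la0 _ hx) => //; first by rewrite !mulf_neq0 ?invr_eq0.
  move=> l j [[le_j le_l] l_gt0].
  have -> : la / t / la * (t ^+ l * y ^+ j) = t ^+ l.-1 * y ^+ j.
    rewrite -[in t ^+ l](prednK l_gt0) exprS; field; by rewrite t0 la0.
  apply: mspan_monomial; split=> //.
  move: le_l l_gt0 b_gt0; move: (e * j)%N => p; lia.
Qed.
End Minimal.
End BoxData.

(** * Minimal linear systems on ruled surfaces *)

Section MinimalData.
Context (k : closedFieldType) (K : fieldType) (iota : {rmorphism k -> K}).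
Local Notation ev1 := (ev1 iota).
Local Notation ev := (ev iota).
Context (n : nat) (x : 'I_n.+1 -> K) (x_neq0 : exists i, x i != 0).
Local Notation fibre_data := (fibre_data iota x).
Local Notation box_data := (box_data iota x).
Local Notation pure := (purely_transcendental iota).

Lemma ev1_comp t (p q : {poly k}) : ev1 t (p \Po q) = ev1 (ev1 t q) p.
Proof.
elim/poly_ind: p => [|p c IH]; first by rewrite comp_poly0 !ev10.
by rewrite comp_poly_MXaddC !ev1D !ev1M IH !ev1C ev1X.
Qed.

Lemma ev_shift_inner t y c P :
  ev (t - iota c) y P = ev t y (map_poly (comp_poly ('X - c%:P)) P).
Proof.
elim/poly_ind: P => [|P p IH]; first by rewrite map_poly0 !ev0.
rewrite !(evD, evM) [in RHS](rmorphD (map_poly _)) [in RHS](rmorphM (map_poly _)) /= map_polyX map_polyC /=.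
rewrite !evD !evM IH !evX !evC.
by rewrite ev1_comp ev1B ev1X ev1C.
Qed.

Definition rev_fibre a (P : {poly {poly k}}) : {poly {poly k}} := \poly_(j < a.+1) P`_(a - j).

Lemma ev_rev a (t y : K) (P : {poly {poly k}}) : y != 0 -> (size P <= a.+1)%N ->
  ev t y^-1 (rev_fibre a P) = y^-1 ^+ a * ev t y P.
Proof.
move=> y0 sP; rewrite ev_sum (ev_sum _ _ _ P).
rewrite (big_ord_widen _ (fun l => ev1 t (rev_fibre a P)`_l * y^-1 ^+ l) (size_poly _ _)).
rewrite (big_ord_widen _ (fun l => ev1 t P`_l * y ^+ l) sP).
have full (Q : {poly {poly k}}) z : \sum_(i < a.+1 | (i < size Q)%N) ev1 t Q`_i * z ^+ i =
    \sum_(i < a.+1) ev1 t Q`_i * z ^+ i.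
  rewrite big_mkcond; apply: eq_bigr => i _; case: ltnP => // /(nth_default 0) ->.
  by rewrite ev10 mul0r.
rewrite !full (reindex_inj rev_ord_inj) big_distrr; apply: eq_bigr => i _ /=.
have le_i : (i <= a)%N by rewrite -ltnS.
rewrite coef_poly subSS ltnS leq_subr subKn // mulrCA; congr (_ * _).
by rewrite -[in y^-1 ^+ a](subnK le_i) exprD mulrAC -mulrA !exprVn mulfV ?mulr1 ?expf_neq0.
Qed.

Lemma mspan_size a t y z : mspan iota (fun _ j => j <= a)%N t y z ->
  exists2 P : {poly {poly k}}, (size P <= a.+1)%N & z = ev t y P.
Proof.
case=> P hP ->; exists P => //; apply/leq_sizeP => j lt_j.
by apply/polyP => l; rewrite coef0; apply/eqP; apply: contraT => /hP; rewrite leqNgt lt_j.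
Qed.

Lemma size_mspan a t y (P : {poly {poly k}}) : (size P <= a.+1)%N -> mspan iota (fun _ j => j <= a)%N t y (ev t y P).
Proof.
move=> sP; exists P => // j l; rewrite -ltnS ltnNge; apply: contraNN => /(leq_trans sP) le_j.
by rewrite (nth_default 0 le_j) coef0.
Qed.

(** The part of the surface over finite t. The second clause says that no fibre t = c is a fixed
    component. *)
Definition half_chart (a : nat) (t y la : K) : Prop := fibre_data a t y la /\
  forall c, exists i P, la * x i = ev t y P /\ map_poly (horner_eval c) P != 0.

Lemma half_chart_inv a t y la : half_chart a t y la -> half_chart a t y^-1 (la * y^-1 ^+ a).
Proof.
move=> [[h la0 hx] ht]; have y0 := pure_neq0 (pure_swap h).
split=> [|c].
  split=> [||i]; [exact: pure_inv2|by rewrite mulf_neq0 ?expf_neq0 ?invr_eq0|].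
  have [P sP e] := mspan_size (hx i).
  rewrite mulrAC e mulrC -ev_rev //; apply: size_mspan; exact: size_poly.
have [i [P [e Pc]]] := ht c; have [P' sP e'] := mspan_size (hx i).
have eP : P = P' by apply: (indep_inj (pure_indep h)); rewrite -e -e'.
exists i, (rev_fibre a P); rewrite eP in Pc *; split; first by rewrite mulrAC e' mulrC ev_rev.
apply: contraNneq Pc => /polyP h0; apply/eqP/polyP => j; rewrite coef0 coef_map /=.
have [le_j|lt_j] := leqP j a; last first.
  by rewrite (nth_default 0 (leq_trans sP lt_j)) /horner_eval horner0.
have := h0 (a - j)%N; rewrite coef0 coef_map coef_poly ltnS leq_subr subKn //=.
Qed.

(** If W is not centred at a closed point, either t has a transcendental residue, or t has a residue
    in k and y a transcendental one; the two lemmas of the previous part cover these cases. *)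
Lemma unit_section_half a t y la W : (forall a' t y la, fibre_data a' t y la -> (a <= a')%N) ->
  half_chart a t y la -> val_ring iota W -> W t -> W y ->
  (forall c c', ~ (max_ideal W (t - iota c) /\ max_ideal W (y - iota c'))) -> unit_section x W la.
Proof.
move=> min_a [hd ht] hW Wt Wy nc.
have [tr|[c mc]] := val_ring_residue hW Wt; first exact: (unit_section_transc x_neq0 min_a hd).
have [tr|[c' mc']] := val_ring_residue hW Wy; last by case: (nc c c').
exact: (unit_section_alg hd hW (ht c)).
Qed.

Section Fixed.
Context (a e b : nat) (min_a : forall a' t y la, fibre_data a' t y la -> (a <= a')%N).
Context (min_N : forall e' b' t y la, box_data a e' b' t y la -> (2 * b + a * e <= 2 * b' + a * e')%N).
Context (t y la : K) (h : box_data a e b t y la).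

Lemma minimal_half : half_chart a t y la.
Proof.
split=> [|c]; first exact: (box_fibre h).
have := box_shift c h => h'.
apply: contrapT => nP.
suff hx : forall i, mspan iota (fun l j => box a e b l j /\ (0 < l)%N) (t - iota c) y (la * x i).
  have [b_gt0 /min_N] := remove_fibre x_neq0 min_a h' hx.
  move: b_gt0; move: (a * e)%N => q; lia.
move=> i; have [_ _ /(_ i) [P hP eP]] := h'; exists P => // j l Pjl; split; first exact: hP.
rewrite lt0n; apply: contraNneq Pjl => ->.
apply: contrapT => /negP P0; apply: nP; exists i, (map_poly (comp_poly ('X - c%:P)) P).
split; first by rewrite eP ev_shift_inner.
apply: contraNneq P0 => /polyP /(_ j); rewrite coef0 !coef_map /= /horner_eval.
by rewrite horner_comp !hornerE subrr horner_coef0 => ->.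
Qed.

(** With m = a./2 + 1 the change a - 2 m is negative, so an elementary transformation would
    contradict the minimality of 2 b + a e. *)
Lemma origin_multiplicity : exists i P j l,
  [/\ la * x i = ev t y P, P`_j`_l != 0 & (l + j <= a./2)%N].
Proof.
apply: contrapT => nP.
suff hx : forall i, mspan iota (fun l j => box a e b l j /\ (a./2.+1 <= l + j)%N) t y (la * x i).
  have [le_m /min_N] := elementary_zero x_neq0 min_a h hx.
  move: le_m; rewrite mulnS; have := odd_double_half a; move: (a * e)%N (odd a) => q o; lia.
move=> i; have [_ _ /(_ i) [P hP eP]] := h; exists P => // j l Pjl; split; first exact: hP.
by rewrite ltnNge; apply/negP => le_m; apply: nP; exists i, P, j, l.
Qed.
End Fixed.

Section Fixed2.
Context (a e b : nat) (min_a : forall a' t y la, fibre_data a' t y la -> (a <= a')%N).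
Context (min_N : forall e' b' t y la, box_data a e' b' t y la -> (2 * b + a * e <= 2 * b' + a * e')%N).
Context (t y la : K) (h : box_data a e b t y la).

Lemma zero_multiplicity c : exists i P j l,
  [/\ la * x i = ev (t - iota c) y P, P`_j`_l != 0 & (l + j <= a./2)%N].
Proof. exact: (origin_multiplicity min_a min_N (box_shift c h)). Qed.

(** A translation brings the point to y = infinity. For e > 0 the transformation lowering e applies;
    for e = 0 the two ends of the fibre are exchanged first. *)
Lemma infty_multiplicity c c' : exists i P j l,
  [/\ la * y^-1 ^+ a * x i = ev (t - iota c) (y^-1 - iota c') P, P`_j`_l != 0 & (l + j <= a./2)%N].
Proof.
have [hty la0 _] := h; have y0 := pure_neq0 (pure_swap hty).
have ey : ((y^-1 - iota c')^-1)^-1 = y^-1 - iota c' by rewrite invrK.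
have := box_shift_infty (box_shift c h) ey.
set t' := t - iota c; set y' := _^-1; set la' := la * _ => h'.
have [hty' _ hx] := h'; have y0' := pure_neq0 (pure_swap hty').
have ela : la * y^-1 ^+ a = la' * y'^-1 ^+ a.
  rewrite /la' expr_div_n [y^-1 ^+ a]exprVn [y'^-1 ^+ a]exprVn.
  have := expf_neq0 a y0; have := expf_neq0 a y0'; move: (y ^+ a) (y' ^+ a) => p q q0 p0.
  by field; rewrite q0 p0.
rewrite ela -ey -/y'.
have [e0|e_gt0] := posnP e.
  have h0 : box_data a e b t' y'^-1 (la' * y'^-1 ^+ a).
    by move: h'; rewrite e0; exact: box_inv_fibre.
  exact: (origin_multiplicity min_a min_N h0).
apply: contrapT => nP.
have h1 : box_data a e.-1.+1 b t' y' la' by rewrite prednK.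
suff hx1 : forall i, mspan iota (fun l j => box a e.-1.+1 b l j /\ (a./2.+1 <= l + (a - j))%N) t' y' (la' * x i).
  have [le_m /min_N] := elementary_infty x_neq0 min_a h1 hx1.
  move: le_m; have := odd_double_half a; rewrite -[in (a * e)%N](prednK e_gt0) mulnS; move: (a * e.-1)%N (odd a) => q o; lia.
move=> i; have [P hP eP] := hx i; exists P => // j l Pjl.
have [le_j le_l] := hP _ _ Pjl; rewrite prednK //; split=> //.
have sP : (size P <= a.+1)%N.
  apply/leq_sizeP => j' lt_j; apply/polyP => l'; rewrite coef0; apply/eqP; apply: contraT => /hP [].
  by rewrite leqNgt lt_j.
rewrite ltnNge; apply/negP => le_m; apply: nP; exists i, (rev_fibre a P), (a - j)%N, l; split=> //.
  by rewrite mulrAC eP mulrC ev_rev.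
by rewrite coef_poly ltnS leq_subr subKn.
Qed.
End Fixed2.

(** The degree a is minimized first, and 2 b + a e only among systems of this degree. Any
    polynomials in t and y fit into a box with e = 0, which starts the second choice. *)
Lemma exists_minimal_data : rational_surface iota -> exists a e b t y la,
  [/\ box_data a e b t y la, forall a' t y la, fibre_data a' t y la -> (a <= a')%N &
      forall e' b' t y la, box_data a e' b' t y la -> (2 * b + a * e <= 2 * b' + a * e')%N].
Proof.
case=> s [t hst].
have /choice [f hf] : forall i, exists PQ : {poly {poly k}} * {poly {poly k}},
    ev s t PQ.2 != 0 /\ x i = ev s t PQ.1 / ev s t PQ.2 by move=> i; exact: pure_frac.
pose la := \prod_i ev s t (f i).2.
have la0 : la != 0 by apply/prodf_neq0 => i _; case: (hf i).
have hk i : kalg iota [set s; t] (la * x i).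
  have sA := kalg_subalg iota [set s; t].
  have kev P : kalg iota [set s; t] (ev s t P) by apply/kalg2E; exists P.
  have [q0 ->] := hf i; rewrite /la (bigD1 i) //=.
  have -> : ev s t (f i).2 * \prod_(j | j != i) ev s t (f j).2 * (ev s t (f i).1 / ev s t (f i).2) =
     ev s t (f i).1 * \prod_(j | j != i) ev s t (f j).2 by field.
  apply: (subalgM sA) => //; elim/big_ind: _ => //; [exact: (subalg1 sA)|exact: (subalgM sA)].
have /choice [P hP] : forall i, exists P, la * x i = ev s t P by move=> i; have /kalg2E := hk i.
have ex_a : exists a, `[< exists t y la, fibre_data a t y la >].
  exists (\sum_i size (P i))%N; apply/asboolP; exists s, t, la; split=> // i.
  rewrite hP; apply: size_mspan; rewrite ltnW // ltnS (bigD1 i) //= leq_addr //.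
have [a /asboolP [t0 [y0 [la1 hd]]] min_a] := ex_minnP ex_a.
have {}min_a a' t' y' la' : fibre_data a' t' y' la' -> (a <= a')%N.
  by move=> h; apply: min_a; apply/asboolP; exists t', y', la'.
have ex_b : exists b, box_data a 0 b t0 y0 la1.
  have [hp l0 hx] := hd; have /choice [Q hQ] : forall i, exists Q : {poly {poly k}}, (size Q <= a.+1)%N /\ la1 * x i = ev t0 y0 Q.
    by move=> i; have [Q] := mspan_size (hx i); exists Q.
  exists (\sum_i \sum_(j < size (Q i)) size ((Q i)`_j)%R)%N; split=> // i.
  have [sQ ->] := hQ i.
  exists (Q i) => // j l Qjl; rewrite /box mul0n addn0.
  have lt_j : (j < size (Q i))%N.
    by rewrite ltnNge; apply: contraNN Qjl => le; rewrite (nth_default 0 le) coef0.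
  split; first by rewrite -ltnS (leq_trans lt_j).
  have lt_l : (l < size ((Q i)`_j)%R)%N.
    by rewrite ltnNge; apply: contraNN Qjl => le; rewrite (nth_default 0 le).
  by rewrite (bigD1 i) //= (bigD1 (Ordinal lt_j)) //= -addnA (leq_trans (ltnW lt_l)) ?leq_addr.
have ex_N : exists N, `[< exists e b t y la, box_data a e b t y la /\ N = (2 * b + a * e)%N >].
  by case: ex_b => b hb; exists (2 * b + a * 0)%N; apply/asboolP; exists 0%N, b, t0, y0, la1.
have [N /asboolP [e [b [t' [y' [la' [hb eN]]]]]] minN] := ex_minnP ex_N.
exists a, e, b, t', y', la'; split=> // e' b' t2 y2 la2 h2; rewrite -eN.
by apply: minN; apply/asboolP; exists e', b', t2, y2, la2.
Qed.
End MinimalData.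

Section Domination.
Context (k : closedFieldType) (K : fieldType) (iota : {rmorphism k -> K}).
Local Notation ev1 := (ev1 iota).
Local Notation ev := (ev iota).
Local Notation pure := (purely_transcendental iota).

Lemma der_exp0 D z l : kderivation iota D -> D z = 0 -> D (z ^+ l) = 0.
Proof.
move=> hD Dz; elim: l => [|l IH]; first by rewrite expr0 (der1 hD).
by rewrite exprS (derM hD) Dz IH mul0r mulr0 addr0.
Qed.

Lemma jacobian_mulX J (t y : K) l : biderivation iota J -> J t (y * t ^+ l) = J t y * t ^+ l.
Proof.
move=> hJ; rewrite (derM (bider_r hJ t)) (der_exp0 _ (bider_r hJ t)) ?mulr0 ?addr0 //.
exact: (bider_alt hJ).
Qed.

Lemma jacobian_inv1 J (t y : K) : biderivation iota J -> t != 0 -> J t^-1 y = - J t y / t ^+ 2.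
Proof. by move=> hJ t0; rewrite -(derV (bider_l hJ y)). Qed.

Lemma jacobian_inv2 J (t y : K) : biderivation iota J -> y != 0 -> J t y^-1 = - J t y / y ^+ 2.
Proof. by move=> hJ y0; rewrite -(derV (bider_r hJ t)). Qed.

Lemma dominates_chart (O : set K) u v zs t y : regular_point iota O u v zs -> O t -> O y ->
  exists2 O', affine_model (kalg iota [set t; y]) O' & dominates O O'.
Proof.
move=> hO Ot Oy; set A := kalg iota [set t; y].
have sA : subalg iota A := kalg_subalg iota _; have sO := rp_sub hO.
have AO : A `<=` O by apply: (kalg_min sO) => _ [->|->].
have nm1 : ~ max_ideal O 1 by case=> O1 /(_ 1 O1); rewrite mulr1.
have m0 : max_ideal O 0.
  split=> [|g _]; first exact: (subalg0 sO).
  by rewrite mul0r => /eqP; rewrite eq_sym oner_eq0.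
have hm : maximal_ideal A [set z | A z /\ max_ideal O z].
  split=> //.
  - by move=> z [].
  - split; first by split=> //; exact: (subalg0 sA).
    by move=> a b [Aa ma] [Ab mb]; split; [exact: (subalgD sA)|exact: (rp_maxD hO)].
  - move=> a b Aa [Ab mb]; split; first exact: (subalgM sA).
    by rewrite mulrC; apply: (max_idealM sO) => //; apply: AO.
  - by case=> _ /nm1.
  move=> a Aa na; have [c mc] := rp_res hO (AO _ Aa).
  have c0 : c != 0.
    by apply/eqP => c0; apply: na; split=> //; move: mc; rewrite c0 rmorph0 subr0.
  exists (iota c^-1); first exact: (subalgC sA).
  split; first by apply: (subalgB sA); [exact: (subalg1 sA)|apply: (subalgM sA) => //; exact: (subalgC sA)].
  have -> : 1 - a * iota c^-1 = (a - iota c) * - iota c^-1.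
    by rewrite mulrN mulrBl -rmorphM mulfV // rmorph1 opprB.
  by apply: (max_idealM sO) => //; apply: (subalgN sO); exact: (subalgC sO).
exists (localization A [set z | A z /\ max_ideal O z]); first by exists [set z | A z /\ max_ideal O z].
have hu b : A b -> ~ (A b /\ max_ideal O b) -> O b^-1.
  move=> Ab nb; have Ob := AO _ Ab.
  by have [|_ //] := max_ideal_unit Ob; move=> mb; apply: nb.
split=> [_ [a [b [Aa Ab nb ->]]]|z /(loc_maxP hm) [a [b [[Aa ma] Ab nb ->]]]].
  by apply: (subalgM sO); [exact: AO|exact: hu].
by apply: (max_idealM sO) => //; exact: hu.
Qed.
End Domination.

(** * The Noether-Fano argument on F_e *)

Section CaseOne.
Context (k : closedFieldType) (K : fieldType) (iota : {rmorphism k -> K}).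
Local Notation ev1 := (ev1 iota).
Local Notation ev := (ev iota).
Local Notation pure := (purely_transcendental iota).
Context (n : nat) (x : 'I_n.+1 -> K) (x_neq0 : exists i, x i != 0).
Local Notation fibre_data := (fibre_data iota x).
Local Notation box_data := (box_data iota x).

(** For a = 0 all ratios of coordinates would lie in k(t), which does not contain y. *)
Lemma fibre_degree_gt0 a t y la :
  kfield iota [set z | exists i j, x i != 0 /\ z = x j / x i] = setT ->
  fibre_data a t y la -> (0 < a)%N.
Proof.
move=> full [h la0 hx]; rewrite lt0n; apply/eqP => a0.
have hp i : exists p, la * x i = ev1 t p.
  have [P sP ->] := mspan_size (hx i); rewrite a0 in sP.
  by exists P`_0; rewrite {1}(size1_polyC sP) evC.
have sA : subalg iota (kalg iota [set t; t]) := kalg_subalg iota _.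
have hA p : kalg iota [set t; t] (ev1 t p) by apply: (subalg_ev1 sA); apply: kalg_gen; left.
have [|A [B [AA AB B0 ey]]] := frac_full_gen sA _ full y.
  move=> _ [i [j [xi ->]]]; have [p ep] := hp i; have [q eq] := hp j.
  exists (ev1 t q), (ev1 t p); split=> //; rewrite -?ep ?mulf_neq0 //.
  by rewrite -eq -mulf_div divff // mul1r.
have hA' z : kalg iota [set t; t] z -> exists p, z = ev1 t p.
  elim=> {z} [c|z|z w _ [p ->] _ [q ->]|z w _ [p ->] _ [q ->]].
  - by exists c%:P; rewrite ev1C.
  - by move=> hz; exists 'X; rewrite ev1X; case: hz.
  - by exists (p + q); rewrite ev1D.
  - by exists (p * q); rewrite ev1M.
have [p ep] := hA' _ AA; have [q eq] := hA' _ AB.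
have e0 : ev t y (q%:P * 'X - p%:P) = 0.
  by rewrite evB evM !evC evX -eq -ep ey mulrC divfK // subrr.
have := pure_indep h e0 => /polyP /(_ 1%N).
rewrite coefB coefMX coef0 !coefC /= subr0 => q0.
by move: B0; rewrite eq q0 ev10 eqxx.
Qed.

Context (a e b : nat) (min_a : forall a' t y la, fibre_data a' t y la -> (a <= a')%N).
Context (min_N : forall e' b' t y la, box_data a e' b' t y la -> (2 * b + a * e <= 2 * b' + a * e')%N).
Context (O : set K) (u v : K) (zs : seq K) (hO : regular_point iota O u v zs).
Context (i0 : 'I_n.+1) (xi0 : x i0 != 0) (Ox : forall j, O (x j / x i0)).
Context (J : K -> K -> K) (hJ : biderivation iota J).
Local Notation kap := (J u v).

Lemma ineq_finite t y la w : box_data a e b t y la -> divisorial iota O w -> vge w 0 t ->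
  w kap *+ a + w (la * x i0) *+ 2 <= w (J t y) *+ a.
Proof.
move=> h dw wt; have [hty la0 _] := h; have [hw _ _] := dw.
have y0 := pure_neq0 (pure_swap hty).
have le_a : (2 * a./2 <= a)%N by rewrite mul2n -[leqRHS](odd_double_half a) leq_addl.
have hc := minimal_half x_neq0 min_a min_N h.
have hop t' y' la' : half_chart iota x a t' y' la' -> vge w 0 t' -> vge w 0 y' ->
    (forall c c', ~ (vge w 1 (t' - iota c) /\ vge w 1 (y' - iota c'))) -> unit_section x (vge w 0) la'.
  move=> hh wt' wy' nc; apply: (unit_section_half x_neq0 min_a hh (val_ring_vge hw)) => // c c'.
  by case=> /(max_ideal_vge _ hw) m1 /(max_ideal_vge _ hw) m2; apply: (nc c c').
have [y_gt0|y_le0] := ltP 0 (w y).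
  have wy : vge w 0 y by right; exact: ltW.
  apply: (chart_ineq hO xi0 Ox hJ hty dw wt wy la0 le_a); last exact: hop.
  (* As y has positive value, only c' = 0 occurs; the other points of the fibre are treated in the
     chart 1 / y. *)
  move=> c c' _ wc'; have -> : c' = 0.
    apply: contrapT => /eqP c0; have : vge w 1 (iota c').
      have -> : iota c' = y - (y - iota c') by rewrite subKr.
      apply: (val_D hw); first by right; rewrite -gtz0_ge1.
      exact: (vgeN hw).
    by rewrite vgeP ?fmorph_eq0 // (val_C hw).
  by rewrite rmorph0 subr0; exact: (zero_multiplicity x_neq0 min_a min_N h).
have wy : vge w 0 y^-1 by right; rewrite (val_V hw) // oppr_ge0.
have la0' : la * y^-1 ^+ a != 0 by rewrite mulf_neq0 ?expf_neq0 ?invr_eq0.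
have := chart_ineq hO xi0 Ox hJ (pure_inv2 hty) dw wt wy la0' le_a.
have J0 := jacobian_neq0 hJ hty.
rewrite (jacobian_inv2 _ hJ y0) !(val_M hw) ?(val_V hw) ?(val_N hw) ?(val_X hw) ?mulf_neq0 ?expf_neq0 ?invr_eq0 ?oppr_eq0 //; last by rewrite expf_neq0.
rewrite ?(val_V hw y0) mulNrn => H.
have {H} := H _ (hop _ _ _ (half_chart_inv hc) wt wy).
have hin : forall c c' : k, vge w 1 (t - iota c) -> vge w 1 (y^-1 - iota c') ->
  exists i P j l, [/\ la * y^-1 ^+ a * x i = ev (t - iota c) (y^-1 - iota c') P, P`_j`_l != 0 & (l + j <= a./2)%N].
  by move=> c c' _ _; exact: (infty_multiplicity x_neq0 min_a min_N h).
move=> /(_ hin).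
(* Passing to 1 / y multiplies both (J t y)^a and (la x)^2 by y^(- 2 a), up to sign, so the
   inequality is unchanged. *)
rewrite !mulrnDl !mulNrn -!mulrnA [(2 * a)%N]mulnC; move: (w y *+ _) => z.
by rewrite [_ - z + _]addrAC addrA lerD2r.
Qed.

(** Where t has a pole the chart at infinity adds w(t) (2 b + a e - 2 a) to the right-hand side,
    which is not positive by hypothesis: a K + 2 L is a nonnegative multiple of a fibre. *)
Lemma ineq_all t y la w : (2 * a <= 2 * b + a * e)%N -> box_data a e b t y la -> divisorial iota O w ->
  w kap *+ a + w (la * x i0) *+ 2 <= w (J t y) *+ a.
Proof.
move=> le_N h dw; have [hty la0 _] := h; have [hw _ _] := dw; have t0 := pure_neq0 hty.
have [t_ge0|t_lt0] := leP 0 (w t); first by apply: ineq_finite => //; right.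
have wt : vge w 0 t^-1 by right; rewrite (val_V hw) // oppr_ge0 ltW.
have := ineq_finite (box_inv h) dw wt; have J0 := jacobian_neq0 hJ hty.
rewrite (jacobian_inv1 _ hJ t0) (jacobian_mulX _ _ _ hJ).
rewrite !(val_M hw) ?(val_V hw) ?(val_N hw) ?(val_X hw) ?mulf_neq0 ?expf_neq0 ?invr_eq0 ?oppr_eq0 //; try by rewrite ?mulf_neq0 ?expf_neq0.
rewrite !(val_M hw) ?(val_V hw) ?(val_X hw) ?expf_neq0 ?invr_eq0 //; try by rewrite ?mulf_neq0 ?expf_neq0.
have le_T : w t *+ (2 * b + a * e) <= w t *+ (2 * a) by apply: ler_wnMn2l => //; exact: ltW.
rewrite mulnC [(a * e)%N]mulnC mulrnDr in le_T.
rewrite !mulrnDl !mulNrn -!mulrnA; move: le_T.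
move: (w kap *+ a) (w la *+ 2) (w (x i0) *+ 2) (w (J t y) *+ a) (w t *+ (b * 2)) (w t *+ (e * a)) (w t *+ (2 * a)); clear.
by move=> p1 p2 p3 p4 p5 p6 p7; lia.
Qed.

(** The section of a K + 2 L given by dt ^ dy and 1 / la, written in the local bases du ^ dv and x
    i0 at the point O of X. *)
Definition adjoint_section (t y la : K) : K := J t y ^+ a / (kap ^+ a * (la * x i0) ^+ 2).

Lemma adjoint_regular t y la : (2 * a <= 2 * b + a * e)%N -> box_data a e b t y la ->
  O (adjoint_section t y la).
Proof.
move=> le_N h; apply: contrapT => /(divisorial_criterion hO) [w [dw]].
have [hw _ _] := dw; have [hty la0 _] := h; have J0 := jacobian_neq0 hJ hty.
have [kap0 _] := jacobian_generator hO hJ.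
have lx0 : la * x i0 != 0 by rewrite mulf_neq0.
rewrite ltNge => /negP; apply; rewrite /adjoint_section (val_M hw) ?invr_eq0 ?mulf_neq0 ?expf_neq0 //.
rewrite (val_V hw) ?mulf_neq0 ?expf_neq0 // (val_M hw (expf_neq0 a kap0)) ?expf_neq0 // !(val_X hw) // subr_ge0.
exact: ineq_all.
Qed.

Section Point.
Context (t y la : K) (h : box_data a e b t y la) (a_gt0 : (0 < a)%N).
Context (OXi : O (adjoint_section t y la)).
Let hty : pure t y. Proof. by have [] := h. Qed.
Let hc := minimal_half x_neq0 min_a min_N h.

Let adjoint_inv : adjoint_section t y^-1 (la * y^-1 ^+ a) = (-1) ^+ a * adjoint_section t y la.
Proof.
have y0 := pure_neq0 (pure_swap hty); have [kap0 _] := jacobian_generator hO hJ.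
have la0 : la != 0 by have [] := h.
rewrite /adjoint_section (jacobian_inv2 _ hJ y0) mulNr -mulN1r !exprMn !exprVn -[(y ^+ 2) ^+ a]exprM [(2 * a)%N]mulnC exprM.
have := expf_neq0 a y0; have := expf_neq0 a kap0; have := expf_neq0 2 la0; have := expf_neq0 2 xi0.
move: (y ^+ a) (kap ^+ a) (la ^+ 2) (x i0 ^+ 2) (J t y ^+ a) ((-1) ^+ a) => p q r s z z' s0 r0 q0 p0.
by field; rewrite p0 q0 r0 s0.
Qed.

(** Otherwise a dominating W exists in which t has a transcendental residue. It contains y or 1 / y,
    and the adjoint section, regular on X, violates [chart_dominate]. *)
Lemma base_point : O t \/ O t^-1.
Proof.
apply: contrapT => /not_orP [nt nt'].
have [W [hW OW dom tr]] := transcendental_residue hO nt nt'.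
have y0 := pure_neq0 (pure_swap hty); have sW : subalg iota W by case: hW.
have nc y' : W y' -> forall c c', ~ (max_ideal W (t - iota c) /\ max_ideal W (y' - iota c')).
  move=> _ c _ [mc _]; have p0 : 'X - c%:P != 0 :> {poly k} by rewrite polyXsubC_eq0.
  by apply: (residue_transc_nmax tr p0); rewrite ev1B ev1X ev1C.
have Wt : W t by have [|_] := @tr ('X : {poly k}); rewrite ?polyX_eq0 ?ev1X.
have [Wy|Wy] := hW.2 y y0.
  have us := unit_section_half x_neq0 min_a hc hW Wt Wy (nc _ Wy).
  by apply: (chart_dominate hO xi0 hJ hty hW OW dom tr Wy us a_gt0 (s := 2)); apply: OW.
have us := unit_section_half x_neq0 min_a (half_chart_inv hc) hW Wt Wy (nc _ Wy).
apply: (chart_dominate hO xi0 hJ (pure_inv2 hty) hW OW dom tr Wy us a_gt0 (s := 2)).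
rewrite -/(adjoint_section _ _ _) adjoint_inv; apply: (subalgM sW); last exact: OW.
by apply: (subalgX sW); apply: (subalgN sW); exact: (subalg1 sW).
Qed.

(** The same argument with the roles of t and y exchanged; J only changes its sign. *)
Lemma fibre_point : O t -> O y \/ O y^-1.
Proof.
move=> Ot; apply: contrapT => /not_orP [ny ny'].
have [W [hW OW dom tr]] := transcendental_residue hO ny ny'.
have Wt := OW _ Ot; have Wy : W y by have [|_] := @tr ('X : {poly k}); rewrite ?polyX_eq0 ?ev1X.
have sW : subalg iota W by case: hW.
have nc : forall c c', ~ (max_ideal W (t - iota c) /\ max_ideal W (y - iota c')).
  move=> _ c [_ mc]; have p0 : 'X - c%:P != 0 :> {poly k} by rewrite polyXsubC_eq0.
  by apply: (residue_transc_nmax tr p0); rewrite ev1B ev1X ev1C.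
have us := unit_section_half x_neq0 min_a hc hW Wt Wy nc.
apply: (chart_dominate hO xi0 hJ (pure_swap hty) hW OW dom tr Wt us a_gt0 (s := 2)).
rewrite (bider_anti t y hJ) -mulN1r exprMn -mulrA; apply: (subalgM sW); last exact: OW.
by apply: (subalgX sW); apply: (subalgN sW); exact: (subalg1 sW).
Qed.

Lemma dominated_finite : O t -> exists2 O', (affine_model (kalg iota [set t; y]) `|`
   affine_model (kalg iota [set t; y^-1])) O' & dominates O O'.
Proof.
move=> Ot; have [Oy|Oy] := fibre_point Ot.
  by have [O' h' d] := dominates_chart hO Ot Oy; exists O' => //; left.
by have [O' h' d] := dominates_chart hO Ot Oy; exists O' => //; right.
Qed.
End Point.

Lemma dominated_hirzebruch t y la : (2 * a <= 2 * b + a * e)%N -> (0 < a)%N -> box_data a e b t y la ->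
  exists2 O', hirzebruch_model iota e t y O' & dominates O O'.
Proof.
move=> le_N a_gt0 h; have OXi := adjoint_regular le_N h.
have [Ot|Ot] := base_point h a_gt0 OXi.
  have [O' [h'|h'] d] := dominated_finite h a_gt0 OXi Ot; exists O' => //.
    by left; left; left.
  by left; left; right.
have h' := box_inv h; have OXi' := adjoint_regular le_N h'.
have [O' [h1|h1] d] := dominated_finite h' a_gt0 OXi' Ot; exists O' => //.
  by left; right.
by right.
Qed.
End CaseOne.

(** * Linear systems on the plane *)

Section PlaneData.
Context (k : closedFieldType) (K : fieldType) (iota : {rmorphism k -> K}).
Local Notation ev1 := (ev1 iota).
Local Notation ev := (ev iota).
Local Notation pure := (purely_transcendental iota).
Context (n : nat) (x : 'I_n.+1 -> K) (x_neq0 : exists i, x i != 0).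
Local Notation fibre_data := (fibre_data iota x).
Local Notation box_data := (box_data iota x).

Definition plane_data (D : nat) (al be mu : K) : Prop :=
  [/\ pure al be, mu != 0 & forall i, mspan iota (fun l j => l + j <= D)%N al be (mu * x i)].

Lemma plane_shift1 D al be mu c : plane_data D al be mu -> plane_data D (al - iota c) be mu.
Proof.
move=> [h mu0 hx]; split=> // [|i]; first exact: pure_shift1.
rewrite -[mu]mul1r -mulrA; apply: mspan_change (hx i) => l j le_D; rewrite mul1r.
rewrite -[X in X ^+ l](subrK (iota c)).
have hj : mspan iota (fun l' j' => l' = 0%N /\ j' = j) (al - iota c) be (be ^+ j).
  by have := @mspan_monomial _ _ iota (fun l' j' => l' = 0%N /\ j' = j) (al - iota c) be 0 j; rewrite mul1r; apply.
apply: (mspanM _ (mspan_shift1 iota (al - iota c) be c l) hj).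
move=> p q p' q' [le_p ->] [-> ->]; rewrite addn0 add0n.
by apply: leq_trans le_D; rewrite leq_add2r.
Qed.

Lemma plane_swap D al be mu : plane_data D al be mu -> plane_data D be al mu.
Proof.
move=> [h mu0 hx]; split=> // [|i]; first exact: pure_swap.
by apply: mspan_sub (mspan_swap (hx i)) => l j; rewrite addnC.
Qed.

Lemma plane_shift D al be mu c c' : plane_data D al be mu -> plane_data D (al - iota c) (be - iota c') mu.
Proof. by move=> /(plane_shift1 c)/plane_swap/(plane_shift1 c')/plane_swap. Qed.

Lemma pure_ratio al be : pure al be -> pure (be / al) al.
Proof. by move=> h; apply: pure_swap; have := pure_divX 1 h; rewrite expr1. Qed.

Lemma plane_infty D al be mu : plane_data D al be mu -> plane_data D al^-1 (be / al) (mu * al^-1 ^+ D).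
Proof.
move=> [h mu0 hx]; have al0 := pure_neq0 h.
split=> [||i].
- by apply/pure_swap/pure_inv2/pure_ratio.
- by rewrite mulf_neq0 ?expf_neq0 ?invr_eq0.
have -> : mu * al^-1 ^+ D * x i = al^-1 ^+ D * (mu * x i) by ring.
apply: mspan_change (hx i) => l j le_D.
have -> : al^-1 ^+ D * (al ^+ l * be ^+ j) = al^-1 ^+ (D - (l + j)) * (be / al) ^+ j.
  rewrite -[in al^-1 ^+ D](subnK le_D) !exprD !exprVn expr_div_n; have := expf_neq0 l al0; have := expf_neq0 j al0.
  have := expf_neq0 (D - (l + j)) al0; move: (al ^+ _) (al ^+ l) (al ^+ j) (be ^+ j) => p q r s p0 r0 q0.
  by field; rewrite p0 q0 r0.
by apply: mspan_monomial; lia.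
Qed.

(** Contraction of the negative section y = 0 of F_1: t becomes the pencil of lines through the
    origin, and the system acquires degree a + b. *)
Lemma plane_of_box a b t y la : box_data a 1 b t y la -> plane_data (a + b) y (y * t) (la * y ^+ b).
Proof.
move=> [h la0 hx]; have y0 := pure_neq0 (pure_swap h).
split=> [||i].
- by have := pure_mulX 1 (pure_swap h); rewrite expr1 mulrC.
- by rewrite mulf_neq0 ?expf_neq0.
have -> : la * y ^+ b * x i = y ^+ b * (la * x i) by ring.
apply: mspan_change (hx i) => l j [le_j]; rewrite mul1n => le_l.
have -> : y ^+ b * (t ^+ l * y ^+ j) = y ^+ (b + j - l) * (y * t) ^+ l.
  rewrite exprMn mulrCA -exprD [RHS]mulrCA mulrA -[in LHS](subnK le_l) exprD; ring.
by apply: mspan_monomial; move: le_l le_j; lia.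
Qed.

Lemma box_of_plane a al be mu : plane_data a al be mu -> box_data a 1 0 (be / al) al mu.
Proof.
move=> [h mu0 hx]; have al0 := pure_neq0 h.
split=> // [|i]; first exact: pure_ratio.
rewrite -[mu]mul1r -mulrA; apply: mspan_change (hx i) => l j le_D; rewrite mul1r.
have -> : al ^+ l * be ^+ j = (be / al) ^+ j * al ^+ (l + j).
  by rewrite expr_div_n exprD mulrCA divfK ?expf_neq0.
by apply: mspan_monomial; split=> //; rewrite add0n mul1n leq_addl.
Qed.

(** If the multiplicity at the origin exceeded b, the lines through the origin would form a pencil
    on which the system has degree less than a. *)
Lemma pencil_multiplicity a b al be mu :
  (forall a' t y la, fibre_data a' t y la -> (a <= a')%N) -> (0 < a)%N -> plane_data (a + b) al be mu ->
  exists i P j l, [/\ mu * x i = ev al be P, P`_j`_l != 0 & (l + j <= b)%N].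
Proof.
move=> min_a a_gt0 [h mu0 hx]; have al0 := pure_neq0 h; apply: contrapT => nP.
suff /min_a : fibre_data a.-1 (be / al) al (mu * al^-1 ^+ b.+1) by rewrite leqNgt ltn_predL a_gt0.
split=> [||i]; [exact: pure_ratio|by rewrite mulf_neq0 ?expf_neq0 ?invr_eq0|].
have [P hP eP] := hx i.
have hx' : mspan iota (fun l j => b < l + j <= a + b)%N al be (mu * x i).
  exists P => // j l Plj; rewrite (hP _ _ Plj) andbT ltnNge; apply/negP => le_b.
  by apply: nP; exists i, P, j, l.
have -> : mu * al^-1 ^+ b.+1 * x i = al^-1 ^+ b.+1 * (mu * x i) by ring.
apply: mspan_change hx' => l j /andP[lt_b le_D].
have -> : al^-1 ^+ b.+1 * (al ^+ l * be ^+ j) = (be / al) ^+ j * al ^+ (l + j - b.+1).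
  have e1 : al ^+ (l + j - b.+1) * al ^+ b.+1 = al ^+ l * al ^+ j by rewrite -!exprD subnK.
  rewrite exprVn expr_div_n; move: e1; have := expf_neq0 b.+1 al0; have := expf_neq0 j al0.
  move: (al ^+ b.+1) (al ^+ l) (al ^+ j) (al ^+ (l + j - b.+1)) (be ^+ j) => p q r s z r0 p0 e1.
  apply: (mulIf p0); transitivity (q * z); first by field.
  by rewrite -[RHS]mulrA e1; field.
by apply: mspan_monomial; lia.
Qed.
End PlaneData.

(** * The Noether-Fano argument on the plane *)

Section CaseTwo.
Context (k : closedFieldType) (K : fieldType) (iota : {rmorphism k -> K}).
Local Notation ev1 := (ev1 iota).
Local Notation ev := (ev iota).
Local Notation pure := (purely_transcendental iota).
Context (n : nat) (x : 'I_n.+1 -> K) (x_neq0 : exists i, x i != 0).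
Local Notation fibre_data := (fibre_data iota x).
Local Notation box_data := (box_data iota x).
Context (a b : nat) (min_a : forall a' t y la, fibre_data a' t y la -> (a <= a')%N).
Context (min_N : forall e' b' t y la, box_data a e' b' t y la -> (2 * b + a * 1 <= 2 * b' + a * e')%N).
Context (lt_b : (2 * b < a)%N).
Context (O : set K) (u v : K) (zs : seq K) (hO : regular_point iota O u v zs).
Context (i0 : 'I_n.+1) (xi0 : x i0 != 0) (Ox : forall j, O (x j / x i0)).
Context (J : K -> K -> K) (hJ : biderivation iota J).
Local Notation kap := (J u v).
Local Notation D := (a + b)%N.

Let a_gt0 : (0 < a)%N. Proof. exact: leq_ltn_trans lt_b. Qed.

Lemma unit_section_mul W la z : subalg iota W -> unit_section x W la -> W z -> z != 0 -> W z^-1 ->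
  unit_section x W (la * z).
Proof.
move=> sW [Wx [i [x0 Wi]]] Wz z0 Wz'; split=> [j|]; first by rewrite mulrAC; apply: (subalgM sW).
by exists i; rewrite mulrAC mulf_neq0 // invfM; split=> //; apply: (subalgM sW).
Qed.

Lemma unit_section_plane t y la W : box_data a 1 b t y la -> val_ring iota W -> W t -> W y ->
  (forall c c', ~ (max_ideal W (y - iota c) /\ max_ideal W (y * t - iota c'))) ->
  unit_section x W (la * y ^+ b).
Proof.
move=> h hW Wt Wy nc; have sW : subalg iota W by case: hW.
have hm := val_ring_maximal hW.
have ny : ~ max_ideal W y.
  move=> my; apply: (nc 0 0); rewrite rmorph0 !subr0; split=> //; exact: (maxMr hm).
have [y0 Wy'] := max_ideal_unit Wy ny.
apply: (unit_section_mul sW); [|exact: (subalgX sW)|exact: expf_neq0|by rewrite -exprVn; apply: (subalgX sW)].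
apply: (unit_section_half x_neq0 min_a (minimal_half x_neq0 min_a min_N h) hW Wt Wy) => c c' [mt my].
apply: (nc c' (c' * c)); split=> //.
have -> : y * t - iota (c' * c) = (y - iota c') * t + iota c' * (t - iota c) by rewrite rmorphM; ring.
by apply: (maxD hm); [apply: (maxMr hm)|apply: (maxM hm) => //; exact: (subalgC sW)].
Qed.

(** With D = a + b the class D K + 3 L is trivial on the plane. Multiplicities are at most b, and 3
    b <= a + b because 2 b < a. *)
Lemma plane_ineq t y la w : box_data a 1 b t y la -> divisorial iota O w ->
  w kap *+ D + w (la * y ^+ b * x i0) *+ 3 <= w (y * J t y) *+ D.
Proof.
have le_D : (3 * b <= D)%N by rewrite mulSn addnC leq_add2r ltnW.
have fin t' y' la' : box_data a 1 b t' y' la' -> divisorial iota O w -> vge w 0 t' ->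
    w kap *+ D + w (la' * y' ^+ b * x i0) *+ 3 <= w (y' * J t' y') *+ D.
  move=> {t y la} h dw wt; have [hty la0 _] := h; have [hw _ _] := dw.
  have y0 := pure_neq0 (pure_swap hty); have J0 := jacobian_neq0 hJ hty.
  have hp := plane_of_box h; have [hal mu0 _] := hp.
  have [y_ge0|y_lt0] := leP 0 (w y').
    have wy : vge w 0 y' by right.
    have wyt : vge w 0 (y' * t') by apply: (vgeM0 hw).
    have -> : w (y' * J t' y') = w (J y' (y' * t')).
      rewrite -[y' * t']mulrC -[y' in t' * y']expr1 (jacobian_mulX _ _ _ hJ) expr1.
      by rewrite (bider_anti t' y' hJ) mulNr (val_N hw) mulrC.
    apply: (chart_ineq hO xi0 Ox hJ hal dw wy wyt mu0 le_D).
      move=> c c' _ _; exact: (pencil_multiplicity min_a a_gt0 (plane_shift c c' hp)).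
    move=> nc; apply: (unit_section_plane h (val_ring_vge hw)) => // c c'.
    by case=> /(max_ideal_vge _ hw) m1 /(max_ideal_vge _ hw) m2; apply: (nc c c').
  have wy : vge w 0 y'^-1 by right; rewrite (val_V hw) // oppr_ge0 ltW.
  have hp' := plane_infty hp; have [hal' mu0' _] := hp'.
  have et : y' * t' / y' = t' by rewrite mulrC mulKf.
  rewrite et in hp' hal'.
  have emu : la' * y' ^+ b * y'^-1 ^+ D = la' * y'^-1 ^+ a.
    rewrite exprD mulrA mulrAC !exprVn mulfK ?expf_neq0 //.
  have := chart_ineq hO xi0 Ox hJ hal' dw wy wt mu0' le_D.
  have hin : forall c c' : k, vge w 1 (y'^-1 - iota c) -> vge w 1 (t' - iota c') ->
    exists i P j l, [/\ la' * y' ^+ b * y'^-1 ^+ D * x i = ev (y'^-1 - iota c) (t' - iota c') P, P`_j`_l != 0 & (l + j <= b)%N].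
    by move=> c c' _ _; exact: (pencil_multiplicity min_a a_gt0 (plane_shift c c' hp')).
  move=> /(_ hin).
  have hop : (forall c c', ~ (vge w 1 (y'^-1 - iota c) /\ vge w 1 (t' - iota c'))) ->
      unit_section x (vge w 0) (la' * y' ^+ b * y'^-1 ^+ D).
    move=> nc; rewrite emu.
    apply: (unit_section_half x_neq0 min_a (half_chart_inv (minimal_half x_neq0 min_a min_N h)) (val_ring_vge hw) wt wy) => c c'.
    by case=> /(max_ideal_vge _ hw) m1 /(max_ideal_vge _ hw) m2; apply: (nc c' c).
  move=> /(_ hop).
  rewrite (bider_anti t' y'^-1 hJ) (jacobian_inv2 _ hJ y0) mulNr opprK.
  set Z := la' * y' ^+ b in mu0 *.
  have -> : w (Z * y'^-1 ^+ D * x i0) = w (Z * x i0) - w y' *+ D.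
    have yV0 : y'^-1 != 0 by rewrite invr_eq0.
    by rewrite mulrAC (val_M hw (mulf_neq0 mu0 xi0) (expf_neq0 D yV0)) (val_X hw D yV0) (val_V hw y0) mulNrn.
  have -> : w (J t' y' / y' ^+ 2) = w (J t' y') - w y' *+ 2.
    by rewrite (val_M hw) ?invr_eq0 ?expf_neq0 // (val_V hw) ?expf_neq0 // (val_X hw).
  rewrite (val_M hw y0 J0) !mulrnDl !mulNrn -!mulrnA.
  (* Passing to the line at infinity changes both sides by 3 D w(y'): the form contributes 2 D and
     the factor y' of the plane Jacobian contributes D. *)
  rewrite (_ : (D * 3 = D + 2 * D)%N); last by rewrite mulnC mulSn.
  rewrite mulrnDr; move: (w kap *+ D) (w (Z * x i0) *+ 3) (w y' *+ D) (w y' *+ (2 * D)) (w (J t' y') *+ D).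
  by clear=> p q r s z; lia.
move=> h dw; have [hty la0 _] := h; have [hw _ _] := dw; have t0 := pure_neq0 hty.
have [t_ge0|t_lt0] := leP 0 (w t); first by apply: fin => //; right.
have wt : vge w 0 t^-1 by right; rewrite (val_V hw) // oppr_ge0 ltW.
have := fin _ _ _ (box_inv h) dw wt.
rewrite (jacobian_inv1 _ hJ t0) (jacobian_mulX _ _ _ hJ) !expr1.
have -> : y * t * (- (J t y * t) / t ^+ 2) = - (y * J t y) by field.
rewrite (val_N hw); have -> // : la * t^-1 ^+ b * (y * t) ^+ b = la * y ^+ b.
by rewrite exprMn exprVn; have := expf_neq0 b t0; move: (t ^+ b) => p p0; field.
Qed.

(** The local expression of D K + 3 L at O; y * J t y is, up to sign, the Jacobian of the plane
    coordinates y and y t. *)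
Definition plane_section (t y la : K) : K := (y * J t y) ^+ D / (kap ^+ D * (la * y ^+ b * x i0) ^+ 3).

Lemma plane_regular t y la : box_data a 1 b t y la -> O (plane_section t y la).
Proof.
move=> h; apply: contrapT => /(divisorial_criterion hO) [w [dw]].
have [hw _ _] := dw; have [hty la0 _] := h; have J0 := jacobian_neq0 hJ hty.
have y0 := pure_neq0 (pure_swap hty); have [kap0 _] := jacobian_generator hO hJ.
have lx0 : la * y ^+ b * x i0 != 0 by rewrite !mulf_neq0 ?expf_neq0.
have yJ0 : y * J t y != 0 by rewrite mulf_neq0.
rewrite ltNge => /negP; apply; rewrite /plane_section (val_M hw (expf_neq0 D yJ0)) ?invr_eq0 ?mulf_neq0 ?expf_neq0 //.
rewrite (val_V hw) ?mulf_neq0 ?expf_neq0 // (val_M hw (expf_neq0 D kap0)) ?expf_neq0 // !(val_X hw) // subr_ge0.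
exact: plane_ineq.
Qed.
End CaseTwo.

Section CaseTwoPoint.
Context (k : closedFieldType) (K : fieldType) (iota : {rmorphism k -> K}).
Local Notation ev1 := (ev1 iota).
Local Notation ev := (ev iota).
Local Notation pure := (purely_transcendental iota).
Context (n : nat) (x : 'I_n.+1 -> K) (x_neq0 : exists i, x i != 0).
Local Notation fibre_data := (fibre_data iota x).
Local Notation box_data := (box_data iota x).
Context (a b : nat) (min_a : forall a' t y la, fibre_data a' t y la -> (a <= a')%N).
Context (min_N : forall e' b' t y la, box_data a e' b' t y la -> (2 * b + a * 1 <= 2 * b' + a * e')%N).
Context (lt_b : (2 * b < a)%N).
Context (O : set K) (u v : K) (zs : seq K) (hO : regular_point iota O u v zs).
Context (i0 : 'I_n.+1) (xi0 : x i0 != 0) (Ox : forall j, O (x j / x i0)).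
Context (J : K -> K -> K) (hJ : biderivation iota J).
Local Notation kap := (J u v).
Local Notation D := (a + b)%N.
Local Notation sec := (plane_section x a b u v i0 J).

Definition dominating_transc (t : K) (W : set K) : Prop := [/\ val_ring iota W, O `<=` W,
  forall z, max_ideal O z -> z != 0 -> ~ W z^-1 & residue_transc iota W t].

(** O contains the coordinates of one of the three standard charts of the plane. *)
Definition plane_point (al be : K) : Prop :=
  [\/ O al /\ O be, O al^-1 /\ O (be / al) | O be^-1 /\ O (al / be)].

Let D_gt0 : (0 < D)%N. Proof. by move: lt_b; lia. Qed.

Let residue_nclosed W t : residue_transc iota W t -> forall c, ~ max_ideal W (t - iota c).
Proof.
move=> tr c mc; have p0 : 'X - c%:P != 0 :> {poly k} by rewrite polyXsubC_eq0.
by apply: (residue_transc_nmax tr p0); rewrite ev1B ev1X ev1C.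
Qed.

Let residue_mem W t : residue_transc iota W t -> W t /\ W t^-1.
Proof. by move=> tr; have [|_] := @tr ('X : {poly k}); rewrite ?polyX_eq0 ?ev1X. Qed.

Section Data.
Context (t y la : K) (h : box_data a 1 b t y la).
Let hty : pure t y. Proof. by have [] := h. Qed.
Let hc := minimal_half x_neq0 min_a min_N h.
Let Osec : O (sec t y la) := plane_regular x_neq0 min_a min_N lt_b hO xi0 Ox hJ h.

Let section_unit W : subalg iota W -> W (sec t y la) -> y != 0 -> W y -> W y^-1 ->
  W (J t y ^+ D / (kap ^+ D * (la * x i0) ^+ 3)).
Proof.
move=> sW Ws y0 Wy Wy'; have [kap0 _] := jacobian_generator hO hJ.
have -> : J t y ^+ D / (kap ^+ D * (la * x i0) ^+ 3) = sec t y la * (y^-1 ^+ D * (y ^+ b) ^+ 3).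
  have la0 : la != 0 by have [] := h.
  rewrite /plane_section !exprMn !exprVn; have := expf_neq0 D y0; have := expf_neq0 D kap0.
  have := expf_neq0 3 (expf_neq0 b y0); have := expf_neq0 3 la0; have := expf_neq0 3 xi0.
  move: (y ^+ D) (kap ^+ D) ((y ^+ b) ^+ 3) (la ^+ 3) (x i0 ^+ 3) (J t y ^+ D) => p q r s z z' z0 s0 r0 q0 p0.
  by field; rewrite p0 q0 r0 s0 z0.
by do !apply: (subalgM sW) => //; do ?apply: (subalgX sW).
Qed.

(** The hypothesis keeps W away from the exceptional curve y = 0 of F_1, where the Jacobians of F_1
    and of the plane differ by the non-unit y. *)
Lemma plane_base : (forall W, dominating_transc t W -> ~ max_ideal W y) -> O t \/ O t^-1.
Proof.
move=> Hy; apply: contrapT => /not_orP [nt nt'].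
have [W [hW OW dom tr]] := transcendental_residue hO nt nt'.
have y0 := pure_neq0 (pure_swap hty); have sW : subalg iota W by case: hW.
have [Wt _] := residue_mem tr.
have nc y' : forall c c', ~ (max_ideal W (t - iota c) /\ max_ideal W (y' - iota c')).
  by move=> c c' [/(residue_nclosed tr)].
have [Wy|Wy] := hW.2 y y0.
  have us := unit_section_half x_neq0 min_a hc hW Wt Wy (nc y).
  have [|_ Wy'] := max_ideal_unit Wy; first by apply: Hy.
  by apply: (chart_dominate hO xi0 hJ hty hW OW dom tr Wy us D_gt0 (s := 3)); apply: section_unit => //; apply: OW.
have us := unit_section_half x_neq0 min_a (half_chart_inv hc) hW Wt Wy (nc y^-1).
apply: (chart_dominate hO xi0 hJ (pure_inv2 hty) hW OW dom tr Wy us D_gt0 (s := 3)).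
have [kap0 _] := jacobian_generator hO hJ; have la0 : la != 0 by have [] := h.
have -> : J t y^-1 ^+ D / (kap ^+ D * (la * y^-1 ^+ a * x i0) ^+ 3) = (-1) ^+ D * sec t y la.
  rewrite (jacobian_inv2 _ hJ y0) mulNr -mulN1r /plane_section !exprMn !exprVn.
  have e1 : (y ^+ 2) ^+ D * (y ^+ D) = (y ^+ a) ^+ 3 * (y ^+ b) ^+ 3.
    by rewrite -!exprM -!exprD; congr (_ ^+ _); lia.
  move: e1; have := expf_neq0 D (expf_neq0 2 y0); have := expf_neq0 D kap0; have := expf_neq0 3 (expf_neq0 a y0).
  have := expf_neq0 3 (expf_neq0 b y0); have := expf_neq0 3 la0; have := expf_neq0 3 xi0.
  move: (y ^+ D) (kap ^+ D) ((y ^+ b) ^+ 3) (la ^+ 3) (x i0 ^+ 3) (J t y ^+ D) ((y ^+ a) ^+ 3) ((y ^+ 2) ^+ D) ((-1) ^+ D).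
  move=> p q r s z z' r' p' sg z0 s0 r0 r0' q0 p0' e1.
  apply: (mulfI (mulf_neq0 p0' r0)); transitivity (sg * z' * (r' * r) / (q * s * z)); first by field; rewrite p0' q0 r0' s0 z0.
  by rewrite -e1; field; rewrite q0 r0 s0 z0.
apply: (subalgM sW); last by apply: OW.
by apply: (subalgX sW); apply: (subalgN sW); exact: (subalg1 sW).
Qed.

Lemma plane_fibre : O t -> O y \/ O y^-1.
Proof.
move=> Ot; apply: contrapT => /not_orP [ny ny'].
have [W [hW OW dom tr]] := transcendental_residue hO ny ny'.
have sW : subalg iota W by case: hW.
have Wt := OW _ Ot; have [Wy Wy'] := residue_mem tr; have y0 := pure_neq0 (pure_swap hty).
have nc : forall c c', ~ (max_ideal W (t - iota c) /\ max_ideal W (y - iota c')).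
  by move=> c c' [_ /(residue_nclosed tr)].
have us := unit_section_half x_neq0 min_a hc hW Wt Wy nc.
apply: (chart_dominate hO xi0 hJ (pure_swap hty) hW OW dom tr Wt us D_gt0 (s := 3)).
rewrite (bider_anti t y hJ) -mulN1r exprMn -mulrA; apply: (subalgM sW).
  by apply: (subalgX sW); apply: (subalgN sW); exact: (subalg1 sW).
by apply: section_unit => //; apply: OW.
Qed.
End Data.

Lemma plane_point_of_data t y la : box_data a 1 b t y la ->
  (forall W, dominating_transc t W -> ~ max_ideal W y) -> plane_point y (y * t).
Proof.
move=> h Hy; have [hty _ _] := h; have sO := rp_sub hO.
have y0 := pure_neq0 (pure_swap hty); have t0 := pure_neq0 hty.
have [Ot|Ot] := plane_base h Hy.
  have [Oy|Oy] := plane_fibre h Ot; first by constructor 1; split=> //; apply: (subalgM sO).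
  by constructor 2; split=> //; rewrite mulrC mulKf.
have [|] := plane_fibre (box_inv h) Ot; rewrite expr1 => Oy.
  by constructor 1; split=> //; rewrite -(mulfK t0 y); apply: (subalgM sO).
by constructor 3; split=> //; rewrite invfM mulrA mulfV // mul1r.
Qed.

(* If b > 0 the pencil is blown up at its base point. *)
Lemma base_point_excluded t y la W : (0 < b)%N -> box_data a 1 b t y la -> dominating_transc t W ->
  ~ max_ideal W y.
Proof.
move=> b_gt0 h [hW OW dom tr] my; have [hty la0 _] := h.
have sW : subalg iota W by case: hW.
have hm := val_ring_maximal hW; have [Wy _] := my.
have y0 := pure_neq0 (pure_swap hty); have J0 := jacobian_neq0 hJ hty.
have [kap0 _] := jacobian_generator hO hJ.
have Ws := OW _ (plane_regular x_neq0 min_a min_N lt_b hO xi0 Ox hJ h).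
have hdom z : max_ideal O z -> max_ideal W z.
  move=> mz; have [->|z0] := eqVneq z 0; first exact: (max0 hm).
  by apply/(val_ring_maxP hW z0)/dom.
have mk := val_ring_jacobian hW hty tr Wy hJ J0 (hdom _ (rp_u hO)) (hdom _ (rp_v hO)).
have X0 : 'X != 0 :> {poly {poly k}} by rewrite polyX_eq0.
have [|g Wg eg] := val_ring_max_form hW hty tr Wy X0 mk.
  move=> P mP; exists 0%N, (drop_poly 1 P); rewrite expr0 mul1r.
  have eP := poly_take_drop 1 P; rewrite expr1 in eP.
  have eT : take_poly 1 P = (P`_0)%:P.
    by apply/polyP => i; rewrite coef_take_poly coefC; case: i.
  rewrite eT in eP; have [p0|p0] := eqVneq P`_0 0; first by rewrite -{1}eP p0 polyC0 add0r.
  case: (residue_transc_nmax tr p0).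
  have -> : ev1 t P`_0 = ev t y P - ev t y (drop_poly 1 P) * y.
    by rewrite -{2}eP evD evM evC evX addrK.
  by apply: (maxB sW hm mP); apply: (maxM hm) => //; apply: (subalg_ev sW) => //; have [] := residue_mem tr.
rewrite evX in eg.
have g0 : g != 0.
  by apply: contraNneq kap0 => g0; rewrite -(divfK J0 kap) eg g0 mulr0 mul0r.
have ek : kap = y * g * J t y by rewrite -eg divfK.
have Wx : W (la * x i0).
  by apply: (section_int (box_fibre h) hW); [have [] := residue_mem tr|].
apply: (max1 hm).
have -> : 1 = sec t y la * (la * x i0) ^+ 3 * g ^+ D * (y ^+ b) ^+ 3.
  rewrite /plane_section ek !exprMn; have := expf_neq0 D y0; have := expf_neq0 D J0; have := expf_neq0 D g0.
  have := expf_neq0 3 (expf_neq0 b y0); have := expf_neq0 3 la0; have := expf_neq0 3 xi0.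
  move: (y ^+ D) (g ^+ D) ((y ^+ b) ^+ 3) (la ^+ 3) (x i0 ^+ 3) (J t y ^+ D) => p q r s z z' z0 s0 r0 q0 z0' p0.
  by field; rewrite p0 q0 r0 s0 z0 z0'.
apply: (maxM hm); first by do !apply: (subalgM sW) => //; apply: (subalgX sW).
have -> : (y ^+ b) ^+ 3 = y ^+ (b * 3).-1 * y by rewrite -exprM -exprSr prednK // muln_gt0 b_gt0.
by apply: (maxM hm) => //; apply: (subalgX sW).
Qed.

Lemma poly_nonroot (p : {poly k}) : p != 0 -> exists c, p.[c] != 0.
Proof.
move=> p0; have [/size_poly1P [c c0 ->]|sp] := boolP (size p == 1%N).
  by exists 0; rewrite hornerC.
have [|c] := closed_rootP (p - 1) _.
  rewrite size_polyDl // size_polyN size_poly1 ltn_neqAle eq_sym sp size_poly_gt0 //.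
by rewrite /root !hornerE subr_eq0 => /eqP ec; exists c; rewrite ec oner_neq0.
Qed.

Lemma poly2_nonroot (P : {poly {poly k}}) : P != 0 -> exists c c', ev (iota c) (iota c') P != 0.
Proof.
move=> P0; have lc0 : lead_coef P != 0 by rewrite lead_coef_eq0.
have [c pc] := poly_nonroot lc0.
have Q0 : map_poly (horner_eval c) P != 0.
  apply: contraNneq pc => /polyP /(_ (size P).-1); rewrite coef0 coef_map /= /horner_eval.
  by rewrite -lead_coefE => ->.
have [c' qc] := poly_nonroot Q0; exists c, c'.
by rewrite ev_horner_inner ev1E horner_map fmorph_eq0.
Qed.

(** Membership in the plane does not depend on the choice of the origin of the affine chart. *)
Lemma plane_point_unshift al be c c' : al != 0 -> be != 0 -> al - iota c != 0 -> be - iota c' != 0 ->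
  plane_point (al - iota c) (be - iota c') -> plane_point al be.
Proof.
have sO := rp_sub hO.
have OC d : O (iota d) by apply: (subalgC sO).
have inf f g d d' : f != 0 -> f - iota d != 0 -> O (f - iota d)^-1 -> O ((g - iota d') / (f - iota d)) ->
    (O f /\ O g) \/ (O f^-1 /\ O (g / f)).
  move=> f0 fd0 Os Or; set s := (f - iota d)^-1 in Os Or *.
  have efs : f * s = 1 + iota d * s by rewrite -(mulfV fd0) -/s; ring.
  have egs : g * s = (g - iota d') * s + iota d' * s by ring.
  have Ofs : O (f * s) by rewrite efs; apply: (subalgD sO); [exact: (subalg1 sO)|apply: (subalgM sO)].
  have Ogs : O (g * s) by rewrite egs; apply: (subalgD sO) => //; apply: (subalgM sO).
  have s0 : s != 0 by rewrite invr_eq0.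
  have [mfs|nfs] := EM (max_ideal O (f * s)).
    have [|_ Os'] := max_ideal_unit Os.
      move=> ms; have : max_ideal O 1.
        have -> : 1 = f * s + s * - iota d by rewrite efs; ring.
        apply: (rp_maxD hO mfs); apply: (max_idealM sO ms); exact: (subalgN sO).
      by case=> O1 /(_ 1 O1); rewrite mulr1.
    by left; rewrite -(mulfK s0 f) -(mulfK s0 g); split; apply: (subalgM sO).
  have [_ Ofs'] := max_ideal_unit Ofs nfs; right.
  have -> : f^-1 = s * (f * s)^-1 by rewrite invfM; field; rewrite f0 s0.
  have -> : g * (s * (f * s)^-1) = g * s * (f * s)^-1 by rewrite mulrA.
  by split; apply: (subalgM sO).
move=> al0 be0 al1 be1 [[Oa Ob]|[Oa Ob]|[Ob Oa]].
- by constructor 1; rewrite -(subrK (iota c) al) -(subrK (iota c') be); split; apply: (subalgD sO).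
- by have [] := inf al be c c' al0 al1 Oa Ob; [constructor 1|constructor 2].
by have [[]|] := inf be al c' c be0 be1 Ob Oa; [constructor 1|constructor 3].
Qed.

(** For b > 0 the exceptional curve is excluded by [base_point_excluded]. For b = 0 the base point
    of the pencil is free and is moved to a point where u has neither zero nor pole. *)
Lemma plane_point_exists t y la : box_data a 1 b t y la -> plane_point y (y * t).
Proof.
move=> h; have [hty _ _] := h.
have [b0|b_gt0] := posnP b; last by apply: (plane_point_of_data h) => W; apply: (base_point_excluded b_gt0 h).
have hp := plane_of_box h; have [hal mu0 _] := hp; rewrite b0 addn0 in hp.
have al0 := pure_neq0 hal; have be0 := pure_neq0 (pure_swap hal).
have [kap0 _] := jacobian_generator hO hJ.
have u0 : u != 0 by apply: contraNneq kap0 => ->; rewrite (der0 (bider_l hJ v)) eqxx.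
have [[A B] /= [B0 eu]] := pure_frac hal u.
have A0 : ev y (y * t) A != 0 by apply: contraNneq u0 => e; rewrite eu e mul0r eqxx.
have AB0 : A * B != 0.
  by apply: contraNneq (mulf_neq0 A0 B0) => e; rewrite -evM e ev0 eqxx.
(* A valuation ring centred on the exceptional curve over (c, c') would contain the inverse of u,
   whereas a ring dominating O does not. *)
have [c [c' eAB]] := poly2_nonroot AB0.
have hq := plane_shift c c' hp; have [hq1 _ _] := hq.
have al1 := pure_neq0 hq1; have be1 := pure_neq0 (pure_swap hq1).
have hb := box_of_plane hq.
apply: (plane_point_unshift (c := c) (c' := c')) => //.
have e : y * t - iota c' = (y - iota c) * ((y * t - iota c') / (y - iota c)) by rewrite [RHS]mulrC divfK.
rewrite e.
have [mu' hb'] : exists mu', box_data a 1 b ((y * t - iota c') / (y - iota c)) (y - iota c) mu'.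
  by eexists; rewrite b0; exact: hb.
apply: (plane_point_of_data hb') => W [hW OW dom tr] my.
have sW : subalg iota W by case: hW.
have hm := val_ring_maximal hW.
have mb : max_ideal W (y * t - iota c') by rewrite e; apply: (maxMr hm my); have [] := residue_mem tr.
have OC d : W (iota d) by apply: (subalgC sW).
have Wy : W y by rewrite -(subrK (iota c) y); apply: (subalgD sW) => //; case: my.
have Wyt : W (y * t) by rewrite -(subrK (iota c') (y * t)); apply: (subalgD sW) => //; case: mb.
have unit (P : {poly {poly k}}) : ev (iota c) (iota c') P != 0 -> W (ev y (y * t) P) /\ W (ev y (y * t) P)^-1.
  move=> P0; have WP : W (ev y (y * t) P) by apply: (subalg_ev sW).
  have [|_ //] := max_ideal_unit WP.
  move=> mP; have := max_cong_ev sW hm P Wy (OC c) Wyt (OC c') my mb => mc.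
  have : max_ideal W (ev (iota c) (iota c') P).
    by rewrite -[X in max_ideal _ X](subKr (ev y (y * t) P)); apply: (maxB sW hm).
  rewrite ev_horner_inner ev1E horner_map in P0 *; rewrite fmorph_eq0 in P0.
  exact: (max_const sW hm P0).
have [cA cB] : ev (iota c) (iota c') A != 0 /\ ev (iota c) (iota c') B != 0.
  by move: eAB; rewrite evM mulf_eq0 => /norP.
have [WA WA'] := unit A cA; have [WB WB'] := unit B cB.
apply: (dom u (rp_u hO) u0); rewrite eu invf_div; exact: (subalgM sW).
Qed.

Definition plane_model (al be : K) : set (set K) :=
  affine_model (kalg iota [set al; be]) `|` affine_model (kalg iota [set al^-1; be / al])
  `|` affine_model (kalg iota [set be^-1; al / be]).

Lemma dominates_plane al be : plane_point al be -> exists2 O', plane_model al be O' & dominates O O'.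
Proof.
case=> [[h1 h2]|[h1 h2]|[h1 h2]]; have [O' hO' d] := dominates_chart hO h1 h2; exists O' => //.
- by left; left.
- by left; right.
by right.
Qed.
End CaseTwoPoint.

(** * Models of Hirzebruch surfaces and of the plane *)

Section ToricSurfaces.
Context (k : closedFieldType) (K : fieldType) (iota : {rmorphism k -> K}).
Local Notation ev1 := (ev1 iota).
Local Notation ev := (ev iota).
Local Notation pure := (purely_transcendental iota).

Lemma kalg_eq S T : S `<=` kalg iota T -> T `<=` kalg iota S -> kalg iota S = kalg iota T.
Proof. by move=> h1 h2; apply/seteqP; split; apply: kalg_mono. Qed.

Lemma pair_seq (t y : K) : [set t; y] = [set z | z \in [:: t; y]].
Proof. by apply/seteqP; split=> z /=; rewrite !inE; [case=> ->; rewrite eqxx ?orbT|case/orP=> /eqP ->; [left|right]]. Qed.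

Lemma pure_frac_full t y : pure t y -> frac_full (kalg iota [set t; y]).
Proof. by case=> _ /frac_fullP. Qed.

Lemma plane_residue t y m z : pure t y -> maximal_ideal (kalg iota [set t; y]) m ->
  kalg iota [set t; y] z -> exists c, m (z - iota c).
Proof.
move=> h; have hA := pure_frac_full h; have htr := pure_trbasis h.
rewrite pair_seq in hA * => hm; exact: (kalg_max_residue htr hm hA).
Qed.

(** The residues c and c' exist by the Nullstellensatz; modulo t - c and y - c' every polynomial is
    a constant, so these two elements generate the maximal ideal. *)
Lemma chart_point t y O : pure t y -> affine_model (kalg iota [set t; y]) O -> exists c c',
  [/\ max_ideal O (t - iota c), max_ideal O (y - iota c') &
    forall f, max_ideal O f -> exists p q, [/\ O p, O q & f = p * (t - iota c) + q * (y - iota c')]].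
Proof.
move=> h [m hm ->]; set A := kalg iota [set t; y] in hm *.
have sA : subalg iota A := kalg_subalg iota _.
have At : A t by apply: kalg_gen; left.
have Ay : A y by apply: kalg_gen; right.
have [c mc] := plane_residue h hm At; have [c' mc'] := plane_residue h hm Ay.
exists c, c'; split; [exact: (max_loc_mem sA hm mc)|exact: (max_loc_mem sA hm mc')|].
have taylor z : A z -> exists d p q, [/\ A p, A q & z = iota d + p * (t - iota c) + q * (y - iota c')].
  have A0 := subalg0 sA; have A1 := subalg1 sA; have AC := subalgC sA.
  elim=> {z} [d|z|z w Az [d [p [q [Ap Aq ez]]]] Aw [d' [p' [q' [Ap' Aq' ew]]]]|z w Az [d [p [q [Ap Aq ez]]]] Aw [d' [p' [q' [Ap' Aq' ew]]]]].
  - by exists d, 0, 0; split=> //; ring.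
  - by case=> ->; [exists c, 1, 0|exists c', 0, 1]; split=> //; ring.
  - exists (d + d'), (p + p'), (q + q'); split; [exact: (subalgD sA)|exact: (subalgD sA)|].
    by rewrite ez ew rmorphD; ring.
  exists (d * d'), (p * w + iota d * p'), (q * w + iota d * q').
  split; [by apply: (subalgD sA); apply: (subalgM sA)|by apply: (subalgD sA); apply: (subalgM sA)|].
  by rewrite ez {2}ew rmorphM ew; ring.
move=> f /(loc_maxP hm) [a [b [ma Ab nb ->]]].
have [d [p [q [Ap Aq ea]]]] := taylor a (max_sub hm ma).
have d0 : d = 0.
  apply/eqP; apply: contraT => d0; case: (max_const sA hm d0).
  have -> : iota d = a - (p * (t - iota c) + q * (y - iota c')) by rewrite ea; ring.
  by apply: (maxB sA hm ma); apply: (maxD hm); apply: (maxM hm).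
exists (p / b), (q / b); split; [by exists p, b|by exists q, b|].
by rewrite ea d0 rmorph0; ring.
Qed.

Lemma chart_regular t y O : pure t y -> affine_model (kalg iota [set t; y]) O -> regular_local_ring_dim2 O.
Proof. by move=> h hO; have [c [c' [h1 h2 h3]]] := chart_point h hO; exists (t - iota c), (y - iota c'). Qed.

Lemma chart_sub t y O : affine_model (kalg iota [set t; y]) O -> subalg iota O /\ O t /\ O y.
Proof.
move=> [m hm ->]; have sA := kalg_subalg iota [set t; y].
by split; [exact: (loc_subalg sA hm)|split; apply: (loc_sub sA hm); apply: kalg_gen; [left|right]].
Qed.

Lemma chart_regular_point t y O : pure t y -> affine_model (kalg iota [set t; y]) O ->
  exists u v zs, regular_point iota O u v zs.
Proof.
move=> h hO; have hr := chart_regular h hO; have hA := pure_frac_full h; have htr := pure_trbasis h.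
case: hO hr => m; rewrite pair_seq in hA * => hm -> hr.
by have [u [v hp]] := regular_point_localization htr hA hm hr; exists u, v, [:: t; y].
Qed.

(** B is A[1/f], so its points form a principal open subset; the contraction of a maximal ideal is
    maximal because all residues lie in k. *)
Lemma affine_model_sub (A B : set K) f : subalg iota A -> subalg iota B -> A `<=` B -> A f -> B f^-1 ->
  f != 0 -> (forall b, B b -> exists N, A (f ^+ N * b)) ->
  (forall m b, maximal_ideal B m -> B b -> exists c, m (b - iota c)) ->
  affine_model B `<=` affine_model A.
Proof.
move=> sA sB AB Af Bf f0 hB res O [m hm ->].
have nf N : ~ m (f ^+ N).
  move=> mf; apply: (max1 hm); rewrite -(mulfV (expf_neq0 N f0)) -exprVn.
  by apply: (maxMr hm mf); apply: (subalgX sB).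
have hm' : maximal_ideal A [set z | A z /\ m z].
  split=> //.
  - by move=> z [].
  - split; first by split; [exact: (subalg0 sA)|exact: (max0 hm)].
    by move=> p q [Ap mp] [Aq mq]; split; [exact: (subalgD sA)|exact: (maxD hm)].
  - by move=> p q Ap [Aq mq]; split; [exact: (subalgM sA)|apply: (maxM hm) => //; exact: AB].
  - by case=> _ /(max1 hm).
  move=> p Ap np; have [c mc] := res m p hm (AB _ Ap).
  have c0 : c != 0.
    by apply/eqP => c0; apply: np; split=> //; move: mc; rewrite c0 rmorph0 subr0.
  exists (iota c^-1); first exact: (subalgC sA).
  split; first by apply: (subalgB sA); [exact: (subalg1 sA)|apply: (subalgM sA) => //; exact: (subalgC sA)].
  have -> : 1 - p * iota c^-1 = - iota c^-1 * (p - iota c).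
    by rewrite fmorphV; field; rewrite fmorph_eq0.
  by apply: (maxM hm) => //; apply: (subalgN sB); exact: (subalgC sB).
exists [set z | A z /\ m z] => //; apply/seteqP; split=> z [p [q [Ap Aq nq ->]]].
  have [N hN] := hB p Ap; have [N' hN'] := hB q Aq.
  exists (f ^+ (N + N') * p), (f ^+ (N + N') * q); split.
  - by rewrite addnC exprD -mulrA; apply: (subalgM sA) => //; apply: (subalgX sA).
  - by rewrite exprD -mulrA; apply: (subalgM sA) => //; apply: (subalgX sA).
  - case=> _ /(max_prime hm (subalgX sB (N + N')%N (AB _ Af)) Aq) [/nf//|//].
  - by rewrite -mulf_div divff ?mul1r ?expf_neq0.
exists p, q; split; [exact: AB|exact: AB| |by []].
by move=> mq; apply: nq.
Qed.

Lemma plane_projective al be : pure al be -> projective_variety iota (plane_model iota al be).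
Proof.
move=> h; have al0 := pure_neq0 h; have be0 := pure_neq0 (pure_swap h).
pose x (i : 'I_3) : K := [:: 1; al; be]`_i.
have x0 i : x i != 0 by case: i => [[|[|[|//]]] lti]; rewrite /x //= oner_neq0.
have ge1 S z : S z -> kalg iota S z by exact: kalg_gen.
have one S : kalg iota S 1 by exact: (subalg1 (kalg_subalg iota S)).
have X0 : x ord0 = 1 by [].
have X1 : x (inord 1) = al by rewrite /x inordK.
have X2 : x (inord 2) = be by rewrite /x inordK.
have cases (i : 'I_3) : [\/ i = ord0, i = inord 1 | i = inord 2].
  case: i => [[|[|[|//]]] lti]; [constructor 1|constructor 2|constructor 3]; apply: val_inj; rewrite /= ?inordK //.
have e0 : kalg iota [set x j / x ord0 | j in [set: 'I_3]] = kalg iota [set al; be].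
  rewrite X0; apply: kalg_eq => [_ [j _ <-]|_ [->|->]].
  - rewrite divr1; case: (cases j) => ->; rewrite ?X0 ?X1 ?X2; [exact: one|by apply: ge1; left|by apply: ge1; right].
  - by apply: ge1; exists (inord 1) => //; rewrite X1 divr1.
  - by apply: ge1; exists (inord 2) => //; rewrite X2 divr1.
have e1 : kalg iota [set x j / x (inord 1) | j in [set: 'I_3]] = kalg iota [set al^-1; be / al].
  rewrite X1; apply: kalg_eq => [_ [j _ <-]|_ [->|->]].
  - case: (cases j) => ->; rewrite ?X0 ?X1 ?X2.
    + by rewrite div1r; apply: ge1; left.
    + by rewrite divff //; exact: one.
    + by apply: ge1; right.
  - by apply: ge1; exists ord0 => //; rewrite X0 div1r.
  - by apply: ge1; exists (inord 2) => //; rewrite X2.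
have e2 : kalg iota [set x j / x (inord 2) | j in [set: 'I_3]] = kalg iota [set be^-1; al / be].
  rewrite X2; apply: kalg_eq => [_ [j _ <-]|_ [->|->]].
  - case: (cases j) => ->; rewrite ?X0 ?X1 ?X2.
    + by rewrite div1r; apply: ge1; left.
    + by apply: ge1; right.
    + by rewrite divff //; exact: one.
  - by apply: ge1; exists ord0 => //; rewrite X0 div1r.
  - by apply: ge1; exists (inord 1) => //; rewrite X1.
exists 2%N, x; split; first by exists ord0.
  have [_ full] := h; apply/frac_fullP; apply: frac_full_sub (pure_frac_full h).
  apply: kalg_mono => _ [->|->]; apply: ge1.
    by exists ord0, (inord 1); split=> //; rewrite X1 X0 divr1.
  by exists ord0, (inord 2); split=> //; rewrite X2 X0 divr1.
apply/seteqP; split=> O.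
  case=> [[hO|hO]|hO]; [exists ord0|exists (inord 1)|exists (inord 2)] => //.
  - by rewrite e0.
  - by rewrite e1.
  - by rewrite e2.
case=> i _; case: (cases i) => ->.
- by rewrite e0 => hO; left; left.
- by rewrite e1 => hO; left; right.
- by rewrite e2 => hO; right.
Qed.
End ToricSurfaces.

(** * Projective embeddings and minimal rational surfaces *)

Section Structure.
Context (k : closedFieldType) (K : fieldType) (iota : {rmorphism k -> K}).
Local Notation ev1 := (ev1 iota).
Local Notation ev := (ev iota).
Local Notation pure := (purely_transcendental iota).

Lemma pure_hirzebruch e t y : pure t y -> pure t^-1 (y * t ^+ e).
Proof. by move=> h; apply/pure_swap/pure_inv2/pure_swap/pure_mulX. Qed.

(** The embedding as a rational normal scroll with coordinates 1, t, y, y t, ..., y t^(e + 1). The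
    four end monomials give the four charts of F_e. *)
Lemma hirzebruch_projective e t y : pure t y -> projective_variety iota (hirzebruch_model iota e t y).
Proof.
move=> h; have t0 := pure_neq0 h; have y0 := pure_neq0 (pure_swap h).
have tn0 l : t ^+ l != 0 by rewrite expf_neq0.
pose X j : K := if (j < 2)%N then t ^+ j else y * t ^+ (j - 2).
pose x (i : 'I_(e + 3).+1) : K := X i.
have Xn0 j : X j != 0 by rewrite /X; case: ifP => _; rewrite ?mulf_neq0.
have ge S z : S z -> kalg iota S z by exact: kalg_gen.
have mul S := subalgM (kalg_subalg iota S).
have pw S z l : kalg iota S z -> kalg iota S (z ^+ l) by exact: (subalgX (kalg_subalg iota S)).
have one S : kalg iota S 1 by exact: (subalg1 (kalg_subalg iota S)).
have xin i j : (j <= e + 3)%N -> [set x j / X i | j in [set: 'I_(e + 3).+1]] (X j / X i).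
  by move=> le_j; exists (inord j) => //; rewrite /x inordK.
pose S i := [set x j / X i | j in [set: 'I_(e + 3).+1]].
have SE i (Q : K -> Prop) : Q (1 / X i) -> Q (t / X i) ->
    (forall l, (l <= e.+1)%N -> Q (y * t ^+ l / X i)) -> forall z, S i z -> Q z.
  move=> q0 q1 q2 _ [j _ <-]; case: j => [[|[|j]] ltj]; rewrite /x /X /=.
  - by rewrite expr0.
  - by rewrite expr1.
  by rewrite subn2; apply: q2; move: ltj; lia.
have X3 : X (e + 3)%N = y * t ^+ e * t by rewrite /X ltnNge addn3 /= subn2 /= exprSr mulrA.
have X2' : X (e + 2)%N = y * t ^+ e by rewrite /X ltnNge addn2 /= subn2.
have k0 : kalg iota (S 0%N) = kalg iota [set t; y].
  have X0 : X 0%N = 1 by rewrite /X expr0.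
  apply: kalg_eq.
    apply: SE; rewrite X0 ?divr1; [exact: one|by apply: ge; left|move=> l _].
    by rewrite divr1; apply: mul; [apply: ge; right|apply: pw; apply: ge; left].
  move=> _ [->|->]; apply: ge.
    have <- : X 1%N / X 0%N = t by rewrite X0 divr1 /X /= expr1.
    by apply: xin; lia.
  have <- : X 2%N / X 0%N = y by rewrite X0 divr1 /X /= expr0 mulr1.
  by apply: xin; lia.
have k1 : kalg iota (S 1%N) = kalg iota [set t^-1; y * t ^+ e].
  have X1 : X 1%N = t by rewrite /X /= expr1.
  apply: kalg_eq.
    apply: SE; rewrite X1; [by rewrite div1r; apply: ge; left|by rewrite divff|move=> l le_l].
    have -> : y * t ^+ l / t = y * t ^+ e * t^-1 ^+ (e.+1 - l).
      have e1 : t ^+ (e.+1 - l) * t ^+ l = t * t ^+ e by rewrite -exprD subnK // exprS.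
      rewrite exprVn; move: e1 (tn0 (e.+1 - l)%N); move: (t ^+ (e.+1 - l)) (t ^+ l) (t ^+ e) => p q r e1 p0.
      apply: (mulfI p0); transitivity (y * (p * q) / t); first ring.
      by rewrite e1; field; rewrite t0 p0.
    by apply: mul; [apply: ge; right|apply: pw; apply: ge; left].
  move=> _ [->|->]; apply: ge.
    have <- : X 0%N / X 1%N = t^-1 by rewrite X1 /X /= expr0 div1r.
    exact: xin.
  have <- : X (e + 3)%N / X 1%N = y * t ^+ e by rewrite X3 X1 mulfK.
  exact: xin.
have k2A l : kalg iota [set t; y^-1] (y * t ^+ l / y).
  by rewrite mulrC mulKf //; apply: pw; apply: ge; left.
have k2 : kalg iota (S 2%N) = kalg iota [set t; y^-1].
  have X2 : X 2%N = y by rewrite /X /= expr0 mulr1.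
  apply: kalg_eq.
    apply: SE; rewrite X2 ?div1r; [by apply: ge; right|by apply: mul; apply: ge; [left|right]|by []].
  move=> _ [->|->]; apply: ge.
    have <- : X 3%N / X 2%N = t by rewrite X2 /X /= expr1 mulrC mulKf.
    by apply: xin; lia.
  have <- : X 0%N / X 2%N = y^-1 by rewrite X2 /X /= expr0 div1r.
  exact: xin.
have k3 : kalg iota (S (e + 3)%N) = kalg iota [set t^-1; (y * t ^+ e)^-1].
  have yt0 : y * t ^+ e != 0 by rewrite mulf_neq0.
  apply: kalg_eq.
    apply: SE; rewrite X3.
    - by rewrite div1r [(_ * t)^-1]invfM; apply: mul; apply: ge; [right|left].
    - have -> : t / (y * t ^+ e * t) = (y * t ^+ e)^-1.
        by rewrite [(_ * t)^-1]invfM mulrCA mulfV ?mulr1.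
      by apply: ge; right.
    move=> l le_l; have -> : y * t ^+ l / (y * t ^+ e * t) = t^-1 ^+ (e.+1 - l).
      have e1 : t ^+ (e.+1 - l) * t ^+ l = t * t ^+ e by rewrite -exprD subnK // exprS.
      rewrite exprVn; move: e1 (tn0 (e.+1 - l)%N) (tn0 e); move: (t ^+ (e.+1 - l)) (t ^+ l) (t ^+ e) => p q r e1 p0 r0.
      apply: (mulfI p0); transitivity (y * (p * q) / (y * r * t)); first ring.
      by rewrite e1; field; rewrite t0 p0 r0 y0.
    by apply: pw; apply: ge; left.
  move=> _ [->|->]; apply: ge.
    have <- : X (e + 2)%N / X (e + 3)%N = t^-1 by rewrite X2' X3 invfM mulrA mulfV ?mul1r.
    by apply: xin; lia.
  have <- : X 1%N / X (e + 3)%N = (y * t ^+ e)^-1.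
    by rewrite X3 /X /= expr1 [_ * t]mulrC invfM mulrA mulfV ?mul1r.
  by apply: xin; lia.
(* The chart of an intermediate coordinate y t^(l + 1) is the part t != 0 of the chart with
   coordinates t and 1 / y, so it adds no point. *)
have mid l : (l < e)%N -> affine_model (kalg iota (S l.+3)) `<=` affine_model (kalg iota [set t; y^-1]).
  move=> lt_l; have Xl : X l.+3 = y * t ^+ l.+1 by rewrite /X /= subn2.
  have Bt : kalg iota (S l.+3) t.
    apply: ge; have <- : X l.+4 / X l.+3 = t.
      rewrite Xl /X /= subn2 /= [t ^+ l.+2]exprS; move: (tn0 l.+1); move: (t ^+ l.+1) => p p0.
      by field; rewrite y0 p0.
    by apply: xin; lia.
  have Bt' : kalg iota (S l.+3) t^-1.
    apply: ge; have <- : X l.+2 / X l.+3 = t^-1.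
      rewrite Xl /X /= subn2 /= [t ^+ l.+1]exprS; move: (tn0 l); move: (t ^+ l) => p p0.
      by field; rewrite y0 t0 p0.
    by apply: xin; lia.
  have By : kalg iota (S l.+3) y^-1.
    have -> : y^-1 = X 0%N / X l.+3 * t ^+ l.+1.
      rewrite Xl /X /= expr0; move: (tn0 l.+1); move: (t ^+ l.+1) => p p0; by field; rewrite y0 p0.
    apply: mul; last exact: pw.
    by apply: ge; apply: xin.
  have AB : kalg iota [set t; y^-1] `<=` kalg iota (S l.+3) by apply: kalg_mono => _ [->|->].
  have hB : frac_full (kalg iota (S l.+3)).
    apply: frac_full_sub AB _; apply: (pure_frac_full (pure_inv2 h)).
  apply: (affine_model_sub (f := t)) => //; first exact: kalg_subalg.
  - exact: kalg_subalg.
  - by apply: ge; left.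
  - have sA := kalg_subalg iota [set t; y^-1].
    have At : kalg iota [set t; y^-1] t by apply: ge; left.
    move=> b; elim=> {b} [c|b|b b' _ [N hN] _ [N' hN']|b b' _ [N hN] _ [N' hN']].
    + by exists 0%N; rewrite mul1r; exact: (subalgC sA).
    + move=> Sb; exists l.+1; move: b Sb.
      have canc z : t ^+ l.+1 * (z / (y * t ^+ l.+1)) = z / y.
        by move: (tn0 l.+1); move: (t ^+ l.+1) => p p0; field; rewrite y0 p0.
      apply: (SE l.+3 (fun b => kalg iota [set t; y^-1] (t ^+ l.+1 * b))); rewrite Xl ?canc ?div1r.
      * by apply: ge; right.
      * by apply: mul => //; apply: ge; right.
      by move=> l' _; rewrite canc.
    + exists (N + N')%N; rewrite mulrDr; apply: (subalgD sA).
        by rewrite addnC exprD -mulrA; apply: mul => //; apply: pw.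
      by rewrite exprD -mulrA; apply: mul => //; apply: pw.
    exists (N + N')%N; rewrite exprD mulrACA; exact: mul.
  have -> : S l.+3 = [set z | z \in [seq x j / X l.+3 | j <- enum 'I_(e + 3).+1]].
    apply/seteqP; split=> [_ [j _ <-]|z /mapP [j _ ->]] /=; last by exists j.
    by apply/mapP; exists j; rewrite ?mem_enum.
  move=> m b hm; apply: (kalg_max_residue (pure_trbasis h) hm).
  rewrite (_ : [set` _] = S l.+3) //.
  apply/seteqP; split=> [z /mapP [j _ ->]|_ [j _ <-]] /=; first by exists j.
  by apply/mapP; exists j; rewrite ?mem_enum.
exists (e + 3)%N, x; split; first by exists ord0; exact: Xn0.
  apply/frac_fullP; apply: frac_full_sub (pure_frac_full h).
  have X0 : X 0%N = 1 by rewrite /X expr0.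
  apply: kalg_mono => _ [->|->]; apply: ge; exists ord0.
    exists (inord 1); split; first exact: Xn0.
    by rewrite /x inordK ?addn3 //= X0 divr1 /X /= expr1.
  exists (inord 2); split; first exact: Xn0.
  by rewrite /x inordK ?addn3 //= X0 divr1 /X /= expr0 mulr1.
have inX j O : (j <= e + 3)%N -> affine_model (kalg iota (S j)) O -> projective_model iota x O.
  move=> le_j hO; exists (inord j); first exact: Xn0.
  have -> : x (inord j) = X j by rewrite /x inordK.
  exact: hO.
apply/seteqP; split=> O.
  case=> [[[hO|hO]|hO]|hO].
  - by apply: (inX 0%N) => //; rewrite k0.
  - by apply: (inX 2%N); [lia|rewrite k2].
  - by apply: (inX 1%N); [lia|rewrite k1].
  by apply: (inX (e + 3)%N); rewrite ?k3.
case=> i _; have := ltn_ord i; rewrite /x -/(S i); move: (nat_of_ord i) => j ltj hO.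
have [ej|[ej|[ej|[ej|[l [lt_l ej]]]]]] : [\/ j = 0%N | j = 1%N \/ j = 2%N \/ j = (e + 3)%N \/ exists l, (l < e)%N /\ j = l.+3].
  case: j ltj {hO} => [|[|[|j]]] ltj; [by left|by right; left|by right; right; left|right; right; right].
  have [lt_j|le_j] := ltnP j e; first by right; exists j.
  by left; move: ltj le_j; lia.
- by left; left; left; rewrite -k0 -ej.
- by left; right; rewrite -k1 -ej.
- by left; left; right; rewrite -k2 -ej.
- by right; rewrite -k3 -ej.
by left; left; right; apply: (mid l lt_l); rewrite -ej.
Qed.

Lemma hirzebruch_chart e t y O : pure t y -> hirzebruch_model iota e t y O ->
  exists t' y', pure t' y' /\ affine_model (kalg iota [set t'; y']) O.
Proof.
move=> h; have h' := pure_hirzebruch e h.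
case=> [[[hO|hO]|hO]|hO].
- by exists t, y.
- by exists t, y^-1; split=> //; exact: pure_inv2.
- by exists t^-1, (y * t ^+ e).
by exists t^-1, (y * t ^+ e)^-1; split=> //; exact: pure_inv2.
Qed.

Lemma pure_plane al be : pure al be -> pure al^-1 (be / al).
Proof. by move=> h; apply/pure_swap/pure_inv2; apply: pure_ratio. Qed.

Lemma plane_chart al be O : pure al be -> plane_model iota al be O ->
  exists t' y', pure t' y' /\ affine_model (kalg iota [set t'; y']) O.
Proof.
move=> h; case=> [[hO|hO]|hO].
- by exists al, be.
- by exists al^-1, (be / al); split=> //; exact: pure_plane.
by exists be^-1, (al / be); split=> //; apply/pure_plane/pure_swap.
Qed.

Lemma hirzebruch_smooth e t y : transcendence_degree_2 iota -> pure t y ->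
  smooth_projective_surface iota (hirzebruch_model iota e t y).
Proof.
move=> td h; split=> //; first exact: hirzebruch_projective.
by move=> O /(hirzebruch_chart h) [t' [y' [h' hO]]]; exact: (chart_regular h' hO).
Qed.

Lemma plane_smooth al be : transcendence_degree_2 iota -> pure al be ->
  smooth_projective_surface iota (plane_model iota al be).
Proof.
move=> td h; split=> //; first exact: plane_projective.
by move=> O /(plane_chart h) [t' [y' [h' hO]]]; exact: (chart_regular h' hO).
Qed.

Lemma hirzebruch1_plane t y : pure t y ->
  birational_morphism (hirzebruch_model iota 1 t y) (plane_model iota y (y * t)).
Proof.
move=> h O hO; have t0 := pure_neq0 h; have y0 := pure_neq0 (pure_swap h).
have [t' [y' [h' hO']]] := hirzebruch_chart h hO.
have [u [v [zs hreg]]] := chart_regular_point h' hO'.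
apply: (dominates_plane hreg).
case: hO => [[[/chart_sub|/chart_sub]|/chart_sub]|/chart_sub] [sO []]; rewrite ?expr1 => O1 O2.
- by constructor 1; split=> //; apply: (subalgM sO).
- by constructor 2; split=> //; rewrite mulrC mulKf.
- by constructor 1; split=> //; rewrite -(mulfK t0 y); apply: (subalgM sO).
by constructor 3; split=> //; rewrite invfM mulrA mulfV // mul1r.
Qed.

Theorem minimal_rational_surface X : smooth_projective_surface iota X -> rational_surface iota ->
  minimal_surface iota X ->
  (exists e t y, e <> 1%N /\ is_hirzebruch iota X e t y) \/
  (exists al be, pure al be /\ X = plane_model iota al be).
Proof.
move=> [td [n [x [x0 full eX]]] reg] hrat hmin.
have [s [t hst]] := hrat; have htr := pure_trbasis hst.
have [J [hJ _]] := pure_biderivation hst.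
have [a [e [b [t1 [y1 [la [hb min_a min_N]]]]]]] := exists_minimal_data x hrat.
have [hty la0 _] := hb.
have a_gt0 := fibre_degree_gt0 full (box_fibre hb).
have pts O : X O -> exists i, [/\ x i != 0, forall j, O (x j / x i) & exists u v zs, regular_point iota O u v zs].
  by move=> XO; apply: (surface_point htr full _ (reg O XO)); rewrite -eX.
have plane al be : pure al be -> birational_morphism X (plane_model iota al be) ->
    exists al be, pure al be /\ X = plane_model iota al be.
  by move=> h bm; exists al, be; split=> //; rewrite (hmin _ (plane_smooth td h) bm).
have [le_N|lt_N] := leqP (2 * a) (2 * b + a * e).
  have bm : birational_morphism X (hirzebruch_model iota e t1 y1).
    move=> O XO; have [i [xi Ox [u [v [zs hO]]]]] := pts O XO.
    exact: (dominated_hirzebruch x0 min_a min_N hO xi Ox hJ le_N a_gt0 hb).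
  have eXh := hmin _ (hirzebruch_smooth e td hty) bm.
  (* F_1 contracts onto the plane, so minimality turns X = F_1 into X = P^2. *)
  have [e1|/eqP e1] := eqVneq e 1%N; last by left; exists e, t1, y1; split=> //; split.
  right; have h' : pure y1 (y1 * t1) by have := pure_mulX 1 (pure_swap hty); rewrite expr1 mulrC.
  apply: (plane _ _ h'); rewrite -eXh e1; exact: hirzebruch1_plane.
(* For e = 0 the other projection gives a <= b, and for e >= 2 already a e >= 2 a; both contradict 2
   b + a e < 2 a. *)
have e1 : e = 1%N.
  case: e hb min_N lt_N => [|[|e]] hb min_N lt_N //.
    by have := min_a _ _ _ _ (box_swap hb); move: lt_N; lia.
  by move: lt_N; rewrite !mulnS; move: (a * e)%N => q; lia.
rewrite e1 in hb min_N lt_N; right.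
have lt_b : (2 * b < a)%N by move: lt_N; lia.
have h' : pure y1 (y1 * t1) by have [] := plane_of_box hb.
apply: (plane _ _ h') => O XO; have [i [xi Ox [u [v [zs hO]]]]] := pts O XO.
apply: (dominates_plane hO).
exact: (plane_point_exists x0 min_a min_N lt_b hO xi Ox hJ hb).
Qed.
End Structure.

(** * Sylvester determinants *)

Section Sylvester.

Section Ring.
Context (R : comNzRingType).

(** p and q carry the formal degrees n and l, not their actual ones, so that the determinant
    commutes with specialization and also detects a common zero at infinity. *)
Definition sylvester (l n : nat) (p q : {poly R}) : 'M[R]_(l + n) :=
  col_mx (\matrix_(i < l, j < l + n) (p * 'X^i)`_j) (\matrix_(i < n, j < l + n) (q * 'X^i)`_j).
End Ring.

Lemma map_sylvester (R S : comNzRingType) (f : {rmorphism R -> S}) l n p q :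
  map_mx f (sylvester l n p q) = sylvester l n (map_poly f p) (map_poly f q).
Proof.
rewrite map_col_mx; congr col_mx; apply/matrixP => i j; rewrite !mxE -coef_map rmorphM /=;
by rewrite map_polyXn.
Qed.

(** A kernel vector is a relation U p + V q = 0 with deg U < l and deg V < n. The polynomial that
    attains its formal degree is coprime to the other one and divides the cofactor of the latter,
    which is too small. *)
Lemma sylvester_neq0 (k : closedFieldType) (l n : nat) (p q : {poly k}) :
  (size p <= n.+1)%N -> (size q <= l.+1)%N -> (forall c, ~ (root p c /\ root q c)) ->
  ~ (p`_n = 0 /\ q`_l = 0) -> \det (sylvester l n p q) != 0.
Proof.
move=> sp sq nroot nlead; apply/negP => /det0P [v v0 vM].
have cop : coprimep p q.
  by apply/Pdiv.ClosedField.coprimepP => c pc; apply/negP => qc; apply: (nroot c).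
have rowE d (a : 'rV[k]_d) : rVpoly a = \sum_i a 0 i *: 'X^i.
  rewrite {1}[a]row_sum_delta linear_sum; apply: eq_bigr => i _.
  by rewrite linearZ /= rVpoly_delta.
pose U := rVpoly (lsubmx v); pose V := rVpoly (rsubmx v).
have eUV : U * p + V * q = 0.
  apply/polyP => j; rewrite coef0; have [lt_j|le_j] := ltnP j (l + n); last first.
    apply: nth_default; apply: leq_trans (size_polyD _ _) _; rewrite geq_max.
    have sz d (W r : {poly k}) e : (size W <= d)%N -> (size r <= e.+1)%N -> (size (W * r)%R <= d + e)%N.
      move=> hW hr; apply: leq_trans (size_polyMleq _ _) _.
      by rewrite -subn1 leq_subLR add1n -addnS leq_add.
    have h1 : (size (U * p)%R <= l + n)%N by apply: sz => //; exact: size_poly.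
    have h2 : (size (V * q)%R <= n + l)%N by apply: sz => //; exact: size_poly.
    by rewrite (leq_trans h1 le_j) (leq_trans h2) // addnC.
  have := congr1 (fun M : 'rV_(l + n) => M 0 (Ordinal lt_j)) vM.
  rewrite -[v]hsubmxK /sylvester mul_row_col !mxE => e; rewrite -[RHS]e coefD /U /V !rowE !mulr_suml !coef_sum.
  by congr (_ + _); apply: eq_bigr => i _; rewrite !mxE -scalerAl coefZ (mulrC 'X^i).
have sU : (size U <= l)%N by exact: size_poly.
have sV : (size V <= n)%N by exact: size_poly.
have back d (a : 'rV[k]_d) : rVpoly a = 0 -> a = 0.
  by move=> a0; apply/rowP => i; rewrite -coef_rVpoly_ord a0 coef0 mxE.
have UV0 : U = 0 /\ V = 0.
  have lead (r : {poly k}) d : r`_d != 0 -> r != 0 /\ (d < size r)%N.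
    move=> rd; split; first by apply: contraNneq rd => ->; rewrite coef0.
    by rewrite ltnNge; apply: contraNN rd => /(nth_default 0) ->.
  have [ql|ql] := eqVneq q`_l 0.
    have [|p0 szp] := lead p n; first by apply/eqP => pn; apply: nlead.
    have V0 : V = 0.
      apply/eqP; apply: contraT => V0; have : p %| V.
        have eV : V * q = - (U * p) by apply/eqP; rewrite -addr_eq0 addrC eUV.
        have : p %| V * q by rewrite eV dvdpNr dvdp_mulIr.
        by rewrite (Gauss_dvdpl V cop).
      by move/(dvdp_leq V0); rewrite leqNgt (leq_ltn_trans sV szp).
    by split=> //; move/eqP: eUV; rewrite V0 mul0r addr0 mulf_eq0 (negbTE p0) orbF => /eqP.
  have [q0 szq] := lead q l ql.
  have U0 : U = 0.
    apply/eqP; apply: contraT => U0; have : q %| U.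
      have eU : U * p = - (V * q) by apply/eqP; rewrite -addr_eq0 eUV.
      have : q %| U * p by rewrite eU dvdpNr dvdp_mulIr.
      by rewrite coprimep_sym in cop; rewrite (Gauss_dvdpl U cop).
    by move/(dvdp_leq U0); rewrite leqNgt (leq_ltn_trans sU szq).
  by split=> //; move/eqP: eUV; rewrite U0 mul0r add0r mulf_eq0 (negbTE q0) orbF => /eqP.
case: UV0 => /back U0 /back V0; move/eqP: v0; apply.
by rewrite -[v]hsubmxK U0 V0 row_mx0.
Qed.

(** The multiple of X p' is removed by row operations, for which n < l provides the row of p' X^(i +
    1). The rest is a conjugation by powers of th; the sum of the indices below l + n exceeds those
    below l and below n by l n. *)
Lemma sylvester_weight (K : fieldType) (l n : nat) (p q p' q1 q' : {poly K}) (u w th mu : K) :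
  (n < l)%N -> th != 0 -> (forall j, p'`_j = u * th ^+ j * p`_j) ->
  (forall j, q1`_j = w * th ^+ j * q`_j) -> q' = q1 + mu *: ('X * p') ->
  \det (sylvester l n p' q') = u ^+ l * w ^+ n * th ^+ (l * n) * \det (sylvester l n p q).
Proof.
move=> lt_nl th0 hp hq ->.
pose N : 'M[K]_(n, l) := \matrix_(i, j) (if j == i.+1 :> nat then mu else 0).
have -> : \det (sylvester l n p' (q1 + mu *: ('X * p'))) = \det (sylvester l n p' q1).
  have -> : sylvester l n p' (q1 + mu *: ('X * p')) = block_mx 1%:M 0 N 1%:M *m sylvester l n p' q1.
    rewrite /sylvester mul_block_col !mul1mx mul0mx addr0; congr col_mx.
    apply/matrixP => i j; rewrite !mxE addrC mulrDl coefD; congr (_ + _).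
    have lt_i : (i.+1 < l)%N by apply: leq_ltn_trans lt_nl; exact: ltn_ord.
    rewrite (bigD1 (Ordinal lt_i)) //= big1 ?addr0; last first.
      by move=> i' ne; rewrite !mxE -val_eqE /= in ne *; rewrite (negbTE ne) mul0r.
    have -> : mu *: ('X * p') * 'X^i = mu *: (p' * 'X^(i.+1)).
      by rewrite -scalerAl exprS; congr (_ *: _); rewrite mulrA [p' * _]mulrC.
    by rewrite !mxE eqxx coefZ.
  by rewrite det_mulmx det_lblock !det1 !mul1r.
pose dl d : 'M[K]_d := diag_mx (\row_(i < d) th ^+ i).
have det_dl d : \det (dl d) = \prod_(i < d) th ^+ i.
  by rewrite /dl det_diag; apply: eq_bigr => i _; rewrite mxE.
have e : block_mx (dl l) 0 0 (dl n) *m sylvester l n p' q1 =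
    block_mx u%:M 0 0 w%:M *m (sylvester l n p q *m dl (l + n)%N).
  have -> : sylvester l n p q *m dl (l + n)%N = col_mx
      ((\matrix_(i < l, j < l + n) (p * 'X^i)`_j) *m dl (l + n)%N)
      ((\matrix_(i < n, j < l + n) (q * 'X^i)`_j) *m dl (l + n)%N) by exact: mul_col_mx.
  rewrite /sylvester 2!mul_block_col !mul0mx !addr0 !add0r.
  congr col_mx; apply/matrixP => i j; rewrite mul_diag_mx mul_scalar_mx mul_mx_diag !mxE !coefMXn.
    case: ltnP => [_|le_i]; first by rewrite mulr0 mul0r mulr0.
    have -> : th ^+ j = th ^+ (j - i) * th ^+ i by rewrite -exprD subnK.
    by rewrite hp; ring.
  case: ltnP => [_|le_i]; first by rewrite mulr0 mul0r mulr0.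
  have -> : th ^+ j = th ^+ (j - i) * th ^+ i by rewrite -exprD subnK.
  by rewrite hq; ring.
have := congr1 determinant e; rewrite !det_mulmx !det_lblock !det_dl !det_scalar.
rewrite big_split_ord /= [X in _ = _ * (_ * (_ * X))](eq_bigr (fun i : 'I_n => th ^+ l * th ^+ i)); last first.
  by move=> i _; rewrite exprD.
rewrite big_split /= prodr_const card_ord -exprM.
have n0 d : \prod_(i < d) th ^+ i != 0 by apply/prodf_neq0 => i _; rewrite expf_neq0.
move: (n0 l) (n0 n); move: (\prod_(i < l) th ^+ i) (\prod_(i < n) th ^+ i) => a b a0 b0 e2.
by apply: (mulfI (mulf_neq0 a0 b0)); rewrite e2; ring.
Qed.
End Sylvester.

(** * Primitive vector fields and monomial units *)

Section PrimitivePairs.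
Context (k : closedFieldType) (K : fieldType) (iota : {rmorphism k -> K}).
Local Notation ev1 := (ev1 iota).
Local Notation ev := (ev iota).
Local Notation pure := (purely_transcendental iota).

Lemma fibre_dvd c (P : {poly {poly k}}) : map_poly (horner_eval c) P = 0 ->
  exists P', P = ('X - c%:P)%:P * P'.
Proof.
move=> /polyP h; exists (map_poly (fun p : {poly k} => p %/ ('X - c%:P)) P).
have d0 : (0 : {poly k}) %/ ('X - c%:P) = 0 by rewrite div0p.
apply/polyP => j; rewrite coefCM coef_map_id0 // mulrC divpK // dvdp_XsubCl /root.
by have := h j; rewrite coef_map coef0 /= /horner_eval => ->.
Qed.

Section Pair.
Context (t y : K) (hty : pure t y) (al be : K).

Let pairing g A B := g * al = ev t y A /\ g * be = ev t y B.

(** Gauss's lemma in minimal form: g is chosen with A of least degree in y and then with leading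
    coefficient of least degree in t. Any other g' satisfies l g' = h g with l in k[t], and a root
    of l of least degree contradicts one of the two choices. *)
Lemma primitive_pair_left : al != 0 -> exists g A B, [/\ g != 0, pairing g A B &
  forall g' A' B', pairing g' A' B' -> exists M, g' = ev t y M * g].
Proof.
move=> al0.
pose fam s d := exists (g : K) (A B : {poly {poly k}}), [/\ g != 0, pairing g A B, A != 0, size A = s & size (lead_coef A) = d].
have nz g A B : pairing g A B -> g != 0 -> A != 0.
  by move=> [e _] g0; apply: contra_neq (mulf_neq0 g0 al0) => A0; rewrite e A0 ev0.
have ex_s : exists s, `[< exists d, fam s d >].
  have [[P Q] /= [q0 ea]] := pure_frac hty al; have [[R S] /= [s0 eb]] := pure_frac hty be.
  have hp : pairing (ev t y Q * ev t y S) (P * S) (R * Q).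
    by split; rewrite evM ?ea ?eb; field.
  exists (size (P * S)); apply/asboolP; exists (size (lead_coef (P * S))), (ev t y Q * ev t y S), (P * S), (R * Q).
  by have g0 := mulf_neq0 q0 s0; split=> //; exact: (nz _ _ _ hp g0).
have [s /asboolP [d0 fd0] min_s] := ex_minnP ex_s.
have ex_d : exists d, `[< fam s d >] by exists d0; apply/asboolP.
have [d /asboolP [g [A [B [g0 hp A0 sA dA]]]] min_d] := ex_minnP ex_d.
exists g, A, B; split=> // g' A' B' [ea eb]; have [ga gb] := hp.
have minS g1 A1 B1 : pairing g1 A1 B1 -> g1 != 0 -> (s <= size A1)%N.
  move=> h1 g10; apply: min_s; apply/asboolP; exists (size (lead_coef A1)), g1, A1, B1.
  by split=> //; apply: nz h1 g10.
pose l0 := lead_coef A ^+ scalp A' A.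
have l00 : l0 != 0 by rewrite expf_neq0 // lead_coef_eq0.
have eg : ev1 t l0 * g' = ev t y (A' %/ A) * g.
  have e := Pdiv.Idomain.divp_eq A' A; rewrite -/l0 in e.
  apply/eqP; rewrite -subr_eq0; apply: contraT => g10.
  have h1 : pairing (ev1 t l0 * g' - ev t y (A' %/ A) * g) (A' %% A) (l0%:P * B' - (A' %/ A) * B).
    split; rewrite mulrBl -!mulrA ?ea ?ga ?eb ?gb; last by rewrite evB !evM evC.
    have -> : A' %% A = l0%:P * A' - (A' %/ A) * A by rewrite mul_polyC e addrC addKr.
    by rewrite evB !evM evC.
  by have := minS _ _ _ h1 g10; rewrite -sA leqNgt ltn_modp A0.
have ex_l : exists m, `[< exists (l : {poly k}) (h : {poly {poly k}}), [/\ l != 0, size l = m & ev1 t l * g' = ev t y h * g] >].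
  by exists (size l0); apply/asboolP; exists l0, (A' %/ A).
have [m /asboolP [l [h [l_neq0 sl el]]] min_m] := ex_minnP ex_l.
have [le_1|lt_1] := leqP (size l) 1.
  have el1 := size1_polyC le_1; have c0 : l`_0 != 0 by apply: contraNneq l_neq0 => c0; rewrite el1 c0 polyC0.
  exists ((l`_0)^-1%:P%:P * h); rewrite evM evC ev1C -mulrA -el {2}el1 ev1C mulrA -rmorphM mulVf //.
  by rewrite rmorph1 mul1r.
have [c /factor_theorem [l' el']] : exists c, root l c by apply/closed_rootP; rewrite neq_ltn lt_1 orbT.
have x0 : 'X - c%:P != 0 :> {poly k} by rewrite polyXsubC_eq0.
have l'0 : l' != 0 by apply: contraNneq l_neq0 => z; rewrite el' z mul0r.
have tc0 : t - iota c != 0 by rewrite subr_eq0 (pure_neq_const _ hty).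
have etc : ev1 t ('X - c%:P) = t - iota c by rewrite ev1B ev1X ev1C.
have eA : l%:P * A' = h * A.
  by apply: (indep_inj (pure_indep hty)); rewrite !evM evC -ea -ga mulrA el mulrA.
have eB : l%:P * B' = h * B.
  by apply: (indep_inj (pure_indep hty)); rewrite !evM evC -eb -gb mulrA el mulrA.
pose sp := map_poly (horner_eval c) : {rmorphism {poly {poly k}} -> {poly k}}.
have sl0 : sp l%:P = 0 by rewrite /sp /= map_polyC /= /horner_eval el' !hornerE subrr mulr0.
(* On the fibre t = c either h vanishes, and l was not minimal, or A and B both vanish, and g could
   be divided by t - c. *)
have [sh|sh] := eqVneq (sp h) 0.
  have [h' eh] := fibre_dvd sh.
  have : (m <= size l')%N.
    apply: min_m; apply/asboolP; exists l', h'; split=> //.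
    by apply: (mulfI tc0); move: el; rewrite el' eh ev1M evM evC etc; move=> e; rewrite mulrA [_ * ev1 t l']mulrC e mulrA.
  by rewrite -sl el' size_mul // size_XsubC addn2 /= ltnn.
have kill P P' : l%:P * P' = h * P -> sp P = 0.
  move=> /(congr1 sp); rewrite !rmorphM sl0 mul0r => /esym /eqP.
  by rewrite mulf_eq0 (negbTE sh) => /eqP.
have [A1 eA1] := fibre_dvd (kill _ _ eA); have [B1 eB1] := fibre_dvd (kill _ _ eB).
have A10 : A1 != 0 by apply: contraNneq A0 => z; rewrite eA1 z mulr0.
have : (d <= size (lead_coef A1))%N.
  apply: min_d; apply/asboolP; exists (g / (t - iota c)), A1, B1; split=> //.
  - by rewrite mulf_neq0 ?invr_eq0.
  - by split; rewrite mulrAC ?ga ?gb ?eA1 ?eB1 evM evC etc mulrC mulKf.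
  by rewrite -sA eA1 size_Cmul.
rewrite -dA eA1 lead_coefM lead_coefC mulrC size_mul ?lead_coef_eq0 //.
by rewrite size_XsubC addn2 /= ltnn.
Qed.
End Pair.

Lemma primitive_pair t y al be : pure t y -> al != 0 \/ be != 0 -> exists g A B,
  [/\ g != 0, g * al = ev t y A, g * be = ev t y B &
  forall g' A' B', g' * al = ev t y A' -> g' * be = ev t y B' -> exists M, g' = ev t y M * g].
Proof.
move=> h [al0|be0].
  have [g [A [B [g0 [e1 e2] u]]]] := primitive_pair_left h be al0.
  by exists g, A, B; split=> // g' A' B' e3 e4; apply: (u g' A' B').
have [g [B [A [g0 [e1 e2] u]]]] := primitive_pair_left h al be0.
by exists g, A, B; split=> // g' A' B' e3 e4; apply: (u g' B' A').
Qed.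

Lemma monomial_factor s (P R : {poly {poly k}}) : P * R = 'X^s ->
  exists c j, c != 0 /\ P = c%:P%:P * 'X^j.
Proof.
elim: s P R => [|s IH] P R e.
  have [p0 r0] : P != 0 /\ R != 0.
    by apply/andP; rewrite -negb_or -mulf_eq0 e expr0 oner_neq0.
  have sPR : size (P * R) = 1%N by rewrite e expr0 size_poly1.
  have [sP sR] : (size P <= 1)%N /\ (size R <= 1)%N.
    by move/eqP: sPR; rewrite size_mul_eq1 => /andP[/eqP -> /eqP ->].
  move: e; rewrite (size1_polyC sP) (size1_polyC sR) expr0 -polyCM => /polyC_inj e.
  have [p1 r1] : P`_0 != 0 /\ R`_0 != 0.
    by apply/andP; rewrite -negb_or -mulf_eq0 e oner_neq0.
  have s1 : size (P`_0 * R`_0) = 1%N by rewrite e size_poly1.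
  have s0 : (size (P`_0)%R <= 1)%N by move/eqP: s1; rewrite size_mul_eq1 => /andP[/eqP -> _].
  exists (P`_0)`_0, 0%N; rewrite expr0 mulr1 -(size1_polyC s0); split=> //.
  by apply: contraNneq p1 => z; rewrite (size1_polyC s0) z polyC0.
have dX (Q : {poly {poly k}}) : Q`_0 = 0 -> Q = drop_poly 1 Q * 'X.
  move=> q0; rewrite -{1}(poly_take_drop 1 Q) expr1 (_ : take_poly 1 Q = 0) ?add0r //.
  by apply/polyP => i; rewrite coef_take_poly coef0; case: i.
have X0 : 'X != 0 :> {poly {poly k}} by rewrite polyX_eq0.
have : P`_0 * R`_0 == 0 by have /polyP/(_ 0%N) := e; rewrite coef0M coefXn => ->.
rewrite mulf_eq0 => /orP[/eqP /dX eP|/eqP /dX eR].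
  have [|c [j [c0 ej]]] := IH (drop_poly 1 P) R.
    by apply: (mulIf X0); rewrite mulrAC -eP e exprSr.
  by exists c, j.+1; split=> //; rewrite eP ej exprSr mulrA.
apply: (IH P (drop_poly 1 R)); apply: (mulIf X0).
by rewrite -mulrA -eR e exprSr.
Qed.

Lemma monomial_unit t y M Q s : pure t y -> kalg iota [set t; y] M -> kalg iota [set t; y] Q ->
  M * Q = y ^+ s -> exists c j, c != 0 /\ M = iota c * y ^+ j.
Proof.
move=> h /kalg2E [P ->] /kalg2E [R ->] e.
have [|c [j [c0 eP]]] := @monomial_factor s P R.
  by apply: (indep_inj (pure_indep h)); rewrite evM evXn evX.
by exists c, j; rewrite eP evM !evC ev1C evXn evX.
Qed.

Lemma monomial_nat t y (c c' : k) m n m' n' : pure t y -> c != 0 ->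
  iota c * t ^+ m * y ^+ n = iota c' * t ^+ m' * y ^+ n' -> m = m' /\ n = n'.
Proof.
move=> h c0 e.
have : (c *: 'X^m)%:P * 'X^n = (c' *: 'X^m')%:P * 'X^n' :> {poly {poly k}}.
  apply: (indep_inj (pure_indep h)); rewrite !evM !evC !evXn !evX -!mul_polyC.
  by rewrite !ev1M !ev1C !ev1Xn !ev1X.
move=> /polyP /(_ n); rewrite !coefCM !coefXn eqxx mulr1.
have [<-|_] := eqVneq n n'; last first.
  rewrite mulr0 => /eqP; rewrite scale_poly_eq0 (negbTE c0) /= expf_eq0 polyX_eq0 andbF //.
rewrite mulr1 => /polyP /(_ m); rewrite !coefZ !coefXn eqxx mulr1.
have [<-//|_] := eqVneq m m'.
by rewrite mulr0 => z; rewrite z eqxx in c0.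
Qed.

Lemma monomial_int t y (c c' : k) (m n m' n' : int) : pure t y -> c != 0 ->
  iota c * t ^ m * y ^ n = iota c' * t ^ m' * y ^ n' -> m = m' /\ n = n'.
Proof.
move=> h c0 e; have t0 := pure_neq0 h; have y0 := pure_neq0 (pure_swap h).
pose M : nat := (absz m + absz m')%N; pose N : nat := (absz n + absz n')%N.
have toN (z : K) (i : int) (L : nat) : z != 0 -> (absz i <= L)%N -> z ^+ L * z ^ i = z ^+ absz (Posz L + i).
  move=> z0 le; rewrite [z ^+ L]exprnP -expfzDr // [RHS]exprnP; congr (z ^ _).
  by rewrite gez0_abs //; lia.
have e1 : iota c * t ^+ absz (Posz M + m) * y ^+ absz (Posz N + n) = iota c' * t ^+ absz (Posz M + m') * y ^+ absz (Posz N + n').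
  rewrite -(toN t m M) -?(toN t m' M) -?(toN y n N) -?(toN y n' N) //; try by rewrite /M /N; lia.
  transitivity (t ^+ M * y ^+ N * (iota c * t ^ m * y ^ n)); first ring.
  by rewrite e; ring.
have [] := monomial_nat h c0 e1; rewrite /M /N; lia.
Qed.

Lemma coef_indep t y (a : nat -> K) (L N : nat) : pure t y ->
  (forall j, exists p, a j * t ^+ L = ev1 t p) -> \sum_(j < N) a j * y ^+ j = 0 ->
  forall j, (j < N)%N -> a j = 0.
Proof.
move=> h /choice [p hp] e j lt_j; have t0 := pure_neq0 h.
have : ev t y (\poly_(j < N) p j) = 0.
  rewrite ev_sum (big_ord_widen _ (fun l => ev1 t (\poly_(j < N) p j)`_l * y ^+ l) (size_poly _ _)).
  transitivity ((\sum_(j < N) a j * y ^+ j) * t ^+ L); last by rewrite e mul0r.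
  rewrite big_mkcond mulr_suml; apply: eq_bigr => i _.
  case: ltnP => [_|/(nth_default 0)]; rewrite coef_poly ltn_ord -?hp; first by rewrite mulrAC.
  by move=> z; have := hp i; rewrite z ev10 mulrAC => ->; rewrite mul0r.
move=> /(pure_indep h) /polyP /(_ j); rewrite coef0 coef_poly lt_j => z.
by have := hp j; rewrite z ev10 => /eqP; rewrite mulf_eq0 (negbTE (expf_neq0 _ t0)) orbF => /eqP.
Qed.

(** P2 is the reversal of P at formal degree n, so n is natural, bounds the degree of P, and the
    value of P2 at 0 is the coefficient of P at infinity. *)
Lemma rev_relation t y (P P2 : {poly {poly k}}) (c : k) (n : int) : pure t y -> c != 0 -> P != 0 ->
  ev t y^-1 P2 = iota c * y ^ (- n) * ev t y P ->
  exists m : nat, [/\ n = m, (size P <= m.+1)%N & P2`_0 = c%:P * P`_m].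
Proof.
move=> h c0 P0 e; have y0 := pure_neq0 (pure_swap h).
have P20 : P2 != 0.
  apply: contra_neq P0 => z; apply: (pure_indep h); move/esym/eqP: e.
  by rewrite z ev0 !mulf_eq0 fmorph_eq0 (negbTE c0) expfz_eq0 (negbTE y0) andbF => /eqP.
set L := (size P2).-1; have sL : (size P2 <= L.+1)%N by rewrite /L leqSpred.
have yi : y^-1 != 0 by rewrite invr_eq0.
have er := @ev_rev _ _ iota L t _ P2 yi sL; rewrite invrK in er.
have coefr i : (rev_fibre L P2)`_i = if (i <= L)%N then P2`_(L - i) else 0 by rewrite coef_poly ltnS.
case: n e => [n|n] e.
  exists n.
  have eq1 : rev_fibre L P2 * 'X^n = c%:P%:P * P * 'X^L.
    apply: (indep_inj (pure_indep h)); rewrite !evM !evC ev1C !evXn !evX er e -exprnN.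
    by have := expf_neq0 n y0; move: (y ^+ n) (y ^+ L) => p q p0; field.
  have cf i := congr1 (fun Q : {poly {poly k}} => Q`_i) eq1.
  split=> //.
    apply/leq_sizeP => j lt_j; have := cf (L + j)%N; rewrite !coefMXn.
    rewrite (ltnNge (L + j) n) (leq_trans (ltnW lt_j) (leq_addl _ _)) (ltnNge (L + j) L) leq_addr /=.
    rewrite addKn coefCM coefr leqNgt ltn_subRL (addnC n L) ltn_add2l lt_j /= => /esym /eqP.
    by rewrite mulf_eq0 polyC_eq0 (negbTE c0) => /eqP.
  have := cf (L + n)%N; rewrite !coefMXn (ltnNge (L + n) n) leq_addl (ltnNge (L + n) L) leq_addr /= addnK addKn coefr leqnn subnn.
  by rewrite coefCM.
exfalso.
have eq1 : rev_fibre L P2 = c%:P%:P * P * 'X^(L + n.+1).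
  apply: (indep_inj (pure_indep h)); rewrite !evM !evC ev1C !evXn !evX er e NegzE opprK exprD.
  by rewrite -exprnP; ring.
have : (size (rev_fibre L P2) <= L.+1)%N by exact: size_poly.
rewrite eq1 size_mulXn ?mulf_neq0 ?polyC_eq0 // size_Cmul ?polyC_eq0 //.
move=> le; have : (L + n.+1 + 1 <= L.+1)%N by apply: leq_trans le; rewrite leq_add2l size_poly_gt0.
by clear; lia.
Qed.
End PrimitivePairs.

(** * Foliations *)

Section LocalFoliations.
Context (k : closedFieldType) (K : fieldType) (iota : {rmorphism k -> K}).
Local Notation ev1 := (ev1 iota).
Local Notation ev := (ev iota).
Local Notation pure := (purely_transcendental iota).
Local Notation val c c' P := (ev (iota c) (iota c') P).

Definition point_ideal (t y : K) (c c' : k) : set K :=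
  [set z | exists2 P, z = ev t y P & val c c' P = 0].

Lemma val_const c c' P : exists d, val c c' P = iota d.
Proof. by rewrite ev_horner_inner ev1E horner_map; eexists. Qed.

Lemma point_ideal_max t y c c' : pure t y -> maximal_ideal (kalg iota [set t; y]) (point_ideal t y c c').
Proof.
move=> h; split.
- by move=> _ [P -> _]; apply/kalg2E; exists P.
- split; first by exists 0; rewrite ev0.
  by move=> _ _ [P -> eP] [Q -> eQ]; exists (P + Q); rewrite evD // eP eQ addr0.
- by move=> _ _ /kalg2E [P ->] [Q -> eQ]; exists (P * Q); rewrite evM // eQ mulr0.
- case=> P e; have -> : P = 1 by apply: (indep_inj (pure_indep h)); rewrite -e evo.
  by rewrite evo => /eqP; rewrite oner_eq0.
move=> _ /kalg2E [P ->] nP; have [d ed] := val_const c c' P.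
have d0 : d != 0.
  by apply/eqP => d0; apply: nP; exists P => //; rewrite ed d0 rmorph0.
exists (iota d^-1); first exact: kalg_const.
exists (1 - P * (d^-1)%:P%:P); rewrite evB evo evM evC ev1C //.
by rewrite ed -rmorphM mulfV // rmorph1 subrr.
Qed.

Definition point_ring (t y : K) (c c' : k) : set K :=
  localization (kalg iota [set t; y]) (point_ideal t y c c').

Lemma point_ringP t y c c' : affine_model (kalg iota [set t; y]) (point_ring t y c c') \/ ~ pure t y.
Proof.
have [h|h] := EM (pure t y); [left|by right].
by exists (point_ideal t y c c') => //; exact: point_ideal_max.
Qed.

Lemma point_ring_frac t y c c' f : pure t y -> point_ring t y c c' f ->
  exists P Q, val c c' Q != 0 /\ f = ev t y P / ev t y Q.
Proof.
move=> h [_ [_ [/kalg2E [P ->] /kalg2E [Q ->] nQ ->]]]; exists P, Q; split=> //.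
by apply/eqP => e; apply: nQ; exists Q.
Qed.

Lemma point_ring_mem t y c c' P Q : val c c' Q != 0 -> pure t y -> point_ring t y c c' (ev t y P / ev t y Q).
Proof.
move=> nQ h; exists (ev t y P), (ev t y Q); split=> //; [by apply/kalg2E; exists P|by apply/kalg2E; exists Q|].
by case=> Q' /(indep_inj (pure_indep h)) <- /eqP; apply/negP.
Qed.

Lemma point_ring_max t y c c' P Q : val c c' Q != 0 -> val c c' P = 0 -> pure t y ->
  max_ideal (point_ring t y c c') (ev t y P / ev t y Q).
Proof.
move=> nQ eP h; apply/(loc_maxP (point_ideal_max c c' h)).
exists (ev t y P), (ev t y Q); split=> //; [by exists P|by apply/kalg2E; exists Q|].
by case=> Q' /(indep_inj (pure_indep h)) <- /eqP; apply/negP.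
Qed.

(** A point where the product of the denominators does not vanish. It serves to compare stalks at
    different points through a common generization. *)
Lemma common_point t y (s : seq K) : pure t y -> exists c c', forall f, f \in s -> point_ring t y c c' f.
Proof.
move=> h; have /choice [f hf] := pure_frac h.
pose Q := \prod_(z <- s) (f z).2.
have Q0 : Q != 0.
  rewrite /Q; elim/big_ind: _ => [|a b a0 b0|z _]; rewrite ?oner_neq0 ?mulf_neq0 //.
  by apply: contraNneq (hf z).1 => ->; rewrite ev0.
have [c [c' cQ]] := poly2_nonroot iota Q0; exists c, c' => z zs.
rewrite (hf z).2; apply: point_ring_mem => //; apply: contraNneq cQ => e.
by rewrite /Q (big_rem z zs) /= evM e mul0r.
Qed.

Lemma kderivation_scale g D : kderivation iota D -> kderivation iota (fun z => g * D z).
Proof.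
move=> hD; split=> [z w|z w|c].
- by rewrite (derD hD) mulrDr.
- by rewrite (derM hD); ring.
- by rewrite (derC hD) mulr0.
Qed.

Lemma kderivation_add D E : kderivation iota D -> kderivation iota E -> kderivation iota (fun z => D z + E z).
Proof.
move=> hD hE; split=> [z w|z w|c].
- by rewrite (derD hD) (derD hE); ring.
- by rewrite (derM hD) (derM hE); ring.
- by rewrite (derC hD) (derC hE) addr0.
Qed.

Lemma der_kalg2 D t y (A : set K) : kderivation iota D -> subalg iota A -> A t -> A y -> A (D t) -> A (D y) ->
  forall z, kalg iota [set t; y] z -> A (D z).
Proof.
move=> hD sA At Ay Dt Dy.
have hk z : kalg iota [set t; y] z -> A z by apply: (kalg_min sA) => _ [->|->].
apply: (@der_kalg k K iota D hD A [set t; y]).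
- exact: (subalg0 sA).
- exact: (subalgD sA).
- by move=> a b /hk Aa Ab; apply: (subalgM sA).
- by move=> _ [->|->].
Qed.

Lemma der_localization D t y O : kderivation iota D -> affine_model (kalg iota [set t; y]) O ->
  O (D t) -> O (D y) -> forall z, O z -> O (D z).
Proof.
move=> hD hO; have [sO [Ot Oy]] := chart_sub hO; case: hO => m hm eO Dt Dy z Oz.
have hA := der_kalg2 hD sO Ot Oy Dt Dy; have sA := kalg_subalg iota [set t; y].
move: (Oz); rewrite {1}eO => -[a [b [Aa Ab nb ->]]].
have AO w : kalg iota [set t; y] w -> O w by rewrite eO; exact: (loc_sub sA hm).
have b0 : b != 0 by apply: (nmax_neq0 hm).
have Ob : O b^-1 by rewrite eO; exists 1, b; split=> //; [exact: (subalg1 sA)|rewrite div1r].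
rewrite (derf hD) // -exprVn; apply: (subalgM sO); last exact: (subalgX sO).
by apply: (subalgB sO); apply: (subalgM sO) => //; [exact: hA|exact: AO|exact: AO|exact: hA].
Qed.

Lemma unimodular_generator (T : set (K -> K)) O a b : pure a b ->
  affine_model (kalg iota [set a; b]) O -> T `<=` tangent_stalk iota O ->
  (forall D E, T D -> T E -> T (fun z => D z + E z)) -> (forall f D, O f -> T D -> T (fun z => f * D z)) ->
  (exists2 D, T D & exists z, D z != 0) -> free_quotient O (tangent_stalk iota O) T ->
  exists2 D, T D & ~ (max_ideal O (D a) /\ max_ideal O (D b)).
Proof.
move=> h hO TO TD TM [D1 T1 [z1 D1z]] [r [B [MB span_B free_B]]].
have [sO [Oa Ob]] := chart_sub hO.
have [Da [hDa Daa Dab]] := pure_derivation h 1 0; have [Db [hDb Dba Dbb]] := pure_derivation h 0 1.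
have O0 := subalg0 sO; have O1 := subalg1 sO.
have tDa : tangent_stalk iota O Da by split=> //; apply: (der_localization hDa hO); rewrite ?Daa ?Dab.
have tDb : tangent_stalk iota O Db by split=> //; apply: (der_localization hDb hO); rewrite ?Dba ?Dbb.
have nm1 : ~ max_ideal O 1 by case=> _ /(_ 1 O1); rewrite mulr1.
have decomp D : kderivation iota D -> forall z, D z = D a * Da z + D b * Db z.
  move=> hD; apply: (der_ext h hD); last 2 first.
  - by rewrite Daa Dba mulr1 mulr0 addr0.
  - by rewrite Dab Dbb mulr1 mulr0 add0r.
  by apply: kderivation_add; apply: kderivation_scale.
have [c Oc Tc] := span_B _ tDa; have [d Od Td] := span_B _ tDb.
have TN D : T D -> T (fun z => - D z).
  by move=> TDD; have := TM (-1) D (subalgN sO O1) TDD; rewrite (_ : (fun z => -1 * D z) = fun z => - D z) //; apply/funext => z; rewrite mulN1r.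
case: r => [|r] in B MB span_B free_B c Oc Tc d Od Td *.
  exists Da; last by rewrite Daa => -[].
  move: Tc; rewrite (_ : (fun z => _) = Da) //; apply/funext => z.
  by rewrite big_ord0 subr0.
have comb p q : O p -> O q -> T (fun z => (p * Da z + q * Db z) - \sum_i (p * c i + q * d i) * B i z).
  move=> Op Oq; have := TD _ _ (TM p _ Op Tc) (TM q _ Oq Td).
  rewrite (_ : (fun z => _) = (fun z => (p * Da z + q * Db z) - \sum_i (p * c i + q * d i) * B i z)) //.
  apply/funext => z; rewrite !mulrBr !big_distrr /= addrACA -opprD -big_split /=; congr (_ - _).
  by apply: eq_bigr => i _; ring.
have rel p q (e : 'I_r.+1 -> K) : O p -> O q -> (forall i, O (e i)) ->
    T (fun z => (p * Da z + q * Db z) - \sum_i e i * B i z) -> forall i, p * c i + q * d i = e i.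
  move=> Op Oq Oe Te i; apply/eqP; rewrite -subr_eq0; apply/eqP.
  apply: (free_B (fun i => p * c i + q * d i - e i)).
    by move=> j; apply: (subalgB sO) => //; apply: (subalgD sO); apply: (subalgM sO).
  have := TD _ _ Te (TN _ (comb p q Op Oq)).
  rewrite (_ : (fun z => _) = (fun z => \sum_j (p * c j + q * d j - e j) * B j z)) //.
  apply/funext => z.
  have -> : \sum_j (p * c j + q * d j - e j) * B j z = \sum_j (p * c j + q * d j) * B j z - \sum_j e j * B j z.
    by rewrite -sumrB; apply: eq_bigr => j _; rewrite mulrBl.
  by move: (\sum_j _) (\sum_j _) => s1 s2; ring.
have O_of D : tangent_stalk iota O D -> O (D a) /\ O (D b) by case=> _ hD; split; apply: hD.
have rel0 : forall i, D1 a * c i + D1 b * d i = 0.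
  have [O1a O1b] := O_of _ (TO _ T1); apply: rel => //.
  rewrite (_ : (fun z => _) = D1) //; apply/funext => z.
  by rewrite big1 ?subr0 -?(decomp _ (TO _ T1).1) // => i _; rewrite mul0r.
have [tB0 OB0] := MB ord0; have [OBa OBb] := O_of _ (MB ord0).
have rel1 : B ord0 a * c ord0 + B ord0 b * d ord0 = 1.
  rewrite (rel _ _ (fun i => if i == ord0 then 1 else 0)) ?eqxx //; first by move=> i; case: ifP.
  have T0 : T (fun z => 0 * D1 z) by apply: TM.
  move: T0; rewrite (_ : (fun z => 0 * D1 z) = (fun z => (B ord0 a * Da z + B ord0 b * Db z) - \sum_i (if i == ord0 then 1 else 0) * B i z)) //.
  apply/funext => z; rewrite -(decomp _ tB0) (bigD1 ord0) //= mul1r big1 ?addr0 ?subrr ?mul0r // => i /negbTE ->.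
  by rewrite mul0r.
have D1n0 : D1 a != 0 \/ D1 b != 0.
  apply: contrapT => /not_orP [/negP/negPn/eqP ea /negP/negPn/eqP eb].
  by move: D1z; rewrite (decomp _ (TO _ T1).1) ea eb !mul0r addr0 eqxx.
(* D1 is orthogonal to every pair (c_i, d_i), so these pairs are all proportional. *)
have det0 i : - d ord0 * c i + c ord0 * d i = 0.
  have e1 := rel0 i; have e2 := rel0 ord0.
  case: D1n0 => n0; apply: (mulfI n0); rewrite mulr0.
    transitivity (c ord0 * (D1 a * 0) - d ord0 * (D1 a * c i + D1 b * d i) + (D1 a * c ord0 + D1 b * d ord0) * d i); first ring.
    by rewrite e1 e2; ring.
  transitivity (c ord0 * (D1 a * c i + D1 b * d i) - c i * (D1 a * c ord0 + D1 b * d ord0)); first ring.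
  by rewrite e1 e2; ring.
exists (fun z => - d ord0 * Da z + c ord0 * Db z).
  have := comb (- d ord0) (c ord0) (subalgN sO (Od _)) (Oc _).
  rewrite (_ : (fun z => _) = (fun z => - d ord0 * Da z + c ord0 * Db z)) //.
  by apply/funext => z; rewrite big1 ?subr0 // => i _; rewrite det0 mul0r.
rewrite Daa Dba Dab Dbb !mulr0 !mulr1 addr0 add0r => -[md mc]; apply: nm1.
have [u [v [zs hreg]]] := chart_regular_point h hO.
rewrite -rel1; apply: (rp_maxD hreg); rewrite mulrC; first exact: (max_idealM sO).
rewrite -[d _]opprK mulNr -mulrN; apply: (max_idealM sO) => //; exact: (subalgN sO).
Qed.
End LocalFoliations.

(** * Generators of a foliation on affine charts *)

Section GlobalFoliations.
Context (k : closedFieldType) (K : fieldType) (iota : {rmorphism k -> K}).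
Local Notation ev1 := (ev1 iota).
Local Notation ev := (ev iota).
Local Notation pure := (purely_transcendental iota).
Local Notation span := Defs.span.
Local Notation val c c' P := (ev (iota c) (iota c') P).
Context (X : set (set K)) (T : set K -> set (K -> K)) (hT : regular_foliation iota X T).
Context (hXc : forall O, X O -> exists t y, pure t y /\ affine_model (kalg iota [set t; y]) O).

Lemma span_add O r (B : 'I_r -> K -> K) D E : subalg iota O -> span O B D -> span O B E ->
  span O B (fun z => D z + E z).
Proof.
move=> sO [c [Oc eD]] [d [Od eE]]; exists (fun i => c i + d i); split=> [i|z]; first exact: (subalgD sO).
by rewrite eD eE -big_split /=; apply: eq_bigr => i _; rewrite mulrDl.
Qed.

Lemma span_mul O r (B : 'I_r -> K -> K) f D : subalg iota O -> O f -> span O B D ->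
  span O B (fun z => f * D z).
Proof.
move=> sO Of [c [Oc eD]]; exists (fun i => f * c i); split=> [i|z]; first exact: (subalgM sO).
by rewrite eD big_distrr /=; apply: eq_bigr => i _; rewrite mulrA.
Qed.

Lemma span_gen O r (B : 'I_r -> K -> K) i : subalg iota O -> span O B (B i).
Proof.
move=> sO; exists (fun j => if j == i then 1 else 0); split=> [j|z].
  by case: ifP => _; [exact: (subalg1 sO)|exact: (subalg0 sO)].
by rewrite (bigD1 i) //= eqxx mul1r big1 ?addr0 // => j /negbTE ->; rewrite mul0r.
Qed.

Let X_subalg O : X O -> subalg iota O.
Proof. by move=> /hXc [t [y [_ /chart_sub []]]]. Qed.

Let X_frac O : X O -> frac_full O.
Proof.
move=> /hXc [t [y [h hO]]]; apply: frac_full_sub (pure_frac_full h).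
by have [sO [Ot Oy]] := chart_sub hO; apply: (kalg_min sO) => _ [->|->].
Qed.

Definition chart (t y : K) : Prop := pure t y /\ affine_model (kalg iota [set t; y]) `<=` X.

(** Coherence shows that all stalks lie on one line K D0 of derivations, and saturation that each
    stalk contains every regular field on this line. *)
Lemma foliation_line t y : chart t y -> exists D0, [/\ kderivation iota D0, exists z, D0 z != 0 &
  forall O, X O -> forall D, T O D <-> tangent_stalk iota O D /\ exists h, forall z, D z = h * D0 z].
Proof.
move=> [hty hX]; have [[[Ttan coh] fol] _] := hT.
have pX c c' : X (point_ring iota t y c c').
  by apply: hX; have [|] := point_ringP iota t y c c'.
have [c0 [c0' _]] := common_point [::] hty; set O0 := point_ring iota t y c0 c0'.
have XO0 : X O0 := pX c0 c0'.
have [[[D0 TD0 [z0 D0z]] _] _ _] := fol O0 XO0.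
have line O D : X O -> T O D -> exists h, forall z, D z = h * D0 z.
  move=> XO TOD; have sO := X_subalg XO.
  have [s [r [B [sB eB]]]] := coh O XO; have [s0 [r0 [B0 [sB0 eB0]]]] := coh O0 XO0.
  (* At this point both local presentations of T are valid, so their generators are proportional. *)
  have [c [c' hc]] := common_point (s ++ s0) hty; set O1 := point_ring iota t y c c' in hc.
  have XO1 : X O1 := pX c c'; have s1 := X_subalg XO1.
  have e1 : T O1 = span O1 B by apply: eB => // f fs; apply: hc; rewrite mem_cat fs.
  have e2 : T O1 = span O1 B0 by apply: eB0 => // f fs; apply: hc; rewrite mem_cat fs orbT.
  have [[_ prop] _ _] := fol O1 XO1.
  have TD := TOD; rewrite (eB O XO sB) in TD; have TDD0 := TD0; rewrite (eB0 O0 XO0 sB0) in TDD0.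
  have [d [_ eD]] := TD; have [d0 [_ eD0]] := TDD0.
  have [j [zj B0j]] : exists j, exists z, B0 j z != 0.
    apply: contrapT => nz; move: D0z; rewrite eD0 big1 ?eqxx // => i _.
    have [->|bz] := eqVneq (B0 i z0) 0; first by rewrite mulr0.
    by case: nz; exists i, z0.
  have TBj : T O1 (B0 j) by rewrite e2; exact: span_gen.
  have ratio F : T O1 F -> exists f, forall z, F z = f * B0 j z.
    move=> TF; have [a [b [ab0 e]]] := prop F (B0 j) TF TBj.
    have a0 : a != 0.
      apply: contra_neq ab0 => a0; have := e zj; rewrite a0 mul0r add0r => /eqP.
      by rewrite mulf_eq0 (negbTE B0j) orbF => /eqP ->.
    exists (- b / a) => z; apply: (mulfI a0); have := e z => /eqP; rewrite addr_eq0 => /eqP ->.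
    by field.
  have /choice [f hf] : forall i, exists f, forall z, B i z = f * B0 j z.
    by move=> i; apply: ratio; rewrite e1; exact: span_gen.
  have /choice [f0 hf0] : forall i, exists f, forall z, B0 i z = f * B0 j z.
    by move=> i; apply: ratio; rewrite e2; exact: span_gen.
  have [p eD'] : exists p, forall z, D z = p * B0 j z.
    exists (\sum_i d i * f i) => z; rewrite eD mulr_suml; apply: eq_bigr => i _; by rewrite hf mulrA.
  have [q eD0'] : exists q, forall z, D0 z = q * B0 j z.
    exists (\sum_i d0 i * f0 i) => z; rewrite eD0 mulr_suml; apply: eq_bigr => i _; by rewrite hf0 mulrA.
  have q0 : q != 0 by apply: contraNneq D0z => q0; rewrite eD0' q0 mul0r.
  by exists (p / q) => z; rewrite eD' eD0'; field.
exists D0; split; first by case: (Ttan O0 XO0 D0 TD0).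
  by exists z0.
move=> O XO D; split=> [TOD|[tD [h eD]]].
  by split; [exact: Ttan|exact: (line O)].
have sO := X_subalg XO.
have [[[D1 TD1 [z1 D1z]] _] tf _] := fol O XO.
have [h1 eD1] := line O D1 XO TD1.
have h10 : h1 != 0 by apply: contraNneq D1z => h10; rewrite eD1 h10 mul0r.
have [p [q [Op Oq q0 epq]]] := X_frac XO (h / h1).
have [s [r [B [sB eB]]]] := coh O XO.
(* Clearing the denominator q of h / h1 turns D into the multiple p D1 of a member of T;
   torsion-freeness of the quotient then yields D itself. *)
apply: (tf q) => //; rewrite (_ : (fun z => q * D z) = (fun z => p * D1 z)).
  by rewrite (eB O XO sB) in TD1 *; apply: span_mul.
apply/funext => z; rewrite eD eD1.
have -> : h = h1 * (p / q) by rewrite -epq mulrC divfK.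
by field.
Qed.

Section Line.
Context (D0 : K -> K) (hD0 : kderivation iota D0) (D0z : exists z, D0 z != 0).
Context (hline : forall O, X O -> forall D, T O D <-> tangent_stalk iota O D /\ exists h, forall z, D z = h * D0 z).

Lemma line_neq0 t y : pure t y -> D0 t != 0 \/ D0 y != 0.
Proof.
move=> h; apply: contrapT => /not_orP [/negP/negPn/eqP et /negP/negPn/eqP ey].
have [z] := D0z; have -> : D0 z = 0; last by rewrite eqxx.
by apply: (der_ext h hD0 (E := fun=> 0)); [split=> *; rewrite ?mulr0 ?mul0r ?addr0|rewrite et|rewrite ey].
Qed.

Definition preserves (A : set K) (g : K) : Prop := forall z, A z -> A (g * D0 z).

(** g D0 generates the foliation on the whole affine chart: its components are polynomials, every
    regular multiple of D0 is a polynomial multiple of it, and it has no zero. *)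
Definition generates (t y g : K) (P Q : {poly {poly k}}) : Prop :=
  [/\ g != 0, g * D0 t = ev t y P, g * D0 y = ev t y Q,
      forall g', preserves (kalg iota [set t; y]) g' -> exists2 M, kalg iota [set t; y] M & g' = M * g &
      forall c c', ~ (val c c' P = 0 /\ val c c' Q = 0)].

Lemma generates_preserves t y g P Q : generates t y g P Q -> preserves (kalg iota [set t; y]) g.
Proof.
move=> [_ eP eQ _ _] z hz; have sA := kalg_subalg iota [set t; y].
apply: (der_kalg2 (kderivation_scale g hD0) sA _ _ _ _ hz).
- by apply: kalg_gen; left.
- by apply: kalg_gen; right.
- by rewrite eP; apply/kalg2E; exists P.
by rewrite eQ; apply/kalg2E; exists Q.
Qed.

(** The primitive multiple of D0 exists since k[t, y] is factorial. Were both components to vanish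
    at a point, every local multiple of D0 would vanish there too, against
    [unimodular_generator]. *)
Lemma chart_generator t y : chart t y -> exists g P Q, generates t y g P Q.
Proof.
move=> [hty hX]; have [[[Ttan coh] fol] reg] := hT.
have [g [P [Q [g0 eP eQ univ]]]] := primitive_pair hty (line_neq0 hty).
exists g, P, Q; split=> // [g' hg'|c c' [cP cQ]].
  have /kalg2E [P' eP'] : kalg iota [set t; y] (g' * D0 t) by apply/hg'/kalg_gen; left.
  have /kalg2E [Q' eQ'] : kalg iota [set t; y] (g' * D0 y) by apply/hg'/kalg_gen; right.
  have [M eM] := univ g' P' Q' eP' eQ'.
  by exists (ev t y M) => //; apply/kalg2E; exists M.
have hO : affine_model (kalg iota [set t; y]) (point_ring iota t y c c') by have [|] := point_ringP iota t y c c'.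
have XO := hX _ hO; have sO := X_subalg XO.
have [s [r [B [sB eB]]]] := coh _ XO.
have [[nz _] _ _] := fol _ XO; have [_ fq] := reg _ XO.
have TDadd D E : T (point_ring iota t y c c') D -> T (point_ring iota t y c c') E ->
    T (point_ring iota t y c c') (fun z => D z + E z).
  by rewrite (eB _ XO sB); exact: span_add.
have TDmul f D : point_ring iota t y c c' f -> T (point_ring iota t y c c') D ->
    T (point_ring iota t y c c') (fun z => f * D z).
  by rewrite (eB _ XO sB); exact: span_mul.
have [D TD nD] := unimodular_generator hty hO (Ttan _ XO) TDadd TDmul nz fq.
have [[hD DO] [h eD]] := (hline XO D).1 TD.
apply: nD; rewrite !eD.
have [_ [Ot Oy]] := chart_sub hO.
have := DO _ Ot; have := DO _ Oy; rewrite !eD.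
move=> /(point_ring_frac hty) [R2 [S2 [nS2 e2]]] /(point_ring_frac hty) [R1 [S1 [nS1 e1]]].
have nS P' : val c c' P' != 0 -> ev t y P' != 0.
  by move=> nP; apply: contraNneq nP => e; rewrite (indep_inj (pure_indep hty) (etrans e (esym (ev0 iota t y)))) ev0.
have [s10 s20] := (nS _ nS1, nS _ nS2).
(* The local field, freed of its denominators S1 and S2, is a polynomial multiple of the primitive
   one. *)
have [||M eM] := univ (h * ev t y (S1 * S2)) (R1 * S2) (R2 * S1).
- by rewrite !evM mulrAC e1; field.
- by rewrite !evM mulrAC e2; field.
have e3 : ev t y (R1 * S2) = ev t y (M * P).
  by rewrite [RHS]evM -eP mulrA -eM !evM mulrAC e1; field.
have e4 : ev t y (R2 * S1) = ev t y (M * Q).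
  by rewrite [RHS]evM -eQ mulrA -eM !evM mulrAC e2; field.
have kill R S R' S' : val c c' S' != 0 -> val c c' R' = 0 -> ev t y (R * S') = ev t y (S * R') -> val c c' R = 0.
  move=> nS' z /(indep_inj (pure_indep hty)) /(congr1 (ev (iota c) (iota c'))).
  by rewrite !evM z mulr0 => /eqP; rewrite mulf_eq0 (negbTE nS') orbF => /eqP.
rewrite e1 e2; split; apply: point_ring_max => //; [exact: (kill _ _ _ _ nS2 cP e3)|exact: (kill _ _ _ _ nS1 cQ e4)].
Qed.

(** By the Leibniz rule f^(L + 1) E z = f E (f^L z) - L E(f) f^L z, so E z acquires only a bounded
    power of f as denominator; it suffices to bound it for the two generators. *)
Lemma transfer_preserves (A : set K) t' y' f E : kderivation iota E -> subalg iota A ->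
  f != 0 -> A f -> kalg iota [set t'; y'] f^-1 ->
  (forall z, kalg iota [set t'; y'] z -> exists N, A (f ^+ N * z)) ->
  (forall z, A z -> exists N, kalg iota [set t'; y'] (f^-1 ^+ N * z)) ->
  (forall z, A z -> A (E z)) ->
  exists N, forall z, kalg iota [set t'; y'] z -> kalg iota [set t'; y'] (f^-1 ^+ N * E z).
Proof.
move=> hE sA f0 Af Bf toA toB EA; have sB := kalg_subalg iota [set t'; y'].
have one z : kalg iota [set t'; y'] z -> exists N, kalg iota [set t'; y'] (f^-1 ^+ N * E z).
  move=> Bz; have [L AL] := toA z Bz.
  have fL0 := expf_neq0 L f0.
  have efL : E (f ^+ L) = f ^+ L / f * E f *+ L.
    elim: {AL fL0} L => [|L IH]; first by rewrite expr0 (der1 hE).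
    rewrite exprS (derM hE) IH mulrS -[f ^+ L / f * E f *+ L]mulr_natr -[f * _ / f * E f *+ L]mulr_natr; move: (E f) (f ^+ L) (L%:R : K) => a p q; by field.
  have ez : f ^+ L.+1 * E z = f * E (f ^+ L * z) - (E f *+ L) * (f ^+ L * z).
    rewrite (derM hE) efL exprS -[_ / f * E f *+ L]mulr_natr -[E f *+ L]mulr_natr; move: (E f) (E z) (f ^+ L) (L%:R : K) => a b p q; by field.
  have Aw : A (f ^+ L.+1 * E z).
    rewrite ez; apply: (subalgB sA); first by apply: (subalgM sA) => //; exact: EA.
    apply: (subalgM sA) => //; rewrite -mulr_natr; apply: (subalgM sA); first exact: EA.
    by rewrite -(rmorph_nat iota); exact: (subalgC sA).
  have [N hN] := toB _ Aw; exists (N + L.+1)%N.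
  rewrite exprD -mulrA.
  rewrite (_ : f^-1 ^+ N * _ = f^-1 ^+ L.+1 * f^-1 ^+ L.+1 * (f^-1 ^+ N * (f ^+ L.+1 * E z))).
    by do !apply: (subalgM sB) => //; apply: (subalgX sB).
  by rewrite !exprVn; have := expf_neq0 L.+1 f0; have := expf_neq0 N f0; move: (f ^+ N) (f ^+ L.+1) => p q p0 q0; field; rewrite p0 q0.
have Bt : kalg iota [set t'; y'] t' by apply: kalg_gen; left.
have By : kalg iota [set t'; y'] y' by apply: kalg_gen; right.
have [N1 h1] := one _ Bt; have [N2 h2] := one _ By.
exists (N1 + N2)%N; apply: (der_kalg2 (kderivation_scale _ hE) sB) => //.
  by rewrite addnC exprD -mulrA; apply: (subalgM sB) => //; apply: (subalgX sB).
by rewrite exprD -mulrA; apply: (subalgM sB) => //; apply: (subalgX sB).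
Qed.

(** Two generators differ by a unit on the overlap of the charts, and the units there are the
    monomials c f^s. *)
Lemma generator_transition t y t' y' f g g' P Q P' Q' : f != 0 ->
  kalg iota [set t; y] f -> kalg iota [set t'; y'] f^-1 ->
  (forall z, kalg iota [set t'; y'] z -> exists N, kalg iota [set t; y] (f ^+ N * z)) ->
  (forall z, kalg iota [set t; y] z -> exists N, kalg iota [set t'; y'] (f^-1 ^+ N * z)) ->
  (forall M R s, kalg iota [set t; y] M -> kalg iota [set t; y] R -> M * R = f ^+ s ->
     exists c j, c != 0 /\ M = iota c * f ^+ j) ->
  generates t y g P Q -> generates t' y' g' P' Q' ->
  exists c (s : int), c != 0 /\ g' = iota c * f ^ s * g.
Proof.
move=> f0 Af Bf toA toB mono hg hg'.
have [g0 _ _ univ _] := hg; have [g0' _ _ univ' _] := hg'.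
have sA := kalg_subalg iota [set t; y]; have sB := kalg_subalg iota [set t'; y'].
have [N hN] := transfer_preserves (kderivation_scale g hD0) sA f0 Af Bf toA toB (generates_preserves hg).
have Af' : kalg iota [set t; y] f^-1^-1 by rewrite invrK.
have fi0 : f^-1 != 0 by rewrite invr_eq0.
have [|N' hN'] := transfer_preserves (kderivation_scale g' hD0) sB fi0 Bf Af' toB _ (generates_preserves hg').
  by move=> z /toA; rewrite invrK.
rewrite invrK in hN'.
have [M' BM' eM'] : exists2 M', kalg iota [set t'; y'] M' & f^-1 ^+ N * g = M' * g'.
  by apply: univ' => z Bz; rewrite -mulrA; exact: hN.
have [M AM eM] : exists2 M, kalg iota [set t; y] M & f ^+ N' * g' = M * g.
  by apply: univ => z Az; rewrite -mulrA; exact: hN'.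
have [L AL] := toA _ BM'.
have fN0 := expf_neq0 N f0; have fN0' := expf_neq0 N' f0.
have eMM : M * (f ^+ L * M' * f ^+ N) = f ^+ (L + N').
  have -> : M = f ^+ N' * g' / g by rewrite eM mulfK.
  have -> : M' = f^-1 ^+ N * g / g' by rewrite eM' mulfK.
  rewrite exprVn exprD; move: fN0; move: (f ^+ N) (f ^+ N') (f ^+ L) => p q r p0; field; by rewrite p0 g0 g0'.
have AR : kalg iota [set t; y] (f ^+ L * M' * f ^+ N) by apply: (subalgM sA) => //; apply: (subalgX sA).
have [c [j [c0 ec]]] := mono M _ _ AM AR eMM.
exists c, (Posz j - Posz N'); split=> //.
apply: (mulfI fN0'); rewrite eM ec expfzDr // -exprnN -exprnP.
by move: fN0'; move: (f ^+ N') (f ^+ j) => p q p0; field.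
Qed.
End Line.
End GlobalFoliations.

(** * Sylvester determinants along the fibres *)

Section FibreCounting.
Context (k : closedFieldType) (K : fieldType) (iota : {rmorphism k -> K}).
Local Notation ev1 := (ev1 iota).
Local Notation ev := (ev iota).
Local Notation pure := (purely_transcendental iota).
Local Notation val c c' P := (ev (iota c) (iota c') P).

Definition laurent (t z : K) : Prop := exists L p, z * t ^+ L = ev1 t p.

Lemma laurent_subalg t : subalg iota (laurent t).
Proof.
split.
- by move=> c; exists 0%N, c%:P; rewrite ev1C mulr1.
- move=> z w [L [p ep]] [M [q eq]]; exists (L + M)%N, (p * 'X^M + q * 'X^L).
  by rewrite ev1D !ev1M !ev1Xn !ev1X -ep -eq exprD; ring.
move=> z w [L [p ep]] [M [q eq]]; exists (L + M)%N, (p * q).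
by rewrite ev1M -ep -eq exprD; ring.
Qed.

Lemma laurent_gen t : laurent t t.
Proof. by exists 0%N, 'X; rewrite ev1X mulr1. Qed.

Lemma laurent_inv t : t != 0 -> laurent t t^-1.
Proof. by move=> t0; exists 1%N, 1; rewrite ev11 expr1 mulVf. Qed.

Lemma laurent_exp t (s : int) : t != 0 -> laurent t (t ^ s).
Proof.
move=> t0; case: s => s.
  by rewrite -exprnP; apply: (subalgX (laurent_subalg t)); exact: laurent_gen.
by rewrite NegzE -exprnN -exprVn; apply: (subalgX (laurent_subalg t)); exact: laurent_inv.
Qed.

Lemma laurent_coef t y (a b : nat -> K) N : pure t y -> (forall j, laurent t (a j)) -> (forall j, laurent t (b j)) ->
  \sum_(j < N) a j * y ^+ j = \sum_(j < N) b j * y ^+ j -> forall j, (j < N)%N -> a j = b j.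
Proof.
move=> h la lb e j lt_j; have sL := laurent_subalg t; have t0 := pure_neq0 h.
have /choice [f hf] : forall j, exists Lp : nat * {poly k}, (a j - b j) * t ^+ Lp.1 = ev1 t Lp.2.
  by move=> i; have [L [p ep]] := subalgB sL (la i) (lb i); exists (L, p).
pose c i := if (i < N)%N then a i - b i else 0.
pose L := (\sum_(i < N) (f i).1)%N.
have hc i : exists p, c i * t ^+ L = ev1 t p.
  rewrite /c; case: ltnP => [lt_i|_]; last by exists 0; rewrite mul0r ev10.
  have le : ((f i).1 <= L)%N by rewrite /L (bigD1 (Ordinal lt_i)) //= leq_addr.
  by exists ((f i).2 * 'X^(L - (f i).1)); rewrite ev1M ev1Xn ev1X -hf -mulrA -exprD subnKC.
have e0 : \sum_(i < N) c i * y ^+ i = 0.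
  rewrite (eq_bigr (fun i : 'I_N => a i * y ^+ i - b i * y ^+ i)); last first.
    by move=> i _; rewrite /c ltn_ord mulrBl.
  by rewrite sumrB e subrr.
have := coef_indep h hc e0 lt_j; rewrite /c lt_j => /eqP.
by rewrite subr_eq0 => /eqP.
Qed.

Lemma ev_sum_wide t y (P : {poly {poly k}}) N : (size P <= N)%N ->
  ev t y P = \sum_(j < N) ev1 t P`_j * y ^+ j.
Proof.
move=> sP; rewrite ev_sum (big_ord_widen _ (fun l => ev1 t P`_l * y ^+ l) sP) big_mkcond.
by apply: eq_bigr => i _; case: ltnP => // /(nth_default 0) ->; rewrite ev10 mul0r.
Qed.

Lemma coef_transform t y rho u (P P' : {poly {poly k}}) : pure t y -> laurent t rho -> laurent t u ->
  ev t^-1 (y * rho) P' = u * ev t y P -> forall j, ev1 t^-1 P'`_j * rho ^+ j = u * ev1 t P`_j.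
Proof.
move=> h lr lu e j; have sL := laurent_subalg t; have t0 := pure_neq0 h.
pose N := (size P + size P' + j.+1)%N.
have lt_j : (j < N)%N by rewrite /N addnS ltnS leq_addl.
apply: (laurent_coef (a := fun j => ev1 t^-1 P'`_j * rho ^+ j) (b := fun j => u * ev1 t P`_j) h _ _ _ lt_j) => [i|i|].
- apply: (subalgM sL); last exact: (subalgX sL).
  by apply: (subalg_ev1 sL); exact: laurent_inv.
- by apply: (subalgM sL) => //; apply: (subalg_ev1 sL); exact: laurent_gen.
transitivity (ev t^-1 (y * rho) P').
  rewrite (@ev_sum_wide _ _ _ N); last by rewrite /N -addnA addnCA leq_addr.
  by apply: eq_bigr => i _; rewrite exprMn; ring.
rewrite e (@ev_sum_wide _ _ _ N); last by rewrite /N -addnA leq_addr.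
by rewrite big_distrr; apply: eq_bigr => i _ /=; rewrite mulrA.
Qed.

Lemma coef_transform2 t y rho w v (P Q Q' : {poly {poly k}}) : pure t y -> laurent t rho -> laurent t w -> laurent t v ->
  ev t^-1 (y * rho) Q' = w * ev t y Q + v * (y * ev t y P) ->
  forall j, ev1 t^-1 Q'`_j * rho ^+ j = w * ev1 t Q`_j + v * ev1 t ('X * P)`_j.
Proof.
move=> h lr lw lv e j; have sL := laurent_subalg t; have t0 := pure_neq0 h.
pose N := (size Q + size ('X * P)%R + size Q' + j.+1)%N.
have lt_j : (j < N)%N by rewrite /N addnS ltnS leq_addl.
apply: (laurent_coef (a := fun j => ev1 t^-1 Q'`_j * rho ^+ j) (b := fun j => w * ev1 t Q`_j + v * ev1 t ('X * P)`_j) h _ _ _ lt_j) => [i|i|].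
- apply: (subalgM sL); last exact: (subalgX sL).
  by apply: (subalg_ev1 sL); exact: laurent_inv.
- by apply: (subalgD sL); apply: (subalgM sL) => //; apply: (subalg_ev1 sL); exact: laurent_gen.
transitivity (ev t^-1 (y * rho) Q').
  rewrite (@ev_sum_wide _ _ _ N); last by rewrite /N; move: (size _) (size _) (size _) => p q r; lia.
  by apply: eq_bigr => i _; rewrite exprMn; ring.

rewrite e (_ : y * ev t y P = ev t y ('X * P)); last by rewrite evM evX.
rewrite (@ev_sum_wide _ _ Q N); last by rewrite /N -!addnA leq_addr.
rewrite (@ev_sum_wide _ _ ('X * P) N); last by rewrite /N -!addnA addnCA leq_addr.
by rewrite !big_distrr -big_split; apply: eq_bigr => i _ /=; ring.
Qed.

(** On every fibre t = c the pair consists of binary forms of degrees n and l without common zero;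
    the last clause is the point at infinity. *)
Definition fibre_good (l n : nat) (P Q : {poly {poly k}}) : Prop :=
  [/\ (size P <= n.+1)%N, (size Q <= l.+1)%N, forall c c', ~ (val c c' P = 0 /\ val c c' Q = 0) &
      forall c, ~ ((P`_n).[c] = 0 /\ (Q`_l).[c] = 0)].

Lemma val_horner c c' P : val c c' P = iota (map_poly (horner_eval c) P).[c'].
Proof. by rewrite ev_horner_inner ev1E horner_map. Qed.

Lemma poly_const (p : {poly k}) : (forall c, p.[c] != 0) -> exists2 d, d != 0 & p = d%:P.
Proof.
move=> hp; have [s1|s1] := eqVneq (size p) 1%N.
  by have /size_poly1P [d d0 ->] := introT eqP s1; exists d.
by have /closed_rootP [c] := s1; rewrite /root (negbTE (hp c)).
Qed.

(** The determinant is a polynomial in t that vanishes for no value of t. *)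
Lemma sylvester_const l n P Q : fibre_good l n P Q ->
  exists2 d, d != 0 & \det (sylvester l n P Q) = d%:P.
Proof.
move=> [sP sQ nz nl]; apply: poly_const => c.
have -> : (\det (sylvester l n P Q)).[c] =
    \det (sylvester l n (map_poly (horner_eval c) P) (map_poly (horner_eval c) Q)).
  by rewrite -map_sylvester det_map_mx.
apply: sylvester_neq0.
- exact: leq_trans (size_poly _ _) sP.
- exact: leq_trans (size_poly _ _) sQ.
- by move=> c' [/eqP h1 /eqP h2]; apply: (nz c c'); rewrite !val_horner h1 h2 rmorph0.
by rewrite !coef_map; exact: nl.
Qed.

(** Both trivializations have constant determinants, so [sylvester_weight] becomes an identity
    between monomials; its exponents carry the Chern number equation. *)
Lemma weight_identity t y rho u w v (l n : nat) (P Q P' Q' : {poly {poly k}}) : pure t y ->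
  laurent t rho -> laurent t u -> laurent t w -> laurent t v -> rho != 0 -> u != 0 -> w != 0 -> (n < l)%N ->
  ev t^-1 (y * rho) P' = u * ev t y P -> ev t^-1 (y * rho) Q' = w * ev t y Q + v * (y * ev t y P) ->
  fibre_good l n P Q -> fibre_good l n P' Q' ->
  exists2 d, d != 0 & iota d * rho ^+ (l * n) = u ^+ l * w ^+ n.
Proof.
move=> h lr lu lw lv r0 u0 w0 lt_nl eP eQ /sylvester_const [d d0 ed] /sylvester_const [d' d0' ed'].
have cP := coef_transform h lr lu eP; have cQ := coef_transform2 h lr lw lv eQ.
pose m1 := map_poly (ev1 t); pose m2 := map_poly (ev1 t^-1).
have th0 : rho^-1 != 0 by rewrite invr_eq0.
have c1 j : (m2 P')`_j = u * rho^-1 ^+ j * (m1 P)`_j.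
  rewrite !coef_map /= exprVn; apply: (mulIf (expf_neq0 j r0)); rewrite cP.
  by have := expf_neq0 j r0; move: (rho ^+ j) => p p0; field.
pose mu := v * rho^-1 / u.
have c2 j : (m2 Q' - mu *: ('X * m2 P'))`_j = w * rho^-1 ^+ j * (m1 Q)`_j.
  rewrite coefB coefZ coefXM; apply: (mulIf (expf_neq0 j r0)).
  rewrite mulrBl [(m2 Q')`_j]coef_map [(m1 Q)`_j]coef_map /= cQ coefXM.
  case: j => [|j] /=; first by rewrite ev10 !expr0; ring.
  rewrite c1 [(m1 P)`_j]coef_map /=.
  rewrite /mu [in RHS]exprS exprS !exprVn; have := expf_neq0 j r0; move: (rho ^+ j) => p p0.
  by field; rewrite p0 r0 u0.
have e2 : m2 Q' = (m2 Q' - mu *: ('X * m2 P')) + mu *: ('X * m2 P') by rewrite subrK.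
have := sylvester_weight lt_nl th0 c1 c2 e2.
rewrite -!map_sylvester !det_map_mx /= ed ed' !ev1C => e.
exists (d' / d); first by rewrite mulf_neq0 ?invr_eq0.
rewrite rmorphM fmorphV e exprVn; have := expf_neq0 (l * n) r0.
have : iota d != 0 by rewrite fmorph_eq0.
by move: (rho ^+ _) (iota d) => p q p0 q0; field; rewrite p0 q0.
Qed.

(** A polynomial in t equal to a polynomial in 1 / t is a constant; this is [rev_relation] with
    exponent 0. *)
Lemma polynomial_laurent t y (r f : {poly k}) i : pure t y -> ev1 t^-1 r = ev1 t f -> f`_i.+1 = 0.
Proof.
move=> h e; have [->|f0] := eqVneq f 0; first by rewrite coef0.
have evmap z p : ev y z (map_poly polyC p) = ev1 z p.
  elim/poly_ind: p => [|p c IH]; first by rewrite map_poly0 ev0 ev10.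
  by rewrite rmorphD rmorphM /= map_polyX map_polyC /= evD evM evX evC ev1C IH ev1D ev1M ev1X ev1C.
have F0 : map_poly polyC f != 0 :> {poly {poly k}} by rewrite map_poly_eq0_id0 // polyC_eq0 lead_coef_eq0.
have [|m [em sf _]] := rev_relation (P2 := map_poly polyC r) (n := 0) (pure_swap h) (oner_neq0 k) F0.
  by rewrite !evmap e oppr0 expr0z rmorph1 !mul1r.
case: em => em; rewrite -em in sf; have := leq_sizeP _ _ sf i.+1 isT.
by rewrite coef_map => /eqP; rewrite polyC_eq0 => /eqP.
Qed.

Section Pair.
Context (D0 : K -> K) (hD0 : kderivation iota D0).

(** In the coordinate 1 / y the first component is multiplied by y^s and the second one also by -
    y^(-2). This fixes the formal degrees m = - s and m + 2, and the absence of zeros of the second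
    pair at 0 is the condition at infinity. *)
Lemma fibre_pair t y g P Q g2 P2 Q2 c (s : int) : pure t y -> c != 0 -> D0 t != 0 ->
  generates iota D0 t y g P Q -> generates iota D0 t y^-1 g2 P2 Q2 -> g2 = iota c * y ^ s * g ->
  exists m : nat, s = - (m : int) /\ fibre_good m.+2 m P Q.
Proof.
move=> h c0 Dt [g0 eP eQ _ nz] [g20 eP2 eQ2 _ nz2] eg; have y0 := pure_neq0 (pure_swap h).
have P0 : P != 0 by apply: contra_neq (mulf_neq0 g0 Dt) => z; rewrite eP z ev0.
have [|m [em sP cP]] := rev_relation (P2 := P2) (n := - s) h c0 P0.
  by rewrite opprK -eP2 eg -eP mulrA.
exists m; split; first by rewrite -em opprK.
have eQ2' : ev t y^-1 Q2 = iota (- c) * y ^ (- (- s + 2)) * ev t y Q.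
  rewrite -eQ2 (derV hD0) // eg -eQ opprD opprK expfzDr // rmorphN -exprnN.
  by move: (y ^ s) => p; field.
have [sQ cQ] : (size Q <= m.+3)%N /\ Q2`_0 = (- c)%:P * Q`_m.+2.
  have [Q0|Q0] := eqVneq Q 0.
    rewrite Q0 size_poly0 coef0 mulr0; split=> //.
    have -> : Q2 = 0 by apply: (pure_indep (pure_inv2 h)); rewrite eQ2' Q0 ev0 mulr0.
    by rewrite coef0.
  have [|m' [em' sQ cQ]] := rev_relation h _ Q0 eQ2'; first by rewrite oppr_eq0.
  by have -> : m.+2 = m' by move: em' em; clear; lia.
split=> // c1 [p0 q0]; apply: (nz2 c1 0).
rewrite !val_horner !horner_coef0 !coef_map /= /horner_eval cP cQ !hornerM p0 q0 !mulr0 rmorph0.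
by [].
Qed.
End Pair.
End FibreCounting.

Section Transitions.
Context (k : closedFieldType) (K : fieldType) (iota : {rmorphism k -> K}).
Local Notation ev1 := (ev1 iota).
Local Notation ev := (ev iota).
Local Notation pure := (purely_transcendental iota).
Local Notation val c c' P := (ev (iota c) (iota c') P).
Context (D0 : K -> K) (hD0 : kderivation iota D0).
Local Notation generates := (generates iota D0).

Lemma expz_nat (z : K) (i : int) (L : nat) : z != 0 -> (absz i <= L)%N ->
  exists n : nat, z ^+ L * z ^ i = z ^+ n.
Proof.
move=> z0 le; exists (absz (Posz L + i)).
rewrite [z ^+ L]exprnP -expfzDr // [RHS]exprnP; congr (z ^ _).
by rewrite gez0_abs //; lia.
Qed.

Lemma kalg_denominators (A S : set K) f : subalg iota A -> A f ->
  (forall z, S z -> exists N, A (f ^+ N * z)) -> forall z, kalg iota S z -> exists N, A (f ^+ N * z).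
Proof.
move=> sA Af hS z; elim=> {z} [c|z /hS //|z w _ [N hN] _ [M hM]|z w _ [N hN] _ [M hM]].
- by exists 0%N; rewrite mul1r; exact: (subalgC sA).
- exists (N + M)%N; rewrite mulrDr; apply: (subalgD sA).
    by rewrite addnC exprD -mulrA; apply: (subalgM sA) => //; apply: (subalgX sA).
  by rewrite exprD -mulrA; apply: (subalgM sA) => //; apply: (subalgX sA).
by exists (N + M)%N; rewrite exprD mulrACA; apply: (subalgM sA).
Qed.

Lemma pairC (t y : K) : [set t; y] = [set y; t].
Proof. by apply/seteqP; split=> z [->|->]; [right|left|right|left]. Qed.

Lemma transition_fibre t y g P Q g' P' Q' : pure t y -> generates t y g P Q ->
  generates t y^-1 g' P' Q' -> exists c (s : int), c != 0 /\ g' = iota c * y ^ s * g.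
Proof.
move=> h; have y0 := pure_neq0 (pure_swap h).
have sA := kalg_subalg iota [set t; y]; have sB := kalg_subalg iota [set t; y^-1].
apply: (generator_transition hD0 y0).
- by apply: kalg_gen; right.
- by apply: kalg_gen; right.
- apply: (kalg_denominators sA); first by apply: kalg_gen; right.
  move=> _ [->|->]; [by exists 0%N; rewrite mul1r; apply: kalg_gen; left|exists 1%N; rewrite expr1 mulfV //].
  exact: (subalg1 sA).
- apply: (kalg_denominators sB); first by apply: kalg_gen; right.
  move=> _ [->|->]; [by exists 0%N; rewrite mul1r; apply: kalg_gen; left|exists 1%N; rewrite expr1 mulVf //].
  exact: (subalg1 sB).
by move=> M R s; exact: monomial_unit.
Qed.

(** The exponent is an integer: it is e or - e on F_e, according to the end of the fibre, and - 1 on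
    the plane. *)
Lemma transition_base t y (e : int) g P Q g' P' Q' : pure t y -> generates t y g P Q ->
  generates t^-1 (y * t ^ e) g' P' Q' -> exists c (s : int), c != 0 /\ g' = iota c * t ^ s * g.
Proof.
move=> h; have t0 := pure_neq0 h; have ti0 : t^-1 != 0 by rewrite invr_eq0.
have sA := kalg_subalg iota [set t; y]; have sB := kalg_subalg iota [set t^-1; y * t ^ e].
have At : kalg iota [set t; y] t by apply: kalg_gen; left.
have Bt : kalg iota [set t^-1; y * t ^ e] t^-1 by apply: kalg_gen; left.
apply: (generator_transition hD0 t0) => //.
- apply: (kalg_denominators sA) => // _ [->|->].
    by exists 1%N; rewrite expr1 mulfV //; exact: (subalg1 sA).
  exists (absz e); rewrite mulrCA; have [N ->] := expz_nat t0 (leqnn (absz e)).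
  by apply: (subalgM sA); [apply: kalg_gen; right|exact: (subalgX sA)].
- apply: (kalg_denominators sB) => // _ [->|->].
    by exists 1%N; rewrite expr1 mulVf //; exact: (subalg1 sB).
  exists (absz e); have [N eN] := expz_nat ti0 (leqnn (absz e)).
  have -> : t^-1 ^+ absz e * y = (y * t ^ e) * (t^-1 ^+ absz e * t^-1 ^ e).
    have tz : t ^ e != 0 by rewrite expfz_neq0.
    by rewrite exprz_inv -invr_expz; move: (t^-1 ^+ _) (t ^ e) tz => p q q0; field.
  by rewrite eN; apply: (subalgM sB); [apply: kalg_gen; right|exact: (subalgX sB)].
by move=> M R s; rewrite pairC; exact: (monomial_unit (pure_swap h)).
Qed.

Lemma generates_swap t y g P Q : generates t y g P Q -> generates y t g (swapXY Q) (swapXY P).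
Proof.
move=> [g0 eP eQ univ nz]; split=> //; rewrite ?ev_swap // 1?pairC //.
by move=> c c'; rewrite !ev_swap => -[h1 h2]; apply: (nz c' c).
Qed.
End Transitions.

(** * Regular foliations on F_e *)

Section Hirzebruch.
Context (k : closedFieldType) (K : fieldType) (iota : {rmorphism k -> K}).
Local Notation ev1 := (ev1 iota).
Local Notation ev := (ev iota).
Local Notation pure := (purely_transcendental iota).
Local Notation val c c' P := (ev (iota c) (iota c') P).
Context (e : nat) (t y : K) (hty : pure t y) (X : set (set K)) (eX : X = hirzebruch_model iota e t y).
Context (T : set K -> set (K -> K)).
Context (D0 : K -> K) (hD0 : kderivation iota D0) (D0z : exists z, D0 z != 0).
Context (hline : forall O, X O -> forall D, T O D <-> tangent_stalk iota O D /\ exists h, forall z, D z = h * D0 z).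
Local Notation generates := (generates iota D0).

(** If D0 kills t', the line K D0 consists of all derivations that kill k(t'). *)
Lemma fibration_of_kernel t' y' : pure t' y' -> D0 t' = 0 -> is_fibration iota X T t'.
Proof.
move=> h Dt O XO; have Dy : D0 y' != 0 by have [] := line_neq0 hD0 D0z h; rewrite ?Dt ?eqxx.
apply/seteqP; split=> D.
  move=> /(hline XO) [tD [g eD]]; split=> // _ [a [b [Aa Ab b0 ->]]].
  have [hD _] := tD; have Dt0 : D t' = 0 by rewrite eD Dt mulr0.
  have ker z : kalg iota [set t'] z -> D z = 0.
    elim=> {z} [c|z ->|z w _ ez _ ew|z w _ ez _ ew] //; first exact: (derC hD).
    - by rewrite (derD hD) ez ew addr0.
    - by rewrite (derM hD) ez ew mul0r mulr0 addr0.
  by rewrite (derf hD) // !ker // mul0r mulr0 subrr mul0r.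
move=> [tD kD]; apply/(hline XO); split=> //; have [hD _] := tD.
exists (D y' / D0 y'); apply: (der_ext h hD (kderivation_scale _ hD0)); last by rewrite divfK.
rewrite Dt mulr0; apply: kD; exists t', 1; split; rewrite ?divr1 ?oner_neq0 //.
  by apply: kalg_gen.
by exact: (subalg1 (kalg_subalg iota _)).
Qed.

Context (g1 g2 g3 g4 : K) (P1 Q1 P2 Q2 P3 Q3 P4 Q4 : {poly {poly k}}).
Context (h1 : generates t y g1 P1 Q1) (h2 : generates t y^-1 g2 P2 Q2).
Context (h3 : generates t^-1 (y * t ^+ e) g3 P3 Q3) (h4 : generates t^-1 (y * t ^+ e)^-1 g4 P4 Q4).
Hypothesis (Dt : D0 t != 0).

Let t0 : t != 0. Proof. exact: pure_neq0 hty. Qed.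
Let y0 : y != 0. Proof. exact: pure_neq0 (pure_swap hty). Qed.
Let hty' : pure t^-1 (y * t ^+ e). Proof. exact: pure_hirzebruch. Qed.

Lemma hirzebruch_weights : exists (m : nat) (s s5 : int) (c2 c3 c5 : k),
  [/\ [/\ c2 != 0, c3 != 0 & c5 != 0],
      [/\ g2 = iota c2 * y ^ (- (m : int)) * g1, g3 = iota c3 * t ^ s * g1 & g4 = iota c5 * t ^ s5 * g2],
      fibre_good iota m.+2 m P1 Q1 & fibre_good iota m.+2 m P3 Q3].
Proof.
have [c2 [s2 [c20 e2]]] := transition_fibre hD0 hty h1 h2.
have [c3 [s3 [c30 e3]]] := transition_base (e := e) hD0 hty h1 h3.
have [c4 [s4 [c40 e4]]] := transition_fibre hD0 hty' h3 h4.
have h4' : generates t^-1 (y^-1 * t ^ (- (e : int))) g4 P4 Q4.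
  by move: h4; rewrite invfM exprnN.
have [c5 [s5 [c50 e5]]] := transition_base hD0 (pure_inv2 hty) h2 h4'.
have g10 : g1 != 0 by case: h1.
(* The transition from the first to the fourth chart, computed along both paths, shows that the
   degree on fibres is the same at both ends of the base. *)
have es : s4 = s2.
  have : iota (c4 * c3) * t ^ ((e : int) * s4 + s3) * y ^ s4 = iota (c5 * c2) * t ^ s5 * y ^ s2.
    apply: (mulIf g10); transitivity g4; last by rewrite e5 e2 rmorphM; ring.
    by rewrite e4 e3 expfzMl exprnP exprz_exp expfzDr // rmorphM; ring.
  by case/(monomial_int hty (mulf_neq0 c40 c30)).
have Dti : D0 t^-1 != 0.
  by rewrite (derV hD0) // mulf_neq0 ?oppr_eq0 ?invr_eq0 ?expf_neq0.
have [m [em gm]] := fibre_pair hD0 hty c20 Dt h1 h2 e2.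
have [m' [em' gm']] := fibre_pair hD0 hty' c40 Dti h3 h4 e4.
have emm : m' = m by move: em em' es; clear; lia.
rewrite emm in gm'; exists m, s3, s5, c2, c3, c5; rewrite -em; split=> //; split=> //.
Qed.

Section Weights.
Context (m : nat) (s : int) (c3 : k) (c30 : c3 != 0) (e3 : g3 = iota c3 * t ^ s * g1).

Let tz i : t ^ i != 0. Proof. by rewrite expfz_neq0. Qed.
Let lt i : laurent iota t (t ^ i). Proof. exact: laurent_exp. Qed.
Let lC c i : laurent iota t (iota c * t ^ i).
Proof.
apply: (subalgM (laurent_subalg iota t)); last exact: laurent_exp.
exact: (subalgC (laurent_subalg iota t)).
Qed.

Lemma base_relation1 : ev t^-1 (y * t ^+ e) P3 = iota (- c3) * t ^ (s - 2) * ev t y P1.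
Proof.
have [_ <- _ _ _] := h3; have [_ <- _ _ _] := h1.
rewrite (derV hD0) // e3 expfzDr // rmorphN -exprnN; move: (t ^ s) => p.
by field.
Qed.

Lemma base_relation2 : ev t^-1 (y * t ^+ e) Q3 = iota c3 * t ^ (s + e) * ev t y Q1 +
  iota (c3 * e%:R) * t ^ (s + e - 1) * (y * ev t y P1).
Proof.
have [_ _ <- _ _] := h3; have [_ <- <- _ _] := h1.
have det l : D0 (t ^+ l) * t = l%:R * t ^+ l * D0 t.
  elim: l => [|l IH]; first by rewrite expr0 (der1 hD0) !mul0r.
  rewrite exprS (derM hD0); transitivity (D0 t * t ^+ l * t + t * (D0 (t ^+ l) * t)); first ring.
  by rewrite IH -natr1; ring.
rewrite (derM hD0) e3 !expfzDr // -exprnP -exprnN expr1 rmorphM rmorph_nat.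
have -> : D0 (t ^+ e) = e%:R * t ^+ e * D0 t / t by rewrite -det mulfK.
by move: (t ^ s) (t ^+ e) => p q; field.
Qed.

Context (G1 : fibre_good iota m.+2 m P1 Q1) (G3 : fibre_good iota m.+2 m P3 Q3).

(** Comparison of the exponents of t in [weight_identity]: the components of the field have weights
    s - 2 and s + e, and the fibre coordinate has weight e. *)
Lemma weight_equation : ((s - 2) * (m.+2 : int) + (s + e) * (m : int) = (e : int) * ((m.+2 : int) * (m : int)))%R.
Proof.
have u0 : iota (- c3) * t ^ (s - 2) != 0 by rewrite mulf_neq0 // fmorph_eq0 oppr_eq0.
have w0 : iota c3 * t ^ (s + e) != 0 by rewrite mulf_neq0 // fmorph_eq0.
have lr : laurent iota t (t ^+ e) by rewrite exprnP.
have [L eL] : exists L, L = m.+2 by exists m.+2.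
have lt_m : (m < L)%N by rewrite eL.
have := G3; have := G1; rewrite -eL => G1' G3'.
have [d d0] := weight_identity hty lr (lC _ _) (lC _ _) (lC _ _) (expf_neq0 e t0) u0 w0 lt_m base_relation1 base_relation2 G1' G3'.
rewrite !exprMn -!rmorphXn -exprM => e0.
have : iota d * t ^ ((e * (L * m))%N : int) * y ^ 0 =
    iota ((- c3) ^+ L * c3 ^+ m) * t ^ ((s - 2) * (L : int) + (s + e) * (m : int)) * y ^ 0.
  rewrite -exprnP e0 [t ^ (_ * _ + _ * _)]expfzDr // -[t ^ (_ * (L : int))]exprz_exp -[t ^ (_ * (m : int))]exprz_exp.
  by rewrite -!exprnP rmorphM; ring.
by case/(monomial_int hty d0) => <- _; rewrite !PoszM.
Qed.

Let rho0 : t ^+ e != 0. Proof. exact: expf_neq0. Qed.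

(** For s > 2 both weights are positive, and a positive power of t times a nonzero polynomial is not
    a polynomial in 1 / t. So P and Q would vanish all along the curve y = 0. *)
Lemma section_vanishes : (2 < s)%R -> False.
Proof.
move=> s_gt2; have lr : laurent iota t (t ^+ e) by rewrite exprnP.
have [_ _ nz _] := G1.
have coef0 c (i : nat) (p q : {poly k}) : c != 0 -> ev1 t^-1 q = iota c * t ^+ i.+1 * ev1 t p -> p = 0.
  move=> c0 eq; have e0 : ev1 t^-1 q = ev1 t (c *: (p * 'X^(i.+1))).
    by rewrite eq -mul_polyC !ev1M ev1C ev1Xn ev1X; ring.
  apply/polyP => j; rewrite coef0; have := polynomial_laurent (i + j) hty e0.
  by rewrite -addSn coefZ coefMXn ltnNge leq_addr /= addKn => /eqP; rewrite mulf_eq0 (negbTE c0) => /eqP.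
have p0 : P1`_0 = 0.
  have := coef_transform hty lr (lC _ _) base_relation1 0%N; rewrite !expr0 mulr1.
  have -> : s - 2 = Posz (absz (s - 3)).+1 by move: s_gt2; clear; lia.
  by rewrite -exprnP; apply: coef0; rewrite oppr_eq0.
have q0 : Q1`_0 = 0.
  have := coef_transform2 hty lr (lC _ _) (lC _ _) base_relation2 0%N.
  rewrite coefXM /= ev10 mulr0 addr0 !expr0 mulr1.
  have -> : s + e = Posz (absz (s + (e : int) - 1)%R).+1 by move: s_gt2; clear; lia.
  by rewrite -exprnP; apply: coef0.
by apply: (nz 0 0); rewrite !val_horner !horner_coef0 !coef_map /= p0 q0 /horner_eval !horner0 rmorph0.
Qed.

Hypothesis m0 : m = 0%N.

(** At a zero of P the quadratic form Q would have no zero on the fibre, not even at infinity, which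
    is impossible over a closed field. *)
Lemma riccati_const : exists2 d, d != 0 & P1 = d%:P%:P.
Proof.
have := G1; rewrite m0 => -[sP sQ nz nl].
have eP := size1_polyC sP.
have hp c : (P1`_0).[c] != 0.
  apply/eqP => pc; have q2 : (Q1`_2).[c] != 0 by apply/eqP => q2; apply: (nl c).
  have : size (map_poly (horner_eval c) Q1) != 1%N.
    apply/eqP => s1; move: q2; rewrite -[_.[c]]/(horner_eval c Q1`_2) -coef_map nth_default ?eqxx //.
    by rewrite s1.
  move=> /closed_rootP [c' /eqP qc']; apply: (nz c c'); rewrite !val_horner qc' eP.
  by rewrite map_polyC /= hornerC /horner_eval pc rmorph0.
by have [d d0 ed] := poly_const hp; exists d => //; rewrite {1}eP ed.
Qed.

(** In the gluing of the coefficient of y in Q, the term in t of degree one is c3 e d; it must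
    vanish as the other side is a polynomial in 1 / t. *)
Lemma riccati_char : s = 2 -> e%:R = 0 :> k.
Proof.
move=> es; have [d d0 eP] := riccati_const; have lr : laurent iota t (t ^+ e) by rewrite exprnP.
have := coef_transform2 hty lr (lC _ _) (lC _ _) base_relation2 1%N.
rewrite coefXM /= eP coefC /= ev1C es !expr1 => e1.
have e0 : ev1 t^-1 Q3`_1 = ev1 t (c3 *: (Q1`_1 * 'X^2) + (c3 * e%:R * d) *: 'X).
  apply: (mulIf rho0); rewrite e1 -!mul_polyC ev1D !ev1M !ev1C ?ev1Xn !ev1X !rmorphM !expfzDr //.
  by rewrite -!exprnP -exprnN expr1; move: (t ^+ e) => p; field.
have := polynomial_laurent 0 hty e0.
rewrite coefD !coefZ coefMXn coefX /= mulr0 add0r mulr1 => /eqP.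
by rewrite !mulf_eq0 (negbTE c30) (negbTE d0) orbF => /eqP.
Qed.

(** For e = 0 the coefficients of Q are multiplied by t^2 without a correction term, which leaves
    only Q = 0. *)
Lemma product_kernel : s = 2 -> e = 0%N -> D0 y = 0.
Proof.
move=> es ee; have lr : laurent iota t (t ^+ e) by rewrite exprnP.
have q0 : Q1 = 0.
  apply/polyP => j; rewrite coef0.
  have := coef_transform2 hty lr (lC _ _) (lC _ _) base_relation2 j.
  have -> : iota (c3 * e%:R) = 0 by rewrite ee mulr0n mulr0 rmorph0.
  have -> : t ^+ e = 1 by rewrite ee expr0.
  have -> : s + e = Posz 2 by rewrite es ee.
  rewrite !mul0r addr0 expr1n mulr1 -exprnP => e1.
  have e0 : ev1 t^-1 Q3`_j = ev1 t (c3 *: (Q1`_j * 'X^2)).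
    by rewrite e1 -mul_polyC !ev1M ev1C ?ev1Xn !ev1X; ring.
  apply/polyP => i; rewrite coef0; have := polynomial_laurent i.+1 hty e0.
  by rewrite coefZ coefMXn /= subn2 /= => /eqP; rewrite mulf_eq0 (negbTE c30) => /eqP.
have [g10 _ eQ _ _] := h1; move/eqP: eQ; rewrite q0 ev0 mulf_eq0 (negbTE g10) => /eqP //.
Qed.
End Weights.
End Hirzebruch.

Section HirzebruchFoliations.
Context (k : closedFieldType) (K : fieldType) (iota : {rmorphism k -> K}).
Local Notation ev1 := (ev1 iota).
Local Notation ev := (ev iota).
Local Notation pure := (purely_transcendental iota).

Lemma generates_local D0 t y g P Q O : kderivation iota D0 -> generates iota D0 t y g P Q ->
  affine_model (kalg iota [set t; y]) O -> forall z, O z -> O (g * D0 z).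
Proof.
move=> hD0 [_ eP eQ _ _] hO; have [sO [Ot Oy]] := chart_sub hO.
apply: (der_localization (kderivation_scale g hD0) hO); rewrite ?eP ?eQ; exact: (subalg_ev sO).
Qed.

Theorem hirzebruch_foliation (p : nat) (hp : has_characteristic k p) (e : nat) (t y : K)
    (X : set (set K)) (T : set K -> set (K -> K)) :
  pure t y -> e <> 1%N -> X = hirzebruch_model iota e t y -> regular_foliation iota X T ->
  (exists2 z, hirzebruch_projection e t y z & is_fibration iota X T z) \/
  [/\ (0 < p)%N, (p %| e)%N & exists2 z, hirzebruch_projection e t y z & is_riccati iota X T z].
Proof.
move=> hty ne1 eX hT; have hty' := pure_hirzebruch e hty.
have hXc O : X O -> exists t y, pure t y /\ affine_model (kalg iota [set t; y]) O.
  by rewrite eX; exact: hirzebruch_chart.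
have ch1 : chart iota X t y by split=> // O hO; rewrite eX; left; left; left.
have ch2 : chart iota X t y^-1 by split=> [|O hO]; [exact: pure_inv2|rewrite eX; left; left; right].
have ch3 : chart iota X t^-1 (y * t ^+ e) by split=> // O hO; rewrite eX; left; right.
have ch4 : chart iota X t^-1 (y * t ^+ e)^-1 by split=> [|O hO]; [exact: pure_inv2|rewrite eX; right].
have [D0 [hD0 D0z hline]] := foliation_line hT hXc ch1.
have [Dt|Dt] := eqVneq (D0 t) 0.
  by left; exists t; [left|exact: (fibration_of_kernel hD0 D0z hline hty Dt)].
have [g1 [P1 [Q1 h1]]] := chart_generator hT hXc hD0 D0z hline ch1.
have [g2 [P2 [Q2 h2]]] := chart_generator hT hXc hD0 D0z hline ch2.
have [g3 [P3 [Q3 h3]]] := chart_generator hT hXc hD0 D0z hline ch3.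
have [g4 [P4 [Q4 h4]]] := chart_generator hT hXc hD0 D0z hline ch4.
have [m [s [s5 [c2 [c3 [c5 [[c20 c30 c50] [e2 e3 e5] G1 G3]]]]]]] := hirzebruch_weights hty hD0 h1 h2 h3 h4 Dt.
have we := weight_equation hty hD0 h1 h3 c30 e3 G1 G3.
(* The weight equation in factored form; m + 1 divides 2. *)
have fac : ((m : int) + 1) * (2 * s - 2 - (e : int) * (m : int)) = 2.
  have -> : ((m : int) + 1) * (2 * s - 2 - (e : int) * (m : int)) =
     (s - 2) * (m.+2 : int) + (s + e) * (m : int) - (e : int) * ((m.+2 : int) * (m : int)) + 2.
    by rewrite -[m.+2]addn2 PoszD; ring.
  by rewrite we subrr add0r.
case: m e2 G1 G3 we fac => [|[|m]] e2 G1 G3 we fac.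
- have es : s = 2 by move: fac; clear; lia.
  have e0 := riccati_char hty hD0 h1 h3 c30 e3 G1 erefl es.
  have [d d0 eP] := riccati_const G1 erefl.
  case: p hp => [|p] hp.
    (* In characteristic zero the vanishing of e in k means e = 0, and the foliation is the second
       projection of P^1 x P^1. *)
    have ee : e = 0%N.
      by have /pcharf0P/(_ e) := hp; rewrite e0 eqxx => /esym/eqP.
    have Dy := product_kernel hty hD0 h1 h3 c30 e3 es ee.
    by left; exists y; [right|exact: (fibration_of_kernel hD0 D0z hline (pure_swap hty) Dy)].
  right; split=> //; first by rewrite (dvdn_pcharf hp) e0.
  exists t; first by left.
  (* No finite fibre is exceptional: g1 D0 is regular over the whole affine line and sends t to the
     nonzero constant d. *)
  exists [::] => c _ O XO mt.
  have sO : subalg iota O by have [t' [y' [_ /chart_sub []]]] := hXc O XO.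
  have t0 := pure_neq0 hty.
  have Ot : O t by rewrite -(subrK (iota c) t); apply: (subalgD sO); [case: mt|exact: (subalgC sO)].
  have OC d' : O (iota d') by exact: (subalgC sO).
  have Otz (z : int) : O t^-1 -> O (t ^ z).
    by move=> Oti; case: z => z; [rewrite -exprnP|rewrite NegzE -exprnN -exprVn]; apply: (subalgX sO).
  have pres g u : g1 = u * g -> O u -> (forall z, O z -> O (g * D0 z)) -> forall z, O z -> O (g1 * D0 z).
    by move=> -> Ou h z Oz; rewrite -mulrA; apply: (subalgM sO) => //; exact: h.
  have e2' : g1 = iota c2^-1 * g2.
    by rewrite e2 fmorphV oppr0 expr0z mulr1 mulKf ?fmorph_eq0.
  have hpres : forall z, O z -> O (g1 * D0 z).
    move: XO; rewrite eX => -[[[hO|hO]|hO]|hO].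
    - exact: (generates_local hD0 h1 hO).
    - exact: (pres g2 _ e2' (OC _) (generates_local hD0 h2 hO)).
    - have [_ [Oti _]] := chart_sub hO.
      apply: (pres g3 (iota c3^-1 * t ^ (- s)) _ _ (generates_local hD0 h3 hO)).
        have tz : t ^ s != 0 by rewrite expfz_neq0.
        have c30' : iota c3 != 0 by rewrite fmorph_eq0.
        by rewrite e3 fmorphV -invr_expz; field; rewrite tz c30'.
      by apply: (subalgM sO) => //; exact: Otz.
    have [_ [Oti _]] := chart_sub hO.
    apply: (pres g4 (iota c2^-1 * (iota c5^-1 * t ^ (- s5))) _ _ (generates_local hD0 h4 hO)).
      have tz : t ^ s5 != 0 by rewrite expfz_neq0.
      have c50' : iota c5 != 0 by rewrite fmorph_eq0.
      rewrite {1}e2' -mulrA; congr (_ * _).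
      by rewrite e5 fmorphV -invr_expz; field; rewrite tz c50'.
    by do !apply: (subalgM sO) => //; exact: Otz.
  exists (fun z => g1 * D0 z).
    apply/(hline O XO); split; last by exists g1.
    by split=> //; exact: (kderivation_scale g1 hD0).
  have [_ -> _ _ _] := h1; rewrite eP evC ev1C => -[_ /(_ (iota d^-1) (OC _))]; apply.
  by rewrite -rmorphM mulfV // rmorph1.
(* For m = 1 the equation reads 2 s = e + 3: e is odd, and e <> 1 gives s > 2. *)
- have [es|es] : (2 < s)%R \/ e = 0%N \/ e = 1%N by move: fac; clear; lia.
    by case: (section_vanishes hty hD0 h1 h3 c30 e3 G1 es).
  by case: es => // es; move: fac; rewrite es; clear; lia.
(* Here m + 1 is at least 3 and cannot divide 2. *)
exfalso; move: fac; move: (2 * s - 2 - _) => q; clear => fac.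
have [q_le|q_gt] := leP q 0; move: fac; nia.
Qed.
End HirzebruchFoliations.

(** * Absence of regular foliations on the plane *)

Section PlaneFoliations.
Context (k : closedFieldType) (K : fieldType) (iota : {rmorphism k -> K}).
Local Notation ev1 := (ev1 iota).
Local Notation ev := (ev iota).
Local Notation pure := (purely_transcendental iota).
Local Notation val c c' P := (ev (iota c) (iota c') P).

(** In the chart (1 / b, a / b) all lines a = c pass through the origin, so a function of the chart
    restricts there to a constant independent of c. *)
Lemma collapse a eta (P : {poly {poly k}}) : exists F f0,
  [/\ ev a eta F = ev eta (a * eta) P, F`_0 = f0%:P & val 0 0 P = iota f0].
Proof.
elim/poly_ind: P => [|R p [F [f0 [e1 e2 e3]]]].
  by exists 0, 0; split; rewrite ?ev0 ?coef0 ?polyC0 ?rmorph0.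
have evmap q : ev a eta (map_poly polyC q) = ev1 eta q.
  elim/poly_ind: q => [|q c IH]; first by rewrite map_poly0 ev0 ev10.
  by rewrite rmorphD rmorphM /= map_polyX map_polyC /= evD evM evX evC ev1C IH ev1D ev1M ev1X ev1C.
exists (F * 'X%:P * 'X + map_poly polyC p), p`_0; split.
- by rewrite !evD !evM !evX !evC ev1X e1 evmap; ring.
- by rewrite coefD coefMX coef_map /= add0r.
rewrite evD evM evX evC rmorph0 mulr0 add0r ev1E -(rmorph0 iota) horner_map.
by rewrite horner_coef0.
Qed.

Section Pair.
Context (D0 : K -> K) (hD0 : kderivation iota D0).
Local Notation generates := (generates iota D0).

(** The fibres are the lines a = c, which meet in one point at infinity. The field does not vanish
    at that point, and this supplies the condition at infinity on every line; the formal degrees are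
    n and n + 1. *)
Lemma plane_fibre_pair a b g P Q g3 P3 Q3 c (s : int) : pure a b -> c != 0 -> D0 a != 0 ->
  generates a b g P Q -> generates b^-1 (a / b) g3 P3 Q3 -> g3 = iota c * b ^ s * g ->
  exists n : nat, s = 1 - (n : int) /\ fibre_good iota n.+1 n P Q.
Proof.
move=> h c0 Da [g0 eP eQ _ nz] [g30 eP3 eQ3 _ nz3] eg; have b0 := pure_neq0 (pure_swap h).
have P0 : P != 0 by apply: contra_neq (mulf_neq0 g0 Da) => z; rewrite eP z ev0.
have [F [f0 [eF F0 vF]]] := collapse a b^-1 P3; have [G [q0 [eG G0 vG]]] := collapse a b^-1 Q3.
have eF' : ev a b^-1 F = iota (- c) * b ^ (- (- s + 2)) * ev a b Q.
  rewrite eF -eP3 (derV hD0) // eg -eQ opprD opprK expfzDr // rmorphN -exprnN.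
  by move: (b ^ s) => r; field.
(* The derivative of a / b mixes P and Q; subtracting a F removes the part coming from Q. *)
have eH : ev a b^-1 (G - 'X%:P * F) = iota c * b ^ (- (1 - s)) * ev a b P.
  rewrite evB evM evC ev1X eG -eQ3 eF' (derf hD0) // eg -eQ -eP !opprD !opprK !expfzDr // rmorphN -!exprnN expr1.
  by move: (b ^ s) => r; field.
have [n [en sP cP]] := rev_relation h c0 P0 eH.
exists n; split; first by rewrite -en subKr.
have [sQ cQ] : (size Q <= n.+2)%N /\ F`_0 = (- c)%:P * Q`_n.+1.
  have [Q0|Q0] := eqVneq Q 0.
    rewrite Q0 size_poly0 coef0 mulr0; split=> //.
    have -> : F = 0 by apply: (pure_indep (pure_inv2 h)); rewrite eF' Q0 ev0 mulr0.
    by rewrite coef0.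
  have [|m' [em' sQ cQ]] := rev_relation h _ Q0 eF'; first by rewrite oppr_eq0.
  by have -> : n.+1 = m' by move: em' en; clear; lia.
split=> // c1 [p1 q1]; apply: (nz3 0 0); rewrite vF vG.
have f00 : f0 = 0 by have := congr1 (horner_eval c1) cQ; rewrite F0 /horner_eval hornerC hornerM q1 mulr0.
have q00 : q0 = 0.
  have := congr1 (horner_eval c1) cP.
  by rewrite coefB coefCM F0 G0 f00 polyC0 mulr0 subr0 /horner_eval hornerC hornerM p1 mulr0.
by rewrite f00 q00 rmorph0.
Qed.
End Pair.

Lemma plane_model_swap a b : plane_model iota a b = plane_model iota b a.
Proof.
rewrite /plane_model (pairC a b); apply/seteqP; split=> O [[h|h]|h].
- by left; left.
- by right.
- by left; right.
- by left; left.
- by right.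
- by left; right.
Qed.

Theorem plane_foliation a b (X : set (set K)) (T : set K -> set (K -> K)) :
  pure a b -> X = plane_model iota a b -> regular_foliation iota X T -> False.
Proof.
move=> hab eX hT.
have hXc O : X O -> exists t y, pure t y /\ affine_model (kalg iota [set t; y]) O.
  by rewrite eX; exact: plane_chart.
have ch0 : chart iota X a b by split=> // O hO; rewrite eX; left; left.
have [D0 [hD0 D0z hline]] := foliation_line hT hXc ch0.
wlog Da : a b hab eX ch0 / D0 a != 0.
  move=> wl; have [Da|Db] := line_neq0 hD0 D0z hab; first exact: (wl a b).
  apply: (wl b a) => //; [exact: pure_swap|by rewrite plane_model_swap|].
  by split; [exact: pure_swap|case: ch0 => _; rewrite pairC].
have a0 := pure_neq0 hab; have b0 := pure_neq0 (pure_swap hab).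
have hab2 := pure_plane hab; have hab3 := pure_plane (pure_swap hab).
have ch2 : chart iota X a^-1 (b / a) by split=> // O hO; rewrite eX; left; right.
have ch3 : chart iota X b^-1 (a / b) by split=> // O hO; rewrite eX; right.
have [g1 [P1 [Q1 h1]]] := chart_generator hT hXc hD0 D0z hline ch0.
have [g2 [P2 [Q2 h2]]] := chart_generator hT hXc hD0 D0z hline ch2.
have [g3 [P3 [Q3 h3]]] := chart_generator hT hXc hD0 D0z hline ch3.
have [c2 [s2 [c20 e2]]] : exists c (s : int), c != 0 /\ g2 = iota c * a ^ s * g1.
  by apply: (transition_base (e := -1) hD0 hab h1); rewrite exprN1; exact: h2.
have [c3 [s3 [c30 e3]]] : exists c (s : int), c != 0 /\ g3 = iota c * b ^ s * g1.
  by apply: (transition_base (e := -1) hD0 (pure_swap hab) (generates_swap h1)); rewrite exprN1; exact: h3.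
have ey : (b / a)^-1 = a / b by rewrite invf_div.
have et : a^-1 / (b / a) = b^-1 by rewrite ey mulrA mulVf // mul1r.
have h3' : generates iota D0 (b / a)^-1 (a^-1 / (b / a)) g3 (swapXY Q3) (swapXY P3).
  by rewrite et ey; exact: generates_swap.
have [c4 [s4 [c40 e4]]] : exists c (s : int), c != 0 /\ g3 = iota c * (b / a) ^ s * g2.
  by apply: (transition_base (e := -1) hD0 (pure_swap hab2) (generates_swap h2)); rewrite exprN1; exact: h3'.
have g10 : g1 != 0 by case: h1.
(* The generator of the third chart is computed from the first one directly and through the second
   one; the exponents of a and b agree. *)
have [es2 es4] : 0 = s2 - s4 /\ s3 = s4.
  have ez : iota c3 * a ^ 0 * b ^ s3 = iota (c4 * c2) * a ^ (s2 - s4) * b ^ s4.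
    apply: (mulIf g10); transitivity g3; first by rewrite e3 expr0z mulr1.
    by rewrite e4 e2 expfzMl expfzDr // -exprz_inv rmorphM; ring.
  by have [] := monomial_int hab c30 ez.
have Dai : D0 a^-1 != 0 by rewrite (derV hD0) // mulf_neq0 ?oppr_eq0 ?invr_eq0 ?expf_neq0.
have [n [en G1]] := plane_fibre_pair hD0 hab c30 Da h1 h3 e3.
have [n' [en' G2]] := plane_fibre_pair hD0 hab2 c40 Dai h2 h3' e4.
have enn : n' = n by move: en en' es4; clear; lia.
rewrite enn in G2.
have az i : a ^ i != 0 by rewrite expfz_neq0.
have lC c i : laurent iota a (iota c * a ^ i).
  by apply: (subalgM (laurent_subalg iota a)); [exact: (subalgC (laurent_subalg iota a))|exact: laurent_exp].
have u0 : iota (- c2) * a ^ (s2 - 2) != 0 by rewrite mulf_neq0 // fmorph_eq0 oppr_eq0.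
have w0 : iota c2 * a ^ (s2 - 1) != 0 by rewrite mulf_neq0 // fmorph_eq0.
have r0 : a^-1 != 0 by rewrite invr_eq0.
have eP : ev a^-1 (b * a^-1) P2 = iota (- c2) * a ^ (s2 - 2) * ev a b P1.
  have [_ <- _ _ _] := h2; have [_ <- _ _ _] := h1.
  by rewrite (derV hD0) // e2 expfzDr // rmorphN -exprnN; move: (a ^ s2) => p; field.
have eQ : ev a^-1 (b * a^-1) Q2 = iota c2 * a ^ (s2 - 1) * ev a b Q1 + iota (- c2) * a ^ (s2 - 2) * (b * ev a b P1).
  have [_ _ <- _ _] := h2; have [_ <- <- _ _] := h1.
  by rewrite (derf hD0) // e2 !expfzDr // rmorphN -!exprnN expr1; move: (a ^ s2) => p; field.
have [L eL] : exists L, L = n.+1 by exists n.+1.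
have lt_n : (n < L)%N by rewrite eL.
rewrite -eL in G1 G2.
have [d d0] := weight_identity hab (laurent_inv iota a0) (lC _ _) (lC _ _) (lC _ _) r0 u0 w0 lt_n eP eQ G1 G2.
rewrite !exprMn -!rmorphXn => e0.
have : iota d * a ^ (- ((L * n)%N : int)) * b ^ 0 =
    iota ((- c2) ^+ L * c2 ^+ n) * a ^ ((s2 - 2) * (L : int) + (s2 - 1) * (n : int)) * b ^ 0.
  rewrite -exprnN -exprVn e0 [a ^ (_ * _ + _ * _)]expfzDr // -[a ^ (_ * (L : int))]exprz_exp -[a ^ (_ * (n : int))]exprz_exp.
  by rewrite -!exprnP rmorphM; ring.
case/(monomial_int hab d0) => eqn _; move: eqn en es2 es4; rewrite eL PoszM; clear.
(* The equation becomes n^2 + n + 1 = 0, whose left-hand side is the number of singularities of a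
   foliation of degree n on the plane. *)
move=> eqn en es2 es4; have es : s2 = 1 - (n : int) by lia.
by move: eqn; rewrite es; nia.
Qed.
End PlaneFoliations.

Theorem theorem1p1 (k : closedFieldType) (p : nat)
    (hp : has_characteristic k p)
    (K : fieldType) (iota : {rmorphism k -> K})
    (X : set (set K)) (hX : smooth_projective_surface iota X)
    (hrat : rational_surface iota) (hmin : minimal_surface iota X)
    (T : set K -> set (K -> K)) (hT : regular_foliation iota X T) :
  exists (e : nat) (t y : K),
    [/\ e <> 1%N, is_hirzebruch iota X e t y &
        (exists2 z, hirzebruch_projection e t y z & is_fibration iota X T z) \/
        [/\ (0 < p)%N, (p %| e)%N &
            exists2 z, hirzebruch_projection e t y z &
                       is_riccati iota X T z]].
Proof.
have [[e [t [y [ne1 [hty eX]]]]]|[a [b [hab eX]]]] := minimal_rational_surface hX hrat hmin.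
  by exists e, t, y; split=> //; exact: (hirzebruch_foliation hp hty ne1 eX hT).
by case: (plane_foliation hab eX hT).
Qed.
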